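(* There exists a deterministic algorithm which, given a directed graph $G=(V,E)$ with $n$ vertices and $m$ edges, edge costs $c:E\to\mathbb{R}$, and a discount factor $\gamma\in(0,1)$, computes the discounted distance $\delta_G(s,t)$ for all pairs $s,t\in V$ (the discounted all-pairs shortest paths problem in the uniform case) in $\tilde{O}(n^{3/2}m^{3/4})$ time.
   Context: For a walk $P=e_1e_2\cdots e_k$ in $G$, its discounted cost is $c(P)=\sum_{i=1}^{k}c(e_i)\gamma^{i-1}$ (the empty walk has cost $0$). Let $\delta^k_G(s,t)$ be the minimum cost of an $s\to t$ walk with exactly $k$ edges ($\infty$ if none exists). The discounted distance is $\delta_G(s,t)=\inf_{k\ge 0}\delta^k_G(s,t)$. Running time counts arithmetic operations and comparisons on reals; $\tilde{O}(\cdot)$ hides polylogarithmic factors in $n$. *)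

(* Defs.v *)
From HB Require Import structures.
From mathcomp Require Import all_boot all_order all_algebra.
From mathcomp Require Import all_classical all_reals all_analysis.

Set Implicit Arguments.
Unset Strict Implicit.
Unset Printing Implicit Defensive.

Import Order.TTheory GRing.Theory Num.Theory.

Local Open Scope ring_scope.

(** ** Discounted distances

    A digraph on the vertex set ['I_n] is a set of ordered pairs, so loops and
    antiparallel edges are allowed, parallel edges are not.  Costs are functions
    on all pairs; only their values on edges matter. *)

Section DiscountedDistance.
Context (R : realType) (n : nat).
Implicit Types (E : {set 'I_n * 'I_n}) (c : 'I_n * 'I_n -> R) (g : R).
Implicit Types (s t : 'I_n) (p : seq ('I_n * 'I_n)).

Fixpoint is_walk E s p t : bool :=
  if p is e :: p' then [&& e \in E, e.1 == s & is_walk E e.2 p' t] else s == t.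

(* Indices start at 0 here, so the exponent [i - 1] becomes [i]. *)
Definition walk_cost c g p : R :=
  \sum_(i < size p) c (tnth (in_tuple p) i) * g ^+ i.

Definition walk_dist E c g (k : nat) s t : \bar R :=
  \big[Order.min/+oo%E]_(p : k.-tuple ('I_n * 'I_n) | is_walk E s p t)
    (walk_cost c g p)%:E.

Definition disc_dist E c g s t : \bar R :=
  ereal_inf [set walk_dist E c g k s t | k in [set: nat]].

End DiscountedDistance.

(** ** Real RAM programs

    The model of computation is the real RAM.  Its memory is a collection of
    integer arrays and a collection of real arrays; both the arrays and their
    cells are numbered by natural numbers.  A program is a finite object that
    does not depend on the input, hence names finitely many arrays (which a
    machine with one integer and one real memory simulates by interleaving).

    Integers are machine words, i.e. integer operations are performed modulo a
    word modulus [M]; they serve for control and for indirect addressing.  On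
    reals there are only the four field operations and comparison: there is no
    rounding and no conversion from reals to integers. *)

Inductive iop := IAdd | ISub | IMul | IDiv | IMod.
Inductive rop := RAdd | RSub | RMul | RDiv.

Inductive iexp :=
| INat of nat
| IGet of nat & iexp (* [IGet a e]: cell [e] of integer array [a] *)
| IBin of iop & iexp & iexp.

Inductive rexp :=
| RNat of nat
| RGet of nat & iexp
| RBin of rop & rexp & rexp.

Inductive bexp :=
| BILe of iexp & iexp
| BRLe of rexp & rexp
| BNot of bexp
| BAnd of bexp & bexp.

Inductive cmd :=
| Skip
| ISet of nat & iexp & iexp (* [ISet a e v]: cell [e] of array [a] := [v] *)
| RSet of nat & iexp & rexp
| Seq of cmd & cmd
| If of bexp & cmd & cmd
| While of bexp & cmd.

(* Every node of an expression costs one unit: each constant, memory access,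
   arithmetic operation, comparison and connective. *)
Fixpoint icost (e : iexp) : nat :=
  match e with
  | INat _ => 1
  | IGet _ e1 => (icost e1).+1
  | IBin _ e1 e2 => (icost e1 + icost e2).+1
  end.

Fixpoint rcost (e : rexp) : nat :=
  match e with
  | RNat _ => 1
  | RGet _ e1 => (icost e1).+1
  | RBin _ e1 e2 => (rcost e1 + rcost e2).+1
  end.

Fixpoint bcost (b : bexp) : nat :=
  match b with
  | BILe e1 e2 => (icost e1 + icost e2).+1
  | BRLe e1 e2 => (rcost e1 + rcost e2).+1
  | BNot b1 => (bcost b1).+1
  | BAnd b1 b2 => (bcost b1 + bcost b2).+1
  end.

Section Semantics.
Context (R : realType) (M : nat).

Record state := State { imem : nat -> nat -> nat; rmem : nat -> nat -> R }.

(* Subtraction is truncated at 0; division by 0 follows the library's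
   conventions.  Both cases can be tested for at constant cost. *)
Definition iop_eval (o : iop) (x y : nat) : nat :=
  (match o with
   | IAdd => x + y
   | ISub => x - y
   | IMul => x * y
   | IDiv => x %/ y
   | IMod => x %% y
   end %% M)%N.

Definition rop_eval (o : rop) (x y : R) : R :=
  match o with
  | RAdd => x + y
  | RSub => x - y
  | RMul => x * y
  | RDiv => x / y
  end.

Fixpoint ieval (st : state) (e : iexp) : nat :=
  match e with
  | INat k => k %% M
  | IGet a e1 => imem st a (ieval st e1)
  | IBin o e1 e2 => iop_eval o (ieval st e1) (ieval st e2)
  end.

Fixpoint reval (st : state) (e : rexp) : R :=
  match e with
  | RNat k => k%:R
  | RGet a e1 => rmem st a (ieval st e1)
  | RBin o e1 e2 => rop_eval o (reval st e1) (reval st e2)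
  end.

Fixpoint beval (st : state) (b : bexp) : bool :=
  match b with
  | BILe e1 e2 => (ieval st e1 <= ieval st e2)%N
  | BRLe e1 e2 => reval st e1 <= reval st e2
  | BNot b1 => ~~ beval st b1
  | BAnd b1 b2 => beval st b1 && beval st b2
  end.

Definition update (T : Type) (mem : nat -> nat -> T) (a i : nat) (v : T) :=
  fun a' i' => if (a' == a) && (i' == i) then v else mem a' i'.

(* [exec p st T st']: started in [st], the program [p] halts in [st'] after [T]
   units of time. *)
Inductive exec : cmd -> state -> nat -> state -> Prop :=
| exec_skip st : exec Skip st 1 st
| exec_iset a e v st :
    exec (ISet a e v) st (icost e + icost v).+1
      (State (update (imem st) a (ieval st e) (ieval st v)) (rmem st))
| exec_rset a e v st :
    exec (RSet a e v) st (icost e + rcost v).+1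
      (State (imem st) (update (rmem st) a (ieval st e) (reval st v)))
| exec_seq p1 p2 st1 T1 st2 T2 st3 :
    exec p1 st1 T1 st2 -> exec p2 st2 T2 st3 ->
    exec (Seq p1 p2) st1 (T1 + T2) st3
| exec_if b p1 p2 st T st' :
    exec (if beval st b then p1 else p2) st T st' ->
    exec (If b p1 p2) st (bcost b + T).+1 st'
| exec_while_done b p st :
    ~~ beval st b -> exec (While b p) st (bcost b).+1 st
| exec_while_step b p st1 T1 st2 T2 st3 :
    beval st1 b -> exec p st1 T1 st2 -> exec (While b p) st2 T2 st3 ->
    exec (While b p) st1 (bcost b + T1 + T2).+1 st3.

Lemma exec_deterministic p st T1 st1 T2 st2 :
  exec p st T1 st1 -> exec p st T2 st2 -> T1 = T2 /\ st1 = st2.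
Proof.
move=> H; elim: H T2 st2 => {p st T1 st1}.
- by move=> st T2 st2 H; inversion H.
- by move=> a e v st T2 st2 H; inversion H.
- by move=> a e v st T2 st2 H; inversion H.
- move=> p1 p2 sa Ta sb Tb sc _ IH1 _ IH2 T2 st2 H.
  inversion H as [| | |? ? ? Tc sd Td ? H1 H2| | |]; subst.
  by have [? ?] := IH1 _ _ H1; subst; have [-> ->] := IH2 _ _ H2.
- move=> b p1 p2 st T st' _ IH T2 st2 H.
  inversion H as [| | | |? ? ? ? Tc ? H1| |]; subst.
  by have [-> ->] := IH _ _ H1.
- move=> b p st nb T2 st2 H.
  inversion H as [| | | | | |? ? ? Tc sd Td ? hb]; subst => //.
  by rewrite hb in nb.
- move=> b p sa Ta sb Tb sc hb _ IH1 _ IH2 T2 st2 H.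
  inversion H as [| | | | |? ? ? nb|? ? ? Tc sd Td ? _ H1 H2]; subst.
    by rewrite hb in nb.
  by have [? ?] := IH1 _ _ H1; subst; have [-> ->] := IH2 _ _ H2.
Qed.

End Semantics.

(** ** Input and output conventions *)

Section InputOutput.
Context (R : realType) (n : nat).

(* The edges are listed in the order of [es]: integer array 0 holds [n] and the
   number of edges, integer arrays 1 and 2 the sources and the targets of the
   edges, real array 0 their costs, cell 0 of real array 1 the discount factor.
   All other cells are initially 0. *)
Definition input_state (es : seq ('I_n * 'I_n)) (c : 'I_n * 'I_n -> R) (g : R) :
    state R :=
  State
    (fun a i =>
       match a with
       | 0 => nth 0%N [:: n; size es] i
       | 1 => nth 0%N [seq nat_of_ord e.1 | e <- es] i
       | 2 => nth 0%N [seq nat_of_ord e.2 | e <- es] i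
       | _ => 0%N
       end)
    (fun a i =>
       match a with
       | 0 => nth 0 [seq c e | e <- es] i
       | 1 => nth 0 [:: g] i
       | _ => 0
       end).

(* The value for the pair [(s, t)] is read at index [s * n + t]: integer array 3
   holds 0 if the value is infinite and a nonzero flag otherwise, in which case
   real array 2 holds the value. *)
Definition output (st : state R) (s t : 'I_n) : \bar R :=
  if imem st 3 (s * n + t) == 0%N then +oo%E else (rmem st 2 (s * n + t))%:E.

End InputOutput.

(* Main.v *)
Require Import Defs.
From HB Require Import structures.
From mathcomp Require Import all_boot all_order all_algebra.
From mathcomp Require Import all_classical all_reals all_analysis.
From mathcomp Require Import zify ring lra.

Set Implicit Arguments.
Unset Strict Implicit.
Unset Printing Implicit Defensive.

Import Order.TTheory GRing.Theory Num.Theory.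
Import numFieldNormedType.Exports.
Local Open Scope ring_scope.

(** Fix k >= 2 minimal with k^4 m >= N^2, where N is the number of vertices that
    are not isolated.  Level i consists of a set S_i of vertices (S_0 being all
    of them) and a length L_i = k^(i+1).

    Upwards, from every s in S_i a dynamic program computes cheapest walks of each
    exact length j <= L_i.  It bounds some distances directly, and the cost of
    going round a closed walk at s for ever, Q(s).  The computed walks of length
    L_i without repeated vertices are hit by a greedily chosen set S_(i+1) of
    about N log N / L_i vertices; the levels stop when no such walk exists.
    Optimal walks that do repeat a vertex contain a closed walk whose infinite
    repetition is optimal as well, which is what Q takes care of.

    Downwards, once all distances from S_(i+1) are known, a walk from s in S_i
    reaches the target, a vertex where going round for ever is optimal, or a
    vertex b of S_(i+1), within L_i steps.  In the last case the distance is the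
    minimum over j of D_j(s,b) + g^j d(b,t): for fixed s and b, a lower envelope
    of L_i + 1 lines evaluated at the point d(b,t).  The envelope is computed once
    for each pair (s,b) and queried by bisection.  On level 0, k rounds of relaxing all
    the edges replace this step.

    Since |S_i| k^i = O(N log N), everything costs O(m N k) or O(N^3 / k^3) up to
    logarithms, and by the choice of k both are O(n^(3/2) m^(3/4)). *)

(** * Weakest preconditions *)

(** The infimum over walks need not be attained: the weight of the tail tends to 0, so going round a
    cheap closed walk very often before leaving for the target can approach a value below that of
    every finite walk. This limit value does not depend on the target, as long as the target can be
    reached; hence one number per vertex serves all targets. In a row of the table these numbers are
    merged per strongly connected component and passed on in one sweep over the edges, sorted so
    that sources of larger reach come first.

    Prefixes of different lengths cannot be compared by cost alone, since the number of edges fixes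
    the discount of what follows. But a prefix of an optimal route may be replaced by a cheapest
    walk of the same length with the same ends, so it suffices to hit computed walks. The central
    notion is [tight]: a walk along which the distance equation holds exactly. It survives
    replacement, splitting and cutting out closed parts although the exponents shift, which makes
    arguments by minimal length possible.

    The condition k^4 m >= N^2 is the balance of m N k against N^3 / k^3. *)

Fixpoint iarrays (e : iexp) : seq nat :=
  match e with
  | INat _ => [::]
  | IGet a e1 => a :: iarrays e1
  | IBin _ e1 e2 => iarrays e1 ++ iarrays e2
  end.

Fixpoint iwrites (c : cmd) : seq nat :=
  match c with
  | ISet a _ _ => [:: a]
  | Seq c1 c2 | If _ c1 c2 => iwrites c1 ++ iwrites c2
  | While _ c1 => iwrites c1
  | _ => [::]
  end.

Fixpoint rwrites (c : cmd) : seq nat :=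
  match c with
  | RSet a _ _ => [:: a]
  | Seq c1 c2 | If _ c1 c2 => rwrites c1 ++ rwrites c2
  | While _ c1 => rwrites c1
  | _ => [::]
  end.

Notation Var x := (IGet x (INat 0)).
Notation "x +^ y" := (IBin IAdd x y) (at level 50, left associativity).
Notation "x -^ y" := (IBin ISub x y) (at level 50, left associativity).
Notation "x *^ y" := (IBin IMul x y) (at level 40, left associativity).
Notation "x ::= e" := (ISet x (INat 0) e) (at level 85).
Notation "c1 ;; c2" := (Seq c1 c2) (at level 90, right associativity).

Definition For x e c :=
  ISet x (INat 0) (INat 0) ;;
  While (BNot (BILe e (Var x))) (c ;; ISet x (INat 0) (Var x +^ INat 1)).

(** * Frame conditions: the memory a program leaves alone *)

Section Frame.
Context (R : realType).
Implicit Types s : state R.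

Definition seti s a i v := State (update (imem s) a i v) (rmem s).
Definition setr s a i v := State (imem s) (update (rmem s) a i v).

Arguments seti : simpl never.
Arguments setr : simpl never.

Definition frame (I J : seq nat) s s' :=
  (forall a, a \notin I -> imem s' a = imem s a) /\
  (forall a, a \notin J -> rmem s' a = rmem s a).

Lemma frame_trans I J s1 s2 s3 :
  frame I J s1 s2 -> frame I J s2 s3 -> frame I J s1 s3.
Proof. by move=> [h1 h2] [h3 h4]; split=> a ha; rewrite ?h3 ?h4 ?h1 ?h2. Qed.

Lemma frame_sub I J I' J' s s' :
  all (mem I') I -> all (mem J') J -> frame I J s s' -> frame I' J' s s'.
Proof.
move=> /allP hI /allP hJ [h1 h2].
by split=> a ha; [apply: h1|apply: h2]; apply: contra ha; [apply: hI|apply: hJ].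
Qed.

Lemma frame_cat I J I' J' s1 s2 s3 :
  frame I J s1 s2 -> frame I' J' s2 s3 -> frame (I ++ I') (J ++ J') s1 s3.
Proof.
move=> f1 f2; apply: frame_trans.
  by apply: frame_sub f1; apply/allP => x hx; rewrite inE mem_cat hx.
by apply: frame_sub f2; apply/allP => x hx; rewrite inE mem_cat hx orbT.
Qed.

Lemma update_ne (T : Type) (f : nat -> nat -> T) a i v b :
  a != b -> update f a i v b = f b.
Proof. by move=> h; apply/funext => j; rewrite /update eq_sym (negbTE h). Qed.

Lemma frame_seti I J s a i v : a \in I -> frame I J s (seti s a i v).
Proof.
by move=> h; split=> // b hb; apply: update_ne; apply: contraNneq hb => <-.
Qed.

Lemma frame_setr I J s a i v : a \in J -> frame I J s (setr s a i v).
Proof.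
by move=> h; split=> // b hb; apply: update_ne; apply: contraNneq hb => <-.
Qed.

(** Array names are literals of the syntax, so the arrays a program may change are computed from its
    text. Preservation of all other arrays then becomes a closed Boolean test, discharged by [isT]
    throughout the proof. *)
Lemma exec_frame M c s T s' :
  exec M c s T s' -> frame (iwrites c) (rwrites c) s s'.
Proof.
elim=> {c s T s'} //=.
- by move=> a e v s; apply: frame_seti; rewrite inE.
- by move=> a e v s; apply: frame_setr; rewrite inE.
- move=> p1 p2 s1 T1 s2 T2 s3 _ IH1 _ IH2; apply: frame_trans.
    by apply: frame_sub IH1; apply/allP => x hx; rewrite inE mem_cat hx.
  by apply: frame_sub IH2; apply/allP => x hx; rewrite inE mem_cat hx orbT.
- move=> b p1 p2 s T s'; case: (beval _ _ _) => _ IH; apply: frame_sub IH;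
    by apply/allP => x hx; rewrite inE mem_cat hx ?orbT.
- by move=> b p s1 T1 s2 T2 s3 _ _ IH1 _ IH2; apply: frame_trans IH1 IH2.
Qed.

Lemma ieval_frame M I J s s' e :
  frame I J s s' -> all (fun a => a \notin I) (iarrays e) ->
  ieval M s' e = ieval M s e.
Proof.
move=> [hI _]; elim: e => //= [a e IH /andP[h1 h2]|o e1 IH1 e2 IH2].
  by rewrite IH// hI.
by rewrite all_cat => /andP[h1 h2]; rewrite IH1 ?IH2.
Qed.

End Frame.

(** * Rules for total correctness with running time *)

Section Wp.
Context (R : realType) (M : nat).
Implicit Types (s : state R) (Q : nat -> state R -> Prop).

(** Termination is part of the claim, and the postcondition sees the running time along with the
    final state. *)
Definition wp c Q s := exists T s', exec M c s T s' /\ Q T s'.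

Lemma wp_weaken c Q Q' s :
  (forall T s', frame (iwrites c) (rwrites c) s s' -> Q T s' -> Q' T s') ->
  wp c Q s -> wp c Q' s.
Proof.
move=> h [T [s' [e q]]]; exists T, s'; split=> //.
by apply: h => //; apply: exec_frame e.
Qed.

Lemma wp_skip Q s : Q 1%N s -> wp Skip Q s.
Proof. by exists 1%N, s; split=> //; constructor. Qed.

Lemma wp_iset a e v Q s :
  Q (icost e + icost v).+1 (seti s a (ieval M s e) (ieval M s v)) ->
  wp (ISet a e v) Q s.
Proof. by move=> h; eexists; eexists; split; [constructor|]. Qed.

Lemma wp_rset a e v Q s :
  Q (icost e + rcost v).+1 (setr s a (ieval M s e) (reval M s v)) ->
  wp (RSet a e v) Q s.
Proof. by move=> h; eexists; eexists; split; [constructor|]. Qed.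

Lemma wp_store a e v Q s i x : ieval M s e = i -> ieval M s v = x ->
  (forall s', frame [:: a] [::] s s' ->
     (forall j, imem s' a j = if j == i then x else imem s a j) ->
     Q (icost e + icost v).+1 s') ->
  wp (ISet a e v) Q s.
Proof.
move=> he hv hQ; apply: wp_iset; rewrite he hv; apply: hQ.
  by apply: frame_seti; rewrite inE.
by move=> j; rewrite /seti /update /= eqxx.
Qed.

Lemma wp_assign a v Q s x : ieval M s v = x ->
  (forall s', frame [:: a] [::] s s' -> imem s' a 0 = x ->
     Q (icost v + 2)%N s') ->
  wp (a ::= v) Q s.
Proof.
move=> hv hQ; apply: (@wp_store _ _ _ _ _ 0%N x) => //=; first exact: mod0n.
move=> s' hf h; rewrite (_ : (1 + icost v).+1 = icost v + 2)%N; last by lia.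
by apply: hQ => //; rewrite h.
Qed.

Lemma wp_seq c1 c2 Q s :
  wp c1 (fun T1 s1 => wp c2 (fun T2 s2 => Q (T1 + T2)%N s2) s1) s ->
  wp (c1 ;; c2) Q s.
Proof.
move=> [T1 [s1 [e1 [T2 [s2 [e2 q]]]]]].
by exists (T1 + T2)%N, s2; split=> //; econstructor; eauto.
Qed.

Lemma wp_if b c1 c2 Q s :
  (beval M s b -> wp c1 (fun T s' => Q (bcost b + T).+1 s') s) ->
  (~~ beval M s b -> wp c2 (fun T s' => Q (bcost b + T).+1 s') s) ->
  wp (If b c1 c2) Q s.
Proof.
move=> h1 h2; case: (boolP (beval M s b)) => hb.
  have [T [s' [e q]]] := h1 hb.
  by exists (bcost b + T).+1, s'; split=> //; constructor; rewrite hb.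
have [T [s' [e q]]] := h2 hb.
by exists (bcost b + T).+1, s'; split=> //; constructor; rewrite (negbTE hb).
Qed.

(* [Inv] carries the time spent so far, so that bodies of varying cost can be
   accounted for by potential arguments. *)
Lemma wp_while b c (Inv : nat -> state R -> Prop) (mu : state R -> nat) Q s :
  Inv 0%N s ->
  (forall T s', frame (iwrites c) (rwrites c) s s' -> Inv T s' ->
    beval M s' b ->
    wp c (fun T' s'' => Inv (T + T' + bcost b).+1 s'' /\
                        (mu s'' < mu s')%N) s') ->
  (forall T s', frame (iwrites c) (rwrites c) s s' -> Inv T s' ->
    ~~ beval M s' b -> Q (T + bcost b).+1 s') ->
  wp (While b c) Q s.
Proof.
move=> h0 hstep hQ.
suff main k : forall T s', (mu s' < k)%N ->
    frame (iwrites c) (rwrites c) s s' -> Inv T s' ->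
    wp (While b c) (fun T' s'' => Q (T + T')%N s'') s'.
  exact: (main (mu s).+1 0%N s).
elim: k => // k IH T s' hk hf hI.
case: (boolP (beval M s' b)) => hb; last first.
  exists (bcost b).+1, s'; split; first by constructor.
  by rewrite addnS; apply: hQ.
have [T1 [s1 [e1 [q1 d1]]]] := hstep T s' hf hI hb.
have hf1 := frame_trans hf (exec_frame e1).
have [|T2 [s2 [e2 q2]]] := IH _ s1 _ hf1 q1; first by lia.
exists (bcost b + T1 + T2).+1, s2; split; first by econstructor; eauto.
suff -> : (T + (bcost b + T1 + T2).+1 = (T + T1 + bcost b).+1 + T2)%N by [].
by lia.
Qed.

(** The bound [e] is evaluated anew in every round, hence the condition that it reads no array the
    loop writes; the invariant must survive the writes to the counter. A round costs [icost e + 11]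
    besides the body: test and increment. The extra [icost e + 8] pays for the initial reset and the
    failing test. *)
Lemma wp_for_gen x e c (Inv : nat -> nat -> state R -> Prop) n Q s :
  x \notin iwrites c -> all (fun a => a \notin x :: iwrites c) (iarrays e) ->
  (n < M)%N -> ieval M s e = n ->
  (forall i T s' v, Inv i T s' -> Inv i T (seti s' x 0 v)) ->
  Inv 0%N 0%N s ->
  (forall i T s', (i < n)%N -> frame (x :: iwrites c) (rwrites c) s s' ->
    imem s' x 0 = i -> Inv i T s' ->
    wp c (fun T' s'' => Inv i.+1 (T + T')%N s'') s') ->
  (forall T s', frame (x :: iwrites c) (rwrites c) s s' ->
    imem s' x 0 = n -> Inv n T s' -> Q (T + n * (icost e + 11) + icost e + 8)%N s') ->
  wp (For x e c) Q s.
Proof.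
move=> xc hx nM en hset h0 hstep hQ.
apply: wp_seq; apply: wp_iset; rewrite /= mod0n.
set s0 := seti s x 0 0.
have f0 : frame (x :: iwrites c) (rwrites c) s s0.
  by apply: frame_seti; rewrite inE eqxx.
pose I' T s' := exists i T0, [/\ (i <= n)%N, imem s' x 0 = i, Inv i T0 s',
   T = (T0 + i * (icost e + 11))%N & frame (x :: iwrites c) (rwrites c) s s'].
have fsub s1 s2 : frame (iwrites c) (rwrites c) s1 s2 ->
    frame (x :: iwrites c) (rwrites c) s1 s2.
  by apply: frame_sub; apply/allP => y hy; rewrite inE ?in_cons ?hy ?orbT.
apply: (@wp_while _ _ I' (fun s' => (n - imem s' x 0)%N)).
- exists 0%N, 0%N; split=> //; last by apply: hset.
  by rewrite /s0 /= /update !eqxx.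
- move=> T s' _ [i [T0 [ile ix hI TE hf]]] /=; rewrite mod0n ix.
  rewrite (ieval_frame M hf hx) en -ltnNge => ilt.
  apply: wp_seq.
  have [T1 [s1 [e1 q1]]] := hstep i T0 s' ilt hf ix hI.
  have f1 := exec_frame e1.
  exists T1, s1; split=> //; apply: wp_iset; rewrite /= /iop_eval /= !mod0n.
  have x1 : imem s1 x 0 = i by rewrite (f1.1 x xc).
  have M1 : (1 < M)%N by lia.
  have vE : ((imem s1 x 0 + 1 %% M) %% M = i.+1)%N.
    by rewrite x1 (modn_small M1) addn1 modn_small //; lia.
  rewrite vE; split; last by rewrite /update !eqxx /=; lia.
  exists i.+1, (T0 + T1)%N; split=> //=.
  + by rewrite /update !eqxx.
  + exact: hset.
  + by rewrite TE mulSn; lia.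
  + apply: frame_trans hf (frame_trans (fsub _ _ f1) _).
    by apply: frame_seti; rewrite inE eqxx.
- move=> T s' _ [i [T0 [ile ix hI TE hf]]] /=; rewrite mod0n ix.
  rewrite (ieval_frame M hf hx) en -ltnNge -leqNgt => nle.
  have iE : i = n by lia.
  rewrite iE in ix hI TE.
  suff -> : (3 + (T + (bcost (BNot (BILe e (Var x))))).+1 =
             T0 + n * (icost e + 11) + icost e + 8)%N by apply: hQ.
  by rewrite TE /=; lia.
Qed.

Lemma wp_for x e c (Inv : nat -> state R -> Prop) n B Q s :
  x \notin iwrites c -> all (fun a => a \notin x :: iwrites c) (iarrays e) ->
  (n < M)%N -> ieval M s e = n ->
  (forall i s' v, Inv i s' -> Inv i (seti s' x 0 v)) ->
  Inv 0%N s ->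
  (forall i s', (i < n)%N -> frame (x :: iwrites c) (rwrites c) s s' ->
    imem s' x 0 = i -> Inv i s' ->
    wp c (fun T' s'' => (T' <= B)%N /\ Inv i.+1 s'') s') ->
  (forall T s', frame (x :: iwrites c) (rwrites c) s s' ->
    imem s' x 0 = n -> Inv n s' ->
    (T <= n * (B + icost e + 11) + icost e + 8)%N -> Q T s') ->
  wp (For x e c) Q s.
Proof.
move=> xc hx nM en hset h0 hstep hQ.
apply: (@wp_for_gen x e c (fun i T s' => (T <= i * B)%N /\ Inv i s') n) => //.
- by move=> i T s' v [? ?]; split=> //; apply: hset.
- move=> i T s' ilt hf ix [hT hI].
  apply: wp_weaken (hstep i s' ilt hf ix hI) => T' s'' _ [h1 h2]; split=> //.
  by rewrite mulSn; lia.
- move=> T s' hf ix [hT hI]; apply: hQ => //.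
  by rewrite !mulnDr; lia.
Qed.

End Wp.

(** * Discounted walks *)

Lemma ex_min (P : nat -> Prop) :
  (exists n, P n) -> exists n, P n /\ forall k, P k -> (n <= k)%N.
Proof.
move=> [n]; elim/ltn_ind: n => n IH Pn.
have [[k [kn Pk]]|h] := pselect (exists k, (k < n)%N /\ P k); first exact: IH Pk.
exists n; split=> // k Pk; rewrite leqNgt; apply/negP => kn.
by apply: h; exists k.
Qed.

(** The order with [None] as infinity, so that partially filled tables are compared without extended
    reals. *)
Definition ole (R : realType) (o : option R) (x : R) :=
  if o is Some y then y <= x else false.

Definition omin (R : realType) (o : option R) (x : R) :=
  if ole o x then o else Some x.

Lemma ole_trans (R : realType) (o : option R) (x y : R) :
  ole o x -> x <= y -> ole o y.
Proof. by case: o => //= z; apply: le_trans. Qed.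

Lemma omin_le (R : realType) (o : option R) (x : R) : ole (omin o x) x.
Proof. by rewrite /omin; case: ifP => //=. Qed.

Lemma ole_omin (R : realType) (o : option R) (x y : R) :
  ole o y -> ole (omin o x) y.
Proof.
rewrite /omin; case: o => //= z zy; case: ifP => //= /negbT.
by rewrite -ltNge => /ltW xz; apply: le_trans xz zy.
Qed.

Section Graph.
Context (R : realType) (N m : nat) (src dst : nat -> nat) (cst : nat -> R) (g : R).
Hypotheses (g0 : 0 < g) (g1 : g < 1).
Hypothesis srcN : forall e, (e < m)%N -> (src e < N)%N.
Hypothesis dstN : forall e, (e < m)%N -> (dst e < N)%N.
Implicit Types (s t u v b : nat) (p q C : seq nat) (x y z : R).

Fixpoint walk s p t : bool :=
  if p is e :: p' then [&& (e < m)%N, src e == s & walk (dst e) p' t] else s == t.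

(** The cost of [p] followed by a continuation of value [x]. As a function of [x] it is affine and
    increasing with slope [g ^+ size p], and concatenation of walks becomes composition of maps;
    [fval p 0] is the discounted cost. *)
Definition fval p x := foldr (fun e y => cst e + g * y) x p.

Definition verts s p := s :: map dst p.

Definition reach s t := exists p, walk s p t.

Lemma fval_cat p q x : fval (p ++ q) x = fval p (fval q x).
Proof. exact: foldr_cat. Qed.

Lemma fvalE p x : fval p x = fval p 0 + g ^+ size p * x.
Proof.
by elim: p => [|e p IH] /=; rewrite ?expr0 ?mul1r ?add0r// IH exprS; ring.
Qed.

Lemma fval_rcons p e : fval (rcons p e) 0 = fval p 0 + cst e * g ^+ size p.
Proof. by rewrite -cats1 fval_cat fvalE /= mulr0 addr0 mulrC. Qed.

Lemma ler_fval p x y : (fval p x <= fval p y) = (x <= y).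
Proof. by rewrite (fvalE _ x) (fvalE _ y) lerD2l ler_pM2l// exprn_gt0. Qed.

Lemma walk_cat s p u q t : walk s p u -> walk u q t -> walk s (p ++ q) t.
Proof.
by elim: p s => [s /eqP->|e p IH s] //= /and3P[-> -> /IH h] /h ->.
Qed.

Lemma walk_split s p q t :
  walk s (p ++ q) t -> exists u, [/\ walk s p u, walk u q t & u = last s (map dst p)].
Proof.
elim: p s => [s|e p IH s] /=; first by exists s.
by move=> /and3P[-> -> /IH[u [h1 h2 h3]]]; exists u.
Qed.

Lemma walk_last s p t : walk s p t -> t = last s (map dst p).
Proof. by elim: p s => [s /eqP->|e p IH s] //= /and3P[_ _ /IH]. Qed.

Lemma walk_rcons s p e : walk s p (src e) -> (e < m)%N -> walk s (rcons p e) (dst e).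
Proof. by move=> h em; rewrite -cats1; apply: walk_cat h _; rewrite /= em !eqxx. Qed.

Lemma walk_rconsP s p e t :
  walk s (rcons p e) t -> [/\ walk s p (src e), (e < m)%N & dst e = t].
Proof.
rewrite -cats1 => /walk_split[u [h1 /=/and3P[em /eqP su /eqP dt] _]].
by rewrite su.
Qed.

Lemma walk_N s p t : (s < N)%N -> walk s p t -> all (fun v => v < N)%N (verts s p).
Proof.
rewrite /verts /= => ->; elim: p s => //= e p IH s /and3P[em _ /IH ->].
by rewrite dstN.
Qed.

Lemma walk_end_N s p t : (s < N)%N -> walk s p t -> (t < N)%N.
Proof.
move=> sN h; apply: (allP (walk_N sN h)).
by rewrite (walk_last h) /verts mem_last.
Qed.

Lemma reach_refl s : reach s s.
Proof. by exists [::] => /=. Qed.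

Lemma reach_trans s u t : reach s u -> reach u t -> reach s t.
Proof. by move=> [p hp] [q hq]; exists (p ++ q); apply: walk_cat hq. Qed.

Lemma reach_edge e : (e < m)%N -> reach (src e) (dst e).
Proof. by move=> em; exists [:: e]; rewrite /= em !eqxx. Qed.

Lemma walk_vert s p u b :
  walk s p u -> b \in verts s p -> exists p1 p2,
    [/\ p = p1 ++ p2, walk s p1 b & walk b p2 u].
Proof.
elim: p s => [s|e p IH s].
  by move=> h; rewrite inE => /eqP->; exists [::], [::]; split=> //=.
move=> h; rewrite inE => /orP[/eqP->|]; first by exists [::], (e :: p); split=> //=.
move: h => /= /and3P[em se /IH h] /h[p1 [p2 [-> h1 h2]]].
by exists (e :: p1), p2; rewrite /= em se.
Qed.

Lemma walk_repeat s p u : walk s p u -> ~~ uniq (verts s p) ->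
  exists v p1 C p2, [/\ p = p1 ++ C ++ p2, C != [::], walk s p1 v, walk v C v
                      & walk v p2 u].
Proof.
elim: p s => [s|e p IH s] // h.
rewrite -[verts s _]/(s :: verts (dst e) p) cons_uniq negb_and negbK.
have /= /and3P[em /eqP se hp] := h.
move=> /orP[sp|nu].
  have [p1 [p2 [pE h1 h2]]] := walk_vert hp sp.
  exists s, [::], (e :: p1), p2; split=> //=; first by rewrite pE.
    by rewrite em se eqxx.
have [v [p1 [C [p2 [-> C0 h1 h2 h3]]]]] := IH _ hp nu.
by exists v, (e :: p1), C, p2; split=> //=; rewrite em se eqxx.
Qed.

Lemma long_walk_repeat s p u : (s < N)%N -> walk s p u -> (N <= size p)%N ->
  ~~ uniq (verts s p).
Proof.
move=> sN h np; apply/negP => un.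
have : (size (verts s p) <= size (iota 0 N))%N.
  by apply: uniq_leq_size => // v /(allP (walk_N sN h)); rewrite mem_iota.
by rewrite size_iota /= size_map; lia.
Qed.

(** The distance is an infimum that may not be attained, so an upper bound on it is expressed by
    walks up to any positive error. Together, [dle] and [dlb] say that [x] is the distance. *)
Definition dle s t x :=
  forall eps : R, 0 < eps -> exists p, walk s p t /\ fval p 0 < x + eps.
Definition dlb s t x := forall p, walk s p t -> x <= fval p 0.

Lemma dle_reach s t x : dle s t x -> reach s t.
Proof. by move=> /(_ 1 ltr01)[p [h _]]; exists p. Qed.

Lemma dle_walk s p t : walk s p t -> dle s t (fval p 0).
Proof. by move=> h e e0; exists p; rewrite ltrDl. Qed.

(** Prefixing [p] multiplies the error by [g ^+ size p], which is at most 1. *)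
Lemma dle_pre s p b t x : walk s p b -> dle b t x -> dle s t (fval p x).
Proof.
move=> h hx e e0; have [q [hq qx]] := hx _ e0.
exists (p ++ q); split; first exact: walk_cat hq.
rewrite fval_cat (fvalE _ x) (fvalE _ (fval q 0)) -addrA ltrD2l.
have gp : 0 < g ^+ size p by rewrite exprn_gt0.
have gp1 : g ^+ size p <= 1 by apply: exprn_ile1; rewrite ltW.
apply: (@lt_le_trans _ _ (g ^+ size p * (x + e))); first by rewrite ltr_pM2l.
by rewrite mulrDr lerD2l ler_piMl// ltW.
Qed.

Lemma gpow1 C : C != [::] -> 0 < 1 - g ^+ size C.
Proof.
by case: C => // e C _; rewrite subr_gt0; apply: exprn_ilt1 => //=; apply: ltW.
Qed.

(* Repeating the closed walk [C] contracts every value towards the fixed point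
   of [fval C]. *)
Lemma dle_loop v C t : walk v C v -> C != [::] -> reach v t ->
  dle v t (fval C 0 / (1 - g ^+ size C)).
Proof.
move=> hC C0 [p hp] eps e0.
set qv := _ / _; set r := g ^+ size C.
have r1 := gpow1 C0.
have qE : fval C qv = qv.
  by rewrite fvalE /qv; field; rewrite lt0r_neq0.
pose it n := iter n (fun q => C ++ q) p.
have wit n : walk v (it n) t by elim: n => //= n IH; apply: walk_cat IH.
have fit n : fval (it n) 0 = qv + r ^+ n * (fval p 0 - qv).
  elim: n => [|n IH]; first by rewrite expr0 mul1r /=; ring.
  move: qE; rewrite fvalE -/r => qE.
  by rewrite /= fval_cat IH exprS fvalE -/r mulrDr addrA qE mulrA.
have rr : `|r| < 1 by rewrite ger0_norm; [rewrite -subr_gt0|rewrite exprn_ge0// ltW].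
have K0 : 0 < `|fval p 0 - qv| + 1 by rewrite ltr_wpDl.
have : ((fun n => r ^+ n) @ \oo --> (0 : R))%classic by apply: cvg_expr.
move=> /cvgrPdist_lt /(_ (eps / (`|fval p 0 - qv| + 1)) (divr_gt0 e0 K0)).
move=> [n _ /(_ n (leqnn n))] /=; rewrite sub0r normrN => hn.
exists (it n); split=> //; rewrite fit ltrD2l.
apply: le_lt_trans (ler_norm _) _; rewrite normrM.
move: hn; rewrite ltr_pdivlMr// => hn; apply: le_lt_trans hn.
by apply: ler_wpM2l => //; rewrite lerDl.
Qed.

(** If no edge costs less than [- K], then [- K / (1 - g)], the fixed point of x -> - K + g x,
    bounds all walks from below. This makes the infimum finite. *)
Lemma walk_lb : exists B : R, forall s p t, walk s p t -> B <= fval p 0.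
Proof.
have [K [K0 hK]] : exists K : R, 0 <= K /\ forall e, (e < m)%N -> - K <= cst e.
  exists (\sum_(e < m) `|cst e|); split; first by apply: sumr_ge0.
  move=> e em; rewrite lerNl; apply: le_trans (ler_norm _) _; rewrite normrN.
  by rewrite (bigD1 (Ordinal em)) //= lerDl; apply: sumr_ge0.
exists (- K / (1 - g)) => s p t.
have h1 : 0 < 1 - g by rewrite subr_gt0.
elim: p s => [s _|e p IH s /= /and3P[em _ /IH h]].
  by rewrite mulNr oppr_le0 divr_ge0// ltW.
apply: (@le_trans _ _ (- K + g * (- K / (1 - g)))).
  rewrite le_eqVlt; apply/orP; left; apply/eqP; field; exact: lt0r_neq0.
by apply: lerD; [apply: hK|rewrite ler_pM2l].
Qed.

Lemma dist_exists s t : reach s t -> exists x, dle s t x /\ dlb s t x.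
Proof.
move=> [p0 hp0]; have [B hB] := walk_lb.
pose A := [set x | exists2 p, walk s p t & x = fval p 0]%classic.
have hA : has_inf A.
  split; first by exists (fval p0 0), p0.
  by exists B => x [p hp ->]; apply: hB hp.
exists (inf A); split=> [e e0|p hp].
  by have [x [p hp ->] hx] := inf_adherent e0 hA; exists p.
by apply: ge_inf; [case: hA|exists p].
Qed.

Lemma dle_dlb s t x y : dle s t x -> dlb s t y -> y <= x.
Proof.
move=> hx hy; apply/ler_addgt0Pr => e e0.
by have [p [/hy hp /ltW]] := hx _ e0; apply: le_trans.
Qed.

(** * Optimal routes to a fixed target *)

Section Target.
Variables (t : nat) (d : nat -> R).
Hypothesis d_le : forall v, reach v t -> dle v t (d v).
Hypothesis d_lb : forall v, dlb v t (d v).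

Lemma d_pre s p b : walk s p b -> reach b t -> d s <= fval p (d b).
Proof. by move=> h /d_le/(dle_pre h)/dle_dlb; apply; apply: d_lb. Qed.

(** There are finitely many edges, so the infimum over the first edge is a minimum even if no walk
    attains the distance. The other alternative is the empty walk, which exists only at the target.
    If both failed, every walk would exceed [d v] by a fixed positive amount. *)
Lemma bellman v : reach v t -> (v = t /\ d t = 0) \/
  exists e, [/\ (e < m)%N, src e = v, reach (dst e) t & d v = cst e + g * d (dst e)].
Proof.
move=> vt; apply: contrapT => /not_orP[h1 h2].
pose P e := [/\ (e < m)%N, src e = v & reach (dst e) t].
have [eps [e0 he]] : exists eps, 0 < eps /\
    forall e, P e -> d v + eps <= cst e + g * d (dst e).
  (* Finitely many positive gaps have a common lower bound; it is built by induction on the number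
     of edges considered. *)
  suff main n : exists eps, 0 < eps /\
      forall e, (e < n)%N -> P e -> d v + eps <= cst e + g * d (dst e).
    by have [eps [? h]] := main m; exists eps; split=> // e Pe; apply: h; case: Pe.
  elim: n => [|n [eps [e0 h]]]; first by exists 1.
  have [Pn|nPn] := pselect (P n); last first.
    exists eps; split=> // e; rewrite ltnS leq_eqVlt => /orP[/eqP->|] //.
    exact: h.
  have gap : d v < cst n + g * d (dst n).
    rewrite lt_neqAle; apply/andP; split.
      by apply/eqP => E; apply: h2; exists n; case: Pn.
    case: Pn => nm sn rn.
    have w1 : walk v [:: n] (dst n) by rewrite /= nm sn !eqxx.
    exact: (d_pre w1 rn).
  exists (Num.min eps (cst n + g * d (dst n) - d v)); split.
    by rewrite lt_min e0 subr_gt0.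
  move=> e; rewrite ltnS leq_eqVlt => /orP[/eqP->|en] Pe.
    rewrite -lerBrDl ge_min; apply/orP; right; lra.
  rewrite -lerBrDl ge_min lerBrDl (h _ en Pe) //.
(* The gap of the empty walk, a competitor only when [v = t]. *)
have [eps' [e0' he']] : exists eps', 0 < eps' /\ (v = t -> eps' <= - d v).
  have [vt'|nvt] := pselect (v = t); last by exists 1.
  exists (- d v); split=> //; rewrite oppr_gt0 lt_neqAle.
  apply/andP; split; first by apply/eqP => E; apply: h1; rewrite -vt'.
  by have /(@d_lb v) : walk v [::] t by rewrite /= vt'.
have : 0 < Num.min eps eps' by rewrite lt_min e0 e0'.
move=> /(d_le vt)[[|e p] []].
  move=> /= /eqP /he' h; rewrite ltNge; apply/negP; rewrite negbK.
  by rewrite -lerBrDl sub0r ge_min h orbT.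
move=> /= /and3P[em /eqP se hp]; rewrite ltNge; apply/negP; rewrite negbK.
have rd : reach (dst e) t by exists p.
apply: (@le_trans _ _ (d v + eps)); first by rewrite lerD2l ge_min lexx.
apply: le_trans (he e _) _ => //.
by rewrite lerD2l ler_pM2l//; apply: d_lb.
Qed.

(** The walk [p] is the beginning of an optimal, possibly infinite, route: following it and then
    continuing optimally from [u] loses nothing. *)
Definition tight s p u := [/\ walk s p u, reach u t & d s = fval p (d u)].

Lemma tight_cat s p u q v : tight s p u -> tight u q v -> tight s (p ++ q) v.
Proof.
move=> [h1 _ h3] [k1 k2 k3]; split=> //; first exact: walk_cat k1.
by rewrite fval_cat -k3.
Qed.

Lemma tight_split s p u q v : walk s p u -> walk u q v -> tight s (p ++ q) v ->
  tight s p u /\ tight u q v.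
Proof.
move=> h1 h2 [_ rv]; rewrite fval_cat => E.
have ru : reach u t by apply: reach_trans rv; exists q.
have le1 := d_pre h2 rv; have le2 := d_pre h1 ru.
have E2 : d u = fval q (d v).
  by apply/eqP; rewrite eq_le le1 -(ler_fval p) -E le2.
by split; split=> //; rewrite E E2.
Qed.

(** Equal length means equal slope of [fval], so a walk that is no more expensive on its own is no
    more expensive with any continuation. This is why costs must be computed for each exact
    length. *)
Lemma tight_canon s p u p' : tight s p u -> walk s p' u -> size p' = size p ->
  fval p' 0 <= fval p 0 -> tight s p' u.
Proof.
move=> [h1 ru E] h' sz le; split=> //; apply/eqP; rewrite eq_le d_pre//=.
by rewrite E (fvalE p) (fvalE p') sz lerD2r.
Qed.

Lemma tight_loop v C : tight v C v -> C != [::] ->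
  d v = fval C 0 / (1 - g ^+ size C).
Proof.
move=> [_ _ E] /gpow1 h; move: E; rewrite fvalE => E.
have h' := lt0r_neq0 h.
by apply: (mulIf h'); rewrite divfK// mulrBr mulr1 [d v * _]mulrC {1}E addrK.
Qed.

Lemma tight_repeat s p u : tight s p u -> ~~ uniq (verts s p) ->
  exists v p1 C p2, [/\ p = p1 ++ C ++ p2, C != [::], tight s p1 v, tight v C v
                      & tight v p2 u].
Proof.
move=> T nu; have [hw _ _] := T.
have [v [p1 [C [p2 [pE C0 h1 h2 h3]]]]] := walk_repeat hw nu.
exists v, p1, C, p2; rewrite pE in T.
have [T1 T2] := tight_split h1 (walk_cat h2 h3) T.
by have [T3 T4] := tight_split h2 h3 T2.
Qed.

(** By [bellman] a tight walk can be prolonged by one edge until it stands at the target with value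
    0. If that never happens, a tight walk of [N] edges repeats a vertex, and the part between the
    two visits is a tight closed walk. *)
Lemma tight_end s : (s < N)%N -> reach s t -> (exists p, tight s p t /\ d t = 0) \/
  exists p v C, [/\ tight s p v, tight v C v & C != [::]].
Proof.
move=> sN st; apply: contrapT => /not_orP[h1 h2].
have long n : exists p u, tight s p u /\ size p = n.
  elim: n => [|n [p [u [T sz]]]]; first by exists [::], s; split=> //; split=> /=.
  have [_ ru _] := T; have [[ut dt]|[e [em se re E]]] := bellman ru.
    by exfalso; apply: h1; exists p; rewrite -{1}ut.
  exists (rcons p e), (dst e); rewrite size_rcons sz; split=> //.
  rewrite -cats1; apply: tight_cat T _; split=> //=.
  by rewrite em se !eqxx.
have [p [u [T sz]]] := long N.
have [hw _ _] := T.
have nu : ~~ uniq (verts s p) by apply: long_walk_repeat hw _ => //; rewrite sz.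
have [v [p1 [C [p2 [_ C0 T1 T2 _]]]]] := tight_repeat T nu.
by apply: h2; exists p1, v, C.
Qed.

Variables (S : nat -> seq nat) (L : nat -> nat) (top : nat) (Q : nat -> option R).
Hypothesis S0 : forall v, (v < N)%N -> v \in S 0.
Hypothesis Stop : S top = [::].

(** Only a substitute [p'] has to be hit, and only if it is free of repetitions: [tight_canon]
    permits the substitution, and a repetition yields a tight closed walk, which is treated
    separately. *)
Definition hits (A B : seq nat) (l : nat) := forall s p v, s \in A ->
  walk s p v -> size p = l -> exists p', [/\ walk s p' v, size p' = l,
    fval p' 0 <= fval p 0 &
    uniq (verts s p') -> exists2 b, b \in B & b \in verts s p'].

Hypothesis Lpos : forall i, (i < top)%N -> (0 < L i)%N.
Hypothesis hitS : forall i, (i < top)%N -> hits (S i) (S i.+1) (L i).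
Hypothesis Qle : forall i s C, (i < top)%N -> s \in S i -> walk s C s ->
  (0 < size C <= L i)%N -> ole (Q s) (fval C 0 / (1 - g ^+ size C)).

(** Vertices from which the rest of an optimal route needs no further search: the end of the walk,
    or a place where [Q] already records the optimal infinite repetition. *)
Definition terminal v := (v = t /\ d t = 0) \/ (reach v t /\ ole (Q v) (d v)).

(** Among all tight closed walks that can be reached tightly, take one of minimal length. It can be
    rotated to start in [S i] for higher and higher [i] until its length is at most [L i], where [Q]
    has seen it; since [S top] is empty, this must happen. Rotation is possible because its first
    [L i] edges, once replaced by a computed walk, either are hit or contain a shorter tight closed
    walk, which minimality excludes. *)
Lemma terminal_exists s : (s < N)%N -> reach s t ->
  exists p v, tight s p v /\ terminal v.
Proof.
move=> sN st.
have [[p [T dt]]|hloop] := tight_end sN st.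
  by exists p, t; split=> //; left.
(* Minimality ranges over all base points, so that it also applies to closed walks found later
   inside substitutes. *)
pose P l := exists p v C, [/\ tight s p v, tight v C v, C != [::] & size C = l].
have [|l [[p [v [C [Tp TC C0 szC]]]] lmin]] := @ex_min P.
  by have [p [v [C [? ? ?]]]] := hloop; exists (size C), p, v, C.
suff main i : (i <= top)%N -> (exists p v, tight s p v /\ terminal v) \/
    exists p v C, [/\ v \in S i, tight s p v, tight v C v, C != [::] & size C = l].
  have [//|[p' [v' [C' []]]]] := main top (leqnn _).
  by rewrite Stop.
elim: i => [_|i IH itop].
  right; exists p, v, C; split=> //; apply: S0.
  by have [/(walk_end_N sN) ->] := Tp.
have [//|[p1 [v1 [C1 [vS T1 T2 C10 sz1]]]]] := IH (ltnW itop); first by left.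
have [lL|Ll] := leqP l (L i).
  left; exists p1, v1; split=> //; right.
  have [_ rv _] := T1; split=> //; rewrite (tight_loop T2 C10).
  apply: (Qle itop vS) => //; first by case: T2.
  by rewrite sz1 lL lt0n -sz1 size_eq0 C10.
right.
have szt : size (take (L i) C1) = L i by rewrite size_takel // sz1 ltnW.
have [hwC _ _] := T2.
have := hwC; rewrite -{1}(cat_take_drop (L i) C1) => /walk_split[u [w1 w2 _]].
have [p' [w1' sz' le' hb]] := hitS itop vS w1 szt.
have [T3 T4] : tight v1 (take (L i) C1) u /\ tight u (drop (L i) C1) v1.
  by apply: tight_split => //; rewrite cat_take_drop.
have T3' := tight_canon T3 w1' (etrans sz' (esym szt)) le'.
have [un|nu] := boolP (uniq (verts v1 p')); last first.
  have [v2 [q1 [C2 [q2 [pE C20 U1 U2 U3]]]]] := tight_repeat T3' nu.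
  exfalso; have : (l <= size C2)%N.
    by apply: lmin; exists (p1 ++ q1), v2, C2; split=> //; apply: tight_cat U1.
  by move: sz'; rewrite pE !size_cat; clear - Ll; lia.
have [b bS bv] := hb un.
have [q1 [q2 [pE k1 k2]]] := walk_vert w1' bv.
move: (T3'); rewrite pE => /(tight_split k1 k2)[U1 U2].
(* The same closed walk, with its first part replaced by the substitute, started at the hit vertex
   [b]; its length is still [l]. *)
exists (p1 ++ q1), b, (q2 ++ drop (L i) C1 ++ q1); split=> //.
- exact: tight_cat U1.
- by apply: tight_cat U2 (tight_cat T4 U1).
- rewrite -size_eq0 !size_cat size_drop; apply/eqP.
  by rewrite sz1; clear - Ll; lia.
- rewrite !size_cat size_drop; move: sz'; rewrite pE size_cat => sz'.
  by rewrite sz1; clear - Ll sz'; lia.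
Qed.

(** Take a tight walk from [s] to a terminal vertex of minimal length. If it has at most [L i]
    edges, [hbase] or [hQ] applies. Otherwise replace its first [L i] edges by a computed walk: a
    repetition there could be cut out, contradicting minimality, so the substitute meets [S i.+1]
    and [hstep] applies. *)
Lemma level_complete i (X : nat -> option R) s : (i < top)%N -> s \in S i ->
  (s < N)%N -> reach s t ->
  (forall p, walk s p t -> (size p <= L i)%N -> ole (X s) (fval p 0)) ->
  (forall p v z, walk s p v -> (size p <= L i)%N -> reach v t -> Q v = Some z ->
     ole (X s) (fval p z)) ->
  (forall p b, b \in S i.+1 -> walk s p b -> (size p <= L i)%N -> reach b t ->
     ole (X s) (fval p (d b))) ->
  ole (X s) (d s).
Proof.
move=> itop sS sN st hbase hQ hstep.
pose P l := exists p v, [/\ tight s p v, terminal v & size p = l].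
have [|l [[p [v [T tv sz]]] lmin]] := @ex_min P.
  by have [p [v [? ?]]] := terminal_exists sN st; exists (size p), p, v.
have [lL|Ll] := leqP l (L i).
  have [w rv E] := T; have [[vt dt]|[rv' hq]] := tv.
    by rewrite E vt dt; apply: hbase; rewrite ?sz// -vt.
  move: hq; case E2 : (Q v) => [z|] //= zd.
  apply: (@ole_trans _ _ (fval p z)); first by apply: (hQ p v z); rewrite ?sz.
  by rewrite E ler_fval.
have szt : size (take (L i) p) = L i by rewrite size_takel // sz ltnW.
have [hw _ _] := T.
have := hw; rewrite -{1}(cat_take_drop (L i) p) => /walk_split[u [w1 w2 _]].
have [p' [w1' sz' le' hb]] := hitS itop sS w1 szt.
have [T3 T4] : tight s (take (L i) p) u /\ tight u (drop (L i) p) v.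
  by apply: tight_split => //; rewrite cat_take_drop.
have T3' := tight_canon T3 w1' (etrans sz' (esym szt)) le'.
have [un|nu] := boolP (uniq (verts s p')); last first.
  have [v2 [q1 [C2 [q2 [pE C20 U1 U2 U3]]]]] := tight_repeat T3' nu.
  (* Without the closed part [C2] the walk is still tight: [tight] refers to the values at the
     vertices, not to absolute exponents. *)
  have : (l <= size (q1 ++ q2 ++ drop (L i) p))%N.
    apply: lmin; exists (q1 ++ q2 ++ drop (L i) p), v; split=> //.
    by apply: tight_cat U1 (tight_cat U3 T4).
  rewrite !size_cat size_drop => hl; exfalso.
  have c2 : (0 < size C2)%N by case: (C2) C20.
  by move: sz' hl c2; rewrite pE !size_cat sz; clear - Ll; lia.
have [b bS bv] := hb un.
have [q1 [q2 [pE k1 k2]]] := walk_vert w1' bv.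
move: (T3'); rewrite pE => /(tight_split k1 k2)[U1 U2].
have [_ rb ->] := U1; apply: hstep => //.
by rewrite -sz' pE size_cat leq_addr.
Qed.

End Target.

(** * The dynamic program over exact walk lengths *)

Definition layer (j E : nat) (o : nat -> nat -> option R) (pa : nat -> nat -> nat) :=
  forall v, (v < N)%N ->
  (forall e y, (e < E)%N -> dst e = v -> o j (src e) = Some y ->
     ole (o j.+1 v) (y + cst e * g ^+ j)) /\
  (forall x, o j.+1 v = Some x -> let e := pa j.+1 v in
     [/\ (e < E)%N, dst e = v & exists2 y, o j (src e) = Some y &
        x = y + cst e * g ^+ j]).

Lemma layer_ext j E o o' pa pa' : (E <= m)%N ->
  (forall v, (v < N)%N -> o' j v = o j v) ->
  (forall v, (v < N)%N -> o' j.+1 v = o j.+1 v) ->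
  (forall v, (v < N)%N -> pa' j.+1 v = pa j.+1 v) ->
  layer j E o pa -> layer j E o' pa'.
Proof.
move=> Em h1 h2 h3 h v vN; have [k1 k2] := h v vN; rewrite h2// h3//; split.
  by move=> e y eE ev; rewrite h1; [apply: k1|apply: srcN; apply: leq_trans Em].
move=> x /k2[eE ev [y Ey ->]]; split=> //; exists y => //.
by rewrite h1//; apply: srcN; apply: leq_trans Em.
Qed.

Lemma layer0 j o pa : (forall v, (v < N)%N -> o j.+1 v = None) -> layer j 0 o pa.
Proof. by move=> h v vN; split=> // x; rewrite h. Qed.

Lemma layerS j E o o' pa pa' : (E < m)%N ->
  (forall v, (v < N)%N -> o' j v = o j v) ->
  (if o j (src E) is Some y then let x := y + cst E * g ^+ j in
     forall v, (v < N)%N ->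
       o' j.+1 v = (if v == dst E then omin (o j.+1 v) x else o j.+1 v) /\
       pa' j.+1 v = (if (v == dst E) && ~~ ole (o j.+1 v) x then E else pa j.+1 v)
   else forall v, (v < N)%N -> o' j.+1 v = o j.+1 v /\ pa' j.+1 v = pa j.+1 v) ->
  layer j E o pa -> layer j E.+1 o' pa'.
Proof.
move=> Em h1; case E0 : (o j (src E)) => [y|] /= h2 h v vN; last first.
  have [k1 k2] := h v vN; have [-> ->] := h2 v vN; split.
    move=> e y; rewrite ltnS leq_eqVlt => /orP[/eqP->|eE] ev.
      by rewrite h1 ?srcN// E0.
    by rewrite h1; [apply: k1|apply: srcN; apply: ltn_trans Em].
  move=> x /k2[eE ev [y Ey ->]]; split=> //; first exact: leq_trans eE _.
  by exists y => //; rewrite h1//; apply: srcN; apply: ltn_trans Em.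
have [k1 k2] := h v vN; have [-> ->] := h2 v vN; split.
  move=> e y'; rewrite ltnS leq_eqVlt => /orP[/eqP->|eE] ev.
    by rewrite h1 ?srcN// E0 => -[<-]; rewrite ev eqxx omin_le.
  rewrite h1; last by apply: srcN; apply: ltn_trans Em.
  by move=> /(k1 _ _ eE ev); case: ifP => // _; apply: ole_omin.
move=> x; have old : o j.+1 v = Some x -> [/\ (pa j.+1 v < E.+1)%N,
    dst (pa j.+1 v) = v & exists2 y0, o' j (src (pa j.+1 v)) = Some y0 &
    x = y0 + cst (pa j.+1 v) * g ^+ j].
  move=> /k2[eE ev [y' Ey ->]]; split=> //; first exact: leq_trans eE _.
  by exists y' => //; rewrite h1//; apply: srcN; apply: ltn_trans Em.
case: eqP => [vE|_] //=; rewrite /omin; case: ifP => //= _ [<-]; split=> //.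
by exists y; rewrite ?h1 ?srcN.
Qed.

(** Table entries are total costs from the source, not nested values, so appending an edge to a walk
    of [j] edges adds [cst e * g ^+ j]. The entry [pa j.+1 v] is the last edge of the recorded walk,
    from which the whole walk is read backwards. *)
Definition dpok s l (o : nat -> nat -> option R) (pa : nat -> nat -> nat) :=
  (forall v, (v < N)%N -> o 0 v = if v == s then Some 0 else None) /\
  forall j, (j < l)%N -> layer j m o pa.

Fixpoint pwalk (pa : nat -> nat -> nat) j v : seq nat :=
  if j is j'.+1 then rcons (pwalk pa j' (src (pa j v))) (pa j v) else [::].

Fixpoint pverts (pa : nat -> nat -> nat) j v : seq nat :=
  if j is j'.+1 then rcons (pverts pa j' (src (pa j v))) v else [:: v].

Lemma dp_le s l o pa : dpok s l o pa -> (s < N)%N ->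
  forall p v, walk s p v -> (size p <= l)%N -> ole (o (size p) v) (fval p 0).
Proof.
move=> [oz ol] sN; elim/last_ind => [v /eqP <- _|p e IH v].
  by rewrite /= oz// eqxx /=.
rewrite size_rcons => /walk_rconsP[w em dv] pl; rewrite fval_rcons.
have := IH _ w (ltnW pl); case E : (o _ _) => [y|] //= yle.
have vN : (v < N)%N by rewrite -dv dstN.
have [h _] := ol _ pl v vN.
by apply: ole_trans (h e y em dv E) _; rewrite lerD2r.
Qed.

(** Every finite entry is the cost of an actual walk, namely the one read off the parents; the last
    clause links its vertices to what [Trace] stores. *)
Lemma dp_sound s l o pa : dpok s l o pa -> (s < N)%N ->
  forall j v x, (j <= l)%N -> (v < N)%N -> o j v = Some x ->
  [/\ walk s (pwalk pa j v) v, size (pwalk pa j v) = j,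
      fval (pwalk pa j v) 0 = x & verts s (pwalk pa j v) = pverts pa j v].
Proof.
move=> [oz ol] sN; elim=> [|j IH] v x jl vN.
  by rewrite oz//; case: eqP => // -> [<-]; rewrite /= eqxx.
move=> E; have [_ h] := ol _ jl v vN.
have [em dv [y Ey ->]] := h _ E.
have sN' : (src (pa j.+1 v) < N)%N by rewrite srcN.
have [w sz f vE] := IH _ y (ltnW jl) sN' Ey.
rewrite /= size_rcons sz fval_rcons sz f; split=> //.
  by have := walk_rcons w em; rewrite dv.
by rewrite -vE /verts map_rcons dv.
Qed.

End Graph.

(** * Expressions evaluated without overflow *)

Fixpoint ridx (v : rexp) : seq nat :=
  match v with
  | RNat _ => [::]
  | RGet _ e => iarrays e
  | RBin _ v1 v2 => ridx v1 ++ ridx v2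
  end.

(* Integer cell 4 holds the stride [W] of all two-dimensional arrays. *)
Definition Ix e1 e2 := e1 *^ Var 4 +^ e2.
Arguments Ix : simpl never.

(** The parent changes exactly when the value is strictly improved or set for the first time, so it
    always belongs to the stored value. An unset real cell may be compared, but the flag decides. *)
Definition SetMin fe fv pa i v e :=
  If (BNot (BAnd (BILe (INat 1) (IGet fe i)) (BRLe (RGet fv i) v)))
    (ISet pa i e ;; RSet fv i v ;; ISet fe i (INat 1)) Skip.

Definition cell (R : realType) (s : state R) fe fv i : option R :=
  if imem s fe i == 0%N then None else Some (rmem s fv i).

Lemma icost_Ix e1 e2 : icost (Ix e1 e2) = (icost e1 + icost e2 + 4)%N.
Proof. by rewrite /Ix /=; lia. Qed.

Lemma idx_eq W a a' b b' : (b < W)%N -> (b' < W)%N ->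
  (a * W + b == a' * W + b')%N = (a == a') && (b == b').
Proof.
move=> hb hb'; apply/eqP/andP => [h|[/eqP-> /eqP->]//].
have W0 : (0 < W)%N by lia.
have E : b = b'.
  by have := congr1 (modn^~ W) h; rewrite /= !modnMDl !modn_small.
by move: h; rewrite E => /addIn/eqP; rewrite eqn_pmul2r// => ->.
Qed.

Section Eval.
Context (R : realType) (M W : nat).
Hypotheses (W2 : (2 < W)%N) (WM : (W * W <= M)%N).
Implicit Types (s : state R) (Q : nat -> state R -> Prop).

Lemma ltWM : (W < M)%N.
Proof. by nia. Qed.

Lemma modW a : (a < W)%N -> (a %% M)%N = a.
Proof. by move=> h; rewrite modn_small//; apply: ltn_trans h ltWM. Qed.

Lemma modA a b : (a < W)%N -> (b < W)%N -> ((a + b) %% M)%N = (a + b)%N.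
Proof. by move=> h1 h2; rewrite modn_small//; nia. Qed.

Lemma modB a b : (a < W)%N -> ((a - b) %% M)%N = (a - b)%N.
Proof. by move=> h1; rewrite modn_small//; have := ltWM; lia. Qed.

Lemma modMul a b : (a < W)%N -> (b < W)%N -> ((a * b) %% M)%N = (a * b)%N.
Proof. by move=> h1 h2; rewrite modn_small//; nia. Qed.

Lemma ievalIx s e1 e2 i j : imem s 4 0 = W -> ieval M s e1 = i ->
  ieval M s e2 = j -> (i < W)%N -> (j < W)%N ->
  ieval M s (Ix e1 e2) = (i * W + j)%N.
Proof.
move=> h4 <- <- h1 h2.
rewrite /Ix /= /iop_eval mod0n h4.
by rewrite (@modn_small (_ * W)) ?modn_small//; nia.
Qed.

Lemma ieval_inc s e j : ieval M s e = j -> (j < W)%N -> ieval M s (e +^ INat 1) = j.+1.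
Proof.
move=> hx jW; rewrite /= /iop_eval hx (@modW 1) ?(ltn_trans _ W2)//.
by rewrite modA ?addn1// ?(ltn_trans _ W2).
Qed.

Lemma ieval_incr s x j : imem s x 0 = j -> (j < W)%N ->
  ieval M s (Var x +^ INat 1) = j.+1.
Proof.
by move=> hx; apply: ieval_inc; rewrite /= mod0n.
Qed.

Lemma reval_seti s a i x v : a \notin ridx v ->
  reval M (seti s a i x) v = reval M s v.
Proof.
have f : frame [:: a] [::] s (seti s a i x) by apply: frame_seti; rewrite inE.
elim: v => //= [b e h|o v1 IH1 v2 IH2].
  rewrite (ieval_frame M f)//; apply/allP => c hc; rewrite inE.
  by apply: contraNneq h => <-.
by rewrite mem_cat negb_or => /andP[h1 h2]; rewrite IH1 ?IH2.
Qed.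

Lemma ieval_seti s a i x e : a \notin iarrays e ->
  ieval M (seti s a i x) e = ieval M s e.
Proof.
move=> h; have f : frame [:: a] [::] s (seti s a i x).
  by apply: frame_seti; rewrite inE.
rewrite (ieval_frame M f)//; apply/allP => c hc; rewrite inE.
by apply: contraNneq h => <-.
Qed.

Lemma ieval_setr s a i x e : ieval M (setr s a i x) e = ieval M s e.
Proof. by elim: e => //= [b e ->|o e1 -> e2 ->]. Qed.

Lemma wp_setmin fe fv pa i v e Q s i0 x e0 :
  pa != fe -> pa \notin iarrays i -> pa \notin ridx v ->
  ieval M s i = i0 -> reval M s v = x -> ieval M s e = e0 ->
  (forall T s', (T <= 5 * icost i + 2 * rcost v + icost e + 20)%N ->
    frame [:: fe; pa] [:: fv] s s' ->
    (forall j, cell s' fe fv j =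
       if j == i0 then omin (cell s fe fv i0) x else cell s fe fv j) ->
    (forall j, imem s' pa j =
       if (j == i0) && ~~ ole (cell s fe fv i0) x then e0 else imem s pa j) ->
    Q T s') ->
  wp M (SetMin fe fv pa i v e) Q s.
Proof.
move=> pf pi pv hi hv he hQ.
have M1 : (1 < M)%N by have := ltWM; lia.
have oE : beval M s (BAnd (BILe (INat 1) (IGet fe i)) (BRLe (RGet fv i) v)) =
    ole (cell s fe fv i0) x.
  rewrite /= hi hv modn_small// /cell; case: ifP => [/eqP->//|/negbT].
  by rewrite lt0n => ->.
apply: wp_if => hb.
  have no : ~~ ole (cell s fe fv i0) x by rewrite -oE.
  apply: wp_seq; apply: wp_iset; rewrite hi he.
  apply: wp_seq; apply: wp_rset; rewrite ieval_seti// reval_seti// hi hv.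
  apply: wp_iset; rewrite ieval_setr ieval_seti// hi /= modn_small//.
  apply: hQ.
  - by rewrite /=; lia.
  - apply: (@frame_trans _ _ _ _ (seti s pa i0 e0)).
      by apply: frame_seti; rewrite !inE eqxx orbT.
    apply: (@frame_trans _ _ _ _ (setr (seti s pa i0 e0) fv i0 x)).
      by apply: frame_setr; rewrite inE.
    by apply: frame_seti; rewrite !inE eqxx.
  - move=> j; rewrite /cell /seti /setr /update /= !eqxx /= [fe == pa]eq_sym.
    rewrite (negbTE pf) /=.
    by case: (j == i0) => //=; rewrite /omin; case: ifP => // h; rewrite /cell h in no.
  - by move=> j; rewrite /seti /setr /update /= (negbTE pf) /= eqxx no andbT.
apply: wp_skip; rewrite /= in hb.
have yo : ole (cell s fe fv i0) x by rewrite -oE /=; rewrite negbK in hb.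
apply: hQ => //.
- by rewrite /=; lia.
- by move=> j; rewrite /omin yo; case: eqP => // ->.
- by move=> j; rewrite yo andbF.
Qed.

End Eval.

Global Opaque Ix.

(** * The program *)

(* Names of the arrays of the program: [v]... are integer arrays of which only
   cell 0 is used, [a]... other integer arrays, [r]... real arrays.  A partial real
   value occupies an integer cell, the flag, and a real cell: [aDe] and [rDv], and
   so on.  Array [ajunk] is never read: it receives the unwanted output of
   [SetMin]. *)
Notation ajunk := 99%N.
Notation vW := 4%N.
Notation vN := 5%N.
Notation aid := 6%N.
Notation aorig := 7%N.
Notation asrc := 8%N.
Notation adst := 9%N.
Notation vk := 10%N.
Notation vlg := 11%N.
Notation vs := 12%N.
Notation vj := 13%N.
Notation vv := 14%N.
Notation ve := 15%N.
Notation vL := 16%N.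
Notation aDe := 20%N.
Notation apar := 21%N.
Notation rpw := 3%N.
Notation rDv := 4%N.
Notation vt := 17%N.
Notation aXe := 22%N.
Notation aQe := 23%N.
Notation rXv := 5%N.
Notation rQv := 6%N.
Notation vq := 29%N.
Notation amem := 30%N.
Notation astamp := 31%N.
Notation atot := 32%N.
Notation acnt := 33%N.
Notation ainv := 34%N.
Notation ahit := 35%N.
Notation vok := 36%N.
Notation vcur := 37%N.
Notation vunhit := 38%N.
Notation vr := 28%N.
Notation vlev := 27%N.
Notation aS := 25%N.
Notation anS := 26%N.
Notation vbest := 39%N.
Notation vi := 40%N.
Notation aadj := 41%N.
Notation adeg := 42%N.
Notation aque := 43%N.
Notation vtail := 44%N.
Notation vhd := 45%N.
Notation amark := 46%N.
Notation vu := 47%N.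
Notation acr := 48%N.
Notation arep := 49%N.
Notation aord := 50%N.
Notation vpos := 51%N.
Notation vc := 52%N.
Notation aBe := 53%N.
Notation rBv := 7%N.
Notation vb := 55%N.
Notation vcn := 56%N.
Notation alo := 57%N.
Notation ahi := 58%N.
Notation ahl := 59%N.
Notation vlo := 60%N.
Notation vhi := 61%N.
Notation vmd := 62%N.
Notation rlo := 8%N.
Notation rhi := 9%N.
Notation vr2 := 63%N.
Notation vpw := 65%N.

(* [None] stands for infinity. *)
Definition minupd (R : realType) (C : nat -> R -> Prop) (X0 X1 : nat -> option R) :=
  [/\ forall i x, ole (X0 i) x -> ole (X1 i) x,
      forall i x, C i x -> ole (X1 i) x &
      forall i x, X1 i = Some x -> X0 i = Some x \/ C i x].

Section MinUpd.
Context (R : realType).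
Implicit Types (C : nat -> R -> Prop) (X : nat -> option R) (s : state R).

Lemma minupd_refl X : minupd (fun _ _ => False) X X.
Proof. by split=> // i x; left. Qed.

Lemma minupd_iff C C' X0 X1 : (forall i x, C i x <-> C' i x) ->
  minupd C X0 X1 -> minupd C' X0 X1.
Proof.
move=> h [h1 h2 h3]; split=> //; first by move=> i x /h; apply: h2.
by move=> i x /h3[|/h]; [left|right].
Qed.

Lemma minupd_trans C1 C2 X0 X1 X2 :
  minupd C1 X0 X1 -> minupd C2 X1 X2 -> minupd (fun i x => C1 i x \/ C2 i x) X0 X2.
Proof.
move=> [h1 h2 h3] [k1 k2 k3]; split.
- by move=> i x /h1/k1.
- by move=> i x [/h2/k1|/k2].
- by move=> i x /k3[/h3[]|]; tauto.
Qed.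

Lemma minupd_set X X' i0 x : (forall j, X' j = if j == i0 then omin (X i0) x else X j) ->
  minupd (fun i y => i = i0 /\ y = x) X X'.
Proof.
move=> h; split=> i y; rewrite h.
- by case: eqP => // ->; apply: ole_omin.
- by case=> -> ->; rewrite eqxx omin_le.
- case: eqP => [->|_]; last by left.
  by rewrite /omin; case: ifP => _; [left|case=> <-; right].
Qed.

(** The candidates of the rounds simply unite: minimum updates need no invariant of their own, and
    the order of the rounds does not show in the conclusion. *)
Lemma wp_for_min M x e c fe fv (C : nat -> nat -> R -> Prop) n B Q s :
  x != fe ->
  x \notin iwrites c -> all (fun a => a \notin x :: iwrites c) (iarrays e) ->
  (n < M)%N -> ieval M s e = n ->
  (forall i s', (i < n)%N -> frame (x :: iwrites c) (rwrites c) s s' ->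
    imem s' x 0 = i ->
    wp M c (fun T' s'' => (T' <= B)%N /\
                      minupd (C i) (cell s' fe fv) (cell s'' fe fv)) s') ->
  (forall T s', frame (x :: iwrites c) (rwrites c) s s' ->
    (T <= n * (B + icost e + 11) + icost e + 8)%N ->
    minupd (fun k y => exists2 i, (i < n)%N & C i k y)
      (cell s fe fv) (cell s' fe fv) -> Q T s') ->
  wp M (For x e c) Q s.
Proof.
move=> xf xc hx nM en hstep hQ.
have cellx s' v : cell (seti s' x 0 v) fe fv = cell s' fe fv.
  by apply/funext => k; rewrite /cell /seti /update /= [fe == x]eq_sym (negbTE xf).
apply: (@wp_for _ _ _ _ _ (fun n' st => minupd (fun k y => exists2 i, (i < n')%N & C i k y)
      (cell s fe fv) (cell st fe fv)) n B) => //.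
- by move=> i s' v; rewrite cellx.
- by apply: minupd_iff (minupd_refl _) => k y; split=> // -[].
- move=> i s' ilt hf ix hI.
  apply: wp_weaken (hstep i s' ilt hf ix) => T' s'' _ [h1 h2]; split=> //.
  apply: minupd_iff (minupd_trans hI h2) => k y; split.
    by move=> [[j ji h]|h]; [exists j => //; lia|exists i].
  move=> [j]; rewrite ltnS leq_eqVlt => /orP[/eqP->|ji] h; [by right|left].
  by exists j.
- by move=> T s' hf ix hI hT; apply: hQ.
Qed.

Section Wp.
Context (M W : nat).
Hypotheses (W2 : (2 < W)%N) (WM : (W * W <= M)%N).

Definition GMin b fe fv i v := If b (SetMin fe fv ajunk i v (INat 0)) Skip.

Lemma wp_gmin b fe fv i v s i0 (bb : bool) x B (Q : nat -> state R -> Prop) :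
  ajunk != fe -> ajunk \notin iarrays i -> ajunk \notin ridx v ->
  beval M s b = bb ->
  (bb -> ieval M s i = i0) -> (bb -> reval M s v = x) ->
  (5 * icost i + 2 * rcost v + bcost b + 22 <= B)%N ->
  (forall T s', (T <= B)%N -> frame [:: fe; ajunk] [:: fv] s s' ->
    minupd (fun k y => [/\ bb, k = i0 & y = x]) (cell s fe fv) (cell s' fe fv) ->
    Q T s') ->
  wp M (GMin b fe fv i v) Q s.
Proof.
move=> jf ji jv hb hi hv hB hQ; apply: wp_if; rewrite hb => h.
  apply: (wp_setmin W2 WM jf ji jv (hi h) (hv h) (erefl _)) => T s' hT hf hc _.
  apply: hQ => //; first by move: hT => /=; lia.
  by apply: minupd_iff (minupd_set hc) => k y; rewrite h; split=> [[]|[]].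
apply: wp_skip; apply: hQ => //; first by lia.
by apply: minupd_iff (minupd_refl _) => k y; rewrite (negbTE h); split=> // -[].
Qed.

End Wp.
End MinUpd.

(** * Code of the upward phase *)

Definition DP :=
  For vv (Var vN) (ISet aDe (Var vv) (INat 0)) ;;
  ISet aDe (Var vs) (INat 1) ;; RSet rDv (Var vs) (RNat 0) ;;
  For vj (Var vL) (
    For vv (Var vN) (ISet aDe (Ix (Var vj +^ INat 1) (Var vv)) (INat 0)) ;;
    For ve (IGet 0 (INat 1)) (
      If (BILe (INat 1) (IGet aDe (Ix (Var vj) (IGet asrc (Var ve)))))
        (SetMin aDe rDv apar (Ix (Var vj +^ INat 1) (IGet adst (Var ve)))
           (RBin RAdd (RGet rDv (Ix (Var vj) (IGet asrc (Var ve))))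
              (RBin RMul (RGet 0 (Var ve)) (RGet rpw (Var vj)))) (Var ve))
        Skip)).

(* [pM] is the word modulus and [pW] the stride of two-dimensional arrays, [pLM]
   bounds the lengths of the walks considered and [pbb] is a logarithm of [pN]. *)
Record params (R : realType) := Params {
  pM : nat; pW : nat; pN : nat; pm : nat; pk : nat; pLM : nat; pbb : nat;
  psrc : nat -> nat; pdst : nat -> nat; pcst : nat -> R; pg : R;
  pW2 : (2 < pW)%N;
  pWM : (pW * pW <= pM)%N;
  pNW : (pN < pW)%N;
  pmW : (pm < pW)%N;
  pLW : (pLM + 2 < pW)%N;
  pW3 : ((pN + 2) * (pN + 2) * (pN + 2) < pW)%N;
  pk2 : (1 < pk)%N;
  pkL : (pN * pk <= pLM)%N;
  pbb1 : (pN * pN + 1 < 2 ^ pbb)%N;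
  pbbW : (pbb < pW)%N;
  psrcN : forall e, (e < pm)%N -> (psrc e < pN)%N;
  pdstN : forall e, (e < pm)%N -> (pdst e < pN)%N;
  pg0 : 0 < pg;
  pg1 : pg < 1 }.

Definition UpdX :=
  For vt (Var vN) (For vj (Var vL +^ INat 1)
    (GMin (BILe (INat 1) (IGet aDe (Ix (Var vj) (Var vt)))) aXe rXv
       (Ix (Var vs) (Var vt)) (RGet rDv (Ix (Var vj) (Var vt))))).

(** A closed walk of cost x and length l repeated for ever costs x + g^l x + g^(2l) x + ..., that is
    x / (1 - g^l). *)
Definition UpdQ :=
  For vj (Var vL)
    (GMin (BILe (INat 1) (IGet aDe (Ix (Var vj +^ INat 1) (Var vs)))) aQe rQv
       (Var vs) (RBin RDiv (RGet rDv (Ix (Var vj +^ INat 1) (Var vs)))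
                  (RBin RSub (RNat 1) (RGet rpw (Var vj +^ INat 1))))).

Ltac fr := repeat match goal with
  H : frame _ _ ?s ?s' |- context [imem ?s' ?a] => rewrite (proj1 H a isT)
| H : frame _ _ ?s ?s' |- context [rmem ?s' ?a] => rewrite (proj2 H a isT) end.

(** Follows the parents back from the end and stores the vertices in row [vq] of [amem]. A vertex of
    walk number q is stamped q + 1, so a repetition is recognized without clearing the stamps
    between walks. *)
Definition Trace :=
  vcur ::= Var vv ;; vok ::= INat 1 ;;
  For vj (Var vL +^ INat 1) (
    ISet amem (Ix (Var vq) (Var vj)) (Var vcur) ;;
    If (BILe (Var vq +^ INat 1) (IGet astamp (Var vcur))) ((vok ::= INat 0)) Skip ;;
    ISet astamp (Var vcur) (Var vq +^ INat 1) ;;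
    vcur ::= (IGet asrc (IGet apar (Ix (Var vL -^ Var vj) (Var vcur))))).

(** An inverted index: row w of [ainv] lists the walks through w. Its length [atot] stays fixed
    during the greedy choice, while [acnt] will count only the walks not yet hit. *)
Definition Index :=
  For vj (Var vL +^ INat 1) (
    vcur ::= (IGet amem (Ix (Var vq) (Var vj))) ;;
    ISet ainv (Ix (Var vcur) (IGet atot (Var vcur))) (Var vq) ;;
    ISet atot (Var vcur) (IGet atot (Var vcur) +^ INat 1) ;;
    ISet acnt (Var vcur) (IGet acnt (Var vcur) +^ INat 1)).

Definition Extract :=
  If (BILe (INat 1) (IGet aDe (Ix (Var vL) (Var vv)))) (
    Trace ;;
    If (BILe (INat 1) (Var vok))
      (Index ;; vunhit ::= (Var vunhit +^ INat 1)) Skip ;;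
    vq ::= (Var vq +^ INat 1)) Skip.

(** The vertex met [i] steps before the end when a walk of length [L] ending at [v] is traced
    backwards. *)
Fixpoint bt (src : nat -> nat) (pa : nat -> nat -> nat) L v i {struct i} :=
  match i, L with
  | i'.+1, L'.+1 => bt src pa L' (src (pa L v)) i'
  | _, _ => v
  end.

Lemma btS src pa L v i : (i < L)%N ->
  bt src pa L v i.+1 = src (pa (L - i)%N (bt src pa L v i)).
Proof.
elim: i L v => [|i IH] [|L] v iL //.
by rewrite -[LHS]/(bt src pa L (src (pa L.+1 v)) i.+1) IH.
Qed.

Lemma bt_pverts src pa L v :
  [seq bt src pa L v i | i <- iota 0 L.+1] = rev (pverts src pa L v).
Proof.
elim: L v => [|L IH] v //; rewrite [pverts _ _ _ _]/= rev_rcons -IH.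
by rewrite -[iota 0 L.+2]/(0%N :: iota (1 + 0) L.+1) iotaDl /= -map_comp.
Qed.

Definition RowUp := DP ;; UpdX ;; UpdQ ;; For vv (Var vN) Extract.

Definition LevelUp :=
  For vr (IGet anS (Var vlev))
    (vs ::= IGet aS (Ix (Var vlev) (Var vr)) ;; RowUp).

Definition mono (R : realType) (X0 X1 : nat -> option R) :=
  forall i x, ole (X0 i) x -> ole (X1 i) x.

Lemma mono_trans (R : realType) (X1 X2 X3 : nat -> option R) :
  mono X1 X2 -> mono X2 X3 -> mono X1 X3.
Proof. by move=> h1 h2 i x /h1/h2. Qed.

Definition PickMax :=
  vbest ::= INat 0 ;;
  For vv (Var vN)
    (If (BILe (IGet acnt (Var vbest)) (IGet acnt (Var vv))) (vbest ::= Var vv) Skip).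

Definition Kill1 :=
  ISet ahit (Var vcur) (INat 1) ;; vunhit ::= Var vunhit -^ INat 1 ;;
  For vj (Var vL +^ INat 1)
    (ISet acnt (IGet amem (Ix (Var vcur) (Var vj)))
       (IGet acnt (IGet amem (Ix (Var vcur) (Var vj))) -^ INat 1)).

Definition Kill :=
  For vi (IGet atot (Var vbest)) (
    vcur ::= IGet ainv (Ix (Var vbest) (Var vi)) ;;
    If (BILe (IGet ahit (Var vcur)) (INat 0)) Kill1 Skip).

(** Greedy hitting set: repeatedly take the vertex on the largest number of unhit walks and retire
    these walks. Each retirement decrements [acnt] at the vertices of the walk, so the counts stay
    exact. *)
Definition Greedy :=
  For vi (Var vq) (ISet ahit (Var vi) (INat 0)) ;;
  ISet anS (Var vlev +^ INat 1) (INat 0) ;;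
  While (BILe (INat 1) (Var vunhit)) (
    PickMax ;;
    ISet aS (Ix (Var vlev +^ INat 1) (IGet anS (Var vlev +^ INat 1))) (Var vbest) ;;
    ISet anS (Var vlev +^ INat 1) (IGet anS (Var vlev +^ INat 1) +^ INat 1) ;;
    Kill).

(** * Counting for greedy hitting sets *)

Section Counting.
Implicit Types (gs : seq nat) (mbs : nat -> seq nat) (al : pred nat).

Lemma sum_mem (s : seq nat) N : uniq s -> all (fun w => w < N)%N s ->
  (\sum_(w < N) (val w \in s) = size s)%N.
Proof.
move=> us als; rewrite -(big_mkord xpredT (fun w => nat_of_bool (w \in s))).
rewrite /index_iota subn0 -big_mkcond /= sum1_count.
rewrite -size_filter; apply: perm_size; apply: uniq_perm => //.
  by rewrite filter_uniq// iota_uniq.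
move=> w; rewrite mem_filter mem_iota /= add0n; case: (boolP (w \in s)) => //=.
by move=> /(allP als) ->.
Qed.

Lemma sum_count gs mbs al N l :
  (forall k, k \in gs -> [/\ uniq (mbs k), all (fun w => w < N)%N (mbs k) & size (mbs k) = l]) ->
  (\sum_(w < N) count (fun k => al k && (val w \in mbs k)) gs = count al gs * l)%N.
Proof.
elim: gs => [|k gs IH] h /=; first by rewrite big1.
have [u a sz] := h k (mem_head _ _).
rewrite big_split /= IH; last by move=> k' k'g; apply: h; rewrite inE k'g orbT.
rewrite mulnDl; congr (_ + _)%N; case: (al k) => /=.
  by rewrite mul1n sum_mem.
by rewrite mul0n big1.
Qed.

Lemma sum_le_max N (f : nat -> nat) b : (forall w, (w < N)%N -> (f w <= f b)%N) ->
  (\sum_(w < N) f w <= N * f b)%N.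
Proof.
move=> h; rewrite -[X in (_ <= X * _)%N](card_ord N) -sum_nat_const.
by apply: leq_sum => w _; apply: h.
Qed.

Lemma count_del gs al (P : pred nat) k : uniq gs -> k \in gs -> al k ->
  count (fun x => al x && P x) gs =
  (count (fun x => (al x && (x != k)) && P x) gs + P k)%N.
Proof.
elim: gs => [|x gs IH] //= /andP[xg ug]; rewrite inE => /orP[/eqP->|kg] ak.
  rewrite ak eqxx /= addnC; congr (_ + _)%N; apply: eq_in_count => y yg.
  by case: eqP => [yx|_]; [rewrite -yx yg in xg|rewrite andbT].
rewrite IH// addnA; congr (_ + _ + _)%N.
case: eqP => [xk|_]; last by rewrite andbT.
by rewrite xk kg in xg.
Qed.

(** The inequality (1 - l/N)^a <= 1/2 for a >= N/l, in natural numbers. *)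
Lemma expn_half N l a : (0 < l <= N)%N -> (N <= a * l)%N ->
  (2 * (N - l) ^ a <= N ^ a)%N.
Proof.
move=> /andP[l0 lN] h.
(* Bernoulli's inequality 1 + b l/(N - l) <= (N/(N - l))^b with denominators cleared. For b = a the
   left side is at least 2, because a l >= N. *)
have bern b : ((N - l) ^ b * ((N - l) + b * l) <= N ^ b * (N - l))%N.
  elim: b => [|b IH]; first by rewrite !expn0 mul0n addn0 !mul1n.
  rewrite !expnS.
  apply: (@leq_trans (((N - l) ^ b * ((N - l) + b * l)) * N)%N); last first.
    by rewrite mulnC -mulnA leq_mul2l IH orbT.
  rewrite -mulnA [X in (_ <= X)%N]mulnAC mulnC -!mulnA leq_mul2l; apply/orP; right.
  have [c ->] : exists c, N = (c + l)%N by exists (N - l)%N; lia.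
  by rewrite addnK mulSn; nia.
have [E|] := posnP (N - l)%N.
  have a0 : (0 < a)%N by case: a h => //; lia.
  by rewrite E exp0n // muln0.
move=> p0; have := bern a; set x := ((N - l) ^ a)%N; set y := (N ^ a)%N => B.
rewrite -(leq_pmul2r p0); apply: leq_trans B.
by nia.
Qed.

(** Each pick leaves at most the fraction 1 - l/N of the unhit sets. Every N/l + 1 picks halve their
    number, so after b such blocks fewer than one of U0 < 2^b sets would be left, against U > 0. *)
Lemma greedy_bound N l U U0 q b : (0 < l <= N)%N -> (0 < U)%N -> (U0 < 2 ^ b)%N ->
  (U * N ^ q <= U0 * (N - l) ^ q)%N -> (q < (N %/ l).+1 * b)%N.
Proof.
move=> lN U1 Ub h; rewrite ltnNge; apply/negP => hq.
set a := (N %/ l).+1 in hq.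
have aN : (N <= a * l)%N.
  by have := ltn_ceil N (proj1 (andP lN)); rewrite /a => /ltnW.
clearbody a.
have half c : (2 ^ c * (N - l) ^ (a * c) <= N ^ (a * c))%N.
  rewrite !expnM -expnMn; apply: leq_trans (_ : (N ^ a) ^ c <= _)%N => //.
  by case: c => [|c]; rewrite ?expn0// leq_exp2r// expn_half.
have hq' : (U * N ^ (a * b) <= U0 * (N - l) ^ (a * b))%N.
  have E : (q = a * b + (q - a * b))%N by lia.
  move: h; rewrite E !expnD; set d := (q - a * b)%N => h.
  have N0 : (0 < N ^ d)%N by rewrite expn_gt0; apply/orP; left; lia.
  rewrite -(leq_pmul2r N0) -!mulnA; apply: leq_trans h _.
  rewrite leq_mul2l; apply/orP; right; rewrite leq_mul2l; apply/orP; right.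
  by case: (d) => [|d']; rewrite ?expn0// leq_exp2r// leq_subr.
have X0 : (0 < N ^ (a * b))%N by rewrite expn_gt0; apply/orP; left; lia.
have := half b; move: hq' X0 Ub U1; move: (N ^ _)%N ((N - l) ^ _)%N (2 ^ b)%N => X Y Z.
clear; move=> h1 h2 h3 h4 h5.
have Y0 : (0 < Y)%N by rewrite lt0n; apply/negP => /eqP E; rewrite E in h1; nia.
nia.
Qed.

End Counting.

Lemma sum_uniq (B : seq nat) N (f : nat -> nat) : uniq B -> all (fun w => w < N)%N B ->
  (\sum_(b <- B) f b <= \sum_(w < N) f w)%N.
Proof.
move=> uB aB; rewrite -(big_mkord xpredT f) /index_iota subn0.
have p : perm_eq B [seq w <- iota 0 N | w \in B].
  apply: uniq_perm => //; first by rewrite filter_uniq// iota_uniq.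
  move=> w; rewrite mem_filter mem_iota /= add0n.
  by case: (boolP (w \in B)) => //= /(allP aB) ->.
rewrite (perm_big _ p) big_filter big_mkcond /=.
by apply: leq_sum => w _; case: ifP.
Qed.

(** The counter [vq] is deliberately not reset between levels: walk numbers are never reused, so
    stamps of earlier levels cannot be mistaken for current ones. *)
Definition ResetFam :=
  For vv (Var vN) (ISet atot (Var vv) (INat 0) ;; ISet acnt (Var vv) (INat 0)) ;;
  vunhit ::= INat 0.

Definition UpBody :=
  ResetFam ;; LevelUp ;; Greedy ;;
  vlev ::= Var vlev +^ INat 1 ;; vL ::= Var vL *^ Var vk.

Definition UpAll :=
  vlev ::= INat 0 ;;
  For vv (Var vN) (ISet aS (Var vv) (Var vv)) ;;
  ISet anS (INat 0) (Var vN) ;;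
  vL ::= Var vk ;; vq ::= INat 0 ;;
  While (BILe (INat 1) (IGet anS (Var vlev))) UpBody.

Lemma up_time T1 T2 T3 nl gl bl q2 L E lev n m' b :
  (T1 <= 30 * (n + 1) -> T2 <= nl * (2000 * (L + 1) * (n + m' + 1) + 100) + 20 ->
   T3 <= 100 * (q2 + 1) + 200 * (n + 1) * bl + 200 * (L + 2) * gl ->
   nl * (L + 1) <= E -> gl <= nl * n -> bl <= n -> q2 <= lev.+1 * (n * n) ->
   lev < b -> nl <= n ->
   T1 + (T2 + (T3 + ((2 + 1).+1 + 2 + ((2 + 2).+1 + 2)))) + 20 <=
   3000 * E * (n + m' + 1) + 2000 * (b + 1) * ((n + 1) * (n + 1)))%N.
Proof.
move=> h1 h2 h3 h4 h5 h6 h7 h8 h9.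
have k1 : (nl * (2000 * (L + 1) * (n + m' + 1) + 100) <= 2100 * E * (n + m' + 1))%N.
  have : (nl * (L + 1) * (2100 * (n + m' + 1)) <= E * (2100 * (n + m' + 1)))%N.
    by rewrite leq_mul2r h4 orbT.
  by clear; nia.
have k2 : (200 * (L + 2) * gl <= 400 * E * (n + m' + 1))%N.
  have e1 : (gl * (L + 2) <= nl * n * (L + 2))%N by rewrite leq_mul2r h5 orbT.
  have e2 : (nl * (L + 1) * (2 * (n + m' + 1)) <= E * (2 * (n + m' + 1)))%N.
    by rewrite leq_mul2r h4 orbT.
  by move: e1 e2; clear; nia.
have k3 : (q2 <= b * (n * n))%N by apply: leq_trans h7 _; rewrite leq_mul2r h8 orbT.
have k4 : (200 * (n + 1) * bl <= 200 * ((n + 1) * (n + 1)))%N.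
  by rewrite -mulnA leq_mul2l leq_mul2l (leq_trans h6) ?leq_addr ?orbT.
have k5 : (100 * q2 <= 100 * b * ((n + 1) * (n + 1)))%N.
  by move: k3; clear; nia.
have b0 : (0 < b)%N by lia.
move: h1 h2 h3 k1 k2 k4 k5 b0; clear; nia.
Qed.

(** * Code for reachability, components and infinite repetitions *)

Definition Adj :=
  For ve (IGet 0 (INat 1)) (
    vu ::= IGet asrc (Var ve) ;;
    ISet aadj (Ix (Var vu) (IGet adeg (Var vu))) (IGet adst (Var ve)) ;;
    ISet adeg (Var vu) (IGet adeg (Var vu) +^ INat 1)).

Definition Visit :=
  ISet amark (Ix (Var vs) (Var vv)) (INat 1) ;;
  ISet aque (Var vtail) (Var vv) ;;
  vtail ::= Var vtail +^ INat 1.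

Definition Scan :=
  vu ::= IGet aque (Var vhd) ;;
  For vi (IGet adeg (Var vu)) (
    vv ::= IGet aadj (Ix (Var vu) (Var vi)) ;;
    If (BILe (IGet amark (Ix (Var vs) (Var vv))) (INat 0)) Visit Skip).

(** The queue never holds more than N vertices, so a counted loop whose rounds do nothing beyond the
    tail of the queue replaces the usual loop until the queue is empty. *)
Definition BFS :=
  vtail ::= INat 0 ;; vv ::= Var vs ;; Visit ;;
  For vhd (Var vN) (If (BILe (Var vhd +^ INat 1) (Var vtail)) Scan Skip).

Definition Closure := Adj ;; For vs (Var vN) BFS.

(** Counts the vertices reachable from u and names its strongly connected component by the last
    vertex v such that u and v reach each other, as later finds overwrite earlier ones. *)
Definition Reps :=
  For vu (Var vN) (For vv (Var vN) (
    ISet acr (Var vu) (IGet acr (Var vu) +^ IGet amark (Ix (Var vu) (Var vv))) ;;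
    If (BILe (INat 2) (IGet amark (Ix (Var vu) (Var vv)) +^ IGet amark (Ix (Var vv) (Var vu))))
      (ISet arep (Var vu) (Var vv)) Skip)).

(** Selects the edges in N + 1 passes, by decreasing reach N - c of the source. Sorting this way
    takes time O(N m), within the budget. Reach decreases strictly from one component to a later
    one, so this is a topological order of the components. *)
Definition SortE :=
  vpos ::= INat 0 ;;
  For vc (Var vN +^ INat 1) (For ve (IGet 0 (INat 1)) (
    vu ::= IGet acr (IGet asrc (Var ve)) +^ Var vc ;;
    If (BAnd (BILe (Var vu) (Var vN)) (BILe (Var vN) (Var vu)))
      (ISet aord (Var vpos) (Var ve) ;; vpos ::= Var vpos +^ INat 1) Skip)).

Definition BReset := For vv (Var vN) (ISet aBe (Var vv) (INat 0)).

(** Candidates D_j(s,v) + g^j Q(v): walk to v and go round there for ever. They are credited to the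
    component of v, since they are valid for every target reachable from v. *)
Definition BQ :=
  For vv (Var vN) (For vj (Var vL +^ INat 1)
    (GMin (BAnd (BILe (INat 1) (IGet aDe (Ix (Var vj) (Var vv)))) (BILe (INat 1) (IGet aQe (Var vv))))
       aBe rBv (IGet arep (Var vv))
       (RBin RAdd (RGet rDv (Ix (Var vj) (Var vv)))
          (RBin RMul (RGet rpw (Var vj)) (RGet rQv (Var vv)))))).

Definition BEdge :=
  ve ::= IGet aord (Var vi) ;;
  GMin (BILe (INat 1) (IGet aBe (IGet arep (IGet asrc (Var ve))))) aBe rBv
    (IGet arep (IGet adst (Var ve))) (RGet rBv (IGet arep (IGet asrc (Var ve)))).

Definition BX :=
  For vt (Var vN)
    (GMin (BILe (INat 1) (IGet aBe (IGet arep (Var vt)))) aXe rXv (Ix (Var vs) (Var vt))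
       (RGet rBv (IGet arep (Var vt)))).

Definition BRow := BReset ;; BQ ;; For vi (IGet 0 (INat 1)) BEdge ;; BX.

(** * Code for lower envelopes, and then for the downward phase *)

Definition HReset :=
  For vj (Var vL +^ INat 1) (ISet alo (Var vj) (INat 0) ;; ISet ahi (Var vj) (INat 0)).

Definition HGuard :=
  BAnd (BILe (INat 1) (IGet aDe (Ix (Var vi) (Var vb)))) (BILe (INat 1) (IGet aDe (Ix (Var vj) (Var vb)))).

Definition HSlope :=
  RBin RDiv (RBin RSub (RGet rDv (Ix (Var vi) (Var vb))) (RGet rDv (Ix (Var vj) (Var vb))))
    (RBin RSub (RGet rpw (Var vi)) (RGet rpw (Var vj))).

(** All pairs of lines are compared, in time O(L^2) per envelope. This suffices: the envelopes of a
    level cost about |S_i| |S_(i+1)| L_i^2, which is N^2 k up to logarithms. *)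
Definition HLo :=
  For vj (Var vL +^ INat 1) (For vi (Var vj) (GMin HGuard alo rlo (Var vj) HSlope)).

Definition HHi :=
  For vj (Var vL +^ INat 1) (For vi (Var vj) (GMin HGuard ahi rhi (Var vi)
    (RBin RSub (RNat 0) HSlope))).

Definition HPush :=
  vcn ::= INat 0 ;;
  For vj (Var vL +^ INat 1)
    (If (BAnd (BILe (INat 1) (IGet aDe (Ix (Var vj) (Var vb))))
           (BNot (BAnd (BAnd (BILe (INat 1) (IGet alo (Var vj))) (BILe (INat 1) (IGet ahi (Var vj))))
              (BNot (BRLe (RNat 0) (RBin RAdd (RGet rlo (Var vj)) (RGet rhi (Var vj))))))))
       (ISet ahl (Var vcn) (Var vj) ;; vcn ::= Var vcn +^ INat 1) Skip).

Definition Hull := HReset ;; HLo ;; HHi ;; HPush.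

(** * Lower envelopes of lines *)

Section HullMath.
Context (R : realType) (g : R).
Hypotheses (g0 : 0 < g) (g1 : g < 1).
Variables (L : nat) (f lo hi : nat -> option R) (kl : nat -> R).

Definition nz i j (a b : R) := (a - b) / (g ^+ i - g ^+ j).

Lemma gpow_lt i j : (i < j)%N -> 0 < g ^+ i - g ^+ j.
Proof. by move=> ij; rewrite subr_gt0 ltr_iXn2l. Qed.

(* The line [j] is below the steeper line [i] exactly to the right of their
   crossing point, whose abscissa is [- nz i j]. *)
Lemma nz_le i j a b x : (i < j)%N -> (0 <= nz i j a b + x) = (b + g ^+ j * x <= a + g ^+ i * x).
Proof.
move=> /gpow_lt h; rewrite /nz -(pmulr_rge0 _ h) mulrDr mulrC divfK; last exact: lt0r_neq0.
by rewrite -[RHS]subr_ge0; congr (0 <= _); ring.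
Qed.

Hypothesis lo1 : forall i j a b, (i < j <= L)%N -> f i = Some a -> f j = Some b ->
  ole (lo j) (nz i j a b).
Hypothesis lo2 : forall j y, (j <= L)%N -> lo j = Some y -> y = kl j /\
  exists i a b, [/\ (i < j)%N, f i = Some a, f j = Some b & y = nz i j a b].
Hypothesis hi1 : forall i j a b, (i < j <= L)%N -> f i = Some a -> f j = Some b ->
  ole (hi i) (- nz i j a b).
Hypothesis hi2 : forall i y, (i <= L)%N -> hi i = Some y ->
  exists j a b, [/\ (i < j <= L)%N, f i = Some a, f j = Some b & y = - nz i j a b].

(** Line [j] is below all steeper lines to the right of [- lo j] and below all flatter ones to the
    left of [hi j], where [None] means no restriction. It is kept if this interval is not empty. *)
Definition keep j := (f j != None) &&
  (if (lo j, hi j) is (Some y, Some z) then 0 <= y + z else true).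

Definition hull := [seq j <- iota 0 L.+1 | keep j].

Lemma hull_mem j : (j \in hull) = keep j && (j <= L)%N.
Proof. by rewrite mem_filter mem_iota ltnS. Qed.

Lemma hull_lt p q : (q < size hull)%N -> (p < q)%N -> (nth 0 hull p < nth 0 hull q)%N.
Proof.
move=> qs pq; have so : sorted ltn hull.
  by apply: sorted_filter; [exact: ltn_trans|exact: iota_ltn_sorted].
by apply: (sorted_ltn_nth ltn_trans) => //; rewrite inE ?(ltn_trans pq).
Qed.

(** The hypotheses on [p] are what the bisection delivers: x lies right of the left end of line p
    and left of the left end of its successor. Here [kl] is the raw content of the real cell, read
    without looking at the flag; by [lo1] the flag is set for every kept line but the first, and for
    that one no inequality is asked. *)
Lemma hull_opt x p d j b : (p < size hull)%N ->
  (p = 0%N \/ 0 <= kl (nth 0%N hull p) + x) ->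
  ((p.+1 < size hull)%N -> kl (nth 0%N hull p.+1) + x < 0) ->
  f (nth 0%N hull p) = Some d -> (j <= L)%N -> f j = Some b ->
  d + g ^+ nth 0%N hull p * x <= b + g ^+ j * x.
Proof.
move=> ps hA hB fd jL fb; set h := nth 0%N hull in hA hB fd *.
(* Take a line J that is minimal at x and show that line p is no higher. J is itself kept, so it has
   a position q to compare with p. *)
pose F (i : 'I_L.+1) := odflt 0 (f i) + g ^+ i * x.
have j0 : f (Ordinal (jL : (j < L.+1)%N)) != None by rewrite fb.
case: (@Order.TotalTheory.arg_minP _ _ _ _ (fun i : 'I_L.+1 => f i != None) F j0) => J fJ Jmin.
have [c fc] : exists c, f J = Some c by move: fJ; case: (f J) => // c; exists c.
have {}Jmin i a : (i <= L)%N -> f i = Some a -> c + g ^+ J * x <= a + g ^+ i * x.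
  move=> iL fa; have := Jmin (Ordinal (iL : (i < L.+1)%N)).
  by rewrite /F /= fc fa /=; apply.
apply: le_trans (Jmin _ _ jL fb).
have JL : (J <= L)%N by rewrite -ltnS.
have loJ y : lo J = Some y -> 0 <= y + x.
  move=> /(lo2 JL)[_ [i [a [c' [iJ fa fc' ->]]]]]; rewrite nz_le//.
  by move: fc'; rewrite fc => -[<-]; apply: Jmin => //; apply: leq_trans (ltnW iJ) JL.
have hiJ l e : (J < l <= L)%N -> f l = Some e -> nz J l c e + x <= 0.
  move=> /andP[Jl lL] fe; rewrite leNgt; apply/negP => pos.
  have := ltW pos; rewrite nz_le// => le1.
  have le2 := Jmin _ _ lL fe.
  have E : nz J l c e + x = 0.
    have h0 := lt0r_neq0 (gpow_lt Jl).
    apply: (mulIf h0); rewrite mul0r /nz mulrDl divfK//.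
    by apply/eqP; rewrite eq_le; apply/andP; split; rewrite -subr_ge0; [rewrite -(subr_ge0 (c + _)) in le2; move: le2|rewrite -(subr_ge0 (e + _)) in le1; move: le1]; congr (0 <= _); ring.
  by rewrite E ltxx in pos.
(* The interval of J is not empty because it contains x. *)
have kJ : keep J.
  rewrite /keep fc /=; case E1 : (lo J) => [y|//]; case E2 : (hi J) => [z|//].
  have h1 := loJ _ E1; have [l [a [e [Jl fa fe zE]]]] := hi2 JL E2.
  move: fa zE; rewrite fc => -[<-] zE.
  by have := hiJ l e Jl fe; rewrite zE; lra.
have Jh : (J : nat) \in hull by rewrite hull_mem kJ.
pose q := index (J : nat) hull.
have qs : (q < size hull)%N by rewrite index_mem.
have qJ : nth 0%N hull q = J by apply: nth_index.
have hL r : (r < size hull)%N -> (h r <= L)%N /\ keep (h r).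
  by move=> rs; have := mem_nth 0%N rs; rewrite hull_mem => /andP[].
case: (ltngtP q p) => [qp|pq|qp].
(* J is steeper than line p; being right of the left end of line p means being where line p is below
   J. *)
- have [p0|A] := hA; first by rewrite p0 ltn0 in qp.
  have Jp := hull_lt ps qp; rewrite qJ in Jp.
  have := @lo1 J (h p) c d; rewrite Jp (hL _ ps).1 => /(_ isT fc fd).
  case E1 : (lo (h p)) => [y|] //=; have [yE _] := lo2 (hL _ ps).1 E1.
  by rewrite -nz_le// => h1; move: A; rewrite -/(h p) -yE; lra.
(* J comes after line p. Let l be the successor of p, whose left end lies right of x. Then J is not
   l, as x is in the interval of J. *)
- have ps1 : (p.+1 < size hull)%N by apply: leq_ltn_trans qs.
  have B := hB ps1; have [lL kl'] := hL _ ps1.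
  set l := h p.+1 in B lL kl' *.
  have [e fe] : exists e, f l = Some e.
    by move: kl' => /andP[]; case: (f l) => // e; exists e.
  have [d' pl] : exists d', f (h p) = Some d' /\ (h p < l)%N by exists d; split=> //; apply: hull_lt.
  have := @lo1 (h p) l d e; rewrite (pl.2) lL => /(_ isT fd fe).
  case E1 : (lo l) => [y|] //= _; have [yE _] := lo2 lL E1.
  have neg : y + x < 0 by rewrite yE.
  exfalso; move: pq; rewrite leq_eqVlt => /orP[/eqP pq|pq].
    by have := loJ y; rewrite -qJ -pq => /(_ E1); rewrite leNgt neg.
  have lJ : (l < J)%N by rewrite -qJ; apply: hull_lt.
  have := @lo1 l J e c; rewrite lJ JL => /(_ isT fe fc); case E2 : (lo J) => [y'|] //= hy'.
  have := loJ _ E2; have := @hi1 l J e c; rewrite lJ JL => /(_ isT fe fc).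
  (* So J comes after l. The interval of l is not empty and lies left of the crossing of l and J,
     which is left of the left end of J and hence of x. This contradicts that l begins right of
     x. *)
  move: kl'; rewrite /keep fe E1 /=; case: (hi l) => [z|] //= kz hz ly'.
  by move: neg; rewrite ltNge => /negP; apply; lra.
- by move: qJ; rewrite qp => hJ; move: fd; rewrite /h hJ fc => -[<-].
Qed.

End HullMath.

Definition Bisect :=
  If (BILe (Var vlo +^ INat 2) (Var vhi)) (
    vmd ::= IBin IDiv (Var vlo +^ Var vhi) (INat 2) ;;
    If (BRLe (RNat 0) (RBin RAdd (RGet rlo (IGet ahl (Var vmd))) (RGet rXv (Ix (Var vb) (Var vt)))))
      (vlo ::= Var vmd) (vhi ::= Var vmd)) Skip.

(** The number of bisection rounds is fixed as [vlg]: an envelope has at most L + 1 <= N lines, and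
    N is below two to the power [vlg]. *)
Definition Query :=
  If (BAnd (BILe (INat 1) (Var vcn)) (BILe (INat 1) (IGet aXe (Ix (Var vb) (Var vt))))) (
    vlo ::= INat 0 ;; vhi ::= Var vcn ;;
    For vj (Var vlg) Bisect ;;
    vj ::= IGet ahl (Var vlo) ;;
    GMin (BILe (INat 1) (IGet aDe (Ix (Var vj) (Var vb)))) aXe rXv (Ix (Var vs) (Var vt))
      (RBin RAdd (RGet rDv (Ix (Var vj) (Var vb)))
         (RBin RMul (RGet rpw (Var vj)) (RGet rXv (Ix (Var vb) (Var vt)))))) Skip.

Definition StepB := vb ::= IGet aS (Ix (Var vlev +^ INat 1) (Var vr2)) ;; Hull ;; For vt (Var vN) Query.

(** The dynamic program is run again for each row, at the cost it had on the way up, instead of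
    keeping all tables. *)
Definition RowDown := DP ;; BRow ;; For vr2 (IGet anS (Var vlev +^ INat 1)) StepB.

Definition LevelDown :=
  For vr (IGet anS (Var vlev)) (vs ::= IGet aS (Ix (Var vlev) (Var vr)) ;; RowDown).

Definition DownBody :=
  vlev ::= Var vlev -^ INat 1 ;; vL ::= IBin IDiv (Var vL) (Var vk) ;; LevelDown.

(** The level is decremented before it is processed, so the last level treated here is 1; level 0 is
    left to [FinQ] and [Relax]. *)
Definition DownAll := While (BILe (INat 2) (Var vlev)) DownBody.

Lemma small_mul n x N b : (n <= (N %/ x.+1).+1 * b)%N -> (x <= N)%N -> (n * x <= 2 * N * b)%N.
Proof.
move=> nx xN; have dv : ((N %/ x.+1).+1 * x <= 2 * N)%N.
  by have := leq_trunc_div N x.+1; move: (N %/ x.+1)%N xN => dd; clear; nia.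
apply: (@leq_trans ((N %/ x.+1).+1 * b * x)%N); first by rewrite leq_mul2r nx orbT.
by rewrite mulnAC leq_mul2r dv orbT.
Qed.

Definition FinQ :=
  For vs (Var vN) (For vt (Var vN)
    (GMin (BAnd (BILe (INat 1) (IGet amark (Ix (Var vs) (Var vt)))) (BILe (INat 1) (IGet aQe (Var vs))))
       aXe rXv (Ix (Var vs) (Var vt)) (RGet rQv (Var vs)))).

Definition Relax :=
  For ve (IGet 0 (INat 1)) (For vt (Var vN)
    (GMin (BILe (INat 1) (IGet aXe (Ix (IGet adst (Var ve)) (Var vt)))) aXe rXv
       (Ix (IGet asrc (Var ve)) (Var vt))
       (RBin RAdd (RGet 0 (Var ve))
          (RBin RMul (RGet 1 (INat 0)) (RGet rXv (Ix (IGet adst (Var ve)) (Var vt))))))).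

Definition Core :=
  Closure ;; Reps ;; SortE ;; UpAll ;; DownAll ;; FinQ ;; For vj (Var vk) Relax.

Definition OIx := IGet aorig (Var vs) *^ IGet 0 (INat 0) +^ IGet aorig (Var vt).

Definition Out :=
  For vi (IGet 0 (INat 0)) (ISet 3 (Var vi *^ IGet 0 (INat 0) +^ Var vi) (INat 1)) ;;
  For vs (Var vN) (For vt (Var vN) (If (BILe (INat 1) (IGet aXe (Ix (Var vs) (Var vt))))
    (ISet 3 OIx (INat 1) ;; RSet 2 OIx (RGet rXv (Ix (Var vs) (Var vt)))) Skip)).

Lemma wp_rstore (R : realType) M a e v (Q : nat -> state R -> Prop) (s : state R) i x :
  ieval M s e = i -> reval M s v = x ->
  (forall s', frame [::] [:: a] s s' ->
     (forall j, rmem s' a j = if j == i then x else rmem s a j) ->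
     Q (icost e + rcost v).+1 s') ->
  wp M (RSet a e v) Q s.
Proof.
move=> he hv hQ; apply: wp_rset; rewrite he hv; apply: hQ.
  by apply: frame_setr; rewrite inE.
by move=> j; rewrite /setr /update /= eqxx.
Qed.

(** * Correctness and cost of the main phases *)

Section Algorithm.
Context (R : realType) (K : params R).
Local Notation M := (pM K).
Local Notation W := (pW K).
Local Notation N := (pN K).
Local Notation m := (pm K).
Local Notation LM := (pLM K).
Local Notation kk := (pk K).
Local Notation bb := (pbb K).
Local Notation src := (psrc K).
Local Notation dst := (pdst K).
Local Notation cst := (pcst K).
Local Notation g := (pg K).
Let W2 : (2 < W)%N. Proof. exact: pW2. Qed.
Let WM : (W * W <= M)%N. Proof. exact: pWM. Qed.
Let NW : (N < W)%N. Proof. exact: pNW. Qed.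
Let mW : (m < W)%N. Proof. exact: pmW. Qed.
Let LW : (LM + 2 < W)%N. Proof. exact: pLW. Qed.
Let srcN e : (e < m)%N -> (src e < N)%N. Proof. exact: psrcN. Qed.
Let dstN e : (e < m)%N -> (dst e < N)%N. Proof. exact: pdstN. Qed.
Let g0 : 0 < g. Proof. exact: pg0. Qed.
Let g1 : g < 1. Proof. exact: pg1. Qed.
Let W3 : ((N + 2) * (N + 2) * (N + 2) < W)%N. Proof. exact: pW3. Qed.
Let k2 : (1 < kk)%N. Proof. exact: pk2. Qed.
Let kL : (N * kk <= LM)%N. Proof. exact: pkL. Qed.
Let bb1 : (N * N + 1 < 2 ^ bb)%N. Proof. exact: pbb1. Qed.
Let bbW : (bb < W)%N. Proof. exact: pbbW. Qed.
Let WltM : (W < M)%N. Proof. exact: ltWM W2 WM. Qed.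
Let M1 : (1 < M)%N. Proof. exact: ltn_trans (ltnW W2) WltM. Qed.

Record glob (s : state R) : Prop := Glob {
  gm : imem s 0 1 = m;
  gW : imem s vW 0 = W;
  gN : imem s vN 0 = N;
  gsrc : forall e, (e < m)%N -> imem s asrc e = src e;
  gdst : forall e, (e < m)%N -> imem s adst e = dst e;
  gcst : forall e, (e < m)%N -> rmem s 0 e = cst e;
  gg : rmem s 1 0 = g }.

Lemma glob_frame I J s s' : frame I J s s' ->
  all (fun a => a \notin I) [:: 0; vW; vN; asrc; adst]%N ->
  all (fun a => a \notin J) [:: 0; 1]%N -> glob s -> glob s'.
Proof.
move=> [f1 f2] /and5P[h1 h2 h3 h4 /andP[h5 _]] /and3P[k1 kx2 _] [*].
by split; rewrite ?f1 ?f2.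
Qed.

Definition pwok (s : state R) := forall j, (j <= LM)%N -> rmem s rpw j = g ^+ j.

Definition Dc (s : state R) j v := cell s aDe rDv (j * W + v).
Definition Dp (s : state R) j v := imem s apar (j * W + v).

Lemma wp_DP s0 a L : glob s0 -> pwok s0 -> imem s0 vs 0 = a -> (a < N)%N ->
  imem s0 vL 0 = L -> (L <= LM)%N ->
  wp M DP (fun T s' => (T <= 400 * (L + 1) * (N + m + 1))%N /\
     dpok N m src dst cst g a L (Dc s') (Dp s')) s0.
Proof.
move=> G P hs sN hL LL; apply: wp_seq.
apply: (@wp_for _ _ _ _ _ (fun i st => forall v, (v < i)%N -> imem st aDe v = 0%N) N 6) => //=.
- exact: ltn_trans (ltWM W2 WM).
- by rewrite mod0n (gN G).
- move=> i st iN hf hi hI; apply: wp_iset => /=; split=> //.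
  rewrite !mod0n hi => v; rewrite ltnS leq_eqVlt => /orP[/eqP->|vi].
    by rewrite /seti /update /= eqxx.
  by rewrite /seti /update /= hI//; case: ifP.
move=> T1 s1 f1 hv1 hz1 hT1.
apply: wp_seq; apply: wp_iset; apply: wp_seq; apply: wp_rset.
rewrite /= !mod0n modn_small// /update /= f1.1// hs.
set s2 := setr _ _ _ _.
have f2 : frame [:: vv; aDe] [:: rDv] s0 s2.
  apply: frame_trans (frame_trans (frame_seti _ _ _ _ _) (frame_setr _ _ _ _ _)).
  - by apply: frame_sub f1.
  - by [].
  - by [].
have D0 v : (v < N)%N -> Dc s2 0 v = if v == a then Some 0 else None.
  move=> vN; rewrite /Dc /cell /s2 /seti /setr /update /= mul0n add0n.
  by case: (v == a) => //=; rewrite hz1.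
apply: (@wp_for _ _ _ _ _ (fun j st => dpok N m src dst cst g a j (Dc st) (Dp st))
          L (200 * (N + m + 1))) => //=.
- by have := ltWM W2 WM; lia.
- by rewrite mod0n /s2 /seti /setr /update /= f1.1.
- move=> j st jL hf hj [hD0 hD].
  have F := frame_cat f2 hf.
  have G1 := glob_frame F isT isT G.
  have jW : (j < W)%N by lia.
  apply: wp_seq.
  apply: (@wp_for _ _ _ _ _ (fun i st' =>
    (forall j' v, (j' <= j)%N -> (v < N)%N -> Dc st' j' v = Dc st j' v) /\
    (forall v, (v < i)%N -> Dc st' j.+1 v = None)) N 20) => //=.
  + exact: ltn_trans (ltWM W2 WM).
  + by rewrite mod0n (gN G1).
  + move=> i st' iN hf' hi [I1 I2]; apply: wp_iset.
    have hj' : imem st' vj 0 = j by rewrite hf'.1.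
    have h4 : imem st' vW 0 = W by rewrite hf'.1// (gW G1).
    rewrite (@ievalIx _ _ _ W2 WM _ _ _ j.+1 i)//; last 4 first.
    * exact: (ieval_incr W2 WM).
    * by rewrite /= mod0n.
    * by lia.
    * exact: ltn_trans NW.
    split; first by rewrite icost_Ix.
    rewrite /= mod0n /Dc /cell /seti /update /=; split.
      move=> j' v j'j vN; rewrite idx_eq ?(ltn_trans _ NW)//.
      have -> : (j' == j.+1) = false by apply/eqP; lia.
      exact: I1.
    move=> v; rewrite ltnS leq_eqVlt => /orP[/eqP->|vi]; first by rewrite eqxx.
    rewrite idx_eq ?(ltn_trans _ NW)//; last exact: ltn_trans iN.
    by rewrite eqxx; case: (v == i) => //=; exact: (I2 v vi).
  move=> T3 s3 f3 _ [I1 I2] hT3.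
  have F3 := frame_cat F f3.
  have G3 := glob_frame F3 isT isT G.
  apply: (@wp_for _ _ _ _ _ (fun E st' =>
    (forall j' v, (j' <= j)%N -> (v < N)%N ->
       Dc st' j' v = Dc st j' v /\ Dp st' j' v = Dp st j' v) /\
    layer N src dst cst g j E (Dc st') (Dp st')) m 170) => //=.
  + exact: ltn_trans (ltWM W2 WM).
  + by rewrite modn_small// (gm G3).
  + split; last exact: layer0.
    by move=> j' v h1 h2; rewrite I1// /Dp f3.1.
  + move=> E st' Em hf' hE [K1 K2].
    have F4 := frame_cat F3 hf'.
    have G4 := glob_frame F4 isT isT G.
    have P4 : rmem st' rpw j = g ^+ j.
      have -> : rmem st' rpw = rmem s0 rpw by rewrite F4.2.
      by rewrite P//; lia.
    have hj' : imem st' vj 0 = j by rewrite hf'.1// f3.1.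
    have sE := srcN Em; have dE := dstN Em.
    have E1 : ieval M st' (Ix (Var vj) (IGet asrc (Var ve))) = (j * W + src E)%N.
      apply: (ievalIx W2 WM) => //=; rewrite ?mod0n ?hE ?(gW G4) ?(gsrc G4)//.
      exact: ltn_trans NW.
    have E2 : ieval M st' (Ix (Var vj +^ INat 1) (IGet adst (Var ve))) =
        (j.+1 * W + dst E)%N.
      apply: (ievalIx W2 WM); rewrite ?(gW G4)//.
      * exact: (ieval_incr W2 WM).
      * by rewrite /= mod0n hE (gdst G4).
      * by lia.
      * exact: ltn_trans NW.
    (* The effect of one edge in a form that covers both branches of the conditional, so that the
       invariant is re-established only once. *)
    have step st'' : (forall j' v, (j' <= j.+1)%N -> (v < N)%N ->
       Dc st'' j' v = (if (j' == j.+1) && (v == dst E) then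
          (if Dc st' j (src E) is Some y then
             omin (Dc st' j.+1 (dst E)) (y + cst E * g ^+ j) else Dc st' j' v)
          else Dc st' j' v) /\
       Dp st'' j' v = (if (j' == j.+1) && (v == dst E) then
          (if Dc st' j (src E) is Some y then
             if ~~ ole (Dc st' j.+1 (dst E)) (y + cst E * g ^+ j) then E
             else Dp st' j' v else Dp st' j' v)
          else Dp st' j' v)) ->
      (forall j' v, (j' <= j)%N -> (v < N)%N ->
         Dc st'' j' v = Dc st j' v /\ Dp st'' j' v = Dp st j' v) /\
      layer N src dst cst g j E.+1 (Dc st'') (Dp st'').
      move=> h; have hlow j' v : (j' <= j)%N -> (v < N)%N ->
          Dc st'' j' v = Dc st' j' v /\ Dp st'' j' v = Dp st' j' v.
        move=> jj vN; have [-> ->] := h j' v (leqW jj) vN.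
        by have -> : (j' == j.+1) = false by apply/eqP; lia.
      split; first by move=> j' v jj vN; have [-> ->] := hlow _ _ jj vN; apply: K1.
      apply: (layerS srcN Em) K2; first by move=> v vN; have [] := hlow _ _ (leqnn j) vN.
      case E0 : (Dc st' j (src E)) => [y|] /= v vN; have [-> ->] := h _ _ (leqnn _) vN;
        rewrite eqxx /= E0; case: eqP => //= ->; by split=> //; case: ifP.
    apply: wp_if => /=; rewrite E1 modn_small// => hb.
      have E0 : Dc st' j (src E) = Some (rmem st' rDv (j * W + src E)).
        by rewrite /Dc /cell; case: eqP hb => // ->.
      apply: (wp_setmin W2 WM (i0 := (j.+1 * W + dst E)%N)
        (x := rmem st' rDv (j * W + src E) + cst E * g ^+ j) (e0 := E)) => //.
      * by rewrite /= E1 !mod0n hE (gcst G4)// hj' P4.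
      * by rewrite /= mod0n.
      move=> T5 s5 hT5 f5 c5 p5; split.
        by move: hT5; rewrite !icost_Ix /= !icost_Ix /=; lia.
      apply: step => j' v jj vN; rewrite E0 /Dc /Dp c5 p5.
      rewrite idx_eq ?(ltn_trans _ NW)//.
      by case: eqP => //= ->; case: eqP => //= ->.
    apply: wp_skip; split; first by rewrite /= icost_Ix.
    apply: step => j' v jj vN.
    have -> : Dc st' j (src E) = None.
      by rewrite /Dc /cell; move: hb; rewrite -eqn0Ngt => ->.
    by case: ifP.
  move=> T4 s4 f4 _ [K1 K2] hT4; split; first by move: hT3 hT4; nia.
  split; first by move=> v vN; rewrite (K1 0%N v _ vN).1 ?hD0.
  move=> j'; rewrite ltnS leq_eqVlt => /orP[/eqP->//|j'j].
  apply: (layer_ext srcN (leqnn m)) (hD _ j'j) => v vN.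
  - by have [] := K1 _ _ (ltnW j'j) vN.
  - by have [] := K1 _ _ j'j vN.
  - by have [] := K1 _ _ j'j vN.
move=> T6 s6 f6 _ hD hT6; split=> //.
by move: hT1 hT6; nia.
Qed.

Lemma cell_some (s : state R) fe fv i x :
  cell s fe fv i = Some x <-> (0 < imem s fe i)%N /\ x = rmem s fv i.
Proof.
rewrite /cell; case: eqP => [->|/eqP]; first by split=> // -[].
by rewrite -lt0n => ->; split=> [[<-]|[_ ->]].
Qed.

Lemma wp_UpdX s0 a L (Q : nat -> state R -> Prop) :
  glob s0 -> imem s0 vs 0 = a -> (a < N)%N -> imem s0 vL 0 = L -> (L <= LM)%N ->
  (forall T s', frame (iwrites UpdX) (rwrites UpdX) s0 s' ->
    (T <= 300 * (L + 1) * (N + 1))%N ->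
    minupd (fun k y => exists2 t, (t < N)%N & exists2 j, (j < L.+1)%N &
       k = (a * W + t)%N /\ Dc s0 j t = Some y)
      (cell s0 aXe rXv) (cell s' aXe rXv) -> Q T s') ->
  wp M UpdX Q s0.
Proof.
move=> G hs aN hL LL hQ.
pose C t k y := exists2 j, (j < L.+1)%N & k = (a * W + t)%N /\ Dc s0 j t = Some y.
apply: (wp_for_min (fe := aXe) (fv := rXv) (C := C) (n := N) (B := (150 * (L + 1) + 50))) => //=.
- exact: ltn_trans NW WltM.
- by rewrite mod0n (gN G).
- move=> t st tN hf ht.
  pose C' j k y := k = (a * W + t)%N /\ Dc s0 j t = Some y.
  apply: (wp_for_min (fe := aXe) (fv := rXv) (C := C') (n := L.+1) (B := 130)) => //=.
  + by lia.
  + by apply: (ieval_incr W2 WM); [fr|lia].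
  + move=> j st' jL hf' hj.
    have h4 : imem st' vW 0 = W by fr; rewrite (gW G).
    have E1 : ieval M st' (Ix (Var vj) (Var vt)) = (j * W + t)%N.
      by apply: (ievalIx W2 WM) => //=; rewrite ?mod0n ?hj//; [fr|lia|lia].
    have E2 : ieval M st' (Ix (Var vs) (Var vt)) = (a * W + t)%N.
      by apply: (ievalIx W2 WM) => //=; rewrite ?mod0n ?hj//; try fr; lia.
    apply: (wp_gmin W2 WM (i0 := (a * W + t)%N) (bb := (0 < imem st' aDe (j * W + t))%N)
      (x := rmem st' rDv (j * W + t)) (B := 130)) => //=.
    * by rewrite E1 modn_small.
    * by rewrite E1.
    * move=> T s' hT _ hm; split=> //; apply: minupd_iff hm => k y.
      rewrite /C' /Dc cell_some; fr.
      by split=> [[h1 h2 h3]|[h1 [h2 h3]]].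
  + move=> T s' _ hT hm; split=> //; by move: hT; lia.
- move=> T s' hf hT hm; apply: hQ; [exact: (frame_sub _ _ hf)| |exact: hm].
  by move: hT; clear; nia.
Qed.

Lemma wp_UpdQ s0 a L (Q : nat -> state R -> Prop) :
  glob s0 -> pwok s0 -> imem s0 vs 0 = a -> (a < N)%N ->
  imem s0 vL 0 = L -> (L <= LM)%N ->
  (forall T s', frame (iwrites UpdQ) (rwrites UpdQ) s0 s' ->
    (T <= 300 * (L + 1))%N ->
    minupd (fun k y => exists2 j, (j < L)%N & exists2 x, Dc s0 j.+1 a = Some x &
       k = a /\ y = x / (1 - g ^+ j.+1))
      (cell s0 aQe rQv) (cell s' aQe rQv) -> Q T s') ->
  wp M UpdQ Q s0.
Proof.
move=> G P hs aN hL LL hQ.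
pose C j k y := exists2 x, Dc s0 j.+1 a = Some x & k = a /\ y = x / (1 - g ^+ j.+1).
apply: (wp_for_min (fe := aQe) (fv := rQv) (C := C) (n := L) (B := 150)) => //=.
- by lia.
- by rewrite mod0n.
- move=> j st' jL hf' hj.
  have h4 : imem st' vW 0 = W by fr; rewrite (gW G).
  have Ej : ieval M st' (Var vj +^ INat 1) = j.+1.
    by apply: (ieval_incr W2 WM); [fr|lia].
  have E1 : ieval M st' (Ix (Var vj +^ INat 1) (Var vs)) = (j.+1 * W + a)%N.
    by apply: (ievalIx W2 WM) => //=; rewrite ?mod0n//; [fr|lia|lia].
  apply: (wp_gmin W2 WM (i0 := a) (bb := (0 < imem st' aDe (j.+1 * W + a))%N)
    (x := rmem st' rDv (j.+1 * W + a) / (1 - g ^+ j.+1)) (B := 150)) => //.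
  + by rewrite /= E1 modn_small.
  + by move=> _; rewrite /= mod0n; fr.
  + move=> _; change (reval M st' (RGet rDv (Ix (Var vj +^ INat 1) (Var vs))) /
      (1 - rmem st' rpw (ieval M st' (Var vj +^ INat 1))) = 
      rmem st' rDv (j.+1 * W + a) / (1 - g ^+ j.+1)).
    by rewrite Ej /= E1; fr; rewrite P//; lia.
  + move=> T s' hT _ hm; split; first exact: hT.
    apply: minupd_iff hm => k y; rewrite /C /Dc; split.
      by move=> [h1 h2 h3]; eexists; [apply/cell_some; split; [|reflexivity]|];
        move: h1 h3; fr.
    move=> [x /cell_some[h1 ->] [-> ->]]; split=> //; fr => //.
- move=> T s' hf hT hm; apply: hQ; [exact: (frame_sub _ _ hf)| |exact: hm].
  by move: hT; clear; nia.
Qed.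

(** * Recording the computed walks *)

Lemma bt_valid L a o pa v i x :
  dpok N m src dst cst g a L o pa -> (v < N)%N -> o L v = Some x -> (i <= L)%N ->
  (bt src pa L v i < N)%N /\ exists y, o (L - i)%N (bt src pa L v i) = Some y.
Proof.
move=> [_ hl] vN ov; elim: i => [_|i IH iL]; first by rewrite subn0 /=; split; [case: (L)|exists x; case: (L) ov].
have [bN [y hy]] := IH (ltnW iL); rewrite btS//.
have jE : (L - i = (L - i.+1).+1)%N by lia.
have jL : (L - i.+1 < L)%N by lia.
move: hy; rewrite jE => hy.
have [_ h] := hl _ jL _ bN; have [em _ [z hz _]] := h _ hy.
by split; [apply: srcN|exists z].
Qed.

Definition mb (st : state R) L k := [seq imem st amem (k * W + j) | j <- iota 0 L.+1].

Lemma size_mb st L k : size (mb st L k) = L.+1.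
Proof. by rewrite size_map size_iota. Qed.

Lemma nth_mb st L k j : (j < L.+1)%N -> nth 0%N (mb st L k) j = imem st amem (k * W + j).
Proof. by move=> h; rewrite (nth_map 0%N) ?size_iota// nth_iota. Qed.

Lemma wp_Trace s0 a L v q x (Q : nat -> state R -> Prop) :
  glob s0 -> imem s0 vL 0 = L -> (L <= LM)%N -> imem s0 vv 0 = v -> (v < N)%N ->
  imem s0 vq 0 = q -> (q + 1 < W)%N -> (forall w, imem s0 astamp w <= q)%N ->
  dpok N m src dst cst g a L (Dc s0) (Dp s0) -> Dc s0 L v = Some x ->
  (forall T s', frame (iwrites Trace) (rwrites Trace) s0 s' -> (T <= 100 * (L + 2))%N ->
     (forall w, imem s' astamp w <= q.+1)%N ->
     (forall k j, k != q -> (j < W)%N ->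
        imem s' amem (k * W + j) = imem s0 amem (k * W + j)) ->
     mb s' L q = rev (pverts src (Dp s0) L v) ->
     (imem s' vok 0 = uniq (mb s' L q) :> nat) -> Q T s') ->
  wp M Trace Q s0.
Proof.
move=> G hL LL hv vN hq qW hst hD hx hQ.
apply: wp_seq; apply: wp_iset; apply: wp_seq; apply: wp_iset.
rewrite /= !mod0n modn_small// hv.
set s1 := seti _ _ _ _.
have f1 : frame [:: vcur; vok] [::] s0 s1.
  by apply: frame_trans (frame_seti _ _ _ _ _) (frame_seti _ _ _ _ _).
pose b := bt src (Dp s0) L v.
pose seen i := [seq b j | j <- iota 0 i].
have seenS i : seen i.+1 = rcons (seen i) (b i).
  by rewrite /seen -addn1 iotaD map_cat cats1.
(* The current vertex is described only up to round L: the last round still follows a parent in row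
   0, which does not exist, and leaves an arbitrary value. *)
apply: (@wp_for _ _ _ _ _ (fun i st =>
  [/\ (i <= L)%N -> imem st vcur 0 = b i,
      forall j, (j < i)%N -> imem st amem (q * W + j) = b j,
      forall k j, k != q -> (j < W)%N -> imem st amem (k * W + j) = imem s0 amem (k * W + j),
      imem st vok 0 = uniq (seen i) :> nat &
      forall w, imem st astamp w = if w \in seen i then q.+1 else imem s0 astamp w]) L.+1 80) => //.
- by lia.
- by apply: (ieval_incr W2 WM); [fr|lia].
- move=> i st iL hf hi [K1 K2 K3 K4 K5].
  rewrite ltnS in iL.
  have [bN [y hy]] := bt_valid hD vN hx iL; rewrite -/(b i) in bN hy.
  have h4 : imem st vW 0 = W by fr; rewrite (gW G).
  have hcur := K1 iL.
  have hq' : imem st vq 0 = q by fr.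
  apply: wp_seq; apply: wp_iset.
  rewrite (@ievalIx _ _ _ W2 WM _ _ _ q i)//=; rewrite ?mod0n//; try lia.
  rewrite hcur; set s2 := seti _ _ _ _.
  have hq2 : ieval M s2 (Var vq +^ INat 1) = q.+1.
    by apply: (ieval_incr W2 WM) => //; lia.
  have hc2 : imem s2 vcur 0 = b i by [].
  have j2 : imem s2 vj 0 = i by [].
  have ok2 : imem s2 vok = imem st vok by [].
  have st2 w : imem s2 astamp w = imem st astamp w by [].
  have kx2 : forall j, (j < i.+1)%N -> imem s2 amem (q * W + j) = b j.
    move=> j jS; rewrite /s2 /seti /update /= idx_eq; try lia.
    by rewrite eqxx /=; case: eqP => [->//|ji]; apply: K2; lia.
  have k3 : forall k j, k != q -> (j < W)%N -> imem s2 amem (k * W + j) = imem s0 amem (k * W + j).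
    move=> k j kq jW; rewrite /s2 /seti /update /= idx_eq; try lia.
    by rewrite (negbTE kq); apply: K3.
  have F2 : frame (vj :: iwrites Trace) [::] s1 s2.
    apply: (@frame_trans _ _ _ _ st); first exact: frame_sub _ _ hf.
    by apply: frame_seti.
  clearbody s2.
  (* The rest of the round is the same whether or not a repetition was noticed; [T0] is the time
     already spent in the conditional. *)
  have tail T0 s3 : (T0 <= 30)%N -> frame [:: vok] [::] s2 s3 ->
      imem s3 vok 0 = uniq (seen i.+1) :> nat ->
      wp M (ISet astamp (Var vcur) (Var vq +^ INat 1) ;;
        vcur ::= (IGet asrc (IGet apar (Ix (Var vL -^ Var vj) (Var vcur)))))
      (fun T s'' => (12 + (T0 + T) <= 80)%N /\
         [/\ (i.+1 <= L)%N -> imem s'' vcur 0 = b i.+1,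
      forall j, (j < i.+1)%N -> imem s'' amem (q * W + j) = b j,
      forall k j, k != q -> (j < W)%N -> imem s'' amem (k * W + j) = imem s0 amem (k * W + j),
      imem s'' vok 0 = uniq (seen i.+1) :> nat &
      forall w, imem s'' astamp w = if w \in seen i.+1 then q.+1 else imem s0 astamp w]) s3.
    move=> hT0 f3 ho.
    apply: wp_seq; apply: wp_iset.
    have -> : ieval M s3 (Var vq +^ INat 1) = q.+1.
      by apply: (ieval_incr W2 WM); [fr|lia].
    have -> : ieval M s3 (Var vcur) = b i by rewrite /= mod0n; fr.
    apply: wp_iset; set s4 := seti s3 _ _ _.
    have f4 : frame [:: astamp] [::] s3 s4 by apply: frame_seti.
    have e4 w : imem s4 astamp w = if w == b i then q.+1 else imem s3 astamp w.
      by rewrite /s4 /seti /update /=.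
    clearbody s4.
    have hL4 : imem s4 vL 0 = L by fr.
    have hj4 : imem s4 vj 0 = i by fr.
    have hc4 : imem s4 vcur 0 = b i by fr.
    have Ei : ieval M s4 (Ix (Var vL -^ Var vj) (Var vcur)) = ((L - i) * W + b i)%N.
      apply: (ievalIx W2 WM); try lia.
      + by fr; rewrite (gW G).
      + by rewrite /= /iop_eval !mod0n hL4 hj4 (modB W2 WM); lia.
      + by rewrite /= mod0n.
    split; first by move: hT0; rewrite /= icost_Ix /=; clear; lia.
    split.
    + move=> iL'; rewrite /seti /update /= Ei mod0n /= /b btS// -/(b i).
      have jE : (L - i = (L - i.+1).+1)%N by lia.
      have jL : (L - i.+1 < L)%N by lia.
      have [_ hl] := hD; have [_ h] := hl _ jL _ bN.
      move: hy; rewrite jE => /h[em _ _].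
      have -> : imem s4 apar = imem s0 apar by fr.
      have -> : imem s4 asrc = imem s0 asrc by fr.
      by rewrite (gsrc G).
    + by move=> j jS; rewrite /seti /update /= -kx2//; fr.
    + by move=> k j kq jW; rewrite /seti /update /= -k3//; fr.
    + by rewrite /seti /update /= -ho; fr.
    + move=> w; rewrite /seti /update /= e4 seenS mem_rcons inE.
      by case: eqP => //= _; have -> : imem s3 astamp = imem s2 astamp by [fr]; rewrite st2 K5.
  have hbE : beval M s2 (BILe (Var vq +^ INat 1) (IGet astamp (Var vcur))) =
      (b i \in seen i).
    rewrite [LHS]/= -/(ieval M s2 (Var vq +^ INat 1)) hq2 mod0n hc2 st2 K5.
    case: ifP => _; first by rewrite leqnn.
    by apply/negbTE; have := hst (b i); lia.
  apply: wp_seq; apply: wp_if; rewrite hbE => hb.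
    apply: wp_assign => //= s3 f3 h3.
    apply: wp_weaken (tail 20%N s3 _ f3 _) => //.
      by move=> T s'' _ [hT ?]; split=> //; move: hT; rewrite icost_Ix /=; clear; lia.
    by rewrite h3 mod0n seenS rcons_uniq hb.
  apply: wp_skip.
  apply: wp_weaken (tail 20%N s2 _ _ _) => //.
    by move=> T s'' _ [hT ?]; split=> //; move: hT; rewrite icost_Ix /=; clear; lia.
  by rewrite ok2 K4 seenS rcons_uniq hb.
- move=> T s' hf _ [K1 K2 K3 K4 K5] hT.
  have mbE : mb s' L q = rev (pverts src (Dp s0) L v).
    rewrite -bt_pverts; apply/eq_in_map => j; rewrite mem_iota => jL.
    by apply: K2; lia.
  apply: hQ => //.
  + exact: (frame_sub _ _ (frame_cat f1 hf)).
  + by move: hT => /=; clear; lia.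
  + by move=> w; rewrite K5; case: ifP => // _; have := hst w; lia.
  + rewrite mbE K4 /seen; congr (nat_of_bool (uniq _)).
    by rewrite -bt_pverts.
Qed.

(* [gs]: the walks recorded so far, [mb st L k] the vertices of walk [k]. *)
Record walkfam L (gs : seq nat) q (st : state R) : Prop := Family {
  fam_uniq : uniq gs;
  fam_lt : forall k, k \in gs -> (k < q)%N;
  fam_mb : forall k, k \in gs ->
    uniq (mb st L k) /\ all (fun w => w < N)%N (mb st L k);
  fam_tot : forall w, (w < N)%N -> imem st atot w = count (fun k => w \in mb st L k) gs;
  fam_cnt : forall w, (w < N)%N -> imem st acnt w = count (fun k => w \in mb st L k) gs;
  fam_inv : forall w r, (w < N)%N -> (r < imem st atot w)%N ->
    imem st ainv (w * W + r) = nth 0%N [seq k <- gs | w \in mb st L k] r;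
  fam_unhit : imem st vunhit 0 = size gs }.

Lemma size_lt (gs : seq nat) q : uniq gs -> (forall k, k \in gs -> (k < q)%N) ->
  (size gs <= q)%N.
Proof.
move=> u h; rewrite -(size_iota 0 q); apply: uniq_leq_size => // k /h.
by rewrite mem_iota.
Qed.

Lemma wp_Index s0 L gs q (Q : nat -> state R -> Prop) :
  glob s0 -> imem s0 vL 0 = L -> (L <= LM)%N -> imem s0 vq 0 = q -> (q + 1 < W)%N ->
  walkfam L gs q s0 -> uniq (mb s0 L q) -> all (fun w => w < N)%N (mb s0 L q) ->
  (forall T s', frame (iwrites Index) (rwrites Index) s0 s' -> (T <= 100 * (L + 2))%N ->
     (forall w, (w < N)%N -> imem s' atot w = (imem s0 atot w + (w \in mb s0 L q))%N) ->
     (forall w, (w < N)%N -> imem s' acnt w = (imem s0 acnt w + (w \in mb s0 L q))%N) ->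
     (forall w r, (w < N)%N -> (r < imem s0 atot w)%N ->
        imem s' ainv (w * W + r) = imem s0 ainv (w * W + r)) ->
     (forall w, w \in mb s0 L q -> imem s' ainv (w * W + imem s0 atot w) = q) ->
     Q T s') ->
  wp M Index Q s0.
Proof.
move=> G hL LL hq qW F um am hQ.
have totW w : (w < N)%N -> (imem s0 atot w <= q)%N.
  move=> wN; rewrite (fam_tot F wN); apply: leq_trans (count_size _ _) _.
  by apply: size_lt (fam_uniq F) (fam_lt F).
have cntW w : (w < N)%N -> (imem s0 acnt w <= q)%N.
  move=> wN; rewrite (fam_cnt F wN); apply: leq_trans (count_size _ _) _.
  by apply: size_lt (fam_uniq F) (fam_lt F).
pose tk i := take i (mb s0 L q).
apply: (@wp_for _ _ _ _ _ (fun i st =>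
  [/\ forall w, (w < N)%N -> imem st atot w = (imem s0 atot w + (w \in tk i))%N,
      forall w, (w < N)%N -> imem st acnt w = (imem s0 acnt w + (w \in tk i))%N,
      forall w r, (w < N)%N -> (r < imem s0 atot w)%N ->
        imem st ainv (w * W + r) = imem s0 ainv (w * W + r) &
      forall w, w \in tk i -> imem st ainv (w * W + imem s0 atot w) = q]) L.+1 70) => //.
- by lia.
- by apply: (ieval_incr W2 WM); [fr|lia].
- by rewrite /tk take0; split=> // w; rewrite in_nil addn0.
- move=> i st iL hf hi [K1 K2 K3 K4].
  have h4 : imem st vW 0 = W by fr; rewrite (gW G).
  have hq' : imem st vq 0 = q by fr.
  pose w := nth 0%N (mb s0 L q) i.
  have wmb : w \in mb s0 L q by apply: mem_nth; rewrite size_mb.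
  have wN : (w < N)%N by apply: (allP am).
  have tkS : tk i.+1 = rcons (tk i) w by rewrite /tk (take_nth 0%N) // size_mb.
  (* The walk has no repeated vertex, so w gets its only entry of this walk now and its list still
     has the old length. *)
  have wtk : w \notin tk i.
    have := take_uniq i.+1 um; rewrite -/(tk _) tkS rcons_uniq => /andP[] //.
  apply: wp_seq; apply: (wp_assign (x := w)).
    rewrite [ieval _ _ _]/= (ievalIx W2 WM (i := q) (j := i)) //=; rewrite ?mod0n//; try lia.
    have -> : imem st amem = imem s0 amem by fr.
    by rewrite -(nth_mb s0 q iL).
  move=> s1 f1 h1; have h41 : imem s1 vW 0 = W by fr; rewrite (gW G).
  have t1 : imem s1 atot w = imem s0 atot w.
    have -> : imem s1 atot = imem st atot by fr.
    by rewrite K1// (negbTE wtk) addn0.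
  have c1 : imem s1 acnt w = imem s0 acnt w.
    have -> : imem s1 acnt = imem st acnt by fr.
    by rewrite K2// (negbTE wtk) addn0.
  have tW := totW _ wN; have cW := cntW _ wN.
  apply: wp_seq; apply: (wp_store (i := (w * W + imem s0 atot w)%N) (x := q)).
  + apply: (ievalIx W2 WM) => //=; rewrite ?mod0n ?h1//; lia.
  + by rewrite /= mod0n; fr.
  move=> s2 f2 h2.
  have t2 : imem s2 atot w = imem s0 atot w by rewrite -t1; fr.
  apply: wp_seq; apply: (wp_store (i := w) (x := (imem s0 atot w).+1)).
  + by rewrite /= mod0n -h1; fr.
  + rewrite /= /iop_eval !mod0n; have -> : imem s2 vcur 0 = w by rewrite -h1; fr.
    by rewrite t2 (modn_small M1) (modA W2 WM) ?addn1; lia.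
  move=> s3 f3 h3; apply: (wp_store (i := w) (x := (imem s0 acnt w).+1)).
  + by rewrite /= mod0n -h1; fr.
  + rewrite /= /iop_eval !mod0n; have -> : imem s3 vcur 0 = w by rewrite -h1; fr.
    have -> : imem s3 acnt w = imem s0 acnt w by rewrite -c1; fr.
    by rewrite (modn_small M1) (modA W2 WM) ?addn1; lia.
  move=> s4 f4 h4'; split; first by rewrite /= icost_Ix.
  split.
  + move=> w' wN'; have -> : imem s4 atot w' = imem s3 atot w' by fr.
    rewrite h3 tkS mem_rcons inE; case: eqP => [->|_]; first by rewrite addn1.
    by have -> : imem s2 atot w' = imem st atot w' by [fr]; rewrite K1.
  + move=> w' wN'; rewrite h4' tkS mem_rcons inE.
    case: eqP => [->|_]; first by rewrite addn1.
    by have -> : imem s3 acnt w' = imem st acnt w' by [fr]; rewrite K2.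
  + move=> w' r wN' rt; have rW := totW _ wN'.
    have -> : imem s4 ainv = imem s2 ainv by fr.
    rewrite h2 idx_eq; [|lia|lia].
    case: eqP => [wE|_] /=.
      rewrite (_ : (r == imem s0 atot w) = false).
        by have -> : imem s1 ainv = imem st ainv by [fr]; apply: K3.
      by apply/eqP; move: rt; rewrite wE; lia.
    by have -> : imem s1 ainv = imem st ainv by [fr]; apply: K3.
  + move=> w'; have -> : imem s4 ainv = imem s2 ainv by fr.
    rewrite tkS mem_rcons inE h2 => /orP[/eqP->|wt]; first by rewrite eqxx.
    have wN' : (w' < N)%N by apply: (allP am); apply: mem_take wt.
    have rW := totW _ wN'.
    rewrite idx_eq; [|lia|lia].
    case: eqP wt => [->|_ wt] /=; first by rewrite (negbTE wtk).
    by have -> : imem s1 ainv = imem st ainv by [fr]; apply: K4.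
- move=> T s' hf _ [K1 K2 K3 K4] hT.
  have tkE : tk L.+1 = mb s0 L q by rewrite /tk take_oversize// size_mb.
  rewrite tkE in K1 K2 K4; apply: hQ => //.
  + exact: (frame_sub _ _ hf).
  + by move: hT => /=; clear; lia.
Qed.

Local Notation walk := (walk m src dst).
Local Notation fval := (fval cst g).
Local Notation verts := (verts dst).
Local Notation dle := (dle m src dst cst g).
Local Notation reach := (reach m src dst).

Implicit Types gs : seq nat.

Lemma family_mb L gs q (s s' : state R) : walkfam L gs q s ->
  (forall k, k \in gs -> mb s' L k = mb s L k) ->
  imem s' atot = imem s atot -> imem s' acnt = imem s acnt ->
  imem s' ainv = imem s ainv -> imem s' vunhit = imem s vunhit ->
  walkfam L gs q s'.
Proof.
move=> F h e1 e2 e3 e4.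
have cE w : count (fun k => w \in mb s' L k) gs = count (fun k => w \in mb s L k) gs.
  by apply: eq_in_count => k /h ->.
have fE w : [seq k <- gs | w \in mb s' L k] = [seq k <- gs | w \in mb s L k].
  by apply: eq_in_filter => k /h ->.
split; rewrite ?e1 ?e2 ?e3 ?e4.
- exact: fam_uniq F.
- exact: fam_lt F.
- by move=> k kg; rewrite h//; apply: (fam_mb F).
- by move=> w wN; rewrite cE; apply: (fam_tot F).
- by move=> w wN; rewrite cE; apply: (fam_cnt F).
- by move=> w r wN rt; rewrite fE; apply: (fam_inv F).
- exact: fam_unhit F.
Qed.

Lemma family_weak L gs q q' (s : state R) : walkfam L gs q s -> (q <= q')%N ->
  walkfam L gs q' s.
Proof.
move=> F qq; split; try by case: F.
by move=> k /(fam_lt F) kq; apply: leq_trans kq qq.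
Qed.

Lemma family_add L gs q (s1 s2 : state R) : walkfam L gs q s1 ->
  uniq (mb s1 L q) -> all (fun w => w < N)%N (mb s1 L q) ->
  imem s2 amem = imem s1 amem ->
  (forall w, (w < N)%N -> imem s2 atot w = (imem s1 atot w + (w \in mb s1 L q))%N) ->
  (forall w, (w < N)%N -> imem s2 acnt w = (imem s1 acnt w + (w \in mb s1 L q))%N) ->
  (forall w r, (w < N)%N -> (r < imem s1 atot w)%N ->
     imem s2 ainv (w * W + r) = imem s1 ainv (w * W + r)) ->
  (forall w, w \in mb s1 L q -> imem s2 ainv (w * W + imem s1 atot w) = q) ->
  imem s2 vunhit 0 = (imem s1 vunhit 0).+1 ->
  walkfam L (rcons gs q) q.+1 s2.
Proof.
move=> F um am e1 h1 h2 h3 h4 h5.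
have mE k : mb s2 L k = mb s1 L k by rewrite /mb e1.
have cE w : count (fun k => w \in mb s2 L k) (rcons gs q) =
    (count (fun k => w \in mb s1 L k) gs + (w \in mb s1 L q))%N.
  rewrite -cats1 count_cat /= addn0 mE; congr (_ + _)%N.
  by apply: eq_count => k; rewrite mE.
split.
- rewrite rcons_uniq (fam_uniq F) andbT; apply/negP => /(fam_lt F).
  by rewrite ltnn.
- by move=> k; rewrite mem_rcons inE => /orP[/eqP->//|/(fam_lt F)]; lia.
- move=> k; rewrite mem_rcons inE mE => /orP[/eqP->//|/(fam_mb F)//].
- by move=> w wN; rewrite h1// cE (fam_tot F).
- by move=> w wN; rewrite h2// cE (fam_cnt F).
- move=> w r wN; rewrite h1// filter_rcons mE.
  have -> : [seq k <- gs | w \in mb s2 L k] = [seq k <- gs | w \in mb s1 L k].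
    by apply: eq_filter => k; rewrite mE.
  have sz : size [seq k <- gs | w \in mb s1 L k] = imem s1 atot w.
    by rewrite size_filter (fam_tot F).
  case: ifP => hw; last by rewrite addn0 => rt; rewrite h3// (fam_inv F).
  rewrite addn1 ltnS leq_eqVlt nth_rcons sz => /orP[/eqP->|rt].
    by rewrite ltnn eqxx h4.
  by rewrite rt h3// (fam_inv F).
- by rewrite h5 size_rcons (fam_unhit F).
Qed.

Lemma wp_Extract s0 a L v q gs (Q : nat -> state R -> Prop) :
  glob s0 -> imem s0 vL 0 = L -> (L <= LM)%N -> imem s0 vv 0 = v ->
  (a < N)%N -> (v < N)%N ->
  imem s0 vq 0 = q -> (q + 1 < W)%N -> (forall w, imem s0 astamp w <= q)%N ->
  dpok N m src dst cst g a L (Dc s0) (Dp s0) -> walkfam L gs q s0 ->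
  (forall T s' gs' q', frame (iwrites Extract) (rwrites Extract) s0 s' ->
     (T <= 300 * (L + 2))%N ->
     imem s' vq 0 = q' -> (q <= q' <= q.+1)%N -> (size gs' + q <= size gs + q')%N ->
     (forall w, imem s' astamp w <= q')%N ->
     walkfam L gs' q' s' -> {subset gs <= gs'} ->
     (forall k, k \in gs -> mb s' L k = mb s0 L k) ->
     (forall x, Dc s0 L v = Some x -> uniq (pverts src (Dp s0) L v) ->
        exists2 k, k \in gs' & mb s' L k = rev (pverts src (Dp s0) L v)) ->
     Q T s') ->
  wp M Extract Q s0.
Proof.
move=> G hL LL hv aN vN hq qW hst hD F hQ.
have h4 : imem s0 vW 0 = W := gW G.
have Ei : ieval M s0 (Ix (Var vL) (Var vv)) = (L * W + v)%N.
  by apply: (ievalIx W2 WM) => //=; rewrite ?mod0n//; lia.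
have bE : beval M s0 (BILe (INat 1) (IGet aDe (Ix (Var vL) (Var vv)))) =
    (Dc s0 L v != None).
  rewrite /= Ei (modn_small M1) /Dc /cell lt0n.
  by case: (_ == 0%N).
apply: wp_if; rewrite bE; last first.
  rewrite negbK => /eqP E; apply: wp_skip; apply: (hQ _ _ gs q) => //.
  - by rewrite /= icost_Ix /=; lia.
  - by rewrite leqnn ltnW.
  - by move=> x; rewrite E.
case E : (Dc s0 L v) => [x|] // _.
have [hw _ _ vE] := dp_sound srcN hD aN (leqnn L) vN E.
have aV : all (fun w => w < N)%N (pverts src (Dp s0) L v).
  by rewrite -vE; apply: walk_N dstN _ _ _ aN hw.
apply: wp_seq; apply: (wp_Trace G hL LL hv vN hq qW hst hD E).
move=> T1 s1 f1 hT1 st1 hm1 mb1 ok1.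
have G1 := glob_frame f1 isT isT G.
have F1 : walkfam L gs q s1.
  apply: (family_mb F); try by rewrite f1.1.
  move=> k /(fam_lt F) kq; apply/eq_in_map => j; rewrite mem_iota => jL.
  by apply: hm1; [rewrite neq_ltn kq|lia].
have old1 k : k \in gs -> mb s1 L k = mb s0 L k.
  move=> /(fam_lt F) kq; apply/eq_in_map => j; rewrite mem_iota => jL.
  by apply: hm1; [rewrite neq_ltn kq|lia].
(* The common end of both branches: the walk number q is used up even if the walk repeats a vertex
   and is not indexed. *)
have fin T2 s2 gs' : (T2 <= 120 * (L + 2))%N -> (size gs' <= (size gs).+1)%N ->
    frame (vunhit :: iwrites Index) [::] s1 s2 ->
    walkfam L gs' q.+1 s2 -> {subset gs <= gs'} ->
    (uniq (mb s1 L q) -> q \in gs') ->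
    wp M (vq ::= Var vq +^ INat 1) (fun T3 s3 => forall T,
      (T <= 120 + (T1 + (T2 + T3)))%N -> Q T s3) s2.
  move=> hT2 hsz f2 F2 sub qg; apply: (wp_assign (x := q.+1)).
    by apply: (ieval_incr W2 WM); [fr|lia].
  move=> s3 f3 h3 T hT; have mE k : mb s3 L k = mb s1 L k.
    rewrite /mb; have -> : imem s3 amem = imem s1 amem by fr.
    by [].
  apply: (hQ _ _ gs' q.+1) => //.
  - exact: (frame_sub _ _ (frame_cat f1 (frame_cat f2 f3))).
  - by move: hT hT1 hT2 => /=; clear; lia.
  - by rewrite leqnn leqnSn.
  - by rewrite addnS -addSn leq_add2r.
  - by move=> w; have -> : imem s3 astamp = imem s1 astamp by fr.
  - apply: (family_mb F2); try by rewrite f3.1.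
    by move=> k _; rewrite /mb f3.1.
  - by move=> k kg; rewrite mE old1.
  - move=> x' _ up; exists q; last by rewrite mE.
    by apply: qg; rewrite mb1 rev_uniq.
have okE : beval M s1 (BILe (INat 1) (Var vok)) = uniq (mb s1 L q).
  move: ok1; move: (uniq (mb s1 L q)) => bb ok1.
  by rewrite /= mod0n (modn_small M1) ok1; case: (bb).
apply: wp_seq; apply: wp_if; rewrite okE => hu; last first.
  apply: wp_skip; apply: wp_weaken (fin 0%N s1 gs _ _ _ _ _ _) => //.
  - by move=> T s' _; apply; rewrite /= icost_Ix /=; clear; lia.
  - exact: (family_weak F1).
  - by rewrite (negbTE hu).
apply: wp_seq; apply: (wp_Index G1 _ LL _ qW F1 hu) => //.
- by fr.
- by fr.
- by rewrite mb1 all_rev.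
move=> T2 s2 f2 hT2 k1 kx2 k3 k4.
have u2 : imem s2 vunhit 0 = size gs by fr; rewrite (fam_unhit F).
apply: (wp_assign (x := (size gs).+1)).
  apply: (ieval_incr W2 WM) => //.
  by have := size_lt (fam_uniq F) (fam_lt F); lia.
move=> s3 f3 h3.
apply: wp_weaken (fin (T2 + 20)%N s3 (rcons gs q) _ _ _ _ _ _) => //.
- by move=> T s' _; apply; rewrite /= icost_Ix /=; clear; lia.
- by move: hT2; clear; lia.
- by rewrite size_rcons.
- exact: (frame_sub _ _ (frame_cat f2 f3)).
- apply: (family_add F1 hu).
  + by rewrite mb1 all_rev.
  + by fr.
  + by move=> w wN; rewrite (f3.1 atot)// k1.
  + by move=> w wN; rewrite (f3.1 acnt)// kx2.
  + by move=> w r wN rt; rewrite (f3.1 ainv)// k3.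
  + by move=> w wm; rewrite (f3.1 ainv)// k4.
  + by rewrite h3 -u2 (f2.1 vunhit).
- by move=> k kg; rewrite mem_rcons inE kg orbT.
- by move=> _; rewrite mem_rcons inE eqxx.
Qed.

(** * Rows and levels of the upward phase *)

Definition covers L gs (st : state R) a := forall p v, walk a p v -> size p = L ->
  exists p', [/\ walk a p' v, size p' = L, fval p' 0 <= fval p 0 &
    uniq (verts a p') -> exists2 k, k \in gs & mb st L k =i verts a p'].

Lemma covers_mono L gs gs' (s s' : state R) a : covers L gs s a -> {subset gs <= gs'} ->
  (forall k, k \in gs -> mb s' L k = mb s L k) -> covers L gs' s' a.
Proof.
move=> h sub e p v hw sz; have [p' [h1 h2 h3 h4]] := h p v hw sz.
exists p'; split=> // /h4[k kg ke]; exists k; first exact: sub.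
by rewrite e.
Qed.

(** Completeness and soundness are kept apart: [xdone] and [qdone] say that all walks up to length
    [L] have been taken into account, [xsound] and [qsound] that entries are genuine upper bounds.
    For [Q] this means a bound for every target reachable from the vertex. *)
Definition xdone (X : nat -> option R) L a := forall t p,
  walk a p t -> (size p <= L)%N -> ole (X (a * W + t)%N) (fval p 0).
Definition qdone (X : nat -> option R) L a := forall C,
  walk a C a -> (0 < size C <= L)%N -> ole (X a) (fval C 0 / (1 - g ^+ size C)).
Definition xsound (X : nat -> option R) := forall u t x, (u < N)%N -> (t < N)%N ->
  X (u * W + t)%N = Some x -> dle u t x.
Definition qsound (X : nat -> option R) := forall v z, (v < N)%N -> X v = Some z ->
  forall t, reach v t -> dle v t z.

Local Notation Xc s := (cell s aXe rXv).
Local Notation Qc s := (cell s aQe rQv).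

Record upst L gs q (s : state R) : Prop := UpSt {
  us_q : imem s vq 0 = q;
  us_stamp : forall w, (imem s astamp w <= q)%N;
  us_fam : walkfam L gs q s;
  us_x : xsound (Xc s);
  us_xq : qsound (Qc s) }.

Definition uprel L gs gs' (s s' : state R) :=
  [/\ {subset gs <= gs'}, forall k, k \in gs -> mb s' L k = mb s L k,
      mono (Xc s) (Xc s') & mono (Qc s) (Qc s')].

Lemma uprel_refl L gs s : uprel L gs gs s s.
Proof. by split. Qed.

Lemma uprel_trans L gs1 gs2 gs3 s1 s2 s3 :
  uprel L gs1 gs2 s1 s2 -> uprel L gs2 gs3 s2 s3 -> uprel L gs1 gs3 s1 s3.
Proof.
move=> [h1 h2 h3 h4] [k1 kx2 k3 k4]; split.
- by move=> k /h1/k1.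
- by move=> k kg; rewrite kx2 ?h2//; apply: h1.
- exact: mono_trans k3.
- exact: mono_trans k4.
Qed.

Lemma wp_RowUp s0 a L q gs (Q : nat -> state R -> Prop) :
  glob s0 -> pwok s0 -> imem s0 vs 0 = a -> (a < N)%N ->
  imem s0 vL 0 = L -> (L <= LM)%N -> (q + N + 1 < W)%N ->
  upst L gs q s0 ->
  (forall T s' gs' q', frame (iwrites RowUp) (rwrites RowUp) s0 s' ->
     (T <= 2000 * (L + 1) * (N + m + 1))%N -> (q <= q' <= q + N)%N ->
     (size gs' + q <= size gs + q')%N ->
     upst L gs' q' s' -> uprel L gs gs' s0 s' ->
     covers L gs' s' a -> xdone (Xc s') L a -> qdone (Qc s') L a -> Q T s') ->
  wp M RowUp Q s0.
Proof.
move=> G P hs aN hL LL qW U hQ.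
apply: wp_seq; apply: wp_weaken (wp_DP G P hs aN hL LL).
move=> T1 s1 f1 [hT1 hD].
have G1 := glob_frame f1 isT isT G.
have P1 : pwok s1 by move=> j jL; rewrite f1.2// P.
apply: wp_seq; apply: (wp_UpdX (a := a) (L := L) G1) => //; try by fr.
move=> T2 s2 f2 hT2 mx.
have G2 := glob_frame f2 isT isT G1.
have P2 : pwok s2 by move=> j jL; rewrite f2.2// P1.
apply: wp_seq; apply: (wp_UpdQ (a := a) (L := L) G2 P2) => //; try by fr.
move=> T3 s3 f3 hT3 mq.
have G3 := glob_frame f3 isT isT G2.
have dcE s' : imem s' aDe = imem s1 aDe -> rmem s' rDv = rmem s1 rDv ->
    Dc s' = Dc s1.
  by move=> e1 e2; apply/funext => j; apply/funext => v; rewrite /Dc /cell e1 e2.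
have dpE s' : imem s' apar = imem s1 apar -> Dp s' = Dp s1.
  by move=> e1; apply/funext => j; apply/funext => v; rewrite /Dp e1.
have F13 := frame_cat f1 (frame_cat f2 f3).
have fam3 : walkfam L gs q s3.
  apply: (family_mb (us_fam U)); try by rewrite F13.1.
  by move=> k _; rewrite /mb F13.1.
have old3 k : mb s3 L k = mb s0 L k by rewrite /mb F13.1.
have X01 : Xc s1 = Xc s0 by apply/funext => i; rewrite /cell (f1.1 aXe)// (f1.2 rXv).
have X23 : Xc s3 = Xc s2 by apply/funext => i; rewrite /cell (f3.1 aXe)// (f3.2 rXv).
have Q02 : Qc s2 = Qc s0.
  by apply/funext => i; rewrite /cell (f2.1 aQe)// (f1.1 aQe)// (f2.2 rQv)// (f1.2 rQv).
rewrite X01 -X23 in mx; rewrite Q02 (dcE s2 (f2.1 aDe isT) (f2.2 rDv isT)) in mq.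
apply: (@wp_for _ _ _ _ _ (fun v st => exists gs' q', [/\
   (q <= q' <= q + v)%N, imem st vq 0 = q', forall w, (imem st astamp w <= q')%N,
   walkfam L gs' q' st & [/\ (size gs' + q <= size gs + q')%N, {subset gs <= gs'},
   forall k, k \in gs -> mb st L k = mb s3 L k &
   forall v' x, (v' < v)%N -> Dc s1 L v' = Some x -> uniq (pverts src (Dp s1) L v') ->
     exists2 k, k \in gs' & mb st L k = rev (pverts src (Dp s1) L v')]]) N (300 * (L + 2))) => //.
- exact: ltn_trans NW WltM.
- by rewrite /= mod0n (gN G3).
- move=> i st v [gs' [q' [h1 h2 h3 F' h5]]]; exists gs', q'; split=> //.
  by apply: (family_mb F').
- exists gs, q; split=> //; rewrite ?addn0 ?leqnn//.
  + by fr; apply: (us_q U).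
  + by move=> w; fr; apply: (us_stamp U).
  + by split.
- move=> v st vN hf hv [gs' [q' [hq' vq' st' F' [szq sub old new]]]].
  have Fx := frame_cat F13 hf.
  have Gs := glob_frame Fx isT isT G.
  have hD' : dpok N m src dst cst g a L (Dc st) (Dp st).
    rewrite (dcE st) ?(dpE st)//; by [fr | rewrite hf.2// f3.2// f2.2].
  apply: (wp_Extract (a := a) (L := L) (v := v) (q := q') (gs := gs') Gs) => //; try by fr.
    by lia.
  move=> T s' gs2 q2 f' hT hq2 q2q sz2 st2 F2 sub2 old2 new2.
  split; first by [].
  exists gs2, q2; split=> //; first by lia.
  split.
  + by move: szq sz2; clear; lia.
  + by move=> k /sub/sub2.
  + by move=> k kg; rewrite old2 ?old//; apply: sub.
  + move=> v' x; rewrite ltnS leq_eqVlt => /orP[/eqP->|v'v] E un.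
      have := new2 x; rewrite (dcE st) ?(dpE st); try by [fr | rewrite hf.2// f3.2// f2.2].
      by apply.
    have [k kg kE] := new _ _ v'v E un.
    by exists k; [apply: sub2|rewrite old2].
- move=> T4 s4 f4 _ [gs' [q' [hq' vq' st' F' [szq sub old new]]]] hT4.
  have X34 : Xc s4 = Xc s3 by apply/funext => i; rewrite /cell (f4.1 aXe)// (f4.2 rXv).
  have Q34 : Qc s4 = Qc s3 by apply/funext => i; rewrite /cell (f4.1 aQe)// (f4.2 rQv).
  have [x1 x2 x3] := mx; have [y1 y2 y3] := mq.
  apply: (hQ _ _ gs' q').
  + exact: (frame_sub _ _ (frame_cat F13 f4)).
  + by move: hT1 hT2 hT3 hT4 => /=; clear; nia.
  + by [].
  + by [].
  + split=> //.
    * move=> u t x uN tN; rewrite X34 => /x3[]; first exact: (us_x U).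
      move=> [t' t'N [j jL [kE Dj]]].
      move: kE => /eqP; rewrite idx_eq ?(ltn_trans _ NW)// => /andP[/eqP-> /eqP->].
      have jL' : (j <= L)%N by [].
      have [w _ <- _] := dp_sound srcN hD aN jL' t'N Dj.
      exact: dle_walk.
    * move=> v z vN; rewrite Q34 => /y3[]; first exact: (us_xq U).
      move=> [j jL [x Dj [-> ->]]] t rt.
      have [w sz <- _] := dp_sound srcN hD aN jL aN Dj.
      by have := dle_loop cst g0 g1 w _ rt; rewrite sz; apply; rewrite -size_eq0 sz.
  + split=> //.
    * by move=> k kg; rewrite old ?old3.
    * by move=> i x; rewrite X34; apply: x1.
    * by move=> i x; rewrite Q34; apply: y1.
  (* The substitute for [p] is the walk the dynamic program found for the same length and end; it
     was recorded unless it repeats a vertex. *)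
  + move=> p v hw sz.
    have vN := walk_end_N dstN aN hw.
    have pL : (size p <= L)%N by rewrite sz.
    have := dp_le dstN hD aN hw pL; rewrite sz.
    case E : (Dc s1 L v) => [x|] //= xp.
    have [w' sz' f' vE] := dp_sound srcN hD aN (leqnn L) vN E.
    exists (pwalk src (Dp s1) L v); split=> //; first by rewrite f'.
    move=> un; have un' : uniq (pverts src (Dp s1) L v) by rewrite -vE.
    have [k kg kE] := new _ _ vN E un'.
    by exists k => // b; rewrite kE mem_rev vE.
  + move=> t p hw sz; rewrite X34.
    have tN := walk_end_N dstN aN hw.
    have := dp_le dstN hD aN hw sz.
    case E : (Dc s1 _ t) => [x|] //= xp.
    by apply: ole_trans xp; apply: x2; exists t => //; exists (size p).
  + move=> C hw /andP[C0 CL]; rewrite Q34.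
    have := dp_le dstN hD aN hw CL.
    case E : (Dc s1 _ a) => [x|] //= xp.
    have Cn : C != [::] by rewrite -size_eq0 -lt0n.
    apply: (@ole_trans _ _ (x / (1 - g ^+ size C))).
      apply: y2; exists (size C).-1; rewrite ?prednK//.
      by exists x.
    by rewrite ler_pM2r// invr_gt0; apply: gpow1.
Qed.

Definition Slist (s : state R) l := [seq imem s aS (l * W + r) | r <- iota 0 (imem s anS l)].

Lemma size_Slist s l : size (Slist s l) = imem s anS l.
Proof. by rewrite size_map size_iota. Qed.

Lemma nth_Slist s l r : (r < imem s anS l)%N -> nth 0%N (Slist s l) r = imem s aS (l * W + r).
Proof. by move=> h; rewrite (nth_map 0%N) ?size_iota// nth_iota. Qed.

Lemma xdone_mono X X' L a : mono X X' -> xdone X L a -> xdone X' L a.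
Proof. by move=> h h1 t p hw sz; apply/h/h1. Qed.

Lemma qdone_mono X X' L a : mono X X' -> qdone X L a -> qdone X' L a.
Proof. by move=> h h1 C hw sz; apply/h/h1. Qed.

Lemma wp_LevelUp s0 lev L q gs (Q : nat -> state R -> Prop) :
  glob s0 -> pwok s0 -> imem s0 vlev 0 = lev -> (lev < W)%N ->
  (imem s0 anS lev <= N)%N -> all (fun a => a < N)%N (Slist s0 lev) ->
  imem s0 vL 0 = L -> (L <= LM)%N -> (q + (imem s0 anS lev + 1) * N + 1 < W)%N ->
  upst L gs q s0 ->
  (forall T s' gs' q', frame (iwrites LevelUp) (rwrites LevelUp) s0 s' ->
     (T <= imem s0 anS lev * (2000 * (L + 1) * (N + m + 1) + 100) + 20)%N ->
     (q <= q' <= q + imem s0 anS lev * N)%N -> (size gs' + q <= size gs + q')%N ->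
     upst L gs' q' s' -> uprel L gs gs' s0 s' ->
     (forall a, a \in Slist s0 lev ->
        [/\ covers L gs' s' a, xdone (Xc s') L a & qdone (Qc s') L a]) -> Q T s') ->
  wp M LevelUp Q s0.
Proof.
move=> G P hlev levW nN aN hL LL qW U hQ.
set n := imem s0 anS lev in nN qW hQ *.
apply: (@wp_for _ _ _ _ _ (fun r st => exists gs' q', [/\ (q <= q' <= q + r * N)%N,
   (size gs' + q <= size gs + q')%N, upst L gs' q' st, uprel L gs gs' s0 st &
   forall r', (r' < r)%N -> let a := nth 0%N (Slist s0 lev) r' in
     [/\ covers L gs' st a, xdone (Xc st) L a & qdone (Qc st) L a]]) n
   (2000 * (L + 1) * (N + m + 1) + 80)) => //.
- by apply: leq_ltn_trans nN (ltn_trans NW WltM).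
- by rewrite /= mod0n hlev.
- move=> r st v [gs' [q' [h1 h2 [u1 u2 u3 u4 u5] h4 h5]]]; exists gs', q'; split=> //.
  by split=> //; apply: (family_mb u3).
- exists gs, q; split; [|by []|by []|exact: uprel_refl|by []].
  by rewrite mul0n addn0 leqnn.
- move=> r st rn hf hr [gs' [q' [hq' szq U' R' done]]].
  have Gs := glob_frame hf isT isT G.
  have rW : (r < W)%N by apply: ltn_trans rn (leq_ltn_trans nN NW).
  pose a := nth 0%N (Slist s0 lev) r.
  have aN' : (a < N)%N by apply: (allP aN); apply: mem_nth; rewrite size_Slist.
  apply: wp_seq; apply: (wp_assign (x := a)).
    rewrite [LHS]/= (ievalIx W2 WM (i := lev) (j := r)) //=; rewrite ?mod0n//.
    + by rewrite /a nth_Slist//; fr.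
    + by rewrite (gW Gs).
    + by fr.
  move=> s1 f1 h1.
  have G1 := glob_frame f1 isT isT Gs.
  have F1 := frame_cat hf f1.
  have P1 : pwok s1 by move=> j jL; rewrite (F1.2 rpw isT) P.
  have U1 : upst L gs' q' s1.
    case: U' => u1 u2 u3 u4 u5; split.
    + by rewrite (f1.1 vq isT).
    + by move=> w; rewrite (f1.1 astamp isT).
    + apply: (family_mb u3); try by fr.
      by move=> k _; rewrite /mb (f1.1 amem isT).
    + have -> : Xc s1 = Xc st by apply/funext => i; rewrite /cell (f1.1 aXe isT) (f1.2 rXv isT).
      by [].
    + have -> : Qc s1 = Qc st by apply/funext => i; rewrite /cell (f1.1 aQe isT) (f1.2 rQv isT).
      by [].
  have X1 : Xc s1 = Xc st by apply/funext => i; rewrite /cell (f1.1 aXe isT) (f1.2 rXv isT).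
  have Q1 : Qc s1 = Qc st by apply/funext => i; rewrite /cell (f1.1 aQe isT) (f1.2 rQv isT).
  have mb1 k : mb s1 L k = mb st L k by rewrite /mb (f1.1 amem isT).
  have q'W : (q' + N + 1 < W)%N.
    have rnN : (r * N <= n * N)%N by rewrite leq_mul2r ltnW ?orbT.
    by move: hq' qW rnN; clear; nia.
  apply: (wp_RowUp G1 P1 h1 aN' _ LL q'W U1); first by fr.
  move=> T2 s2 gs2 q2 f2 hT2 hq2 sz2 U2 R2 C2 x2 y2.
  have R02 : uprel L gs' gs2 st s2.
    case: R2 => k1 kx2 k3 k4; split=> //.
    + by move=> k kg; rewrite kx2// mb1.
    + by rewrite -X1.
    + by rewrite -Q1.
  split; first by move: hT2 => /=; rewrite icost_Ix /=; clear; lia.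
  exists gs2, q2; split=> //.
  + by move: hq' hq2; rewrite mulSn; clear; lia.
  + by move: szq sz2; clear; lia.
  + exact: uprel_trans R' R02.
  + move=> r'; rewrite ltnS leq_eqVlt => /orP[/eqP->//|r'r].
    have [c1 c2 c3] := done r' r'r; have [k1 kx2 k3 k4] := R02; split.
    * exact: covers_mono c1 k1 kx2.
    * exact: xdone_mono c2.
    * exact: qdone_mono c3.
- move=> T s' hf _ [gs' [q' [hq' szq U' R' done]]] hT; apply: (hQ _ _ gs' q') => //.
  + exact: (frame_sub _ _ hf).
  + by move: hT => /=; clear; nia.
  + move=> a /(nthP 0%N)[r]; rewrite size_Slist => rn <-.
    exact: done.
Qed.

(** * The greedy hitting set *)

Lemma wp_PickMax s0 (Q : nat -> state R -> Prop) :
  glob s0 -> (0 < N)%N ->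
  (forall T s' b, frame (iwrites PickMax) (rwrites PickMax) s0 s' -> (T <= 60 * (N + 1))%N ->
     imem s' vbest 0 = b -> (b < N)%N ->
     (forall w, (w < N)%N -> imem s0 acnt w <= imem s0 acnt b)%N -> Q T s') ->
  wp M PickMax Q s0.
Proof.
move=> G N0 hQ; apply: wp_seq; apply: (wp_assign (x := 0%N)); first exact: mod0n.
move=> s1 f1 h1.
apply: (@wp_for _ _ _ _ _ (fun i st => (imem st vbest 0 < N)%N /\
   forall w, (w < i)%N -> (imem s0 acnt w <= imem s0 acnt (imem st vbest 0))%N) N 30) => //.
- exact: ltn_trans NW WltM.
- by rewrite /= mod0n; fr; rewrite (gN G).
- by rewrite h1.
- move=> i st iN hf hi [I1 I2].
  have cE : imem st acnt = imem s0 acnt by fr.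
  apply: wp_if; rewrite /= !mod0n hi cE => hb.
    apply: wp_assign => // s2 f2 h2; rewrite /= mod0n hi in h2; split=> //.
    rewrite h2; split=> // w; rewrite ltnS leq_eqVlt => /orP[/eqP->//|/I2 wi].
    exact: leq_trans wi hb.
  apply: wp_skip; split=> //; split=> // w; rewrite ltnS leq_eqVlt => /orP[/eqP->|/I2//].
  by apply: ltnW; rewrite ltnNge.
- move=> T s' hf _ [I1 I2] hT; apply: (hQ _ _ (imem s' vbest 0)) => //.
  + exact: (frame_sub _ _ (frame_cat f1 hf)).
  + by move: hT => /=; clear; lia.
Qed.

(* A recorded walk is alive while its [ahit] flag is 0. *)
Definition alive (st : state R) k := imem st ahit k == 0%N.

Definition gstate L (gs : seq nat) (s0 st : state R) (al : pred nat) :=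
  [/\ forall k, k \in gs -> alive st k = al k,
      forall w, (w < N)%N -> imem st acnt w = count (fun k => al k && (w \in mb s0 L k)) gs &
      imem st vunhit 0 = count al gs].

Lemma gstate_eq L gs s0 st al al' : (forall k, k \in gs -> al k = al' k) ->
  gstate L gs s0 st al -> gstate L gs s0 st al'.
Proof.
move=> e [h1 h2 h3]; split.
- by move=> k kg; rewrite h1// e.
- by move=> w wN; rewrite h2//; apply: eq_in_count => k kg; rewrite e.
- by rewrite h3; apply: eq_in_count.
Qed.

Lemma wp_Kill1 s0 s1 L gs q k (al : pred nat) (Q : nat -> state R -> Prop) :
  glob s1 -> walkfam L gs q s0 -> imem s1 amem = imem s0 amem ->
  imem s1 vL 0 = L -> (L <= LM)%N -> imem s1 vcur 0 = k -> k \in gs -> al k -> (q < W)%N ->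
  gstate L gs s0 s1 al ->
  (forall T s', frame (iwrites Kill1) (rwrites Kill1) s1 s' -> (T <= 60 * (L + 2))%N ->
     gstate L gs s0 s' (fun x => al x && (x != k)) ->
     imem s' vunhit 0 = (imem s1 vunhit 0).-1 -> (0 < imem s1 vunhit 0)%N -> Q T s') ->
  wp M Kill1 Q s1.
Proof.
move=> G F hm hL LL hc kg ak qW [S1 S2 S3] hQ.
have kq := fam_lt F kg; have [uk ck] := fam_mb F kg.
have ug := fam_uniq F.
have gW' : (size gs <= q)%N by apply: size_lt ug (fam_lt F).
have u1 : imem s1 vunhit 0 = (count (fun x => al x && (x != k)) gs).+1.
  rewrite S3 -(eq_count (a1 := fun x => al x && true)); last by move=> x; rewrite andbT.
  rewrite (count_del xpredT ug kg ak) addn1; congr _.+1.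
  by apply: eq_count => x; rewrite andbT.
apply: wp_seq; apply: (wp_store (i := k) (x := 1%N)).
- by rewrite /= mod0n.
- by rewrite /= modn_small.
move=> s2 f2 h2; apply: wp_seq.
apply: (wp_assign (x := count (fun x => al x && (x != k)) gs)).
  rewrite /= /iop_eval mod0n (modn_small M1) (f2.1 vunhit isT) u1 subn1 /= modn_small//.
  by have := count_size (fun x => al x && (x != k)) gs; lia.
move=> s3 f3 h3.
pose dr j := drop j (mb s0 L k).
apply: (@wp_for _ _ _ _ _ (fun j st => forall w, (w < N)%N -> imem st acnt w =
   (count (fun x => (al x && (x != k)) && (w \in mb s0 L x)) gs + (w \in dr j))%N) L.+1 40) => //.
- by lia.
- by apply: (ieval_incr W2 WM); [fr|lia].
- move=> w wN; have -> : imem s3 acnt w = imem s1 acnt w by fr.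
  by rewrite S2// (count_del (fun x => w \in mb s0 L x) ug kg ak) /dr drop0.
- move=> j st jL hf hj I.
  pose w := nth 0%N (mb s0 L k) j.
  have szj : (j < size (mb s0 L k))%N by rewrite size_mb.
  have wN : (w < N)%N by apply: (allP ck); apply: mem_nth.
  have drE : dr j = w :: dr j.+1 by rewrite /dr (drop_nth 0%N).
  have ud : uniq (dr j) by apply: drop_uniq.
  have wE : ieval M st (IGet amem (Ix (Var vcur) (Var vj))) = w.
    rewrite [LHS]/= (ievalIx W2 WM (i := k) (j := j)) //=; rewrite ?mod0n//; try by fr.
    + have -> : imem st amem = imem s0 amem by rewrite -hm; fr.
      by rewrite -(nth_mb s0 k jL).
    + by fr; rewrite (gW G).
    + by lia.
    + by lia.
  have cw : imem st acnt w =
      (count (fun x => (al x && (x != k)) && (w \in mb s0 L x)) gs).+1.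
    by rewrite I// drE inE eqxx /= addn1.
  apply: (wp_store (i := w) (x := (imem st acnt w).-1)) => //.
    rewrite [LHS]/= -[imem st amem _]/(ieval M st (IGet amem (Ix (Var vcur) (Var vj)))) wE.
    rewrite /iop_eval (modn_small M1) subn1 modn_small// cw /=.
    apply: leq_ltn_trans (count_size _ _) _.
    exact: leq_ltn_trans gW' (ltn_trans qW WltM).
  move=> s4 f4 h4; split; first by rewrite /= !icost_Ix.
  move=> w' wN'; rewrite h4; case: eqP => [->|/eqP ne].
    rewrite cw /= ; move: ud; rewrite drE /= => /andP[/negbTE-> _].
    by rewrite addn0.
  by rewrite I// drE inE (negbTE ne).
- move=> T s' hf _ I hT; apply: hQ.
  + exact: (frame_sub _ _ (frame_cat f2 (frame_cat f3 hf))).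
  + by move: hT => /=; clear; lia.
  + split.
    * move=> x xg; rewrite /alive; have -> : imem s' ahit x = imem s2 ahit x by fr.
      by rewrite h2; case: (x =P k) => [->|_]; rewrite ?andbF// andbT -S1.
    * by move=> w wN; rewrite I// /dr drop_oversize ?size_mb// in_nil addn0.
    * by rewrite (hf.1 vunhit isT).
  + by rewrite (hf.1 vunhit isT) h3 u1.
  + by rewrite u1.
Qed.

(** The time is amortized: looking at an entry of the index is cheap, and the expensive update,
    proportional to L, occurs once for each walk that drops out of the unhit count. *)
Lemma wp_Kill s0 s1 L gs q b (al : pred nat) (Q : nat -> state R -> Prop) :
  glob s1 -> walkfam L gs q s0 -> imem s1 amem = imem s0 amem ->
  imem s1 atot = imem s0 atot -> imem s1 ainv = imem s0 ainv ->
  imem s1 vL 0 = L -> (L <= LM)%N -> imem s1 vbest 0 = b -> (b < N)%N -> (q < W)%N ->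
  gstate L gs s0 s1 al ->
  (forall T s', frame (iwrites Kill) (rwrites Kill) s1 s' ->
     gstate L gs s0 s' (fun x => al x && (b \notin mb s0 L x)) ->
     (imem s' vunhit 0 <= imem s1 vunhit 0)%N ->
     (T <= 60 * imem s0 atot b +
        60 * (L + 2) * (imem s1 vunhit 0 - imem s' vunhit 0) + 20)%N -> Q T s') ->
  wp M Kill Q s1.
Proof.
move=> G F hm ht hv hL LL hb bN qW S hQ.
have ug := fam_uniq F.
have gW' : (size gs <= q)%N by apply: size_lt ug (fam_lt F).
pose ks := [seq k <- gs | b \in mb s0 L k].
have szk : size ks = imem s0 atot b by rewrite (fam_tot F bN) size_filter.
have szk' : (size ks <= size gs)%N by rewrite size_filter count_size.
apply: (@wp_for_gen _ _ _ _ _ (fun i T st =>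
   [/\ gstate L gs s0 st (fun x => al x && (x \notin take i ks)),
       (imem st vunhit 0 <= imem s1 vunhit 0)%N &
       (T <= 40 * i + 60 * (L + 2) * (imem s1 vunhit 0 - imem st vunhit 0))%N]) (size ks)) => //.
- by lia.
- by rewrite /= mod0n hb ht szk.
- split=> //; apply: gstate_eq S => k kg; rewrite take0 in_nil.
  by rewrite andbT.
- move=> i T st ik hf hi [I1 I2 I3].
  have Gs := glob_frame hf isT isT G.
  pose k := nth 0%N ks i.
  have kks : k \in ks by apply: mem_nth.
  have kg : k \in gs by move: kks; rewrite mem_filter => /andP[].
  have tS : take i.+1 ks = rcons (take i ks) k by rewrite (take_nth 0%N).
  have uks : uniq ks by apply: filter_uniq.
  have knt : k \notin take i ks.
    by have := take_uniq i.+1 uks; rewrite tS rcons_uniq => /andP[].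
  apply: wp_seq; apply: (wp_assign (x := k)).
    have iW : (i < W)%N by clear - ik szk' gW' qW; lia.
    rewrite [LHS]/= (ievalIx W2 WM (i := b) (j := i)) //=; rewrite ?mod0n//.
    + have -> : imem st ainv = imem s0 ainv by rewrite -hv; fr.
      by rewrite (fam_inv F bN)// -szk.
    + by rewrite (gW Gs).
    + by fr.
    + exact: ltn_trans bN NW.
  move=> s2 f2 h2; have Gs2 := glob_frame f2 isT isT Gs.
  have I1' : gstate L gs s0 s2 (fun x => al x && (x \notin take i ks)).
    case: I1 => k1 kx2 k3; split.
    - by move=> x xg; rewrite /alive (f2.1 ahit isT); apply: k1.
    - by move=> w wN; rewrite (f2.1 acnt isT) kx2.
    - by rewrite (f2.1 vunhit isT).
  have u2 : imem s2 vunhit 0 = imem st vunhit 0 by fr.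
  have bE : beval M s2 (BILe (IGet ahit (Var vcur)) (INat 0)) = al k.
    rewrite /= !mod0n h2 leqn0; have [h _ _] := I1'.
    by have := h k kg; rewrite /alive knt andbT.
  apply: wp_if; rewrite bE => hk.
    apply: (wp_Kill1 Gs2 F _ _ LL h2 kg _ qW I1').
    + by rewrite -hm; fr.
    + by fr.
    + by rewrite hk.
    move=> T3 s3 f3 hT3 S3 u3 u30; split.
    + by apply: gstate_eq S3 => x xg; rewrite tS mem_rcons inE negb_or andbCA andbC.
    + by rewrite u3 u2; clear - I2; lia.
    + by rewrite u3; move: hT3 I2 I3 u30; rewrite u2 /= icost_Ix /=; clear; nia.
  apply: wp_skip; split.
  + apply: gstate_eq I1' => x xg; rewrite tS mem_rcons inE negb_or.
    by case: eqP => // ->; rewrite (negbTE hk).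
  + by rewrite u2.
  + by rewrite u2; move: I3; rewrite /= icost_Ix /=; clear; lia.
- move=> T s' hf _ [I1 I2 I3]; apply: hQ => //.
  + exact: (frame_sub _ _ hf).
  + apply: gstate_eq I1 => x xg; rewrite take_oversize// mem_filter xg andbT.
    by [].
  + by rewrite -szk; move: I3 => /=; clear; lia.
Qed.

Definition row_ok (s s' : state R) lev (B : seq nat) :=
  [/\ imem s' anS lev = size B,
      forall r, (r < size B)%N -> imem s' aS (lev * W + r) = nth 0%N B r,
      forall l r, l != lev -> (r < W)%N -> imem s' aS (l * W + r) = imem s aS (l * W + r) &
      forall l, l != lev -> imem s' anS l = imem s anS l].

(** True of the walks that [B] misses, which are those still alive. *)
Definition picked L (s : state R) (B : seq nat) := fun k => ~~ has (mem (mb s L k)) B.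

(** The field [gi_bound] says that the alive walks are at most the fraction (1 - (L+1)/N)^|B| of
    all. In [gi_time] the index entries of the picks and the retired walks are charged separately,
    as in [wp_Kill]. *)
Record greedy_inv L gs (s0 : state R) lev (B : seq nat) T (st : state R) : Prop := GreedyInv {
  gi_uniq : uniq B;
  gi_lt : all (fun w => w < N)%N B;
  gi_row : row_ok s0 st lev B;
  gi_state : gstate L gs s0 st (picked L s0 B);
  gi_bound : (count (picked L s0 B) gs * N ^ size B <= size gs * (N - L.+1) ^ size B)%N;
  gi_LN : B != [::] -> (L < N)%N;
  gi_small : forall bb, (size gs < 2 ^ bb)%N -> (size B <= (N %/ L.+1).+1 * bb)%N;
  gi_time : (T <= 200 * (N + 1) * size B + 60 * (\sum_(b <- B) imem s0 atot b) +
     60 * (L + 2) * (size gs - count (picked L s0 B) gs))%N }.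

Definition greedy_body :=
  PickMax ;;
  ISet aS (Ix (Var vlev +^ INat 1) (IGet anS (Var vlev +^ INat 1))) (Var vbest) ;;
  ISet anS (Var vlev +^ INat 1) (IGet anS (Var vlev +^ INat 1) +^ INat 1) ;;
  Kill.

Lemma fam_sum L gs q s0 (al : pred nat) : walkfam L gs q s0 ->
  (\sum_(w < N) count (fun k => al k && (val w \in mb s0 L k)) gs = count al gs * L.+1)%N.
Proof.
move=> F; apply: sum_count => k kg; have [h1 h2] := fam_mb F kg.
by split=> //; apply: size_mb.
Qed.

Lemma wp_greedy_body s0 s1 L gs q lev B T0 (Q : nat -> state R -> Prop) :
  glob s1 -> (0 < N)%N -> walkfam L gs q s0 -> imem s1 amem = imem s0 amem ->
  imem s1 atot = imem s0 atot -> imem s1 ainv = imem s0 ainv ->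
  imem s1 vL 0 = L -> (L <= LM)%N -> imem s1 vlev 0 = lev -> (lev.+1 < W)%N -> (q < W)%N ->
  greedy_inv L gs s0 lev.+1 B T0 s1 -> (0 < imem s1 vunhit 0)%N ->
  (forall T s' B', frame (iwrites greedy_body) (rwrites greedy_body) s1 s' ->
     greedy_inv L gs s0 lev.+1 B' (T0 + T + 20) s' ->
     (imem s' vunhit 0 < imem s1 vunhit 0)%N -> Q T s') ->
  wp M greedy_body Q s1.
Proof.
move=> G N0 F hm ht hv hL LL hlev levW qW I u0 hQ.
have [uB aB [r1 r2 r3 r4] S bound BLN small time] := I.
have [S1 S2 S3] := S.
apply: wp_seq; apply: (wp_PickMax G N0) => T1 s2 b f1 hT1 hb bN bmax.
have Gs2 := glob_frame f1 isT isT G.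
pose al := picked L s0 B.
have sumc := fam_sum al F.
(* Averaging: each alive walk has L + 1 distinct vertices, so some vertex lies on at least the
   fraction (L+1)/N of the alive walks. *)
have unb : (imem s1 vunhit 0 * L.+1 <= N * imem s1 acnt b)%N.
  rewrite S3 -sumc; apply: leq_trans (sum_le_max (f := imem s1 acnt) bmax).
  by apply: leq_sum => w _; rewrite S2.
have cb0 : (0 < imem s1 acnt b)%N.
  by rewrite lt0n; apply/negP => /eqP E; move: unb; rewrite E muln0 leqn0 muln_eq0 /= orbF; lia.
have [k kg /andP[ak bk]] : exists2 k, k \in gs & al k && (b \in mb s0 L k).
  by move: cb0; rewrite S2// -has_count => /hasP[k kg h]; exists k.
have bB : b \notin B by apply: contra ak => bB; apply/hasP; exists b.
have LN : (L < N)%N.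
  have [uk ck] := fam_mb F kg.
  rewrite -(size_mb s0 L k) -(size_iota 0 N); apply: uniq_leq_size => // w /(allP ck).
  by rewrite mem_iota.
have uB' : uniq (rcons B b) by rewrite rcons_uniq bB.
have aB' : all (fun w => w < N)%N (rcons B b) by rewrite all_rcons bN.
have szB : (size B < N)%N.
  have : (size (rcons B b) <= size (iota 0 N))%N.
    by apply: uniq_leq_size => // w /(allP aB'); rewrite mem_iota.
  by rewrite size_rcons size_iota.
have E1 : ieval M s2 (Var vlev +^ INat 1) = lev.+1.
  by apply: (ieval_incr W2 WM); [fr|apply: ltnW].
have szW : (size B < W)%N by apply: ltn_trans szB NW.
have n2 : imem s2 anS lev.+1 = size B by rewrite (f1.1 anS isT).
apply: wp_seq; apply: (wp_store (i := (lev.+1 * W + size B)%N) (x := b)).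
- apply: (ievalIx W2 WM) => //; first by rewrite (gW Gs2).
  by rewrite [LHS]/= -/(ieval M s2 (Var vlev +^ INat 1)) E1.
- by rewrite /= mod0n.
move=> s3 f3 h3.
have E3 : ieval M s3 (Var vlev +^ INat 1) = lev.+1.
  by apply: (ieval_incr W2 WM); [fr|apply: ltnW].
have n3 : imem s3 anS lev.+1 = size B by rewrite (f3.1 anS isT).
apply: wp_seq; apply: (wp_store (i := lev.+1) (x := (size B).+1)) => //.
  apply: (ieval_inc W2 WM) => //.
  by rewrite [LHS]/= -/(ieval M s3 (Var vlev +^ INat 1)) E3.
move=> s4 f4 h4.
have Gs4 := glob_frame f4 isT isT (glob_frame f3 isT isT Gs2).
have S4 : gstate L gs s0 s4 al.
  split.
  - move=> x xg; rewrite -[al x](S1 x xg) /alive.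
    by have -> : imem s4 ahit = imem s1 ahit by fr.
  - by move=> w wN; have -> : imem s4 acnt = imem s1 acnt by [fr]; rewrite S2.
  - by have -> : imem s4 vunhit = imem s1 vunhit by [fr]; rewrite S3.
apply: (wp_Kill Gs4 F _ _ _ _ LL _ bN qW S4).
- by rewrite -hm; fr.
- by rewrite -ht; fr.
- by rewrite -hv; fr.
- by fr.
- by rewrite -hb; fr.
move=> T5 s5 f5 S5 u5 hT5.
have alE x : picked L s0 (rcons B b) x = al x && (b \notin mb s0 L x).
  by rewrite /picked has_rcons negb_or andbC.
have cE : count (picked L s0 (rcons B b)) gs = (imem s1 vunhit 0 - imem s1 acnt b)%N.
  rewrite S3 S2//; have := count_predC (fun k => b \in mb s0 L k) [seq k <- gs | al k].
  rewrite !count_filter size_filter -/al => <-.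
  rewrite (@eq_count _ (predI (fun k => b \in mb s0 L k) al)
    (fun k => al k && (b \in mb s0 L k))); last by move=> x /=; rewrite andbC.
  rewrite addKn; apply: eq_count => x /=.
  by rewrite alE andbC.
have u4 : imem s4 vunhit 0 = imem s1 vunhit 0 by fr.
have u5E : imem s5 vunhit 0 = count (picked L s0 (rcons B b)) gs.
  by have [_ _ ->] := S5; apply: eq_count => x; rewrite alE.
have cbu : (imem s1 acnt b <= imem s1 vunhit 0)%N.
  by rewrite S3 S2//; apply: sub_count => x /= /andP[].
apply: (hQ _ _ (rcons B b)).
- exact: (frame_sub _ _ (frame_cat f1 (frame_cat f3 (frame_cat f4 f5)))).
- split=> //.
  + split.
    * by rewrite (f5.1 anS isT) h4 eqxx size_rcons.
    * move=> r; rewrite size_rcons ltnS => rB.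
      have -> : imem s5 aS = imem s3 aS by fr.
      have rW : (r < W)%N by exact: leq_ltn_trans rB szW.
      rewrite h3 idx_eq// eqxx /= nth_rcons.
      case: eqP => [->|/eqP ne]; first by rewrite ltnn.
      have rlt : (r < size B)%N by rewrite ltn_neqAle ne rB.
      by rewrite rlt (f1.1 aS isT) r2.
    * move=> l r ll rW; have -> : imem s5 aS = imem s3 aS by fr.
      by rewrite h3 idx_eq// (negbTE ll) /= (f1.1 aS isT) r3.
    * move=> l ll; rewrite (f5.1 anS isT) h4 (negbTE ll).
      by have -> : imem s3 anS = imem s1 anS by [fr]; apply: r4.
  + by apply: gstate_eq S5 => x xg; rewrite alE.
  + rewrite size_rcons cE !expnS.
    move: bound; rewrite -/al -S3; move: unb cbu LN.
    move: (N) (size gs) ((N - L.+1) ^ _)%N (N ^ _)%N (imem s1 acnt b) (imem s1 vunhit 0).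
    clear; move=> n z Y X c U h1 h2 h3 h4.
    (* This is the averaging bound again: the pick retires at least the fraction (L+1)/N of the
       alive walks. *)
    have : ((U - c) * n <= U * (n - L.+1))%N by nia.
    move: (U - c)%N (n - L.+1)%N => U' n' h.
    apply: (@leq_trans (U * n' * X)%N); first by rewrite mulnA leq_mul2r h orbT.
    by rewrite mulnAC [X in (_ <= X)%N]mulnCA mulnC leq_mul2l h4 orbT.
  (* The logarithmic bound is applied to the state before this pick, where some walk is still unhit;
     its strict inequality leaves room for one more vertex. *)
  + move=> bb hbb; rewrite size_rcons.
    by apply: (@greedy_bound N L.+1 _ _ _ _ _ u0 hbb) => //; rewrite S3.
  + have uE : (size gs - count (picked L s0 (rcons B b)) gs =
       (size gs - count (picked L s0 B) gs) + (imem s1 vunhit 0 - imem s5 vunhit 0))%N.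
      rewrite u5E -S3; have := count_size (picked L s0 B) gs; rewrite -S3.
      move: u5; rewrite u4 u5E; clear; lia.
    rewrite uE size_rcons -cats1 big_cat big_seq1 /=.
    move: time hT1 hT5; rewrite u4 icost_Ix /=; clear.
    move: (\sum_(b0 <- B) _)%N (imem s1 vunhit 0 - imem s5 vunhit 0)%N (size gs - _)%N => x y z.
    move: (imem s0 atot b) (size B) => t p; nia.
- by rewrite u5E cE; move: cb0 cbu; clear; lia.
Qed.

Lemma wp_Greedy s0 L gs q lev (Q : nat -> state R -> Prop) :
  glob s0 -> (0 < N)%N -> walkfam L gs q s0 ->
  imem s0 vL 0 = L -> (L <= LM)%N -> imem s0 vlev 0 = lev -> (lev.+1 < W)%N ->
  imem s0 vq 0 = q -> (q < W)%N ->
  (forall T s' B, frame (iwrites Greedy) (rwrites Greedy) s0 s' ->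
     uniq B -> all (fun w => w < N)%N B -> row_ok s0 s' lev.+1 B ->
     (forall k, k \in gs -> exists2 b, b \in B & b \in mb s0 L k) ->
     (B != [::] -> (L < N)%N) ->
     (forall bb, (size gs < 2 ^ bb)%N -> (size B <= (N %/ L.+1).+1 * bb)%N) ->
     (T <= 100 * (q + 1) + 200 * (N + 1) * size B + 200 * (L + 2) * size gs)%N ->
     Q T s') ->
  wp M Greedy Q s0.
Proof.
move=> G N0 F hL LL hlev levW hq qW hQ.
apply: wp_seq.
apply: (@wp_for _ _ _ _ _ (fun i st => forall k, (k < i)%N -> imem st ahit k = 0%N) q 10) => //.
- exact: ltn_trans qW WltM.
- by rewrite /= mod0n.
- move=> i st iq hf hi I; apply: (wp_store (i := i) (x := 0%N)).
  + by rewrite /= mod0n.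
  + exact: mod0n.
  move=> s2 f2 h2; split=> // k; rewrite ltnS leq_eqVlt h2.
  by case: eqP => //= _ /I.
move=> T1 s1 f1 _ hz hT1.
apply: wp_seq; apply: (wp_store (i := lev.+1) (x := 0%N)).
- by apply: (ieval_incr W2 WM); [fr|apply: ltnW].
- exact: mod0n.
move=> s2 f2 h2.
have I0 : greedy_inv L gs s0 lev.+1 [::] 0 s2.
  split=> //.
  - split=> //; first by rewrite h2 eqxx.
      by move=> l r _ _; fr.
    by move=> l ll; rewrite h2 (negbTE ll); fr.
  - split.
    + move=> k /(fam_lt F) kq; rewrite /alive (f2.1 ahit isT) hz//.
    + by move=> w wN; fr; rewrite (fam_cnt F).
    + by fr; rewrite (fam_unhit F) count_predT.
apply: (@wp_while _ _ _ _ (fun T st => exists B, greedy_inv L gs s0 lev.+1 B T st)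
   (fun st => imem st vunhit 0)).
- by exists [::].
- move=> T st hf [B I]; rewrite /= mod0n (modn_small M1) => hu.
  have Ff := frame_cat f1 (frame_cat f2 hf).
  have Gs := glob_frame Ff isT isT G.
  apply: (wp_greedy_body Gs N0 F _ _ _ _ LL _ levW qW I hu); try by fr.
  move=> T3 s3 B' f3 I3 u3; split=> //; exists B'.
  case: I3 => k1 kx2 k3 k4 k5 k6 k7 k8; split=> //.
  by apply: leq_trans k8; rewrite /=; clear; lia.
- move=> T st hf [B I]; rewrite /= mod0n (modn_small M1) -leqNgt leqn0 => /eqP hu.
  have [uB aB rB [S1 S2 S3] bound BLN small time] := I.
  have dead k : k \in gs -> exists2 b, b \in B & b \in mb s0 L k.
    move=> kg; move: hu; rewrite S3 => /eqP; rewrite -leqn0 leqNgt -has_count.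
    by move=> /hasPn /(_ k kg); rewrite negbK => /hasP[b bB bk]; exists b.
  apply: (hQ _ _ B) => //.
  + exact: (frame_sub _ _ (frame_cat f1 (frame_cat f2 hf))).
  (* The vertices in [B] are distinct, so their index lists together are no longer than the whole
     index, which has L + 1 entries per walk. *)
  + have sums : (\sum_(b <- B) imem s0 atot b <= size gs * L.+1)%N.
      apply: leq_trans (sum_uniq (imem s0 atot) uB aB) _.
      rewrite -(count_predT gs) -(fam_sum xpredT F); apply: leq_sum => w _.
      by rewrite (fam_tot F).
    move: time hT1 sums; rewrite /=; clear.
    move: (\sum_(b0 <- B) _)%N (size B) (size gs) => x y z.
    move: (count _ _) => c h1 h2 h3; nia.
Qed.

(** * The upward phase as a whole *)

Local Notation hits := (hits m src dst cst g).

Lemma wp_ResetFam s0 L q (Q : nat -> state R -> Prop) :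
  glob s0 ->
  (forall T s', frame (iwrites ResetFam) (rwrites ResetFam) s0 s' ->
     (T <= 30 * (N + 1))%N -> walkfam L [::] q s' -> Q T s') ->
  wp M ResetFam Q s0.
Proof.
move=> G hQ; apply: wp_seq.
apply: (@wp_for _ _ _ _ _ (fun i st => forall v, (v < i)%N ->
   imem st atot v = 0%N /\ imem st acnt v = 0%N) N 12) => //.
- exact: ltn_trans NW WltM.
- by rewrite /= mod0n (gN G).
- move=> i st iN hf hi I; apply: wp_seq; apply: (wp_store (i := i) (x := 0%N)).
  + by rewrite /= mod0n.
  + exact: mod0n.
  move=> s1 f1 h1; apply: (wp_store (i := i) (x := 0%N)).
  + by rewrite /= mod0n; fr.
  + exact: mod0n.
  move=> s2 f2 h2; split=> // v; rewrite ltnS leq_eqVlt => /orP[/eqP->|vi].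
    by rewrite h2 eqxx (f2.1 atot isT) h1 eqxx.
  have [i1 i2] := I v vi.
  by rewrite h2 (f2.1 atot isT) h1 (f1.1 acnt isT) i1 i2; case: (v == i).
move=> T s' hf _ I hT; apply: wp_assign; first exact: mod0n.
move=> s2 f2 h2; apply: hQ.
- exact: (frame_sub _ _ (frame_cat hf f2)).
- by move: hT => /=; clear; lia.
- split=> //.
  + by move=> w /I[h _]; rewrite (f2.1 atot isT).
  + by move=> w /I[_ h]; rewrite (f2.1 acnt isT).
  + by move=> w r /I[h _]; rewrite (f2.1 atot isT) h.
Qed.

(** Levels below [lev] are finished and level [lev] has just been chosen. [ui_small] is the greedy
    bound on its size; [ui_LN] holds because a nonempty level comes from a recorded walk with L + 1
    distinct vertices. Together they bound the number of levels and the work on each. *)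
Record upinv lev q (st : state R) : Prop := UpInv {
  ui_lev : imem st vlev 0 = lev;
  ui_L : imem st vL 0 = (kk ^ lev.+1)%N;
  ui_q : (q <= lev * (N * N))%N;
  ui_n : forall l, (l <= lev)%N -> (imem st anS l <= N)%N /\ all (fun a => a < N)%N (Slist st l);
  ui_S0 : Slist st 0 = iota 0 N;
  ui_small : forall l, (l < lev)%N ->
    (imem st anS l.+1 <= (N %/ (kk ^ l.+1).+1).+1 * bb)%N;
  ui_LN : forall l, (l < lev)%N -> (0 < imem st anS l.+1)%N -> (kk ^ l.+1 < N)%N;
  ui_pos : forall l, (l < lev)%N -> (0 < imem st anS l)%N;
  ui_hits : forall l, (l < lev)%N -> hits (Slist st l) (Slist st l.+1) (kk ^ l.+1)%N;
  ui_done : forall l a, (l < lev)%N -> a \in Slist st l ->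
    xdone (Xc st) (kk ^ l.+1) a /\ qdone (Qc st) (kk ^ l.+1) a;
  ui_vq : imem st vq 0 = q;
  ui_stamp : forall w, (imem st astamp w <= q)%N;
  ui_x : xsound (Xc st);
  ui_xq : qsound (Qc st) }.

Lemma N_lt_exp : (N < 2 ^ bb)%N.
Proof. by apply: leq_ltn_trans bb1; case: N => // n; rewrite mulSn; lia. Qed.

Lemma lev_pow lev q st : upinv lev q st -> (0 < imem st anS lev)%N ->
  (0 < N)%N /\ (kk ^ lev <= N)%N.
Proof.
move=> U n0; have [nN _] := ui_n U (leqnn _).
have N0 : (0 < N)%N by apply: leq_trans nN.
split=> //; case: lev U n0 nN => [|l] U n0 nN; first by rewrite expn0.
by apply: ltnW; apply: (ui_LN U (ltnSn l)).
Qed.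

Lemma lev_lt lev q st : upinv lev q st -> (0 < imem st anS lev)%N -> (lev < bb)%N.
Proof.
move=> U n0; have [N0 h] := lev_pow U n0.
rewrite -(ltn_exp2l _ _ (ltnSn 1)); apply: leq_ltn_trans N_lt_exp.
by apply: leq_trans h; case: (lev) => // l; rewrite leq_exp2r.
Qed.

Lemma lev_ltN lev q st : upinv lev q st -> (0 < imem st anS lev)%N -> (lev < N)%N.
Proof.
move=> U n0; have [N0 h] := lev_pow U n0.
by apply: leq_trans h; apply: ltn_expl.
Qed.

Lemma lev_LM lev q st : upinv lev q st -> (0 < imem st anS lev)%N -> (kk ^ lev.+1 <= LM)%N.
Proof.
move=> U n0; have [N0 h] := lev_pow U n0.
by apply: leq_trans kL; rewrite expnSr leq_mul2r h orbT.
Qed.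

(** The size of a level is about N bb / k^lev while the length on it is k^(lev+1); so the total
    length of its dynamic programs exceeds N bb only by a factor of order k, the same on all
    levels. *)
Lemma lev_size lev q st : upinv lev q st -> (0 < imem st anS lev)%N ->
  (imem st anS lev * (kk ^ lev.+1 + 1) <= 4 * N * kk * bb)%N.
Proof.
move=> U n0; have [N0 h] := lev_pow U n0.
have b0 : (0 < bb)%N by have := lev_lt U n0; lia.
case: lev U n0 h => [|l] U n0 h.
  have [nN _] := ui_n U (leqnn _); rewrite expn1.
  apply: (@leq_trans (N * (kk + 1))%N); first by rewrite leq_mul2r nN orbT.
  by rewrite -!mulnA; nia.
have := ui_small U (ltnSn l).
move: h; rewrite (expnS kk l.+1); set x := (kk ^ l.+1)%N => h hs.
have x0 : (0 < x)%N by rewrite expn_gt0; lia.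
have dv : ((N %/ x.+1).+1 * x <= 2 * N)%N.
  have := leq_trunc_div N x.+1; move: (N %/ x.+1)%N => dd; nia.
apply: (@leq_trans ((N %/ x.+1).+1 * bb * (2 * kk * x))%N).
  by apply: leq_mul => //; nia.
have e1 : ((N %/ x.+1).+1 * bb * (2 * kk * x) = ((N %/ x.+1).+1 * x) * (2 * kk * bb))%N by ring.
have e2 : (4 * N * kk * bb = (2 * N) * (2 * kk * bb))%N by ring.
by rewrite e1 e2 leq_mul2r dv orbT.
Qed.

Definition lev_cost := (3000 * (4 * N * kk * bb) * (N + m + 1) + 2000 * (bb + 1) * ((N + 1) * (N + 1)))%N.

Lemma Slist_eq s s' l : imem s' anS l = imem s anS l ->
  (forall r, (r < imem s anS l)%N -> imem s' aS (l * W + r) = imem s aS (l * W + r)) ->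
  Slist s' l = Slist s l.
Proof.
move=> e h; rewrite /Slist e; apply/eq_in_map => r; rewrite mem_iota => rn.
exact: h.
Qed.

Lemma wp_UpBody s0 lev q (Q : nat -> state R -> Prop) :
  glob s0 -> pwok s0 -> imem s0 vk 0 = kk -> upinv lev q s0 -> (0 < imem s0 anS lev)%N ->
  (forall T s' q', frame (iwrites UpBody) (rwrites UpBody) s0 s' ->
     (T + 20 <= lev_cost)%N -> upinv lev.+1 q' s' -> Q T s') ->
  wp M UpBody Q s0.
Proof.
move=> G P hk U n0 hQ.
have [N0 hpow] := lev_pow U n0.
have levN := lev_ltN U n0; have levb := lev_lt U n0.
have LLM := lev_LM U n0; have szE := lev_size U n0.
have [nN aN] := ui_n U (leqnn lev).
set L := (kk ^ lev.+1)%N in LLM szE *.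
(* Each of the at most N levels uses at most N^2 walk numbers; the cubic lower bound on the stride
   keeps all of them valid row indices. *)
have NN : (lev * (N * N) + (N + 1) * N + 1 + N < W)%N.
  apply: leq_ltn_trans _ W3; move: levN; clear; move: N => n; nia.
have levW : (lev.+2 < W)%N by move: NN levN N0; clear; move: N => n; nia.
apply: wp_seq; apply: (wp_ResetFam (L := L) (q := q) G) => T1 s1 f1 hT1 fam1.
have G1 := glob_frame f1 isT isT G.
have P1 : pwok s1 by move=> j jL; rewrite (f1.2 rpw isT) P.
have X1 : Xc s1 = Xc s0 by apply/funext => i; rewrite /cell (f1.1 aXe isT) (f1.2 rXv isT).
have Q1 : Qc s1 = Qc s0 by apply/funext => i; rewrite /cell (f1.1 aQe isT) (f1.2 rQv isT).
have U1 : upst L [::] q s1.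
  split=> //.
  - by fr; apply: (ui_vq U).
  - by move=> w; fr; apply: (ui_stamp U).
  - by rewrite X1; apply: (ui_x U).
  - by rewrite Q1; apply: (ui_xq U).
have n1 : imem s1 anS lev = imem s0 anS lev by fr.
have S1 l : Slist s1 l = Slist s0 l by apply: Slist_eq => *; fr.
apply: wp_seq; apply: (wp_LevelUp G1 P1 (lev := lev) (L := L) _ _ _ _ _ LLM _ U1).
- by fr; apply: (ui_lev U).
- by apply: ltn_trans levW.
- by rewrite n1.
- by rewrite S1.
- by fr; apply: (ui_L U).
- rewrite n1; have nn : ((imem s0 anS lev + 1) * N <= (N + 1) * N)%N.
    by rewrite leq_mul2r leq_add2r nN orbT.
  by move: (ui_q U) NN nn; clear; lia.
move=> T2 s2 gs q2 f2 hT2 hq2 szq U2 [_ _ mx mq] done2.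
have G2 := glob_frame f2 isT isT G1.
have q2b : (q2 <= lev.+1 * (N * N))%N.
  have h1 : (imem s1 anS lev * N <= N * N)%N by rewrite n1 leq_mul2r nN orbT.
  by move: hq2 (ui_q U) h1; rewrite mulSn; clear; lia.
have q2W : (q2 < W)%N.
  by apply: leq_ltn_trans q2b (leq_ltn_trans _ NN); rewrite mulSn; clear; nia.
apply: wp_seq; apply: (wp_Greedy G2 N0 (us_fam U2) _ LLM _ (ltnW levW) (us_q U2) q2W).
- by fr; apply: (ui_L U).
- by fr; apply: (ui_lev U).
move=> T3 s3 B f3 uB aB rB hitB BLN small hT3.
have szB : (size B <= N)%N.
  by rewrite -(size_iota 0 N); apply: uniq_leq_size => // w /(allP aB); rewrite mem_iota.
have szgs : (size gs <= imem s0 anS lev * N)%N.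
  by move: szq hq2; rewrite n1 /=; clear; lia.
apply: wp_seq; apply: (wp_assign (x := lev.+1)).
  by apply: (ieval_incr W2 WM); [fr; apply: (ui_lev U)|apply: ltn_trans (ltnW levW)].
move=> s4 f4 h4; apply: (wp_assign (x := (kk ^ lev.+2)%N)).
  have hL4 : imem s4 vL 0 = L by fr; apply: (ui_L U).
  have hk4 : imem s4 vk 0 = kk by fr.
  have kW : (kk < W)%N.
    apply: leq_ltn_trans _ LW; apply: leq_trans (leq_addr _ _); apply: leq_trans kL.
    by rewrite leq_pmull.
  rewrite /= /iop_eval !mod0n hL4 hk4 (modMul W2 WM) ?[(kk ^ lev.+2)%N]expnSr//.
  by apply: leq_ltn_trans LLM _; move: LW; clear; lia.
move=> s5 f5 h5.
have F35 := frame_cat f3 (frame_cat f4 f5).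
have F := frame_cat f1 (frame_cat f2 F35).
have [r1 r2 r3 r4] := rB.
have n5 l : imem s5 anS l = imem s3 anS l by fr.
have n5o l : l != lev.+1 -> imem s5 anS l = imem s0 anS l.
  by move=> ll; rewrite n5 r4//; fr.
have S5o l : (l <= lev)%N -> Slist s5 l = Slist s0 l.
  move=> ll; have ne : l != lev.+1 by rewrite neq_ltn ltnS ll.
  apply: Slist_eq; first exact: n5o.
  move=> r rn; have [lN _] := ui_n U ll.
  have rW : (r < W)%N by apply: ltn_trans rn (leq_ltn_trans lN NW).
  have -> : imem s5 aS = imem s3 aS by fr.
  by rewrite r3//; fr.
have S5 : Slist s5 lev.+1 = B.
  apply: (@eq_from_nth _ 0%N); first by rewrite size_Slist n5.
  move=> r; rewrite size_Slist => rn; rewrite nth_Slist//.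
  have -> : imem s5 aS = imem s3 aS by fr.
  by apply: r2; rewrite -r1 -n5.
have X5 : Xc s5 = Xc s2 by apply/funext => i; rewrite /cell (F35.1 aXe isT) (F35.2 rXv isT).
have Q5 : Qc s5 = Qc s2 by apply/funext => i; rewrite /cell (F35.1 aQe isT) (F35.2 rQv isT).
(* The origin of the condition on [bb]: a level records at most N^2 walks, so [bb] halvings exhaust
   them. *)
have szgs2 : (size gs < 2 ^ bb)%N.
  apply: leq_ltn_trans szgs _; apply: leq_ltn_trans bb1.
  by apply: leq_trans (leq_addr _ _); rewrite leq_mul2r nN orbT.
apply: (hQ _ _ q2).
- exact: (frame_sub _ _ F).
- rewrite /lev_cost; move: hT1 hT2 hT3 szE szgs szB q2b levb nN; rewrite n1 /=.
  exact: up_time.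
- split=> //.
  + by rewrite (f5.1 vlev isT).
  + move=> l; rewrite leq_eqVlt ltnS => /orP[/eqP->|ll].
      by rewrite S5 n5 r1.
    have ne : l != lev.+1 by rewrite neq_ltn ltnS ll.
    by rewrite S5o// n5o//; apply: (ui_n U).
  + by rewrite S5o//; apply: (ui_S0 U).
  + move=> l; rewrite ltnS leq_eqVlt => /orP[/eqP->|ll].
      by rewrite n5 r1; apply: small.
    by rewrite n5o ?eqSS ?neq_ltn ?ll//; apply: (ui_small U).
  + move=> l; rewrite ltnS leq_eqVlt => /orP[/eqP->|ll].
      by rewrite n5 r1 => b0; apply: BLN; rewrite -size_eq0 -lt0n.
    by rewrite n5o ?eqSS ?neq_ltn ?ll//; apply: (ui_LN U).
  + move=> l; rewrite ltnS => ll; rewrite n5o ?neq_ltn ?ltnS ?ll//.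
    by move: ll; rewrite leq_eqVlt => /orP[/eqP->//|]; apply: (ui_pos U).
  + move=> l; rewrite ltnS leq_eqVlt => /orP[/eqP->|ll]; last first.
      by rewrite !S5o//; [apply: (ui_hits U)|apply: ltnW].
    rewrite S5 S5o// => a p v aS' hw sz; rewrite -S1 in aS'.
    have [cov _ _] := done2 a aS'; have [p' [w' sz' le' hu]] := cov p v hw sz.
    exists p'; split=> // /hu[x xg xE]; have [b bB bx] := hitB x xg.
    by exists b => //; rewrite -xE.
  + move=> l a; rewrite ltnS leq_eqVlt => /orP[/eqP->|ll].
      rewrite S5o// X5 Q5 -S1 => aS'.
      by have [_ h1 h2] := done2 a aS'.
    rewrite S5o; last exact: ltnW.
    move=> aS'; have [h1 h2] := ui_done U ll aS'; rewrite X5 Q5.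
    by split; [apply: xdone_mono h1; rewrite -X1|apply: qdone_mono h2; rewrite -Q1].
  + by rewrite (F35.1 vq isT) (us_q U2).
  + by move=> w; rewrite (F35.1 astamp isT); apply: (us_stamp U2).
  + by rewrite X5; apply: (us_x U2).
  + by rewrite Q5; apply: (us_xq U2).
Qed.

Lemma wp_UpAll s0 (Q : nat -> state R -> Prop) :
  glob s0 -> pwok s0 -> imem s0 vk 0 = kk -> (kk < W)%N ->
  (forall w, imem s0 astamp w = 0%N) ->
  (forall i, Xc s0 i = None) -> (forall i, Qc s0 i = None) ->
  (forall T s' lev q, frame (iwrites UpAll) (rwrites UpAll) s0 s' ->
     (T <= (bb + 1) * lev_cost + 50 * (N + 1))%N -> (lev <= bb)%N ->
     upinv lev q s' -> imem s' anS lev = 0%N -> Q T s') ->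
  wp M UpAll Q s0.
Proof.
move=> G P hk kW st0 X0 Q0 hQ.
apply: wp_seq; apply: (wp_assign (x := 0%N)); first exact: mod0n.
move=> s1 f1 h1; apply: wp_seq.
apply: (@wp_for _ _ _ _ _ (fun i st => forall v, (v < i)%N -> imem st aS v = v) N 6) => //.
- exact: ltn_trans NW WltM.
- by rewrite /= mod0n; fr; rewrite (gN G).
- move=> i st iN hf hi I; apply: (wp_store (i := i) (x := i)); rewrite /= ?mod0n//.
  move=> s2 f2 h2; split=> // v; rewrite ltnS leq_eqVlt h2.
  by case: eqP => [->//|_] /= /I.
move=> T2 s2 f2 _ I2 hT2; apply: wp_seq; apply: (wp_store (i := 0%N) (x := N)).
- exact: mod0n.
- by rewrite /= mod0n; fr; rewrite (gN G).
move=> s3 f3 h3; apply: wp_seq; apply: (wp_assign (x := kk)).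
  by rewrite /= mod0n; fr.
move=> s4 f4 h4; apply: wp_seq; apply: (wp_assign (x := 0%N)); first exact: mod0n.
move=> s5 f5 h5.
have F := frame_cat f1 (frame_cat f2 (frame_cat f3 (frame_cat f4 f5))).
have X5 : Xc s5 = Xc s0 by apply/funext => i; rewrite /cell (F.1 aXe isT) (F.2 rXv isT).
have Q5 : Qc s5 = Qc s0 by apply/funext => i; rewrite /cell (F.1 aQe isT) (F.2 rQv isT).
have n5 : imem s5 anS 0 = N by rewrite (f5.1 anS isT) (f4.1 anS isT) h3.
have S5 : Slist s5 0 = iota 0 N.
  rewrite /Slist n5 -[RHS]map_id; apply/eq_in_map => r; rewrite mem_iota => rN.
  have -> : imem s5 aS = imem s2 aS by fr.
  by rewrite mul0n add0n I2.
have U0 : upinv 0 0 s5.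
  split=> //.
  - by rewrite (f5.1 vlev isT) (f4.1 vlev isT) (f3.1 vlev isT) (f2.1 vlev isT) h1.
  - by rewrite expn1 (f5.1 vL isT) h4.
  - move=> l; rewrite leqn0 => /eqP->; rewrite n5 S5; split=> //.
    by apply/allP => v; rewrite mem_iota.
  - by move=> w; rewrite (F.1 astamp isT) st0.
  - by rewrite X5 => u t x _ _; rewrite X0.
  - by rewrite Q5 => v z _; rewrite Q0.
apply: (@wp_while _ _ _ _ (fun T st => exists lev q, [/\ upinv lev q st,
    (T <= lev * lev_cost)%N & (lev <= bb)%N])
   (fun st => (bb.+1 - imem st vlev 0)%N)).
- by exists 0%N, 0%N.
- move=> T st hf [lev [q [U hT hl]]]; rewrite /= mod0n (modn_small M1) (ui_lev U) => n0.
  have Ff := frame_cat F hf.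
  have Gs := glob_frame Ff isT isT G.
  have Ps : pwok st by move=> j jL; rewrite (Ff.2 rpw isT) P.
  have levb := lev_lt U n0.
  apply: (wp_UpBody Gs Ps _ U n0); first by rewrite (Ff.1 vk isT).
  move=> T3 s' q' f3' hT3 U3; split; last by rewrite (ui_lev U3); move: levb; clear; lia.
  by exists lev.+1, q'; split=> //; move: hT hT3; rewrite mulSn; clear; lia.
- move=> T st hf [lev [q [U hT hl]]]; rewrite /= mod0n (modn_small M1) (ui_lev U) -leqNgt leqn0.
  move=> /eqP n0; apply: (hQ _ _ lev q) => //.
  + exact: (frame_sub _ _ (frame_cat F hf)).
  + have : (lev * lev_cost <= bb * lev_cost)%N by rewrite leq_mul2r hl orbT.
    have : (0 < lev_cost)%N.
      rewrite /lev_cost addn_gt0 !muln_gt0 !addn_gt0 /= !orbT //.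
    by move: hT hT2 => /=; move: lev_cost => c; clear; lia.
Qed.

(** * Reachability by breadth-first search *)

Definition adj u := [seq dst e | e <- iota 0 m & src e == u].

Lemma size_adj u : (size (adj u) <= m)%N.
Proof. by rewrite size_map size_filter; apply: leq_trans (count_size _ _) _; rewrite size_iota. Qed.

Lemma mem_adj u v : v \in adj u -> exists2 e, (e < m)%N & src e = u /\ dst e = v.
Proof.
move=> /mapP[e]; rewrite mem_filter mem_iota add0n => /andP[/eqP su em] ->.
by exists e.
Qed.

Lemma adj_mem e : (e < m)%N -> dst e \in adj (src e).
Proof. by move=> em; apply: map_f; rewrite mem_filter eqxx mem_iota. Qed.

Lemma sum_adj q : uniq q -> (\sum_(u <- q) size (adj u) <= m)%N.
Proof.
move=> uq; apply: (@leq_trans (count (fun e => src e \in q) (iota 0 m))); last first.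
  by apply: leq_trans (count_size _ _) _; rewrite size_iota.
rewrite -sum1_count (eq_bigr (fun u => \sum_(e <- iota 0 m | src e == u) 1)%N); last first.
  by move=> u _; rewrite size_map size_filter -sum1_count.
elim: q uq => [|u q IH] /=; first by rewrite big_nil.
move=> /andP[uq /IH h]; rewrite big_cons.
apply: leq_trans (leq_add (leqnn _) h) _.
rewrite [X in (X + _)%N]big_mkcond [X in (_ + X)%N]big_mkcond -big_split [leqRHS]big_mkcond /=.
apply: leq_sum => e _; rewrite inE; case: eqP => [->|_] //=.
by rewrite (negbTE uq).
Qed.

Definition adjok (s : state R) := forall u, (u < N)%N ->
  imem s adeg u = size (adj u) /\
  forall i, (i < size (adj u))%N -> imem s aadj (u * W + i) = nth 0%N (adj u) i.

Lemma wp_Adj s0 (Q : nat -> state R -> Prop) :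
  glob s0 -> (forall u, imem s0 adeg u = 0%N) ->
  (forall T s', frame (iwrites Adj) (rwrites Adj) s0 s' -> (T <= 70 * (m + 1))%N ->
     adjok s' -> Q T s') ->
  wp M Adj Q s0.
Proof.
move=> G z hQ.
pose adk k u := [seq dst e | e <- iota 0 k & src e == u].
have szk k u : (size (adk k u) <= k)%N.
  by rewrite size_map size_filter; apply: leq_trans (count_size _ _) _; rewrite size_iota.
have adkS k u : adk k.+1 u = if src k == u then rcons (adk k u) (dst k) else adk k u.
  rewrite /adk -addn1 iotaD add0n filter_cat /=.
  by case: eqP => _; rewrite ?cats0// map_cat cats1.
apply: (@wp_for _ _ _ _ _ (fun k st => forall u, (u < N)%N ->
  imem st adeg u = size (adk k u) /\
  forall i, (i < size (adk k u))%N -> imem st aadj (u * W + i) = nth 0%N (adk k u) i) m 50) => //.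
- exact: ltn_trans mW WltM.
- by rewrite /= modn_small// (gm G).
- move=> k st km hf hk I.
  have Gs := glob_frame hf isT isT G.
  have sN := srcN km; have [dE aE] := I _ sN.
  have dW : (size (adk k (src k)) < W)%N by apply: leq_ltn_trans (szk _ _) (ltn_trans km mW).
  apply: wp_seq; apply: (wp_assign (x := src k)).
    by rewrite /= mod0n hk (gsrc Gs).
  move=> s1 f1 h1; apply: wp_seq.
  apply: (wp_store (i := (src k * W + size (adk k (src k)))%N) (x := dst k)).
  + apply: (ievalIx W2 WM) => //.
    * by rewrite (f1.1 vW isT) (gW Gs).
    * by rewrite /= mod0n.
    * by rewrite /= mod0n h1 (f1.1 adeg isT).
    * exact: ltn_trans NW.
  + by rewrite /= mod0n (f1.1 ve isT) hk (f1.1 adst isT) (gdst Gs).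
  move=> s2 f2 h2; apply: (wp_store (i := src k) (x := (size (adk k (src k))).+1)).
  + by rewrite /= mod0n (f2.1 vu isT).
  + apply: (ieval_inc W2 WM) => //.
    by rewrite /= mod0n (f2.1 vu isT) h1 (f2.1 adeg isT) (f1.1 adeg isT).
  move=> s3 f3 h3; split; first by rewrite /= icost_Ix.
  move=> u uN; rewrite h3 adkS (f2.1 adeg isT) (f1.1 adeg isT).
  have [dE' aE'] := I _ uN.
  have iW i : (i < size (adk k u))%N -> (i < W)%N.
    by move=> h; apply: ltn_trans h (leq_ltn_trans (szk _ _) (ltn_trans km mW)).
  rewrite [u == _]eq_sym; case: eqP => [<-|ne].
    rewrite size_rcons; split=> // i; rewrite ltnS leq_eqVlt nth_rcons => /orP[/eqP->|ilt].
      by rewrite ltnn eqxx (f3.1 aadj isT) h2 eqxx.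
    rewrite ilt (f3.1 aadj isT) h2 idx_eq ?eqxx ?(ltn_trans ilt)//= (ltn_eqF ilt).
    by rewrite (f1.1 aadj isT) aE.
  split=> // i ilt; rewrite (f3.1 aadj isT) h2 (idx_eq _ _ (iW _ ilt) dW) [u == _]eq_sym (introF eqP ne) /=.
  by rewrite (f1.1 aadj isT) aE'.
- move=> T s' hf _ I hT; apply: hQ => //; first exact: (frame_sub _ _ hf).
  by move: hT => /=; clear; lia.
Qed.

Definition bfs a (s0 : state R) (q : seq nat) (st : state R) :=
  [/\ imem st vtail 0 = size q, forall j, (j < size q)%N -> imem st aque j = nth 0%N q j,
      uniq q, forall v, v \in q -> (v < N)%N /\ reach a v &
      forall u v, (v < N)%N -> imem st amark (u * W + v) =
        if u == a then nat_of_bool (v \in q) else imem s0 amark (u * W + v)].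

Lemma size_bfs a s0 q st : bfs a s0 q st -> (size q <= N)%N.
Proof.
move=> [_ _ uq h _]; rewrite -(size_iota 0 N); apply: uniq_leq_size => // v /h[vN _].
by rewrite mem_iota.
Qed.

Lemma wp_Visit s0 a q v st (Q : nat -> state R -> Prop) :
  glob st -> imem st vs 0 = a -> (a < N)%N -> imem st vv 0 = v -> (v < N)%N ->
  reach a v -> v \notin q -> bfs a s0 q st ->
  (forall T s', frame (iwrites Visit) (rwrites Visit) st s' -> (T <= 30)%N ->
     bfs a s0 (rcons q v) s' -> Q T s') ->
  wp M Visit Q st.
Proof.
move=> G ha aN hv vN rv vq B hQ; have szq := size_bfs B; have [B1 B2 B3 B4 B5] := B.
apply: wp_seq; apply: (wp_store (i := (a * W + v)%N) (x := 1%N)).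
- apply: (ievalIx W2 WM); rewrite /= ?mod0n ?(gW G)//; exact: ltn_trans NW.
- by rewrite /= modn_small.
move=> s1 f1 h1; apply: wp_seq; apply: (wp_store (i := size q) (x := v)).
- by rewrite /= mod0n (f1.1 vtail isT).
- by rewrite /= mod0n (f1.1 vv isT).
move=> s2 f2 h2; apply: (wp_assign (x := (size q).+1)).
  by apply: (ieval_incr W2 WM); [rewrite (f2.1 vtail isT) (f1.1 vtail isT)|exact: leq_ltn_trans NW].
move=> s3 f3 h3; apply: hQ.
- exact: (frame_sub _ _ (frame_cat f1 (frame_cat f2 f3))).
- by rewrite /= icost_Ix /=.
split.
- by rewrite size_rcons.
- move=> j; rewrite size_rcons ltnS leq_eqVlt nth_rcons (f3.1 aque isT) h2 => /orP[/eqP->|jq].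
    by rewrite ltnn eqxx.
  by rewrite jq (ltn_eqF jq) (f1.1 aque isT) B2.
- by rewrite rcons_uniq vq.
- by move=> u; rewrite mem_rcons inE => /orP[/eqP->|/B4].
- move=> u w wN; rewrite (f3.1 amark isT) (f2.1 amark isT) h1 idx_eq ?(ltn_trans _ NW)//.
  rewrite B5// mem_rcons inE; case: (u == a) => //=.
  by case: (w == v).
Qed.

Lemma wp_Scan s0 a h q st (Q : nat -> state R -> Prop) :
  glob st -> adjok st -> imem st vs 0 = a -> (a < N)%N -> imem st vhd 0 = h ->
  (h < size q)%N -> bfs a s0 q st ->
  (forall T s' q', frame (iwrites Scan) (rwrites Scan) st s' ->
     (T <= 150 * (size (adj (nth 0 q h)) + 1))%N ->
     bfs a s0 q' s' -> (exists r, q' = q ++ r) -> {subset adj (nth 0%N q h) <= q'} -> Q T s') ->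
  wp M Scan Q st.
Proof.
move=> G A ha aN hh hq B hQ; have szq := size_bfs B; have [B1 B2 B3 B4 B5] := B.
set u := nth 0%N q h in hQ *.
have [uN ru] : (u < N)%N /\ reach a u by apply: B4; apply: mem_nth.
have [dE aE] := A u uN.
have dW : (size (adj u) < W)%N := leq_ltn_trans (size_adj u) mW.
apply: wp_seq; apply: (wp_assign (x := u)).
  by rewrite /= mod0n hh B2.
move=> s1 f1 h1.
apply: (@wp_for _ _ _ _ _ (fun i st' => exists q', [/\ bfs a s0 q' st', exists r, q' = q ++ r &
   forall j, (j < i)%N -> nth 0%N (adj u) j \in q']) (size (adj u)) 80) => //.
- exact: ltn_trans dW WltM.
- by rewrite /= mod0n h1 (f1.1 adeg isT).
- exists q; split=> //; last by exists [::]; rewrite cats0.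
  split=> //; first by rewrite (f1.1 vtail isT).
  + by move=> j jq; rewrite (f1.1 aque isT) B2.
  + by move=> *; rewrite (f1.1 amark isT) B5.
- move=> i s2 iu hf hi [q' [B' [r rE] I]].
  have F2 := frame_cat f1 hf.
  have G2 := glob_frame F2 isT isT G.
  have iW : (i < W)%N := ltn_trans iu dW.
  set v := nth 0%N (adj u) i.
  have [e em [su dv]] : exists2 e, (e < m)%N & src e = u /\ dst e = v.
    by apply: mem_adj; apply: mem_nth.
  have vN : (v < N)%N by rewrite -dv dstN.
  apply: wp_seq; apply: (wp_assign (x := v)).
    rewrite [LHS]/= (ievalIx W2 WM (i := u) (j := i)) //=; rewrite ?mod0n//.
    + by rewrite (F2.1 aadj isT) aE.
    + by rewrite (gW G2).
    + by rewrite (hf.1 vu isT).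
    + exact: ltn_trans NW.
  move=> s3 f3 h3.
  have F3 := frame_cat F2 f3.
  have G3 := glob_frame f3 isT isT G2.
  have hs3 : imem s3 vs 0 = a by rewrite (F3.1 vs isT).
  have B3' : bfs a s0 q' s3.
    by case: B' => c1 c2 c3 c4 c5; split=> //; move=> *; rewrite ?(f3.1 vtail isT) ?(f3.1 aque isT) ?(f3.1 amark isT); auto.
  have mE : ieval M s3 (IGet amark (Ix (Var vs) (Var vv))) = nat_of_bool (v \in q').
    rewrite [LHS]/= (ievalIx W2 WM (i := a) (j := v)) //=; rewrite ?mod0n//.
    + by case: B3' => _ _ _ _ ->//; rewrite eqxx.
    + by rewrite (gW G3).
    + exact: ltn_trans NW.
    + exact: ltn_trans NW.
  apply: wp_if; rewrite -[beval _ _ _]/(ieval M s3 (IGet amark (Ix (Var vs) (Var vv))) <= 0 %% M)%N mE mod0n.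
    case: (boolP (v \in q')) => // vq _.
    have rv : reach a v.
      by apply: reach_trans ru _; rewrite -su -dv; apply: reach_edge.
    apply: (wp_Visit G3 hs3 aN h3 vN rv vq B3') => T4 s4 f4 hT4 B4'.
    split; first by move: hT4; rewrite /= !icost_Ix /=; clear; lia.
    exists (rcons q' v); split=> //; first by exists (rcons r v); rewrite rE rcons_cat.
    move=> j; rewrite ltnS mem_rcons inE leq_eqVlt => /orP[/eqP->|/I->].
      by rewrite eqxx.
    by rewrite orbT.
  case: (boolP (v \in q')) => // vq _; apply: wp_skip; split.
    by rewrite /= !icost_Ix /=.
  exists q'; split=> //; first by exists r.
  by move=> j; rewrite ltnS leq_eqVlt => /orP[/eqP->|/I->].
- move=> T s' hf _ [q' [B' rE I]] hT; apply: (hQ _ _ q') => //.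
  + exact: (frame_sub _ _ (frame_cat f1 hf)).
  + by move: hT => /=; clear; lia.
  + by move=> v /(nthP 0%N)[j jl <-]; apply: I.
Qed.

Lemma wp_BFS s0 a (Q : nat -> state R -> Prop) :
  glob s0 -> adjok s0 -> imem s0 vs 0 = a -> (a < N)%N ->
  (forall v, (v < N)%N -> imem s0 amark (a * W + v) = 0%N) ->
  (forall T s', frame (iwrites BFS) (rwrites BFS) s0 s' -> (T <= 400 * (N + m + 1))%N ->
     (forall v, (v < N)%N -> imem s' amark (a * W + v) = `[< reach a v >] :> nat) ->
     (forall u v, u != a -> (v < N)%N -> imem s' amark (u * W + v) = imem s0 amark (u * W + v)) ->
     Q T s') ->
  wp M BFS Q s0.
Proof.
move=> G A ha aN z hQ.
apply: wp_seq; apply: (wp_assign (x := 0%N)); first exact: mod0n.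
move=> s1 f1 h1; apply: wp_seq; apply: (wp_assign (x := a)).
  by rewrite /= mod0n (f1.1 vs isT).
move=> s2 f2 h2; have F2 := frame_cat f1 f2; have G2 := glob_frame F2 isT isT G.
have B0 : bfs a s0 [::] s2.
  split=> //; first by rewrite (f2.1 vtail isT).
  by move=> u v vN; rewrite (F2.1 amark isT); case: eqP => // ->; rewrite z.
apply: wp_seq; apply: (wp_Visit G2 _ aN h2 aN (reach_refl _ _ _ a) _ B0) => //.
  by rewrite (F2.1 vs isT).
move=> T3 s3 f3 hT3 B3; have F3 := frame_cat F2 f3.
(* The time is charged to the out-degrees of the scanned part of the queue; queue entries are
   distinct, so by [sum_adj] this adds up to at most m. *)
apply: (@wp_for_gen _ _ _ _ _ (fun i T st => exists q, [/\ bfs a s0 q st, a \in q,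
   (T <= 150 * \sum_(u <- take i q) size (adj u) + 180 * i)%N &
   forall u, u \in take i q -> {subset adj u <= q}]) N) => //.
- exact: ltn_trans NW WltM.
- by rewrite /= mod0n (F3.1 vN isT) (gN G).
- by exists [:: a]; split=> //; rewrite ?inE ?eqxx// take0 // big_nil.
- move=> i T st iN hf hi [q [B aq hT cl]].
  have Fs := frame_cat F3 hf.
  have Gs := glob_frame Fs isT isT G.
  have [B1 _ _ _ _] := B.
  have iE : ieval M st (Var vhd +^ INat 1) = i.+1.
    by apply: (ieval_incr W2 WM) => //; apply: ltn_trans NW.
  apply: wp_if; rewrite -[beval _ _ _]/(ieval M st (Var vhd +^ INat 1) <= imem st vtail (0 %% M))%N iE mod0n B1 => hq.
    have As : adjok st by move=> u uN; rewrite (Fs.1 adeg isT) (Fs.1 aadj isT); apply: A.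
    have hs : imem st vs 0 = a by rewrite (Fs.1 vs isT).
    apply: (wp_Scan Gs As hs aN hi hq B) => T4 s4 q' f4 hT4 B4 [r rE] sub.
    have tkE j : (j <= size q)%N -> take j q' = take j q.
      by move=> h; rewrite rE takel_cat.
    exists q'; split=> //.
    + by rewrite rE mem_cat aq.
    + rewrite tkE// (take_nth 0%N)// -cats1 big_cat /= big_seq1 /=.
      by move: hT hT4; move: (\sum_(u <- _) _)%N (size _) => x y; clear; lia.
    + move=> u; rewrite tkE// (take_nth 0%N)// mem_rcons inE => /orP[/eqP->//|/cl h].
      by move=> v /h vq; rewrite rE mem_cat vq.
  have tkE j : (i <= j)%N -> take j q = q.
    by move=> h; rewrite take_oversize// (leq_trans _ h)// leqNgt.
  apply: wp_skip; exists q; split=> //.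
  + by move: hT; rewrite !tkE ?leqnSn//=; clear; lia.
  + by move: cl; rewrite !tkE ?leqnSn.
- move=> T s' hf _ [q [B aq hT cl]].
  have szq := size_bfs B.
  rewrite take_oversize// in hT cl; have [_ _ uq rq mk] := B.
  apply: hQ.
  + exact: (frame_sub _ _ (frame_cat F3 hf)).
  + by have := sum_adj uq; move: hT hT3 => /=; move: (\sum_(u <- _) _)%N => x; clear; lia.
  + move=> v vN; rewrite mk// eqxx; congr nat_of_bool.
    apply/idP/asboolP => [/rq[]//|[p]].
    suff cl' p' b : walk b p' v -> b \in q -> v \in q by move=> h; exact: cl' h aq.
    elim: p' b => [b /eqP->//|e p' IH b] /= /and3P[em /eqP se hw] bq.
    by apply: IH hw _; apply: cl bq _ _; rewrite -se adj_mem.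
  + by move=> u v ua vN; rewrite mk// (negbTE ua).
Qed.

Definition marks (s : state R) := forall u v, (u < N)%N -> (v < N)%N ->
  imem s amark (u * W + v) = `[< reach u v >] :> nat.

Lemma wp_Closure s0 (Q : nat -> state R -> Prop) :
  glob s0 -> (forall u, imem s0 adeg u = 0%N) -> (forall i, imem s0 amark i = 0%N) ->
  (forall T s', frame (iwrites Closure) (rwrites Closure) s0 s' ->
     (T <= 500 * (N + 1) * (N + m + 1))%N -> marks s' -> Q T s') ->
  wp M Closure Q s0.
Proof.
move=> G zd zm hQ; apply: wp_seq; apply: (wp_Adj G zd) => T1 s1 f1 hT1 A1.
apply: (@wp_for _ _ _ _ _ (fun i st => forall u v, (u < N)%N -> (v < N)%N ->
  imem st amark (u * W + v) = if (u < i)%N then nat_of_bool `[< reach u v >] else 0%N) N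
  (400 * (N + m + 1))) => //.
- exact: ltn_trans NW WltM.
- by rewrite /= mod0n (f1.1 vN isT) (gN G).
- by move=> u v _ _; rewrite (f1.1 amark isT) zm.
- move=> i st iN hf hi I.
  have Gs := glob_frame (frame_cat f1 hf) isT isT G.
  have As : adjok st by move=> u uN; rewrite (hf.1 adeg isT) (hf.1 aadj isT); apply: A1.
  apply: (wp_BFS Gs As hi iN) => [v vN|T s' f hT h1 h2]; first by rewrite I// ltnn.
  split=> // u v uN vN; rewrite ltnS leq_eqVlt; case: eqP => [->|/eqP ne] /=.
    by rewrite h1.
  by rewrite h2// I.
- move=> T s' hf _ I hT; apply: hQ.
  + exact: (frame_sub _ _ (frame_cat f1 hf)).
  + by move: hT1 hT => /=; clear; nia.
  + by move=> u v uN vN; rewrite I// uN.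
Qed.

(** * Strongly connected components and the order of the edges *)

Definition mutual u v := `[< reach u v >] && `[< reach v u >].
Definition ncr u := count (fun v => `[< reach u v >]) (iota 0 N).
Definition rep u := last 0%N [seq v <- iota 0 N | mutual u v].

Lemma mutual_eq u v w : mutual u v -> mutual u w = mutual v w.
Proof.
move=> /andP[/asboolP uv /asboolP vu]; apply/andP/andP => -[/asboolP h1 /asboolP h2];
  by split; apply/asboolP; [apply: reach_trans h1|apply: reach_trans h2 _].
Qed.

Lemma rep_eq u v : mutual u v -> rep u = rep v.
Proof. by move=> h; congr last; apply: eq_filter => w; apply: mutual_eq. Qed.

Lemma mutual_rep u : (u < N)%N -> (rep u < N)%N /\ mutual u (rep u).
Proof.
move=> uN; have : u \in [seq v <- iota 0 N | mutual u v].
  rewrite mem_filter mem_iota uN !andbT.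
  by apply/andP; split; apply/asboolP; apply: reach_refl.
rewrite /rep; case E : [seq _ <- _ | _] => [//|v l] _.
have : last 0%N (v :: l) \in v :: l by rewrite /= mem_last.
rewrite -E; move: (last _ _) => x.
by rewrite mem_filter mem_iota add0n => /andP[-> /andP[_ ->]].
Qed.

Lemma ncr_N u : (ncr u <= N)%N.
Proof. by rewrite -[leqRHS](size_iota 0); apply: count_size. Qed.

Lemma ncr_le u v : reach u v -> (ncr v <= ncr u)%N.
Proof.
move=> uv; apply: sub_count => w /asboolP vw; apply/asboolP.
exact: reach_trans vw.
Qed.

(** All that v reaches is reached by u. If v did not reach u, then u itself would be counted for u
    and not for v. *)
Lemma ncr_eq u v : (u < N)%N -> reach u v -> (ncr u <= ncr v)%N -> mutual u v.
Proof.
move=> uN uv le; apply/andP; split; apply/asboolP => //.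
have sub w : `[< reach v w >] -> `[< reach u w >].
  by move=> /asboolP vw; apply/asboolP; apply: reach_trans vw.
apply: contrapT => nvu; move: le; rewrite leqNgt => /negP; apply.
have ui : u \in iota 0 N by rewrite mem_iota.
rewrite /ncr (permP (perm_to_rem ui)) (permP (perm_to_rem ui) (fun w => `[< reach u w >])) /=.
rewrite (introF (asboolP _) nvu) (introT (asboolP _) (reach_refl _ _ _ u)) add0n add1n ltnS.
exact: sub_count.
Qed.

Lemma wp_Reps s0 (Q : nat -> state R -> Prop) :
  glob s0 -> marks s0 -> (forall u, imem s0 acr u = 0%N) ->
  (forall T s', frame (iwrites Reps) (rwrites Reps) s0 s' -> (T <= 200 * (N + 1) * (N + 1))%N ->
     (forall u, (u < N)%N -> imem s' acr u = ncr u /\ imem s' arep u = rep u) -> Q T s') ->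
  wp M Reps Q s0.
Proof.
move=> G A z hQ.
apply: (@wp_for _ _ _ _ _ (fun i st => (forall u, (u < i)%N ->
    imem st acr u = ncr u /\ imem st arep u = rep u) /\
    forall u, (i <= u)%N -> imem st acr u = 0%N) N (150 * (N + 1))) => //.
- exact: ltn_trans NW WltM.
- by rewrite /= mod0n (gN G).
- move=> u s1 uN f1 hu [I1 I2].
  pose ct i := count (fun v => `[< reach u v >]) (iota 0 i).
  pose rt i := last 0%N [seq v <- iota 0 i | mutual u v].
  apply: (@wp_for _ _ _ _ _ (fun i st => [/\ imem st acr u = ct i,
     (0 < size [seq v <- iota 0 i | mutual u v])%N -> imem st arep u = rt i &
     forall w, w != u -> imem st acr w = imem s1 acr w /\ imem st arep w = imem s1 arep w]) N 100) => //.
  + exact: ltn_trans NW WltM.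
  + by rewrite /= mod0n (f1.1 vN isT) (gN G).
  + by rewrite I2.
  + move=> v s2 vN f2 hv [J1 J2 J3].
    have F2 := frame_cat f1 f2; have G2 := glob_frame F2 isT isT G.
    have hu2 : imem s2 vu 0 = u by rewrite (f2.1 vu isT).
    have mE x y i j (s : state R) : imem s vW 0 = W -> imem s x 0 = i -> imem s y 0 = j ->
        imem s amark = imem s0 amark -> (i < N)%N -> (j < N)%N ->
        imem s amark (ieval M s (Ix (Var x) (Var y))) = `[< reach i j >] :> nat.
      move=> h4 hx hy e iN jN; rewrite (ievalIx W2 WM (i := i) (j := j))//= ?mod0n//.
      * by rewrite e A.
      * exact: ltn_trans NW.
      * exact: ltn_trans NW.
    have a2 : imem s2 amark = imem s0 amark by rewrite (F2.1 amark isT).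
    have ctW : (ct v < W)%N.
      apply: leq_ltn_trans (ltn_trans vN NW).
      by rewrite -[leqRHS](size_iota 0); apply: count_size.
    apply: wp_seq; apply: (wp_store (i := u) (x := ct v.+1)).
    * by rewrite /= mod0n.
    * rewrite /= !mod0n hu2 J1 (mE vu vv u v) ?(gW G2)//.
      rewrite /iop_eval (modA W2 WM)//; last by case: (`[< _ >]); lia.
      by rewrite /ct -addn1 iotaD count_cat /= addn0.
    move=> s3 f3 h3; have F3 := frame_cat F2 f3.
    have a3 : imem s3 amark = imem s0 amark by rewrite (F3.1 amark isT).
    have G3 := glob_frame F3 isT isT G.
    have bE : beval M s3 (BILe (INat 2) (IGet amark (Ix (Var vu) (Var vv)) +^ IGet amark (Ix (Var vv) (Var vu)))) = mutual u v.
      have hu3 : imem s3 vu 0 = u by rewrite (f3.1 vu isT).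
      have hv3 : imem s3 vv 0 = v by rewrite (f3.1 vv isT).
      rewrite /= (mE vu vv u v) ?(gW G3)// (mE vv vu v u) ?(gW G3)//.
      rewrite (modW W2 WM W2) /iop_eval (modA W2 WM); try by case: (`[< _ >]); lia.
      by rewrite /mutual; case: (`[< _ >]); case: (`[< _ >]).
    have lS : [seq w <- iota 0 v.+1 | mutual u w] =
        if mutual u v then rcons [seq w <- iota 0 v | mutual u w] v
        else [seq w <- iota 0 v | mutual u w].
      rewrite -addn1 iotaD add0n filter_cat /=.
      by case: ifP => _; rewrite ?cats0 ?cats1.
    apply: wp_if; rewrite bE => mu.
      apply: (wp_store (i := u) (x := v)).
      * by rewrite /= mod0n (f3.1 vu isT).
      * by rewrite /= mod0n (f3.1 vv isT).
      move=> s4 f4 h4; split; first by rewrite /= !icost_Ix.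
      split.
      * by rewrite (f4.1 acr isT) h3 eqxx.
      * by rewrite /rt lS mu last_rcons h4 eqxx.
      * move=> w wu; rewrite h4 (f4.1 acr isT) h3 (negbTE wu) (f3.1 arep isT).
        exact: J3.
    apply: wp_skip; split; first by rewrite /= !icost_Ix.
    split.
    * by rewrite h3 eqxx.
    * by rewrite /rt lS (negbTE mu) (f3.1 arep isT); apply: J2.
    * by move=> w wu; rewrite h3 (negbTE wu) (f3.1 arep isT); apply: J3.
  + move=> T s2 f2 _ [J1 J2 J3] hT; split; first by move: hT => /=; clear; lia.
    have uu : (0 < size [seq v <- iota 0 N | mutual u v])%N.
      rewrite size_filter -has_count; apply/hasP; exists u; rewrite ?mem_iota//.
      by apply/andP; split; apply/asboolP; apply: reach_refl.
    split.
      move=> w; rewrite ltnS leq_eqVlt => /orP[/eqP->|wu]; first by rewrite J1 J2.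
      by have [-> ->] := J3 w (negbT (ltn_eqF wu)); apply: I1.
    move=> w uw; have [-> _] : imem s2 acr w = imem s1 acr w /\ imem s2 arep w = imem s1 arep w.
      by apply: J3; rewrite gtn_eqF.
    exact: I2 (ltnW uw).
- move=> T s' hf _ [I1 I2] hT; apply: hQ => //; first exact: (frame_sub _ _ hf).
  by move: hT => /=; clear; nia.
Qed.

Definition higher e f := (ncr (src f) <= ncr (src e))%N.

Definition ordok (s : state R) := exists el, [/\ perm_eq el (iota 0 m), pairwise higher el &
  forall i, (i < m)%N -> imem s aord i = nth 0%N el i].

Lemma wp_SortE s0 (Q : nat -> state R -> Prop) :
  glob s0 -> (forall u, (u < N)%N -> imem s0 acr u = ncr u) ->
  (forall T s', frame (iwrites SortE) (rwrites SortE) s0 s' -> (T <= 200 * (N + 1) * (m + 1))%N ->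
     ordok s' -> Q T s') ->
  wp M SortE Q s0.
Proof.
move=> G A hQ; apply: wp_seq; apply: (wp_assign (x := 0%N)); first exact: mod0n.
move=> s1 f1 h1.
(* The list after the passes before c and the first k edges of pass c, described by its members.
   Edges of equal reach come in any order, which [higher] permits. *)
pose I c k (st : state R) := exists el : seq nat, [/\ imem st vpos 0 = size el,
  forall i, (i < size el)%N -> imem st aord i = nth 0%N el i,
  uniq el, pairwise higher el &
  forall e, (e \in el) = (e < m)%N && ((N - ncr (src e) < c)%N || (N - ncr (src e) == c)%N && (e < k)%N)].
apply: (@wp_for _ _ _ _ _ (fun c st => I c 0%N st) N.+1 (100 * (m + 1))) => //.
- by move: NW WltM; lia.
- by apply: (ieval_incr W2 WM) => //; rewrite (f1.1 vN isT) (gN G).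
- by exists [::]; split=> // e; rewrite in_nil ltn0 andbF andbF.
- move=> c s2 cN f2 hc Ic; have F2 := frame_cat f1 f2.
  apply: (@wp_for _ _ _ _ _ (fun k st => I c k st) m 60) => //.
  + exact: ltn_trans mW WltM.
  + by rewrite /= modn_small// (F2.1 0%N isT) (gm G).
  + move=> k s3 km f3 hk [el [E1 E2 E3 E4 E5]]; have F3 := frame_cat F2 f3.
    have G3 := glob_frame F3 isT isT G.
    have sN := srcN km; have nN := ncr_N (src k).
    apply: wp_seq; apply: (wp_assign (x := (ncr (src k) + c)%N)).
      rewrite /= !mod0n hk (gsrc G3)// (f3.1 vc isT) hc (F3.1 acr isT) A//.
      by rewrite /iop_eval (modA W2 WM)//; move: NW; lia.
    move=> s4 f4 h4; have F4 := frame_cat F3 f4.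
    have bE : beval M s4 (BAnd (BILe (Var vu) (Var vN)) (BILe (Var vN) (Var vu))) =
        (N - ncr (src k) == c)%N.
      rewrite /= !mod0n h4 (F4.1 vN isT) (gN G) -eqn_leq; apply/eqP/eqP; lia.
    apply: wp_if; rewrite bE => hb.
      have kel : k \notin el by rewrite E5 hb ltnn andbF orbF (eqP hb) ltnn andbF.
      have szW : (size el < W)%N.
        apply: leq_ltn_trans mW; rewrite -(size_iota 0 m); apply: uniq_leq_size => // e.
        by rewrite E5 mem_iota => /andP[].
      apply: wp_seq; apply: (wp_store (i := size el) (x := k)).
      * by rewrite /= mod0n (f4.1 vpos isT).
      * by rewrite /= mod0n (f4.1 ve isT).
      move=> s5 f5 h5; apply: (wp_assign (x := (size el).+1)).
        by apply: (ieval_incr W2 WM) => //; rewrite (f5.1 vpos isT) (f4.1 vpos isT).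
      move=> s6 f6 h6; split; first by [].
      exists (rcons el k); split.
      * by rewrite size_rcons.
      * move=> i; rewrite size_rcons ltnS nth_rcons (f6.1 aord isT) h5 leq_eqVlt.
        case: eqP => [->|_] /=; first by rewrite ltnn.
        by move=> ie; rewrite ie (f4.1 aord isT) E2.
      * by rewrite rcons_uniq kel.
      * rewrite pairwise_rcons E4 andbT; apply/allP => e; rewrite E5 /higher.
        move=> /andP[_ /orP[h|/andP[/eqP h _]]]; move: (eqP hb) nN (ncr_N (src e)) h; clear; lia.
      * move=> e; rewrite mem_rcons inE E5; case: eqP => [->|/eqP ne] /=.
          by rewrite km hb ltnS leqnn orbT.
        by have -> : (e < k.+1)%N = (e < k)%N by rewrite ltnS leq_eqVlt (negbTE ne).
    apply: wp_skip; split; first by [].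
    exists el; split=> //; rewrite ?(f4.1 vpos isT) ?(f4.1 aord isT)//.
    move=> e; have -> : (e < k.+1)%N = (e == k) || (e < k)%N by rewrite ltnS leq_eqVlt.
    by rewrite E5; case: (e =P k) => [->|//]; rewrite (negbTE hb).
  + move=> T s3 f3 _ [el [E1 E2 E3 E4 E5]] hT; split; first by move: hT => /=; clear; lia.
    exists el; split=> // e; rewrite E5 ltn0 andbF orbF ltnS.
    by case: (e < m)%N; rewrite ?andbF//= andbT [in RHS]leq_eqVlt orbC.
- move=> T s2 f2 _ [el [E1 E2 E3 E4 E5]] hT; apply: hQ.
  + exact: (frame_sub _ _ (frame_cat f1 f2)).
  + by move: hT => /=; clear; nia.
  + have pe : perm_eq el (iota 0 m).
      apply: uniq_perm => //; first exact: iota_uniq.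
      by move=> e; rewrite E5 mem_iota ltnS leq_subr /= andbT.
    exists el; split=> // i im; apply: E2; by rewrite (perm_size pe) size_iota.
Qed.

(** * Values of infinite repetitions, passed on between components *)

Local Notation Bc s := (cell s aBe rBv).

Definition repok (s : state R) := forall u, (u < N)%N -> imem s arep u = rep u.

Lemma rep_mutual u v : (u < N)%N -> (v < N)%N -> rep u = rep v -> mutual u v.
Proof.
move=> uN vN E; have [_ /andP[/asboolP h1 /asboolP h2]] := mutual_rep uN.
have [_ /andP[/asboolP h3 /asboolP h4]] := mutual_rep vN.
by rewrite E in h1 h2; apply/andP; split; apply/asboolP; [apply: reach_trans h4|apply: reach_trans h2].
Qed.

Lemma repN u : (u < N)%N -> (rep u < N)%N.
Proof. by move=> /mutual_rep[]. Qed.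

Lemma rep_reach u t : (u < N)%N -> reach (rep u) t <-> reach u t.
Proof.
move=> uN; have [_ /andP[/asboolP h1 /asboolP h2]] := mutual_rep uN.
by split; apply: reach_trans.
Qed.

Definition bsound a (B : nat -> option R) := forall r t x, (r < N)%N -> B r = Some x ->
  reach r t -> dle a t x.

(** Neither cost nor discount appears along an edge: the limit value of a repetition is the same for
    all targets reachable from it, so it is passed on unchanged. *)
Definition relaxed el i (B : nat -> option R) := forall j y, (j < i)%N ->
  ole (B (rep (src (nth 0%N el j)))) y -> ole (B (rep (dst (nth 0%N el j)))) y.

Lemma relaxed_reach el (B : nat -> option R) v t y : perm_eq el (iota 0 m) ->
  relaxed el m B -> reach v t -> ole (B (rep v)) y -> ole (B (rep t)) y.
Proof.
move=> pe rl [p]; elim: p v => [v /eqP->//|e p IH v] /= /and3P[em /eqP <- hw] h.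
apply: IH hw _; have ee : e \in el by rewrite (perm_mem pe) mem_iota.
rewrite -(nth_index 0%N ee); apply: rl; last by rewrite nth_index.
by have := ee; rewrite -index_mem (perm_size pe) size_iota.
Qed.

(* Lowering the value of a component never breaks the edges treated before,
   since these leave components of at least the same reach. *)
Lemma relaxed_step el i (B B' : nat -> option R) x :
  perm_eq el (iota 0 m) -> pairwise (higher) el -> (i < m)%N ->
  minupd (fun k y => [/\ B (rep (src (nth 0 el i))) = Some x,
    k = rep (dst (nth 0%N el i)) & y = x]) B B' ->
  (forall y, B (rep (src (nth 0 el i))) = Some y -> y = x) ->
  relaxed el i B -> relaxed el i.+1 B'.
Proof.
move=> pe so im [h1 h2 h3] hx rl j y ji.
have sz : size el = m by rewrite (perm_size pe) size_iota.
have elm l : (l < m)%N -> (nth 0%N el l < m)%N.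
  by move=> lm; have : nth 0%N el l \in el; [apply: mem_nth; rewrite sz|rewrite (perm_mem pe) mem_iota].
have jm : (j < m)%N by lia.
(* An edge inside a component offers the component its own value, so nothing changes. *)
have same : rep (src (nth 0%N el i)) = rep (dst (nth 0%N el i)) -> relaxed el i.+1 B'.
  move=> E j' y' j'i; case E1 : (B' _) => [z|] //= zy.
  have old : B (rep (src (nth 0%N el j'))) = Some z.
    by case: (h3 _ _ E1) => // -[Bs kE ->]; rewrite kE -E.
  move: j'i; rewrite ltnS leq_eqVlt => /orP[/eqP ji'|j'i].
    by apply: h1; rewrite ji' -E -ji' old.
  by apply: h1; apply: rl => //; rewrite old.
case: (rep (src (nth 0%N el i)) =P rep (dst (nth 0%N el i))) => [/same|ne]; first exact.
case E1 : (B' _) => [z|] //= zy.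
move: ji; rewrite ltnS leq_eqVlt => /orP[/eqP jE|ji].
  subst j; have [old|[_ kE _]] := h3 _ _ E1; last by case: ne.
  by apply: ole_trans zy; apply: h2; rewrite old -(hx _ old).
have [old|[_ kE _]] := h3 _ _ E1; first by apply: h1; apply: rl => //; rewrite old.
(* The earlier edge j would leave the component just lowered, whose reach is then at least that of
   the source of edge i by the order. Since edge i leads into that component, its two ends have
   equal reach and lie in one component, which was excluded. *)
case: ne; have em := elm _ im; have fm := elm _ jm.
apply: rep_eq; apply: ncr_eq; [exact: srcN|exact: reach_edge|].
have /andP[/asboolP r1 /asboolP r2] := rep_mutual (srcN fm) (dstN em) kE.
apply: leq_trans (ncr_le r2).
move/(pairwiseP 0%N): so => /(_ j i); rewrite !inE sz => so.
exact: so jm im ji.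
Qed.

Lemma wp_BEdge s0 i el a (Q : nat -> state R -> Prop) :
  glob s0 -> repok s0 -> imem s0 vi 0 = i -> (i < m)%N ->
  perm_eq el (iota 0 m) -> pairwise (higher) el ->
  imem s0 aord i = nth 0%N el i ->
  bsound a (Bc s0) -> relaxed el i (Bc s0) ->
  (forall T s', frame (iwrites BEdge) (rwrites BEdge) s0 s' -> (T <= 80)%N ->
     bsound a (Bc s') -> mono (Bc s0) (Bc s') -> relaxed el i.+1 (Bc s') -> Q T s') ->
  wp M BEdge Q s0.
Proof.
move=> G Rp hi im pe so hel bs rl hQ.
set e := nth 0%N el i in hel *.
have em : (e < m)%N.
  have : e \in el by apply: mem_nth; rewrite (perm_size pe) size_iota.
  by rewrite (perm_mem pe) mem_iota.
have sN := srcN em; have dN := dstN em.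
apply: wp_seq; apply: (wp_assign (x := e)); first by rewrite /= mod0n hi.
move=> s1 f1 h1; have G1 := glob_frame f1 isT isT G.
have B1 : Bc s1 = Bc s0 by apply/funext => j; rewrite /cell (f1.1 aBe isT) (f1.2 rBv isT).
have sE : imem s1 arep (imem s1 asrc e) = rep (src e).
  by rewrite (gsrc G1)// (f1.1 arep isT) Rp.
have dE : imem s1 arep (imem s1 adst e) = rep (dst e).
  by rewrite (gdst G1)// (f1.1 arep isT) Rp.
apply: (wp_gmin W2 WM (i0 := rep (dst e)) (bb := (0 < imem s1 aBe (rep (src e)))%N)
  (x := rmem s1 rBv (rep (src e))) (B := 70)) => //.
- by rewrite /= mod0n h1 sE (modn_small M1).
- by rewrite /= mod0n h1 dE.
- by rewrite /= mod0n h1 sE.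
move=> T s2 hT f2 mu.
set x := rmem s1 rBv (rep (src e)) in mu.
have mu' : minupd (fun k y => [/\ Bc s0 (rep (src e)) = Some x, k = rep (dst e) & y = x])
    (Bc s0) (Bc s2).
  rewrite -B1; apply: minupd_iff mu => k y; split=> [[b0 -> ->]|[/cell_some[b0 _] -> ->]] //.
  by split=> //; apply/cell_some.
apply: hQ.
- exact: (frame_sub _ _ (frame_cat f1 f2)).
- by move: hT => /=; clear; lia.
- case: mu' => _ _ h3 r t z rN /h3[|[Bx -> ->]]; first exact: bs.
  move=> /(rep_reach _ dN) rt; apply: (bs (rep (src e))) => //; first exact: repN.
  by apply/(rep_reach _ sN); apply: reach_trans rt; apply: reach_edge.
- by case: mu'.
- apply: (relaxed_step pe so im mu') rl => y.
  by rewrite -B1 cell_some => -[_ ->].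
Qed.

Lemma wp_BRow s0 a L (Q : nat -> state R -> Prop) :
  glob s0 -> pwok s0 -> repok s0 -> ordok s0 ->
  imem s0 vs 0 = a -> (a < N)%N -> imem s0 vL 0 = L -> (L <= LM)%N ->
  dpok N m src dst cst g a L (Dc s0) (Dp s0) -> qsound (Qc s0) -> xsound (Xc s0) ->
  (forall T s', frame (iwrites BRow) (rwrites BRow) s0 s' ->
     (T <= 500 * (L + 1) * (N + m + 1))%N ->
     xsound (Xc s') -> mono (Xc s0) (Xc s') ->
     (forall p v z t, walk a p v -> (size p <= L)%N -> (t < N)%N -> reach v t ->
        Qc s0 v = Some z -> ole (Xc s' (a * W + t)%N) (fval p z)) -> Q T s') ->
  wp M BRow Q s0.
Proof.
move=> G P Rp [el [pe so hel]] hs aN hL LL hD qs xs hQ.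
apply: wp_seq; apply: (@wp_for _ _ _ _ _ (fun i st => forall v, (v < i)%N -> imem st aBe v = 0%N) N 6) => //.
- exact: ltn_trans NW WltM.
- by rewrite /= mod0n (gN G).
- move=> i st iN hf hi I; apply: (wp_store (i := i) (x := 0%N)); rewrite /= ?mod0n//.
  move=> s2 f2 h2; split=> // v; rewrite ltnS leq_eqVlt h2.
  by case: eqP => [->//|_] /= /I.
move=> T1 s1 f1 _ B1 hT1; have G1 := glob_frame f1 isT isT G.
pose C v k y := exists2 j, (j < L.+1)%N & exists x z, [/\ Dc s0 j v = Some x, Qc s0 v = Some z,
  k = rep v & y = x + g ^+ j * z].
apply: wp_seq; apply: (wp_for_min (fe := aBe) (fv := rBv) (C := C) (n := N) (B := 200 * (L + 1) + 50)) => //.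
- exact: ltn_trans NW WltM.
- by rewrite /= mod0n (gN G1).
- move=> v s2 vN' f2 hv; have F2 := frame_cat f1 f2; have G2 := glob_frame F2 isT isT G.
  pose C' j k y := exists x z, [/\ Dc s0 j v = Some x, Qc s0 v = Some z, k = rep v & y = x + g ^+ j * z].
  apply: (wp_for_min (fe := aBe) (fv := rBv) (C := C') (n := L.+1) (B := 180)) => //.
  + by move: LL LW WltM; clear; lia.
  + apply: (ieval_incr W2 WM); first by rewrite (F2.1 vL isT).
    by move: LL LW; clear; lia.
  + move=> j s3 jL f3 hj; have F3 := frame_cat F2 f3; have G3 := glob_frame F3 isT isT G.
    have hv3 : imem s3 vv 0 = v by rewrite (f3.1 vv isT).
    have jLM : (j <= LM)%N by lia.
    have E1 : ieval M s3 (Ix (Var vj) (Var vv)) = (j * W + v)%N.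
      apply: (ievalIx W2 WM) => //=; rewrite ?mod0n ?(gW G3)//.
      * by move: jLM LW; clear; lia.
      * exact: ltn_trans NW.
    apply: (wp_gmin W2 WM (i0 := rep v)
      (bb := (0 < imem s0 aDe (j * W + v))%N && (0 < imem s0 aQe v)%N)
      (x := rmem s0 rDv (j * W + v) + g ^+ j * rmem s0 rQv v) (B := 180)) => //.
    * by rewrite /= E1 mod0n hv3 (modn_small M1) (F3.1 aDe isT) (F3.1 aQe isT).
    * by rewrite /= mod0n hv3 (F3.1 arep isT) Rp.
    * by rewrite /= E1 !mod0n hv3 hj (F3.2 rDv isT) (F3.2 rQv isT) (F3.2 rpw isT) P.
    move=> T s4 hT _ mu; split=> //; apply: minupd_iff mu => k y; split.
      move=> [/andP[d0 q0] -> ->]; exists (rmem s0 rDv (j * W + v)), (rmem s0 rQv v).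
      by split=> //; apply/cell_some.
    by move=> [x [z [/cell_some[d0 ->] /cell_some[q0 ->] -> ->]]]; rewrite d0 q0.
  + by move=> T s3 _ hT mu; split=> //; move: hT => /=; clear; lia.
move=> T2 s2 f2 hT2 [b1 b2 b3]; have F2 := frame_cat f1 f2; have G2 := glob_frame F2 isT isT G.
have bs2 : bsound a (Bc s2).
  move=> r t x rN /b3[|[v vN' [j jL [x0 [z [dx qz rE ->]]]]]].
    by rewrite /cell B1//.
  move=> rt; have [w sz fx _] := dp_sound srcN hD aN jL vN' dx.
  have -> : x0 + g ^+ j * z = fval (pwalk src (Dp s0) j v) z by rewrite fvalE fx sz.
  apply: (dle_pre g0 g1 w); apply: (qs v z) => //.
  by apply/(rep_reach _ vN'); rewrite -rE.
apply: wp_seq; apply: (@wp_for _ _ _ _ _ (fun i st =>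
  [/\ bsound a (Bc st), mono (Bc s2) (Bc st) & relaxed el i (Bc st)]) m 80) => //.
- exact: ltn_trans mW WltM.
- by rewrite /= modn_small// (gm G2).
- by split.
- move=> i s3 im f3 hi [I1 I2 I3]; have F3 := frame_cat F2 f3; have G3 := glob_frame F3 isT isT G.
  have R3 : repok s3 by move=> u uN; rewrite (F3.1 arep isT) Rp.
  apply: (wp_BEdge G3 R3 hi im pe so _ I1 I3); first by rewrite (F3.1 aord isT) hel.
  move=> T s4 _ hT J1 J2 J3; split=> //; split=> //.
  exact: mono_trans I2 J2.
move=> T3 s3 f3 _ [I1 I2 I3] hT3; have F3 := frame_cat F2 f3; have G3 := glob_frame F3 isT isT G.
have X3 : Xc s3 = Xc s0 by apply/funext => i; rewrite /cell (F3.1 aXe isT) (F3.2 rXv isT).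
pose C4 t k y := k = (a * W + t)%N /\ Bc s3 (rep t) = Some y.
apply: (wp_for_min (fe := aXe) (fv := rXv) (C := C4) (n := N) (B := 100)) => //.
- exact: ltn_trans NW WltM.
- by rewrite /= mod0n (gN G3).
- move=> t s4 tN f4 ht; have F4 := frame_cat F3 f4; have G4 := glob_frame F4 isT isT G.
  have rE : imem s4 arep t = rep t by rewrite (F4.1 arep isT) Rp.
  apply: (wp_gmin W2 WM (i0 := (a * W + t)%N) (bb := (0 < imem s3 aBe (rep t))%N)
    (x := rmem s3 rBv (rep t)) (B := 100)) => //.
  + by rewrite /= mod0n ht rE (modn_small M1) (f4.1 aBe isT).
  + move=> _; apply: (ievalIx W2 WM) => //=; rewrite ?mod0n ?(gW G4)//.
    * by rewrite (F4.1 vs isT).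
    * exact: ltn_trans NW.
    * exact: ltn_trans NW.
  + by rewrite /= mod0n ht rE (f4.2 rBv isT).
  move=> T s5 hT _ mu; split=> //; apply: minupd_iff mu => k y.
  by split=> [[b0 -> ->]|[-> /cell_some[b0 ->]]] //; split=> //; apply/cell_some.
move=> T4 s4 f4 hT4 []; rewrite X3 => x1 x2 x3; apply: hQ.
- exact: (frame_sub _ _ (frame_cat F3 f4)).
- by move: hT1 hT2 hT3 hT4 => /=; clear; nia.
- move=> u t x uN tN /x3[|[t' t'N [kE Bx]]]; first exact: xs.
  have : (u * W + t == a * W + t')%N by rewrite kE.
  rewrite idx_eq ?(ltn_trans _ NW)// => /andP[/eqP-> /eqP->].
  apply: (I1 (rep t')) => //; first exact: repN.
  by apply/(rep_reach _ t'N); apply: reach_refl.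
- exact: x1.
- move=> p v z t hw sz tN vt qz.
  have vN' : (v < N)%N := walk_end_N dstN aN hw.
  have := dp_le dstN hD aN hw sz; case dx : (Dc s0 _ v) => [x|] //= xp.
  have : ole (Bc s3 (rep t)) (fval p z).
    apply: (relaxed_reach pe I3 vt); apply: I2; apply: (@ole_trans _ _ (x + g ^+ size p * z)).
      by apply: b2; exists v => //; exists (size p) => //; exists x, z.
    by rewrite [leRHS]fvalE lerD2r.
  case Bx : (Bc s3 _) => [y|] //= yp.
  by apply: ole_trans yp; apply: x2; exists t.
Qed.

(** * Envelopes computed and queried *)

Definition pair_cand (f : nat -> option R) i j y :=
  exists a b, [/\ f i = Some a, f j = Some b & y = nz g i j a b].

Lemma hguard s b i j : glob s -> imem s vi 0 = i -> imem s vj 0 = j -> imem s vb 0 = b ->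
  (b < N)%N -> (i <= LM)%N -> (j <= LM)%N ->
  [/\ ieval M s (Ix (Var vi) (Var vb)) = (i * W + b)%N,
      ieval M s (Ix (Var vj) (Var vb)) = (j * W + b)%N &
      beval M s HGuard = (0 < imem s aDe (i * W + b))%N && (0 < imem s aDe (j * W + b))%N].
Proof.
move=> G hi hj hb bN iL jL.
have bW : (b < W)%N := ltn_trans bN NW.
have E1 : ieval M s (Ix (Var vi) (Var vb)) = (i * W + b)%N.
  by apply: (ievalIx W2 WM) => //=; rewrite ?mod0n ?(gW G)//; move: iL LW; clear; lia.
have E2 : ieval M s (Ix (Var vj) (Var vb)) = (j * W + b)%N.
  by apply: (ievalIx W2 WM) => //=; rewrite ?mod0n ?(gW G)//; move: jL LW; clear; lia.
by split=> //; rewrite /= E1 E2 (modn_small M1).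
Qed.

Lemma hslope s b i j : pwok s -> imem s vi 0 = i -> imem s vj 0 = j ->
  (i <= LM)%N -> (j <= LM)%N ->
  ieval M s (Ix (Var vi) (Var vb)) = (i * W + b)%N ->
  ieval M s (Ix (Var vj) (Var vb)) = (j * W + b)%N ->
  reval M s HSlope = nz g i j (rmem s rDv (i * W + b)) (rmem s rDv (j * W + b)).
Proof. by move=> P hi hj iL jL E1 E2; rewrite /= E1 E2 !mod0n hi hj !P. Qed.

(** One statement for [HLo] and [HHi]: [i] selects which of the two lines is updated, [sg] is the
    identity or the negation. *)
Lemma wp_pairs s0 L b fe fv i v sg (f := fun j => Dc s0 j b) (Q : nat -> state R -> Prop)
    (c := For vj (Var vL +^ INat 1) (For vi (Var vj) (GMin HGuard fe fv (Var i) v))) :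
  (i == vi) || (i == vj) -> fe \in [:: alo; ahi]%N -> fv \in [:: rlo; rhi]%N ->
  (ajunk \notin ridx v) -> (rcost v <= 40)%N ->
  (forall s, reval M s v = sg (reval M s HSlope)) ->
  glob s0 -> pwok s0 -> imem s0 vL 0 = L -> (L <= LM)%N -> imem s0 vb 0 = b -> (b < N)%N ->
  (forall T s', frame (iwrites c) (rwrites c) s0 s' ->
     (T <= 400 * (L + 1) * (L + 1))%N ->
     minupd (fun k y => exists2 j, (j < L.+1)%N & exists2 i', (i' < j)%N &
        exists2 z, pair_cand f i' j z & k = (if i == vj then j else i') /\ y = sg z)
       (cell s0 fe fv) (cell s' fe fv) -> Q T s') ->
  wp M c Q s0.
Proof.
move=> iE feE fvE jv rv vE G P hL LL hb bN hQ.
have nfe x : x \notin [:: alo; ahi]%N -> x != fe by apply: contraNneq => ->.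
have nfv x : x \notin [:: rlo; rhi]%N -> x != fv by apply: contraNneq => ->.
pose C j k y := exists2 i', (i' < j)%N & exists2 z, pair_cand f i' j z & k = (if i == vj then j else i') /\ y = sg z.
apply: (wp_for_min (fe := fe) (fv := fv) (C := C) (n := L.+1) (B := 330 * (L + 1))) => //.
- exact: nfe.
- by rewrite /= !inE !negb_or nfe.
- by rewrite /= !inE !negb_or !nfe.
- by move: LL LW WltM; clear; lia.
- by apply: (ieval_incr W2 WM) => //; move: LL LW; clear; lia.
- move=> j s1 jL f1 hj.
  pose C' i' k y := exists2 z, pair_cand f i' j z & k = (if i == vj then j else i') /\ y = sg z.
  apply: (wp_for_min (fe := fe) (fv := fv) (C := C') (n := j) (B := 240)) => //.
  + exact: nfe.
  + by rewrite /= !inE !negb_or nfe.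
  + by rewrite /= !inE !negb_or !nfe.
  + by move: LL jL LW WltM; clear; lia.
  + by rewrite /= mod0n.
  + move=> i' s2 ij f2 hi.
    have F2 : frame [:: vj; vi; ajunk; fe] [:: fv] s0 s2.
      apply: frame_trans (frame_sub _ _ f1) (frame_sub _ _ f2); rewrite /= !inE !eqxx ?orbT//.
    have G2 : glob s2.
      apply: (glob_frame F2) G; first by rewrite /= !inE !nfe.
      by rewrite /= !inE !nfv.
    have P2 : pwok s2 by move=> l lL; rewrite F2.2 ?P// inE nfv.
    have hj2 : imem s2 vj 0 = j.
      by rewrite (f2.1 vj)//= !inE !negb_or nfe.
    have hb2 : imem s2 vb 0 = b by rewrite F2.1// !inE !negb_or nfe.
    have dE : imem s2 aDe = imem s0 aDe by rewrite F2.1// !inE !negb_or nfe.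
    have dV : rmem s2 rDv = rmem s0 rDv by rewrite F2.2// !inE nfv.
    have jLM : (j <= LM)%N by apply: leq_trans LL.
    have iLM : (i' <= LM)%N := leq_trans (ltnW ij) jLM.
    have [E1 E2 bE] := hguard G2 hi hj2 hb2 bN iLM jLM.
    apply: (wp_gmin W2 WM (i0 := if i == vj then j else i')
      (bb := (0 < imem s0 aDe (i' * W + b))%N && (0 < imem s0 aDe (j * W + b))%N)
      (x := sg (nz g i' j (rmem s0 rDv (i' * W + b)) (rmem s0 rDv (j * W + b)))) (B := 240)) => //.
    * exact: nfe.
    * by case/orP: iE => /eqP->.
    * by rewrite bE dE.
    * by rewrite /= mod0n; case/orP: iE => /eqP->.
    * by rewrite vE (hslope P2 hi hj2 iLM jLM E1 E2) dV.
    * by rewrite /HGuard /= !icost_Ix /=; move: rv; clear; lia.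
    move=> T s3 hT _ mu; split=> //; apply: minupd_iff mu => k y; split.
      move=> [/andP[d0 d1] -> ->]; eexists; last by split.
      by do 2 eexists; split; [apply/cell_some; split|apply/cell_some; split|].
    by move=> [z [x [x' [/cell_some[d0 ->] /cell_some[d1 ->] ->]]] [-> ->]]; rewrite d0 d1.
  + move=> T s2 f2 hT mu; split; last exact: mu.
    by move: hT jL => /=; clear; nia.
- move=> T s1 f1 hT mu; apply: hQ; last exact: mu.
  + by apply: (frame_sub _ _ f1); rewrite /= !inE !eqxx ?orbT.
  + by move: hT => /=; clear; nia.
Qed.

Record hok L b (s : state R) : Prop := Hok {
  h_lo1 : forall i j x y, (i < j <= L)%N -> Dc s i b = Some x -> Dc s j b = Some y ->
    ole (cell s alo rlo j) (nz g i j x y);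
  h_lo2 : forall j z, (j <= L)%N -> cell s alo rlo j = Some z -> z = rmem s rlo j /\
    exists i x y, [/\ (i < j)%N, Dc s i b = Some x, Dc s j b = Some y & z = nz g i j x y];
  h_hi1 : forall i j x y, (i < j <= L)%N -> Dc s i b = Some x -> Dc s j b = Some y ->
    ole (cell s ahi rhi i) (- nz g i j x y);
  h_hi2 : forall i z, (i <= L)%N -> cell s ahi rhi i = Some z ->
    exists j x y, [/\ (i < j <= L)%N, Dc s i b = Some x, Dc s j b = Some y & z = - nz g i j x y];
  h_cn : imem s vcn 0 = size (hull L (fun j => Dc s j b) (cell s alo rlo) (cell s ahi rhi));
  h_hl : forall r, (r < imem s vcn 0)%N -> imem s ahl r =
    nth 0%N (hull L (fun j => Dc s j b) (cell s alo rlo) (cell s ahi rhi)) r }.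

Lemma hok_frame I J L b s s' : frame I J s s' ->
  all (fun a => a \notin I) [:: aDe; alo; ahi; vcn; ahl]%N ->
  all (fun a => a \notin J) [:: rDv; rlo; rhi]%N -> hok L b s -> hok L b s'.
Proof.
move=> [f1 f2] /and5P[a1 a2 a3 a4 /andP[a5 _]] /and4P[b1 b2 b3 _] [*].
have E1 : Dc s' = Dc s by rewrite /Dc /cell (f1 aDe a1) (f2 rDv b1).
have E2 : cell s' alo rlo = cell s alo rlo by rewrite /cell (f1 alo a2) (f2 rlo b2).
have E3 : cell s' ahi rhi = cell s ahi rhi by rewrite /cell (f1 ahi a3) (f2 rhi b3).
by split; rewrite ?E1 ?E2 ?E3 ?(f2 rlo b2) ?(f1 vcn a4) ?(f1 ahl a5).
Qed.

Lemma wp_Hull s0 L b (Q : nat -> state R -> Prop) :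
  glob s0 -> pwok s0 -> imem s0 vL 0 = L -> (L <= LM)%N -> imem s0 vb 0 = b -> (b < N)%N ->
  (forall T s', frame (iwrites Hull) (rwrites Hull) s0 s' ->
     (T <= 1500 * (L + 1) * (L + 1))%N -> hok L b s' -> Q T s') ->
  wp M Hull Q s0.
Proof.
move=> G P hL LL hb bN hQ.
have LW1 : (L.+1 < W)%N by move: LL LW; clear; lia.
apply: wp_seq; apply: (@wp_for _ _ _ _ _ (fun i st => forall j, (j < i)%N ->
   imem st alo j = 0%N /\ imem st ahi j = 0%N) L.+1 12) => //.
- exact: ltn_trans LW1 WltM.
- by apply: (ieval_incr W2 WM) => //; apply: ltn_trans LW1.
- move=> i st iN hf hi I; apply: wp_seq; apply: (wp_store (i := i) (x := 0%N)); rewrite /= ?mod0n//.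
  move=> s1 f1 h1; apply: (wp_store (i := i) (x := 0%N)); rewrite /= ?mod0n//.
    by rewrite (f1.1 vj isT).
  move=> s2 f2 h2; split=> // v; rewrite ltnS leq_eqVlt h2 (f2.1 alo isT) h1.
  case: (v =P i) => [->//|_] /= /I[i1 i2]; split=> //.
  by rewrite (f1.1 ahi isT).
move=> T1 s1 f1 _ Z hT1; have G1 := glob_frame f1 isT isT G.
have P1 : pwok s1 by move=> l lL; rewrite (f1.2 rpw isT) P.
apply: wp_seq; apply: (@wp_pairs s1 L b alo rlo vj HSlope id) => //.
- by rewrite (f1.1 vL isT).
- by rewrite (f1.1 vb isT).
move=> T2 s2 f2 hT2 [_ lo1 lo2]; have F2 := frame_cat f1 f2; have G2 := glob_frame F2 isT isT G.
have P2 : pwok s2 by move=> l lL; rewrite (F2.2 rpw isT) P.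
have D2 : Dc s2 = Dc s1 by rewrite /Dc /cell (f2.1 aDe isT) (f2.2 rDv isT).
apply: wp_seq; apply: (@wp_pairs s2 L b ahi rhi vi (RBin RSub (RNat 0) HSlope) (fun z => - z)) => //.
- by move=> s; rewrite -[LHS]/(0 - reval M s HSlope) sub0r.
- by rewrite (F2.1 vL isT).
- by rewrite (F2.1 vb isT).
rewrite D2; move=> T3 s3 f3 hT3 [_ hi1 hi2]; have F3 := frame_cat F2 f3; have G3 := glob_frame F3 isT isT G.
have D3 : Dc s3 = Dc s1 by rewrite -D2 /Dc /cell (f3.1 aDe isT) (f3.2 rDv isT).
have lo3 : cell s3 alo rlo = cell s2 alo rlo by rewrite /cell (f3.1 alo isT) (f3.2 rlo isT).
have Hlo1 i j x y : (i < j <= L)%N -> Dc s1 i b = Some x -> Dc s1 j b = Some y ->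
    ole (cell s3 alo rlo j) (nz g i j x y).
  move=> /andP[ij jL] dx dy; rewrite lo3; apply: lo1.
  by exists j => //; exists i => //; exists (nz g i j x y) => //; exists x, y.
have Hlo2 j z : (j <= L)%N -> cell s3 alo rlo j = Some z -> z = rmem s3 rlo j /\
    exists i x y, [/\ (i < j)%N, Dc s1 i b = Some x, Dc s1 j b = Some y & z = nz g i j x y].
  move=> jL cz; split; first by case/cell_some: cz.
  move: cz; rewrite lo3 => /lo2[|[j' j'L [i ij [y [x [x' [dx dx' ->]]] [-> ->]]]]].
    by rewrite /cell (Z _ _).1.
  by exists i, x, x'.
have Hhi1 i j x y : (i < j <= L)%N -> Dc s1 i b = Some x -> Dc s1 j b = Some y ->
    ole (cell s3 ahi rhi i) (- nz g i j x y).
  move=> /andP[ij jL] dx dy; apply: hi1.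
  by exists j => //; exists i => //; exists (nz g i j x y) => //; exists x, y.
have Hhi2 i z : (i <= L)%N -> cell s3 ahi rhi i = Some z ->
    exists j x y, [/\ (i < j <= L)%N, Dc s1 i b = Some x, Dc s1 j b = Some y & z = - nz g i j x y].
  move=> iL /hi2[|[j j'L [i' ij [y [x [x' [dx dx' ->]]] [-> ->]]]]].
    by rewrite /cell (f2.1 ahi isT) (Z _ _).2.
  by exists j, x, x'; rewrite ij.
apply: wp_seq; apply: (wp_assign (x := 0%N)); first exact: mod0n.
move=> s4 f4 h4; have F4 := frame_cat F3 f4.
have D4 : Dc s4 = Dc s1 by rewrite -D3 /Dc /cell (f4.1 aDe isT) (f4.2 rDv isT).
have lo4 : cell s4 alo rlo = cell s3 alo rlo by rewrite /cell (f4.1 alo isT) (f4.2 rlo isT).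
have hi4 : cell s4 ahi rhi = cell s3 ahi rhi by rewrite /cell (f4.1 ahi isT) (f4.2 rhi isT).
set kp := keep (fun j => Dc s1 j b) (cell s3 alo rlo) (cell s3 ahi rhi).
pose hl i := [seq j <- iota 0 i | kp j].
apply: (@wp_for _ _ _ _ _ (fun i st => imem st vcn 0 = size (hl i) /\
   forall r, (r < size (hl i))%N -> imem st ahl r = nth 0%N (hl i) r) L.+1 70) => //.
- exact: ltn_trans LW1 WltM.
- by apply: (ieval_incr W2 WM); [rewrite (F4.1 vL isT)|apply: ltn_trans LW1].
- move=> j s5 jL f5 hj [I1 I2]; have F5 := frame_cat F4 f5; have G5 := glob_frame F5 isT isT G.
  have jLM : (j <= LM)%N by apply: leq_trans LL.
  have E2 : ieval M s5 (Ix (Var vj) (Var vb)) = (j * W + b)%N.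
    apply: (ievalIx W2 WM) => //=; rewrite ?mod0n ?(gW G5)//.
    + by rewrite (F5.1 vb isT).
    + by move: jLM LW; clear; lia.
    + exact: ltn_trans NW.
  have D5 : Dc s5 = Dc s1 by rewrite -D4 /Dc /cell (f5.1 aDe isT) (f5.2 rDv isT).
  have lo5 : cell s5 alo rlo = cell s3 alo rlo by rewrite -lo4 /cell (f5.1 alo isT) (f5.2 rlo isT).
  have hi5 : cell s5 ahi rhi = cell s3 ahi rhi by rewrite -hi4 /cell (f5.1 ahi isT) (f5.2 rhi isT).
  have szl : (size (hl j) <= j)%N.
    by rewrite size_filter; apply: leq_trans (count_size _ _) _; rewrite size_iota.
  have hS : hl j.+1 = if kp j then rcons (hl j) j else hl j.
    by rewrite /hl -addn1 iotaD filter_cat /= add0n; case: ifP; rewrite ?cats1 ?cats0.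
  have bE : beval M s5 (BAnd (BILe (INat 1) (IGet aDe (Ix (Var vj) (Var vb))))
           (BNot (BAnd (BAnd (BILe (INat 1) (IGet alo (Var vj))) (BILe (INat 1) (IGet ahi (Var vj))))
              (BNot (BRLe (RNat 0) (RBin RAdd (RGet rlo (Var vj)) (RGet rhi (Var vj)))))))) = kp j.
    rewrite /= E2 !mod0n hj (modn_small M1) /kp /keep -D5 -lo5 -hi5 /Dc /cell !lt0n.
    case: (_ == 0%N) => //=; case: (_ == 0%N) => //=; case: (_ == 0%N) => //=.
    by rewrite negbK.
  apply: wp_if; rewrite bE => kj; last first.
    apply: wp_skip; split; first by rewrite /= !icost_Ix.
    by rewrite hS (negbTE kj).
  have szW : (size (hl j) < W)%N by move: szl jL LW1; clear; lia.
  apply: wp_seq; apply: (wp_store (i := size (hl j)) (x := j)); rewrite /= ?mod0n//.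
  move=> s6 f6 h6; apply: (wp_assign (x := (size (hl j)).+1)).
    by apply: (ieval_incr W2 WM) => //; rewrite (f6.1 vcn isT).
  move=> s7 f7 h7; split; first by rewrite /= !icost_Ix.
  rewrite hS kj size_rcons h7; split=> // r; rewrite ltnS leq_eqVlt (f7.1 ahl isT) h6 nth_rcons.
  case: eqP => [->|_] /=; first by rewrite ltnn.
  by move=> rs; rewrite rs I2.
- move=> T s5 f5 _ [I1 I2] hT.
  have D5 : Dc s5 = Dc s1 by rewrite -D4 /Dc /cell (f5.1 aDe isT) (f5.2 rDv isT).
  have lo5 : cell s5 alo rlo = cell s3 alo rlo by rewrite -lo4 /cell (f5.1 alo isT) (f5.2 rlo isT).
  have hi5 : cell s5 ahi rhi = cell s3 ahi rhi by rewrite -hi4 /cell (f5.1 ahi isT) (f5.2 rhi isT).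
  have rl5 : rmem s5 rlo = rmem s3 rlo by rewrite (f5.2 rlo isT) (f4.2 rlo isT).
  apply: hQ.
  + exact: (frame_sub _ _ (frame_cat F4 f5)).
  + by move: hT1 hT2 hT3 hT => /=; clear; nia.
  + by split; rewrite ?D5 ?lo5 ?hi5 ?rl5// ?I1.
Qed.

Definition hseq L b (s : state R) := hull L (fun j => Dc s j b) (cell s alo rlo) (cell s ahi rhi).

Lemma hseq_size L b s : (size (hseq L b s) <= L.+1)%N.
Proof. by rewrite size_filter; apply: leq_trans (count_size _ _) _; rewrite size_iota. Qed.

Lemma hseq_mem L b s r : (r < size (hseq L b s))%N ->
  (nth 0%N (hseq L b s) r <= L)%N /\ exists d, Dc s (nth 0%N (hseq L b s) r) b = Some d.
Proof.
move=> rs; have := mem_nth 0%N rs; rewrite mem_filter mem_iota ltnS => /andP[/andP[h _] /= ->].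
by split=> //; move: h; case: (Dc s _ b) => // d _; exists d.
Qed.

(** A line without a steeper rival has no left end and is kept; descending from any line to a
    steeper one leads to such a line. *)
Lemma hseq_pos L b s j d : hok L b s -> (j <= L)%N -> Dc s j b = Some d ->
  (0 < size (hseq L b s))%N.
Proof.
move=> H; elim/ltn_ind: j d => j IH d jL dj.
case kj : (keep (fun j => Dc s j b) (cell s alo rlo) (cell s ahi rhi) j).
  have : j \in hseq L b s by rewrite mem_filter kj mem_iota.
  by case: (hseq L b s).
move: kj; rewrite /keep dj /=; case E : (cell s alo rlo j) => [z|//] _.
have [_ [i [x [y [ij dx _ _]]]]] := h_lo2 H jL E.
exact: IH ij _ (leq_trans (ltnW ij) jL) dx.
Qed.

Lemma wp_Query s0 a b t L (Q : nat -> state R -> Prop) :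
  glob s0 -> pwok s0 -> imem s0 vlg 0 = bb -> hok L b s0 ->
  imem s0 vs 0 = a -> (a < N)%N -> imem s0 vb 0 = b -> (b < N)%N -> imem s0 vt 0 = t -> (t < N)%N ->
  (L < N)%N -> (L <= LM)%N ->
  (forall T s', frame (iwrites Query) (rwrites Query) s0 s' -> (T <= 300 * (bb + 1))%N ->
     mono (Xc s0) (Xc s') ->
     (forall k y, Xc s' k = Some y -> Xc s0 k = Some y \/ (k = (a * W + t)%N /\
        exists j d x, [/\ (j <= L)%N, Dc s0 j b = Some d, Xc s0 (b * W + t)%N = Some x & y = d + g ^+ j * x])) ->
     (forall j d x, (j <= L)%N -> Dc s0 j b = Some d -> Xc s0 (b * W + t)%N = Some x ->
        ole (Xc s' (a * W + t)%N) (d + g ^+ j * x)) -> Q T s') ->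
  wp M Query Q s0.
Proof.
move=> G P hlg H hs aN hb bN ht tN LN LL hQ.
have aW := ltn_trans aN NW; have bW := ltn_trans bN NW; have tW := ltn_trans tN NW.
have cE : imem s0 vcn 0 = size (hseq L b s0) by apply: h_cn H.
have E1 s : imem s vW 0 = W -> imem s vb 0 = b -> imem s vt 0 = t ->
    ieval M s (Ix (Var vb) (Var vt)) = (b * W + t)%N.
  by move=> h4 h1 h2; apply: (ievalIx W2 WM) => //=; rewrite mod0n.
have bE : beval M s0 (BAnd (BILe (INat 1) (Var vcn)) (BILe (INat 1) (IGet aXe (Ix (Var vb) (Var vt))))) =
    (0 < size (hseq L b s0))%N && (Xc s0 (b * W + t)%N != None).
  rewrite /= E1 ?(gW G)// mod0n cE (modn_small M1) /cell !lt0n.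
  by case: (imem s0 aXe _ == 0%N).
apply: wp_if; rewrite bE => hc; last first.
  apply: wp_skip; apply: hQ => //.
  - by rewrite /= icost_Ix /=; clear; lia.
  - by move=> k y; left.
  - move=> j d x jL dj xE; move: hc; rewrite xE andbT => /negP[].
    exact: hseq_pos H jL dj.
move: hc => /andP[sz0]; case xE : (Xc s0 _) => [x|//] _.
have [x0 xv] := (cell_some _ _ _ _ _).1 xE.
apply: wp_seq; apply: (wp_assign (x := 0%N)); first exact: mod0n.
move=> s1 f1 h1; apply: wp_seq; apply: (wp_assign (x := size (hseq L b s0))).
  by rewrite /= mod0n (f1.1 vcn isT).
move=> s2 f2 h2; have F2 := frame_cat f1 f2.
have szN : (size (hseq L b s0) <= N)%N by apply: leq_trans (hseq_size _ _ _) _.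
(* The index [vhi] may equal the number of kept lines, as if a further line began at infinity; the
   interval of indices halves each round, hence the power of 2. *)
pose inv i (st : state R) := [/\ (imem st vlo 0 < imem st vhi 0 <= size (hseq L b s0))%N,
  (imem st vhi 0 - imem st vlo 0 <= 2 ^ (bb - i))%N,
  imem st vlo 0 = 0%N \/ 0 <= rmem s0 rlo (nth 0%N (hseq L b s0) (imem st vlo 0)) + x &
  (imem st vhi 0 < size (hseq L b s0))%N ->
     rmem s0 rlo (nth 0%N (hseq L b s0) (imem st vhi 0)) + x < 0].
apply: wp_seq; apply: (@wp_for _ _ _ _ _ inv bb 70) => //.
- exact: ltn_trans bbW WltM.
- by rewrite /= mod0n (F2.1 vlg isT).
- rewrite /inv h2 (f2.1 vlo isT) h1; split=> //.
  + by rewrite sz0 leqnn.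
  + rewrite !subn0; apply: ltnW; apply: leq_ltn_trans szN _; exact: N_lt_exp.
  + by left.
  + by rewrite ltnn.
- move=> i s3 ib f3 hi [I1 I2 I3 I4]; have F3 := frame_cat F2 f3; have G3 := glob_frame F3 isT isT G.
  move: I1 I2 I3 I4; set p := imem s3 vlo 0; set q := imem s3 vhi 0 => /andP[pq qs] I2 I3 I4.
  have pW : (p + 2 < W)%N by move: pq qs szN W3; clear; move: N => n; nia.
  have qW : (q < W)%N by move: qs szN NW; clear; lia.
  have pqW : (p + q < W)%N by move: pq qs szN W3; clear; move: N => n; nia.
  apply: wp_if.
    have -> : beval M s3 (BILe (Var vlo +^ INat 2) (Var vhi)) = (p + 2 <= q)%N.
      by rewrite /= !mod0n (modW W2 WM W2) /iop_eval (modA W2 WM)// -/p; lia.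
    move=> pq2; pose r := ((p + q) %/ 2)%N.
    have rp : (p < r < q)%N by rewrite /r; move: pq2; clear; lia.
    apply: wp_seq; apply: (wp_assign (x := r)).
      rewrite /= !mod0n (modW W2 WM W2) /iop_eval -/p -/q (modA W2 WM (ltn_trans pq qW) qW).
      by rewrite (modW W2 WM)//; apply: leq_ltn_trans (leq_div _ _) pqW.
    move=> s4 f4 h4; have F4 := frame_cat F3 f4; have G4 := glob_frame F4 isT isT G.
    have rs : (r < size (hseq L b s0))%N by move: rp qs; clear; lia.
    have exd : (2 ^ (bb - i) = 2 * 2 ^ (bb - i.+1))%N.
      by rewrite -expnS; congr (2 ^ _)%N; move: ib; clear; lia.
    have vE : reval M s4 (RBin RAdd (RGet rlo (IGet ahl (Var vmd))) (RGet rXv (Ix (Var vb) (Var vt)))) =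
        rmem s0 rlo (nth 0%N (hseq L b s0) r) + x.
      rewrite /= E1 ?(gW G4) ?(F4.1 vb isT) ?(F4.1 vt isT)//.
      rewrite mod0n h4 (F4.1 ahl isT) (F4.2 rlo isT) (F4.2 rXv isT) xv (h_hl H)//.
      by rewrite cE.
    apply: wp_if; rewrite -[beval _ _ _]/(0 <= reval M s4 (RBin RAdd (RGet rlo (IGet ahl (Var vmd))) (RGet rXv (Ix (Var vb) (Var vt))))) vE => hr.
      apply: (wp_assign (x := r)); first by rewrite /= mod0n.
      move=> s5 f5 h5; split; first by rewrite /= !icost_Ix.
      rewrite /inv h5 (f5.1 vhi isT) (f4.1 vhi isT) -/q; split=> //.
      + by move: rp qs; clear; lia.
      + by move: I2; rewrite exd /r; clear; lia.
      + by right.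
    apply: (wp_assign (x := r)); first by rewrite /= mod0n.
    move=> s5 f5 h5; split; first by rewrite /= !icost_Ix.
    rewrite /inv h5 (f5.1 vlo isT) (f4.1 vlo isT) -/p; split=> //.
    + by move: rp qs; clear; lia.
    + by move: I2; rewrite exd /r; clear; lia.
    + by rewrite ltNge.
  have -> : beval M s3 (BILe (Var vlo +^ INat 2) (Var vhi)) = (p + 2 <= q)%N.
    by rewrite /= !mod0n (modW W2 WM W2) /iop_eval (modA W2 WM)// -/p; lia.
  move=> npq; apply: wp_skip; split=> //.
  split=> //; first by rewrite -/p -/q pq.
  have e0 : (0 < 2 ^ (bb - i.+1))%N by rewrite expn_gt0.
  by rewrite -/p -/q; move: npq e0; clear; lia.
move=> T3 s3 f3 _ [I1 I2 I3 I4] hT3; have F3 := frame_cat F2 f3; have G3 := glob_frame F3 isT isT G.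
move: I1 I2 I3 I4; set p := imem s3 vlo 0; set q := imem s3 vhi 0 => /andP[pq qs] I2 I3 I4.
(* After [bb] rounds the interval has length at most 2 ^ 0. *)
have qE : q = p.+1 by move: I2 pq; rewrite subnn expn0; clear; lia.
have ps : (p < size (hseq L b s0))%N by rewrite -qE.
set h := nth 0%N (hseq L b s0) p.
have [hL [d dh]] := hseq_mem ps; rewrite -/h in hL dh.
have hW : (h < W)%N by move: hL LN NW; clear; lia.
apply: wp_seq; apply: (wp_assign (x := h)).
  by rewrite /= mod0n -/p (F3.1 ahl isT) (h_hl H)// cE.
move=> s4 f4 h4; have F4 := frame_cat F3 f4; have G4 := glob_frame F4 isT isT G.
have X4 : Xc s4 = Xc s0 by rewrite /cell (F4.1 aXe isT) (F4.2 rXv isT).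
have [d0 dv] := (cell_some _ _ _ _ _).1 dh.
have E2 : ieval M s4 (Ix (Var vj) (Var vb)) = (h * W + b)%N.
  by apply: (ievalIx W2 WM) => //=; rewrite ?mod0n ?(gW G4)// (F4.1 vb isT).
have E4 : ieval M s4 (Ix (Var vb) (Var vt)) = (b * W + t)%N.
  by apply: E1; rewrite ?(gW G4) ?(F4.1 vb isT) ?(F4.1 vt isT).
apply: (wp_gmin W2 WM (i0 := (a * W + t)%N) (bb := true) (x := d + g ^+ h * x) (B := 150)) => //.
- by rewrite /= E2 (modn_small M1) (F4.1 aDe isT).
- by move=> _; apply: (ievalIx W2 WM) => //=; rewrite ?mod0n ?(gW G4) ?(F4.1 vs isT) ?(F4.1 vt isT).
- move=> _; rewrite /= E2 E4 mod0n h4 (F4.2 rDv isT) (F4.2 rpw isT) (F4.2 rXv isT).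
  by rewrite P ?xv ?dv//; apply: leq_trans hL LL.
move=> T5 s5 hT5 f5 []; rewrite X4 => m1 m2 m3; apply: hQ.
- exact: (frame_sub _ _ (frame_cat F4 f5)).
- by move: hT3 hT5 => /=; rewrite icost_Ix /=; clear; lia.
- exact: m1.
- move=> k y /m3[|[_ -> ->]]; [by left|right; split=> //].
  by exists h, d, x.
- move=> j d' x' jL dj; rewrite xE => -[<-].
  have : ole (Xc s5 (a * W + t)%N) (d + g ^+ h * x) by apply: m2.
  move=> /ole_trans; apply.
  apply: (hull_opt g0 g1 (h_lo1 H) (h_lo2 H) (h_hi1 H) (h_hi2 H) ps _ _ dh jL dj).
  + by case: I3 => [->|]; [left|right].
  + by move=> ps1; rewrite -qE; apply: I4; rewrite qE.
Qed.

(** * The downward phase *)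

Definition xcomp (X : nat -> option R) a := forall t y, (t < N)%N -> dle a t y ->
  ole (X (a * W + t)%N) y.

Definition qpart (q X : nat -> option R) L a := forall p v z t, walk a p v -> (size p <= L)%N ->
  (t < N)%N -> reach v t -> q v = Some z -> ole (X (a * W + t)%N) (fval p z).

(** [X0] is the table before, [X] the table after: prefixes of at most [L] edges from [a] to [b]
    have been combined with what was known at [b]. *)
Definition spart (X0 X : nat -> option R) L a b := forall p t x, walk a p b -> (size p <= L)%N ->
  (t < N)%N -> ole (X0 (b * W + t)%N) x -> ole (X (a * W + t)%N) (fval p x).

Lemma qpart_mono q X X' L a : mono X X' -> qpart q X L a -> qpart q X' L a.
Proof. by move=> h h1 p v z t *; apply/h/(h1 p v z t). Qed.

Lemma spart_mono X0 X1 X X' L a b : mono X1 X0 -> mono X X' -> spart X0 X L a b -> spart X1 X' L a b.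
Proof. by move=> h h' h1 p t x hw sz tN /h hx; apply/h'/h1. Qed.

(** This instantiates [level_complete] for each target separately. The levels, [Q] and the hitting
    sets do not depend on the target, only the distance function does. *)
Lemma xcomp_step (S : nat -> seq nat) top (q X0 X : nat -> option R) i a :
  (forall v, (v < N)%N -> v \in S 0%N) -> S top = [::] ->
  (forall l, (l < top)%N -> hits (S l) (S l.+1) (kk ^ l.+1)) ->
  (forall l b, (l < top)%N -> b \in S l -> qdone q (kk ^ l.+1) b) ->
  (i < top)%N -> a \in S i -> (a < N)%N -> xdone X (kk ^ i.+1) a -> qpart q X (kk ^ i.+1) a ->
  (forall b, b \in S i.+1 -> spart X0 X (kk ^ i.+1) a b /\ xcomp X0 b) -> xcomp X a.
Proof.
move=> S0 St hS hq itop aS aN hx hqp hsp t y tN ay.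
(* The distances to [t] as one function; 0 stands in where [t] cannot be reached, and there [dlb]
   holds vacuously. *)
have /choice[d hd] : forall v, exists x, (reach v t -> dle v t x) /\ dlb m src dst cst g v t x.
  move=> v; have [vt|nvt] := pselect (reach v t).
    by have [x [h1 h2]] := dist_exists cst g0 g1 vt; exists x; split.
  by exists 0; split=> // p hp; case: nvt; exists p.
have [hd1 hd2] : (forall v, reach v t -> dle v t (d v)) /\ (forall v, dlb m src dst cst g v t (d v)).
  by split=> v; case: (hd v).
have rt := dle_reach ay.
apply: ole_trans (dle_dlb ay (hd2 a)).
have lc := @level_complete _ N m src dst cst g g0 g1 dstN t d hd1 hd2 S (fun l => kk ^ l.+1)%N
  top q S0 St hS _ i (fun s => X (s * W + t)%N) a.
apply: lc => //.
- by move=> l s C ltop sS hC szC; apply: (hq l s ltop sS).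
- by move=> p hw sz; apply: hx.
- by move=> p v z hw sz vt qz; apply: (hqp p v z t).
- move=> p b bS hw sz bt; have [sp cb] := hsp b bS.
  by apply: sp => //; apply: cb => //; apply: hd1.
Qed.

Lemma wp_StepB s0 a b L lev r (Q : nat -> state R -> Prop) :
  glob s0 -> pwok s0 -> imem s0 vlg 0 = bb -> imem s0 vlev 0 = lev -> (lev.+1 < W)%N ->
  imem s0 vr2 0 = r -> (r < N)%N -> imem s0 aS (lev.+1 * W + r) = b -> (b < N)%N ->
  imem s0 vs 0 = a -> (a < N)%N -> imem s0 vL 0 = L -> (L < N)%N -> (L <= LM)%N ->
  dpok N m src dst cst g a L (Dc s0) (Dp s0) -> xsound (Xc s0) ->
  (forall T s', frame (iwrites StepB) (rwrites StepB) s0 s' ->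
     (T <= 2000 * (L + 1) * (L + 1) + 400 * (N + 1) * (bb + 1))%N ->
     xsound (Xc s') -> mono (Xc s0) (Xc s') -> spart (Xc s0) (Xc s') L a b -> Q T s') ->
  wp M StepB Q s0.
Proof.
move=> G P hlg hlev levW hr rN hb bN hs aN hL LN LL hD xs hQ.
have rW := ltn_trans rN NW.
apply: wp_seq; apply: (wp_assign (x := b)).
  have E1 : ieval M s0 (Var vlev +^ INat 1) = lev.+1 by apply: (ieval_incr W2 WM) => //; apply: ltnW.
  have E2 : ieval M s0 (Var vr2) = r by rewrite /= mod0n.
  by rewrite [LHS]/= (ievalIx W2 WM (gW G) E1 E2).
move=> s1 f1 h1; have G1 := glob_frame f1 isT isT G.
have P1 : pwok s1 by move=> l lL; rewrite (f1.2 rpw isT) P.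
apply: wp_seq; apply: (wp_Hull (L := L) (b := b) G1 P1) => //.
  by rewrite (f1.1 vL isT).
move=> T2 s2 f2 hT2 H2; have F2 := frame_cat f1 f2.
have D2 : Dc s2 = Dc s0 by rewrite /Dc /cell (F2.1 aDe isT) (F2.2 rDv isT).
have X2 : Xc s2 = Xc s0 by rewrite /cell (F2.1 aXe isT) (F2.2 rXv isT).
apply: (@wp_for _ _ _ _ _ (fun i st => [/\ xsound (Xc st), mono (Xc s0) (Xc st) &
  forall t j d x, (t < i)%N -> (j <= L)%N -> Dc s0 j b = Some d -> Xc s0 (b * W + t)%N = Some x ->
    ole (Xc st (a * W + t)%N) (d + g ^+ j * x)]) N (300 * (bb + 1))) => //.
- exact: ltn_trans NW WltM.
- by rewrite /= mod0n (F2.1 vN isT) (gN G).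
- by rewrite X2; split.
- move=> t s3 tN f3 ht [I1 I2 I3]; have F3 := frame_cat F2 f3; have G3 := glob_frame F3 isT isT G.
  have P3 : pwok s3 by move=> l lL; rewrite (F3.2 rpw isT) P.
  have H3 : hok L b s3 := hok_frame f3 isT isT H2.
  have D3 : Dc s3 = Dc s0 by rewrite /Dc /cell (F3.1 aDe isT) (F3.2 rDv isT).
  apply: (wp_Query (a := a) (b := b) (t := t) (L := L) G3 P3) => //.
  + by rewrite (F3.1 vlg isT).
  + by rewrite (F3.1 vs isT).
  + by rewrite (f3.1 vb isT) (f2.1 vb isT).
  move=> T4 s4 f4 hT4 m1 m2 m3; split=> //; rewrite D3 in m2 m3; split.
  + move=> u t' y uN tN' /m2[|[kE [j [d [x [jL dj xE ->]]]]]]; first exact: I1.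
    have : (u * W + t' == a * W + t)%N by rewrite kE.
    rewrite idx_eq ?(ltn_trans _ NW)// => /andP[/eqP-> /eqP->].
    have [w sz fx _] := dp_sound srcN hD aN jL bN dj.
    have -> : d + g ^+ j * x = fval (pwalk src (Dp s0) j b) x by rewrite fvalE fx sz.
    by apply: (dle_pre g0 g1 w); apply: I1.
  + exact: mono_trans I2 m1.
  + move=> t' j d x; rewrite ltnS leq_eqVlt => /orP[/eqP->|t't] jL dj xE; last first.
      by apply: m1; apply: I3.
    (* The query uses the current entry for (b,t), which may have dropped since the start of the
       loop; a smaller continuation only lowers the result. *)
    have : ole (Xc s3 (b * W + t)%N) x by apply: I2; rewrite xE /=.
    case xE3 : (Xc s3 _) => [x3|] //= le3.
    apply: (@ole_trans _ _ (d + g ^+ j * x3)); first exact: m3.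
    by rewrite lerD2l ler_pM2l// exprn_gt0.
- move=> T3 s3 f3 _ [I1 I2 I3] hT3; apply: hQ => //.
  + exact: (frame_sub _ _ (frame_cat F2 f3)).
  + by move: hT2 hT3 => /=; rewrite icost_Ix /=; clear; nia.
  + move=> p t x hw sz tN; case xE : (Xc s0 _) => [x0|] //= le0.
    have := dp_le dstN hD aN hw sz; case dx : (Dc s0 _ b) => [d|] //= dp.
    apply: ole_trans (I3 t _ d x0 tN sz dx xE) _.
    by rewrite [leRHS]fvalE; apply: lerD => //; rewrite ler_pM2l// exprn_gt0.
Qed.

Definition step_cost L := (2000 * (L + 1) * (L + 1) + 400 * (N + 1) * (bb + 1) + 20)%N.

Lemma wp_RowDown s0 a L lev (Q : nat -> state R -> Prop) :
  glob s0 -> pwok s0 -> repok s0 -> ordok s0 -> imem s0 vlg 0 = bb ->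
  imem s0 vlev 0 = lev -> (lev.+1 < W)%N ->
  (imem s0 anS lev.+1 <= N)%N -> all (fun b => b < N)%N (Slist s0 lev.+1) ->
  ((0 < imem s0 anS lev.+1)%N -> (L < N)%N) ->
  imem s0 vs 0 = a -> (a < N)%N -> imem s0 vL 0 = L -> (L <= LM)%N ->
  xsound (Xc s0) -> qsound (Qc s0) ->
  (forall T s', frame (iwrites RowDown) (rwrites RowDown) s0 s' ->
     (T <= 1000 * (L + 1) * (N + m + 1) + imem s0 anS lev.+1 * step_cost L)%N ->
     xsound (Xc s') -> mono (Xc s0) (Xc s') -> qpart (Qc s0) (Xc s') L a ->
     (forall b, b \in Slist s0 lev.+1 -> spart (Xc s0) (Xc s') L a b) -> Q T s') ->
  wp M RowDown Q s0.
Proof.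
move=> G P Rp O hlg hlev levW nN bN Ln hs aN hL LL xs qs hQ.
apply: wp_seq; apply: wp_weaken (wp_DP G P hs aN hL LL) => T1 s1 f1 [hT1 hD].
have G1 := glob_frame f1 isT isT G.
have P1 : pwok s1 by move=> l lL; rewrite (f1.2 rpw isT) P.
have X1 : Xc s1 = Xc s0 by rewrite /cell (f1.1 aXe isT) (f1.2 rXv isT).
have Q1 : Qc s1 = Qc s0 by rewrite /cell (f1.1 aQe isT) (f1.2 rQv isT).
apply: wp_seq; apply: (wp_BRow (a := a) (L := L) G1 P1) => //; rewrite ?X1 ?Q1//.
- by move=> u uN; rewrite (f1.1 arep isT) Rp.
- by case: O => el [? ? o3]; exists el; split=> //; rewrite (f1.1 aord isT).
- by rewrite (f1.1 vs isT).
- by rewrite (f1.1 vL isT).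
move=> T2 s2 f2 hT2 xs2 mx2 qp2; have F2 := frame_cat f1 f2.
have D2 : Dc s2 = Dc s1 by rewrite /Dc /cell (f2.1 aDe isT) (f2.2 rDv isT).
have Dp2 : Dp s2 = Dp s1 by rewrite /Dp (f2.1 apar isT).
set n := imem s0 anS lev.+1 in nN Ln hQ *.
apply: (@wp_for _ _ _ _ _ (fun r st => [/\ xsound (Xc st), mono (Xc s2) (Xc st) &
  forall r', (r' < r)%N -> spart (Xc s0) (Xc st) L a (nth 0%N (Slist s0 lev.+1) r')]) n
  (2000 * (L + 1) * (L + 1) + 400 * (N + 1) * (bb + 1))) => //.
- exact: leq_ltn_trans nN (ltn_trans NW WltM).
- rewrite [LHS]/= -[iop_eval _ _ _ _]/(ieval M s2 (Var vlev +^ INat 1)).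
  rewrite (ieval_incr W2 WM (j := lev)) ?(F2.1 anS isT)//; last exact: ltnW.
  by rewrite (F2.1 vlev isT).
- by split.
- move=> r s3 rn f3 hr [I1 I2 I3]; have F3 := frame_cat F2 f3; have G3 := glob_frame F3 isT isT G.
  have P3 : pwok s3 by move=> l lL; rewrite (F3.2 rpw isT) P.
  have LN : (L < N)%N by apply: Ln; apply: leq_ltn_trans rn.
  apply: (wp_StepB (a := a) (b := nth 0%N (Slist s0 lev.+1) r) (L := L) (lev := lev) (r := r) G3 P3) => //.
  + by rewrite (F3.1 vlg isT).
  + by rewrite (F3.1 vlev isT).
  + exact: leq_trans rn nN.
  + by rewrite nth_Slist// (F3.1 aS isT).
  + by apply: (allP bN); apply: mem_nth; rewrite size_Slist.
  + by rewrite (F3.1 vs isT).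
  + by rewrite (F3.1 vL isT).
  + have -> : Dc s3 = Dc s1 by rewrite -D2 /Dc /cell (f3.1 aDe isT) (f3.2 rDv isT).
    by have -> : Dp s3 = Dp s1 by rewrite -Dp2 /Dp (f3.1 apar isT).
  move=> T4 s4 f4 hT4 xs4 m4 sp4; split=> //; split=> //; first exact: mono_trans I2 m4.
  move=> r'; rewrite ltnS leq_eqVlt => /orP[/eqP->|/I3 h].
    by apply: spart_mono sp4 => //; apply: mono_trans mx2 I2.
  exact: spart_mono h.
- move=> T3 s3 f3 _ [I1 I2 I3] hT3; apply: hQ => //.
  + exact: (frame_sub _ _ (frame_cat F2 f3)).
  + by move: hT1 hT2 hT3; rewrite /step_cost /=; clear; nia.
  + exact: mono_trans mx2 I2.
  + by apply: qpart_mono I2 _ => p v z t; apply: qp2.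
  + by move=> b /(nthP 0%N)[r]; rewrite size_Slist => rn <-; apply: I3.
Qed.

Lemma wp_LevelDown s0 L lev (Q : nat -> state R -> Prop) :
  glob s0 -> pwok s0 -> repok s0 -> ordok s0 -> imem s0 vlg 0 = bb ->
  imem s0 vlev 0 = lev -> (lev.+1 < W)%N ->
  (imem s0 anS lev <= N)%N -> all (fun b => b < N)%N (Slist s0 lev) ->
  (imem s0 anS lev.+1 <= N)%N -> all (fun b => b < N)%N (Slist s0 lev.+1) ->
  ((0 < imem s0 anS lev.+1)%N -> (L < N)%N) ->
  imem s0 vL 0 = L -> (L <= LM)%N -> xsound (Xc s0) -> qsound (Qc s0) ->
  (forall T s', frame (iwrites LevelDown) (rwrites LevelDown) s0 s' ->
     (T <= imem s0 anS lev * (1100 * (L + 1) * (N + m + 1) + imem s0 anS lev.+1 * step_cost L) + 20)%N ->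
     xsound (Xc s') -> mono (Xc s0) (Xc s') ->
     (forall a, a \in Slist s0 lev -> qpart (Qc s0) (Xc s') L a /\
        forall b, b \in Slist s0 lev.+1 -> spart (Xc s0) (Xc s') L a b) -> Q T s') ->
  wp M LevelDown Q s0.
Proof.
move=> G P Rp O hlg hlev levW nN aN nN1 bN Ln hL LL xs qs hQ.
set n := imem s0 anS lev in nN hQ *.
apply: (@wp_for _ _ _ _ _ (fun r st => [/\ xsound (Xc st), mono (Xc s0) (Xc st) &
  forall r', (r' < r)%N -> let a := nth 0%N (Slist s0 lev) r' in qpart (Qc s0) (Xc st) L a /\
    forall b, b \in Slist s0 lev.+1 -> spart (Xc s0) (Xc st) L a b]) n
  (1000 * (L + 1) * (N + m + 1) + imem s0 anS lev.+1 * step_cost L + 20)) => //.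
- exact: leq_ltn_trans nN (ltn_trans NW WltM).
- by rewrite /= mod0n hlev.
- by split.
- move=> r s1 rn f1 hr [I1 I2 I3]; have G1 := glob_frame f1 isT isT G.
  have rW : (r < W)%N by apply: ltn_trans rn (leq_ltn_trans nN NW).
  apply: wp_seq; apply: (wp_assign (x := nth 0%N (Slist s0 lev) r)).
    rewrite [LHS]/= (ievalIx W2 WM (i := lev) (j := r)) ?(gW G1)//=; rewrite ?mod0n//.
    + by rewrite nth_Slist// (f1.1 aS isT).
    + by rewrite (f1.1 vlev isT).
    + exact: ltnW.
  move=> s2 f2 h2; have F2 := frame_cat f1 f2; have G2 := glob_frame F2 isT isT G.
  have P2 : pwok s2 by move=> l lL; rewrite (F2.2 rpw isT) P.
  have X2 : Xc s2 = Xc s1 by rewrite /cell (f2.1 aXe isT) (f2.2 rXv isT).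
  have Q2 : Qc s2 = Qc s0 by rewrite /cell (F2.1 aQe isT) (F2.2 rQv isT).
  have n2 l : imem s2 anS l = imem s0 anS l by rewrite (F2.1 anS isT).
  have S2 l : Slist s2 l = Slist s0 l by apply: Slist_eq => // i _; rewrite (F2.1 aS isT).
  apply: (wp_RowDown (a := nth 0%N (Slist s0 lev) r) (L := L) (lev := lev) G2 P2) => //; rewrite ?n2 ?S2 ?X2 ?Q2//.
  + by move=> u uN; rewrite (F2.1 arep isT) Rp.
  + by case: O => el [? ? o3]; exists el; split=> //; rewrite (F2.1 aord isT).
  + by rewrite (F2.1 vlg isT).
  + by rewrite (F2.1 vlev isT).
  + by apply: (allP aN); apply: mem_nth; rewrite size_Slist.
  + by rewrite (F2.1 vL isT).
  move=> T3 s3 f3 hT3 xs3 m3 qp3 sp3; split; first by move: hT3; rewrite /= icost_Ix /=; clear; lia.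
  split=> //; first exact: mono_trans I2 m3.
  move=> r'; rewrite ltnS leq_eqVlt => /orP[/eqP->|/I3[k1 k3]].
    by split=> // b bS; apply: spart_mono (sp3 b bS).
  by split=> [|b bS]; [apply: qpart_mono k1|apply: spart_mono (k3 b bS)].
- move=> T3 s3 f3 _ [I1 I2 I3] hT3; apply: hQ => //.
  + exact: (frame_sub _ _ f3).
  + by move: hT3 => /=; clear; nia.
  + by move=> a /(nthP 0%N)[r]; rewrite size_Slist => rn <-; apply: I3.
Qed.

Definition down_cost := (1100 * (4 * N * kk * bb) * (N + m + 1) + 32 * 1000 * (N * N * kk * (bb * bb)) +
  840 * (bb + 1) * (4 * (N * N * N) * (bb * bb) %/ (kk * kk * kk)) + 100)%N.

Lemma upinv_pow top q s l : upinv top q s -> (0 < l < top)%N -> (kk ^ l < N)%N.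
Proof.
move=> U; case: l => // l /= lt; apply: (ui_LN U (ltnW lt)).
exact: (ui_pos U lt).
Qed.

Lemma upinv_mul top q s l : upinv top q s -> (0 < l <= top)%N ->
  (imem s anS l * kk ^ l <= 2 * N * bb)%N.
Proof.
move=> U; case: l => // l /= lt; have [n0|n0] := posnP (imem s anS l.+1).
  by rewrite n0 mul0n.
by apply: (small_mul (ui_small U lt)); apply: ltnW; apply: (ui_LN U lt).
Qed.

(** With |S_l| k^l and |S_(l+1)| k^(l+1) both at most 2 N bb, the dynamic programs cost N k (N + m)
    and the envelopes N^2 k, up to logarithms. The queries number |S_l| |S_(l+1)| N, of order N^3 /
    k^(2l+1), which is within N^3 / k^3 only for l > 0; hence the separate treatment of level 0. *)
Lemma down_time top q s l : upinv top q s -> (0 < l < top)%N ->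
  (imem s anS l * (1100 * (kk ^ l.+1 + 1) * (N + m + 1) + imem s anS l.+1 * step_cost (kk ^ l.+1)) + 100
   <= down_cost)%N.
Proof.
move=> U /andP[l0 lt].
have h1 : (imem s anS l * kk ^ l <= 2 * N * bb)%N by apply: upinv_mul U _; rewrite l0 ltnW.
have h2 : (imem s anS l.+1 * kk ^ l.+1 <= 2 * N * bb)%N by apply: upinv_mul U _.
have hp : (kk * kk <= kk * kk ^ l)%N.
  by rewrite leq_mul2l -[X in (X <= _)%N]expn1 leq_exp2l// l0 orbT.
have N0 : (0 < N)%N by have := upinv_pow U (l := l); rewrite l0 lt => /(_ isT); lia.
rewrite /step_cost /down_cost; rewrite expnS in h2 *.
have L0 : (0 < kk * kk ^ l)%N by rewrite muln_gt0 expn_gt0 (ltnW k2).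
move: h1 h2 hp L0 (k2) N0.
move: (imem s anS l) (imem s anS l.+1) (kk ^ l)%N => a b x.
move: (kk) (m) (bb) (N) => k m' c n h1 h2 hp L0 k2' N0.
have A : (a * (k * x + 1) <= 4 * n * k * c)%N.
  apply: (@leq_trans (2 * k * (a * x))%N); last first.
    by apply: (@leq_trans (2 * k * (2 * n * c))%N); [rewrite leq_mul2l h1 orbT|clear; lia].
  have : (a * 1 <= a * (k * x))%N by rewrite leq_mul2l L0 orbT.
  by clear; lia.
have B : (b * (k * x + 1) <= 4 * n * c)%N.
  have : (b * 1 <= b * (k * x))%N by rewrite leq_mul2l L0 orbT.
  by move: h2; clear; lia.
have C1 : (a * b * (k * k * k) <= 4 * (n * n) * (c * c))%N.
  apply: (@leq_trans ((a * x) * (b * (k * x)))%N).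
    have -> : ((a * x) * (b * (k * x)) = a * b * (k * x * x))%N by ring.
    rewrite leq_mul2l; apply/orP; right; apply: leq_mul => //.
    by move: hp; rewrite leq_pmul2l ?(ltnW k2').
  apply: leq_trans (leq_mul h1 h2) _; by clear; lia.
(* The quotient is kept, since the defining inequality of k is used only when all costs are added
   up. *)
have Z : (a * b * n <= 4 * (n * n * n) * (c * c) %/ (k * k * k))%N.
  rewrite leq_divRL ?muln_gt0 ?(ltnW k2')//.
  have -> : (a * b * n * (k * k * k) = a * b * (k * k * k) * n)%N by ring.
  apply: (@leq_trans (4 * (n * n) * (c * c) * n)%N); first by rewrite leq_mul2r C1 orbT.
  by clear; lia.
have e1 : (a * (1100 * (k * x + 1) * (n + m' + 1)) <= 1100 * (4 * n * k * c) * (n + m' + 1))%N.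
  have -> : (a * (1100 * (k * x + 1) * (n + m' + 1)) = a * (k * x + 1) * (1100 * (n + m' + 1)))%N by ring.
  have -> : (1100 * (4 * n * k * c) * (n + m' + 1) = 4 * n * k * c * (1100 * (n + m' + 1)))%N by ring.
  by rewrite leq_mul2r A orbT.
have e2 : (a * b * (2000 * (k * x + 1) * (k * x + 1)) <= 32 * 1000 * (n * n * k * (c * c)))%N.
  have -> : (a * b * (2000 * (k * x + 1) * (k * x + 1)) = 2000 * ((a * (k * x + 1)) * (b * (k * x + 1))))%N by ring.
  have -> : (32 * 1000 * (n * n * k * (c * c)) = 2000 * ((4 * n * k * c) * (4 * n * c)))%N by ring.
  by rewrite leq_mul2l leq_mul.
have e3 : (a * b * (400 * (n + 1) * (c + 1) + 20) <= 840 * (c + 1) * (a * b * n))%N.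
  have h : (400 * (n + 1) * (c + 1) + 20 <= 840 * (c + 1) * n)%N by move: N0; clear; nia.
  have := leq_mul (leqnn (a * b)%N) h; by clear; lia.
have e4 : (840 * (c + 1) * (a * b * n) <= 840 * (c + 1) * (4 * (n * n * n) * (c * c) %/ (k * k * k)))%N.
  by rewrite leq_mul2l Z orbT.
have -> : (a * (1100 * (k * x + 1) * (n + m' + 1) + b * (2000 * (k * x + 1) * (k * x + 1) + 400 * (n + 1) * (c + 1) + 20)) + 100 =
  a * (1100 * (k * x + 1) * (n + m' + 1)) + a * b * (2000 * (k * x + 1) * (k * x + 1)) + a * b * (400 * (n + 1) * (c + 1) + 20) + 100)%N by ring.
by rewrite leq_add2r; apply: leq_add; [apply: leq_add|apply: leq_trans e3 e4].
Qed.

Lemma wp_DownAll s0 top q (Q : nat -> state R -> Prop) :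
  glob s0 -> pwok s0 -> repok s0 -> ordok s0 -> imem s0 vlg 0 = bb -> imem s0 vk 0 = kk -> (kk < W)%N ->
  upinv top q s0 -> imem s0 anS top = 0%N -> (top <= bb)%N ->
  (forall T s', frame (iwrites DownAll) (rwrites DownAll) s0 s' ->
     (T <= (bb + 1) * down_cost)%N ->
     xsound (Xc s') -> mono (Xc s0) (Xc s') ->
     ((0 < top)%N -> forall b, b \in Slist s0 1 -> xcomp (Xc s') b) -> Q T s') ->
  wp M DownAll Q s0.
Proof.
move=> G P Rp O hlg hk kW U n0 topb hQ.
have St : Slist s0 top = [::] by rewrite /Slist n0.
(* The loop ends at level 1, or at level 0 if [top] is 0; the minimum covers both. *)
apply: (@wp_while _ _ _ _ (fun T st => exists l, [/\ imem st vlev 0 = l, imem st vL 0 = (kk ^ l.+1)%N,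
    (l <= top)%N /\ (minn 1 top <= l)%N, (T <= (top - l) * down_cost)%N &
    [/\ xsound (Xc st), mono (Xc s0) (Xc st) & forall b, b \in Slist s0 l -> xcomp (Xc st) b]])
   (fun st => imem st vlev 0)).
- exists top; split=> //; [exact: ui_lev U|exact: ui_L U|by rewrite geq_minr|].
  by split=> //; [exact: ui_x U|move=> b; rewrite St].
- move=> T st hf [l [hl hL [lt l1] hT [xs mx xc]]]; rewrite /= mod0n (modW W2 WM W2) hl => l2.
  have lW : (l < W)%N by move: lt topb bbW; clear; lia.
  have kl : (0 < kk ^ l)%N by rewrite expn_gt0 (ltnW k2).
  case: l hl hL lt l1 hT xc l2 lW kl => // l hl hL lt l1 hT xc l2 lW kl.
  have hpow : (kk ^ l < N)%N by apply: upinv_pow U _; rewrite lt andbT.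
  have LL : (kk ^ l.+1 <= LM)%N.
    by apply: leq_trans kL; rewrite expnSr leq_mul2r (ltnW hpow) orbT.
  apply: wp_seq; apply: (wp_assign (x := l)).
    by rewrite /= mod0n hl /iop_eval (modn_small M1) (modB W2 WM)// subn1.
  move=> s1 f1 h1; have F1 := frame_cat hf f1.
  apply: wp_seq; apply: (wp_assign (x := (kk ^ l.+1)%N)).
    rewrite /= !mod0n /iop_eval (f1.1 vL isT) hL (F1.1 vk isT) hk expnSr mulnK ?(ltnW k2)//.
    by rewrite (modW W2 WM)//; move: LL LW; clear; lia.
  move=> s2 f2 h2; have F2 := frame_cat F1 f2; have G2 := glob_frame F2 isT isT G.
  have P2 : pwok s2 by move=> j jL; rewrite (F2.2 rpw isT) P.
  have n2 i : imem s2 anS i = imem s0 anS i by rewrite (F2.1 anS isT).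
  have S2 i : Slist s2 i = Slist s0 i by apply: Slist_eq => // r _; rewrite (F2.1 aS isT).
  have X2 : Xc s2 = Xc st by rewrite /cell (f2.1 aXe isT) (f1.1 aXe isT) (f2.2 rXv isT) (f1.2 rXv isT).
  have Q2 : Qc s2 = Qc s0 by rewrite /cell (F2.1 aQe isT) (F2.2 rQv isT).
  have [nN aN] := ui_n U (ltnW lt); have [nN1 aN1] := ui_n U lt.
  apply: (wp_LevelDown (L := (kk ^ l.+1)%N) (lev := l) G2 P2) => //; rewrite ?n2 ?S2 ?X2 ?Q2//.
  + by move=> u uN; rewrite (F2.1 arep isT) Rp.
  + by case: O => el [? ? o3]; exists el; split=> //; rewrite (F2.1 aord isT).
  + by rewrite (F2.1 vlg isT).
  + by rewrite (f2.1 vlev isT).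
  + exact: (ui_LN U lt).
  + exact: (ui_xq U).
  move=> T3 s3 f3 hT3 xs3 m3 done; split; last first.
    by rewrite (f3.1 vlev isT) (f2.1 vlev isT) h1.
  exists l; split.
  + by rewrite (f3.1 vlev isT) (f2.1 vlev isT).
  + by rewrite (f3.1 vL isT).
  + by split; [apply: ltnW|apply: leq_trans (geq_minl _ _) _].
  + have dt : (imem s0 anS l * (1100 * (kk ^ l.+1 + 1) * (N + m + 1) + imem s0 anS l.+1 * step_cost (kk ^ l.+1)) + 100
       <= down_cost)%N by apply: down_time U _; rewrite lt andbT.
    have -> : (top - l = (top - l.+1).+1)%N by move: lt; clear; lia.
    rewrite mulSn; move: hT hT3 dt; set x := ((top - l.+1) * down_cost)%N; rewrite /=.
    by move: (imem s0 anS l * _)%N (down_cost) => y z; clear; lia.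
  + have mx3 : mono (Xc s0) (Xc s3) := mono_trans mx m3.
    split=> // a aS; have [qp sp] := done a aS.
    apply: (xcomp_step (S := Slist s0) (top := top) (q := Qc s0) (X0 := Xc st) (i := l)) => //.
    * by move=> v vN; rewrite (ui_S0 U) mem_iota.
    * by move=> i it; apply: (ui_hits U).
    * by move=> i b it bS; case: (ui_done U it bS).
    * exact: (allP aN).
    * by apply: xdone_mono mx3 _; case: (ui_done U lt aS).
    * by move=> b bS; split; [apply: sp|apply: xc].
- move=> T st hf [l [hl hL [lt l1] hT [xs mx xc]]]; rewrite /= mod0n (modW W2 WM W2) hl -ltnNge => l2.
  apply: hQ => //.
  + have d0 : (100 <= down_cost)%N by rewrite leq_addl.
    have : ((top - l) * down_cost <= bb * down_cost)%N.
      by rewrite leq_mul2r; apply/orP; right; move: topb; clear; lia.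
    by move: hT d0; set x := ((top - l) * down_cost)%N; move: (down_cost) => z /=; clear; lia.
  + move=> top0 b bS; apply: xc; suff -> : l = 1%N by [].
    by move: l1 l2 top0; clear; lia.
Qed.

(** * Level 0 and the complete algorithm *)

Lemma wp_FinQ s0 (Q : nat -> state R -> Prop) :
  glob s0 -> marks s0 -> qsound (Qc s0) -> xsound (Xc s0) ->
  (forall T s', frame (iwrites FinQ) (rwrites FinQ) s0 s' ->
     (T <= 200 * (N + 1) * (N + 1))%N -> xsound (Xc s') -> mono (Xc s0) (Xc s') ->
     (forall v t z, (v < N)%N -> (t < N)%N -> reach v t -> Qc s0 v = Some z ->
        ole (Xc s' (v * W + t)%N) z) -> Q T s') ->
  wp M FinQ Q s0.
Proof.
move=> G A qs xs hQ.
pose C v k y := exists2 t, (t < N)%N & [/\ reach v t, Qc s0 v = Some y & k = (v * W + t)%N].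
apply: (wp_for_min (fe := aXe) (fv := rXv) (C := C) (n := N) (B := 150 * (N + 1))) => //.
- exact: ltn_trans NW WltM.
- by rewrite /= mod0n (gN G).
- move=> v s1 vN' f1 hv; have G1 := glob_frame f1 isT isT G.
  pose C' t k y := [/\ reach v t, Qc s0 v = Some y & k = (v * W + t)%N].
  apply: (wp_for_min (fe := aXe) (fv := rXv) (C := C') (n := N) (B := 110)) => //.
  + exact: ltn_trans NW WltM.
  + by rewrite /= mod0n (gN G1).
  + move=> t s2 tN f2 ht; have F2 := frame_cat f1 f2; have G2 := glob_frame F2 isT isT G.
    have hv2 : imem s2 vs 0 = v by rewrite (f2.1 vs isT).
    have E1 : ieval M s2 (Ix (Var vs) (Var vt)) = (v * W + t)%N.
      apply: (ievalIx W2 WM) => //=; rewrite ?mod0n ?(gW G2)//; exact: ltn_trans NW.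
    apply: (wp_gmin W2 WM (i0 := (v * W + t)%N)
      (bb := `[< reach v t >] && (0 < imem s0 aQe v)%N) (x := rmem s0 rQv v) (B := 110)) => //.
    * rewrite /= E1 mod0n hv2 (modn_small M1) (F2.1 amark isT) (F2.1 aQe isT) A//.
      by case: (`[< _ >]).
    * by rewrite /= mod0n hv2 (F2.2 rQv isT).
    move=> T s3 hT _ mu; split=> //; apply: minupd_iff mu => k y; split.
      by move=> [/andP[/asboolP r0 q0] -> ->]; split=> //; apply/cell_some.
    by move=> [r0 /cell_some[q0 ->] ->]; split=> //; apply/andP; split=> //; apply/asboolP.
  + by move=> T s2 f2 hT mu; split=> //; move: hT => /=; clear; nia.
- move=> T s1 f1 hT [m1 m2 m3]; apply: hQ => //.
  + exact: (frame_sub _ _ f1).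
  + by move: hT => /=; clear; nia.
  + move=> u t x uN tN /m3[|[v vN' [t' tN' [vt qv kE]]]]; first exact: xs.
    have : (u * W + t == v * W + t')%N by rewrite kE.
    rewrite idx_eq ?(ltn_trans _ NW)// => /andP[/eqP-> /eqP->].
    exact: qs qv _ vt.
  + by move=> v t z vN' tN vt qv; apply: m2; exists v => //; exists t.
Qed.

Definition estep (X X' : nat -> option R) e t := forall y, ole (X (dst e * W + t)%N) y ->
  ole (X' (src e * W + t)%N) (cst e + g * y).

Lemma wp_Relax s0 (Q : nat -> state R -> Prop) :
  glob s0 -> xsound (Xc s0) ->
  (forall T s', frame (iwrites Relax) (rwrites Relax) s0 s' ->
     (T <= 200 * (m + 1) * (N + 1))%N -> xsound (Xc s') -> mono (Xc s0) (Xc s') ->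
     (forall e t, (e < m)%N -> (t < N)%N -> estep (Xc s0) (Xc s') e t) -> Q T s') ->
  wp M Relax Q s0.
Proof.
move=> G xs hQ.
apply: (@wp_for _ _ _ _ _ (fun i st => [/\ xsound (Xc st), mono (Xc s0) (Xc st) &
  forall e t, (e < i)%N -> (t < N)%N -> estep (Xc s0) (Xc st) e t]) m (150 * (N + 1))) => //.
- exact: ltn_trans mW WltM.
- by rewrite /= modn_small// (gm G).
- by split.
- move=> e s1 em f1 he [I1 I2 I3]; have G1 := glob_frame f1 isT isT G.
  have sN := srcN em; have dN := dstN em.
  apply: (@wp_for _ _ _ _ _ (fun i st => [/\ xsound (Xc st), mono (Xc s1) (Xc st) &
    forall t, (t < i)%N -> estep (Xc s1) (Xc st) e t]) N 120) => //.
  + exact: ltn_trans NW WltM.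
  + by rewrite /= mod0n (gN G1).
  + by split.
  + move=> t s2 tN f2 ht [J1 J2 J3]; have F2 := frame_cat f1 f2; have G2 := glob_frame F2 isT isT G.
    have he2 : imem s2 ve 0 = e by rewrite (f2.1 ve isT).
    have Es : ieval M s2 (Ix (IGet asrc (Var ve)) (Var vt)) = (src e * W + t)%N.
      apply: (ievalIx W2 WM) => //=; rewrite ?mod0n ?(gW G2) ?he2 ?(gsrc G2)//; exact: ltn_trans NW.
    have Ed : ieval M s2 (Ix (IGet adst (Var ve)) (Var vt)) = (dst e * W + t)%N.
      apply: (ievalIx W2 WM) => //=; rewrite ?mod0n ?(gW G2) ?he2 ?(gdst G2)//; exact: ltn_trans NW.
    apply: (wp_gmin W2 WM (i0 := (src e * W + t)%N)
      (bb := (0 < imem s2 aXe (dst e * W + t))%N) (x := cst e + g * rmem s2 rXv (dst e * W + t)) (B := 120)) => //.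
    * by rewrite /= Ed (modn_small M1).
    * by rewrite /= Ed !mod0n he2 (gcst G2)// (gg G2).
    move=> T s3 hT _ [m1 m2 m3]; split=> //; split.
    * move=> u t' x uN tN' /m3[|[x0 kE ->]]; first exact: J1.
      have : (u * W + t' == src e * W + t)%N by rewrite kE.
      rewrite idx_eq ?(ltn_trans _ NW)// => /andP[/eqP-> /eqP->].
      have w1 : walk (src e) [:: e] (dst e) by rewrite /= em !eqxx.
      apply: (dle_pre g0 g1 w1 (x := rmem s2 rXv (dst e * W + t))).
      by apply: J1 => //; apply/cell_some.
    * exact: mono_trans J2 m1.
    * move=> t'; rewrite ltnS leq_eqVlt => /orP[/eqP->|/J3 h] y hy; last by apply: m1; apply: h.
      have := J2 _ _ hy; case E : (Xc s2 _) => [x|] //= xy.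
      have [x0 xE] := (cell_some _ _ _ _ _).1 E.
      apply: (@ole_trans _ _ (cst e + g * x)); last by rewrite lerD2l ler_pM2l.
      by apply: m2; rewrite -xE.
  + move=> T s2 f2 _ [J1 J2 J3] hT; split; first by move: hT => /=; clear; nia.
    split=> //; first exact: mono_trans I2 J2.
    move=> e' t; rewrite ltnS leq_eqVlt => /orP[/eqP->|/I3 h] tN y hy.
      by apply: J3 => //; apply: I2.
    by apply: J2; apply: h.
- move=> T s1 f1 _ [I1 I2 I3] hT; apply: hQ => //.
  + exact: (frame_sub _ _ f1).
  + by move: hT => /=; clear; nia.
Qed.

(** After i rounds all prefixes of at most i edges have been taken into account, by induction on the
    prefix from its first edge. Entries lowered early within a round do no harm, since all updates
    are monotone and sound. *)
Lemma wp_Rounds s0 (Q : nat -> state R -> Prop) :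
  glob s0 -> xsound (Xc s0) -> imem s0 vk 0 = kk -> (kk < W)%N ->
  (forall T s', frame (iwrites (For vj (Var vk) Relax)) (rwrites (For vj (Var vk) Relax)) s0 s' ->
     (T <= 300 * (kk + 1) * (m + 1) * (N + 1))%N -> xsound (Xc s') -> mono (Xc s0) (Xc s') ->
     (forall a b, spart (Xc s0) (Xc s') kk a b) -> Q T s') ->
  wp M (For vj (Var vk) Relax) Q s0.
Proof.
move=> G xs hk kW hQ.
apply: (@wp_for _ _ _ _ _ (fun i st => [/\ xsound (Xc st), mono (Xc s0) (Xc st) &
  forall a b, spart (Xc s0) (Xc st) i a b]) kk (200 * (m + 1) * (N + 1))) => //.
- exact: ltn_trans kW WltM.
- by rewrite /= mod0n.
- by split=> // a b [|e p] t x //= /eqP->.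
- move=> i s1 ik f1 hi [I1 I2 I3]; have G1 := glob_frame f1 isT isT G.
  apply: (wp_Relax G1 I1) => T s2 f2 hT xs2 m2 e2; split=> //; split=> //.
    exact: mono_trans I2 m2.
  move=> a b [|e p] t x /=; first by move=> /eqP-> _ tN hx; apply: m2; apply: I2.
  move=> /and3P[em /eqP <- hw] sz tN hx; apply: e2 => //.
  exact: I3 hx.
- move=> T s1 f1 _ [I1 I2 I3] hT; apply: hQ => //.
  + exact: (frame_sub _ _ f1).
  + by move: hT => /=; clear; nia.
Qed.

Definition core_cost :=
  (2000 * (kk + 1) * (N + 1) * (N + m + 1) + (bb + 1) * (lev_cost + down_cost))%N.

Lemma wp_Core s0 (Q : nat -> state R -> Prop) :
  glob s0 -> pwok s0 -> imem s0 vlg 0 = bb -> imem s0 vk 0 = kk -> (kk < W)%N ->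
  (forall a i, a \in [:: adeg; amark; acr; astamp; aXe; aQe]%N -> imem s0 a i = 0%N) ->
  (forall T s', frame (iwrites Core) (rwrites Core) s0 s' -> (T <= core_cost)%N ->
     xsound (Xc s') -> (forall a, (a < N)%N -> xcomp (Xc s') a) -> Q T s') ->
  wp M Core Q s0.
Proof.
move=> G P hlg hk kW z hQ.
apply: wp_seq; apply: (wp_Closure G) => [u|i|]; [exact: z|exact: z|].
move=> T1 s1 f1 hT1 A1; have G1 := glob_frame f1 isT isT G.
apply: wp_seq; apply: (wp_Reps G1 A1) => [u|]; first by rewrite (f1.1 acr isT) z.
move=> T2 s2 f2 hT2 R2; have F2 := frame_cat f1 f2; have G2 := glob_frame F2 isT isT G.
apply: wp_seq; apply: (wp_SortE G2) => [u /R2[]//|].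
move=> T3 s3 f3 hT3 [el [pel sel ael]]; have F3 := frame_cat F2 f3; have G3 := glob_frame F3 isT isT G.
have P3 : pwok s3 by move=> l lL; rewrite (F3.2 rpw isT) P.
apply: wp_seq; apply: (wp_UpAll G3 P3) => //.
- by rewrite (F3.1 vk isT).
- by move=> w; rewrite (F3.1 astamp isT) z.
- by move=> i; rewrite /cell (F3.1 aXe isT) z.
- by move=> i; rewrite /cell (F3.1 aQe isT) z.
move=> T4 s4 top q f4 hT4 topb U n0; have F4 := frame_cat F3 f4; have G4 := glob_frame F4 isT isT G.
have P4 : pwok s4 by move=> l lL; rewrite (F4.2 rpw isT) P.
apply: wp_seq; apply: (wp_DownAll G4 P4 _ _ _ _ kW U n0 topb).
- by move=> u uN; rewrite (f4.1 arep isT) (f3.1 arep isT); case: (R2 u uN).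
- by exists el; split=> //; rewrite (f4.1 aord isT).
- by rewrite (F4.1 vlg isT).
- by rewrite (F4.1 vk isT).
move=> T5 s5 f5 hT5 xs5 m5 c5; have F5 := frame_cat F4 f5; have G5 := glob_frame F5 isT isT G.
have Q5 : Qc s5 = Qc s4 by rewrite /cell (f5.1 aQe isT) (f5.2 rQv isT).
apply: wp_seq; apply: (wp_FinQ G5) => //.
- by move=> u v uN vN; rewrite (f5.1 amark isT) (f4.1 amark isT) (f3.1 amark isT) (f2.1 amark isT) A1.
- by rewrite Q5; apply: (ui_xq U).
move=> T6 s6 f6 hT6 xs6 m6 q6; have F6 := frame_cat F5 f6; have G6 := glob_frame F6 isT isT G.
apply: (wp_Rounds G6 xs6 _ kW); first by rewrite (F6.1 vk isT).
move=> T7 s7 f7 hT7 xs7 m7 sp7; apply: hQ => //.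
- by apply: (frame_sub _ _ (frame_cat F6 f7)); vm_compute.
- have e1 : (500 * (N + 1) * (N + m + 1) + 200 * (N + 1) * (N + 1) + 200 * (N + 1) * (m + 1) + 50 * (N + 1) +
    200 * (N + 1) * (N + 1) + 300 * (kk + 1) * (m + 1) * (N + 1) <= 2000 * (kk + 1) * (N + 1) * (N + m + 1))%N.
    by clear; nia.
  have -> : core_cost = (2000 * (kk + 1) * (N + 1) * (N + m + 1) + ((bb + 1) * lev_cost + (bb + 1) * down_cost))%N.
    by rewrite /core_cost (mulnDr (bb + 1)%N (lev_cost)).
  move: hT1 hT2 hT3 hT4 hT5 hT6 hT7 e1.
  move: (2000 * _ * _ * _)%N (_ * lev_cost)%N (_ * down_cost)%N => c x y.
  by clear; lia.
- move=> a aN; have N0 : (0 < N)%N by apply: leq_ltn_trans aN.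
  have top0 : (0 < top)%N.
    rewrite lt0n; apply/eqP => t0; move: n0; rewrite t0 => n0.
    by have := ui_S0 U; rewrite /Slist n0 /=; move: N0; case: (N).
  have m47 : mono (Xc s4) (Xc s7) := mono_trans m5 (mono_trans m6 m7).
  apply: (xcomp_step (S := Slist s4) (top := top) (q := Qc s4) (X0 := Xc s5) (i := 0%N)) => //.
  + by move=> v vN; rewrite (ui_S0 U) mem_iota.
  + by rewrite /Slist n0.
  + by move=> i it; apply: (ui_hits U).
  + by move=> i b it bS; case: (ui_done U it bS).
  + by rewrite (ui_S0 U) mem_iota.
  + have aS : a \in Slist s4 0 by rewrite (ui_S0 U) mem_iota.
    by apply: xdone_mono m47 _; case: (ui_done U top0 aS).
  (* [FinQ] has entered Q(v) itself at (v,t); the rounds then put every prefix of at most k edges in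
     front of it. *)
  + rewrite expn1 => p v x t hw sz tN vt qv; apply: (sp7 a v) => //.
    by apply: q6 => //; [exact: (walk_end_N dstN aN hw)|rewrite Q5].
  + move=> b bS; split; last exact: c5.
    by rewrite expn1; apply: spart_mono (sp7 a b).
Qed.

(** * Output in terms of the original vertices *)

Definition diag (s t : nat) : option R := if s == t then Some 0 else None.

(** An isolated vertex has only the empty walk, so the diagonal is preset with 0 and the computed
    entries overwrite it; a missing entry leaves the preset. *)
Definition res (o : seq nat) (X : nat -> option R) (s t : nat) :=
  if X (index s o * W + index t o)%N is Some x then Some x else diag s t.

Lemma wp_Out s0 n (o : seq nat) (Q : nat -> state R -> Prop) :
  glob s0 -> imem s0 0 0 = n -> (n * n < W)%N -> uniq o -> size o = N -> all (fun u => u < n)%N o ->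
  (forall i, (i < N)%N -> imem s0 aorig i = nth 0%N o i) ->
  (forall i, imem s0 3 i = 0%N) -> (forall i, rmem s0 2 i = 0) ->
  (forall T s', frame (iwrites Out) (rwrites Out) s0 s' ->
     (T <= 50 * (n + 1) + 200 * (N + 1) * (N + 1))%N ->
     (forall s t, (s < n)%N -> (t < n)%N -> cell s' 3 2 (s * n + t) =
        if (s \in o) && (t \in o) then res o (Xc s0) s t else diag s t) -> Q T s') ->
  wp M Out Q s0.
Proof.
move=> G hn nnW uo szo ao ho z3 z2 hQ.
have nW : (n < W)%N by case: (n) nnW => // n'; rewrite mulSn; clear; lia.
have oM x y : (x < n)%N -> (y < n)%N -> iop_eval M IAdd (iop_eval M IMul x n) y = (x * n + y)%N.
  move=> xn yn; have xnW : (x * n < W)%N.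
    by apply: leq_ltn_trans nnW; rewrite leq_mul2r ltnW ?orbT.
  rewrite /iop_eval (modMul W2 WM)//; last exact: ltn_trans xn nW.
  by rewrite (modA W2 WM)//; apply: ltn_trans yn nW.
apply: wp_seq; apply: (@wp_for _ _ _ _ _ (fun i st => forall s t, (s < n)%N -> (t < n)%N ->
   cell st 3 2 (s * n + t) = if (s < i)%N then diag s t else None) n 20) => //.
- exact: ltn_trans nW WltM.
- by rewrite /= mod0n.
- by move=> s t sn tn; rewrite /cell z3.
- move=> i s1 iN f1 hi I; apply: (wp_store (i := (i * n + i)%N) (x := 1%N)).
  + by rewrite /= !mod0n hi (f1.1 0%N isT) hn oM.
  + exact: modn_small.
  move=> s2 f2 h2; split=> // s t sn tn.
  rewrite /cell h2 idx_eq// (f2.2 2%N isT); case: (s =P i) => [->|ne] /=.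
    rewrite ltnSn /diag [t == i]eq_sym; case: (i =P t) => [<-|_] /=.
      by rewrite (f1.2 2%N isT) z2.
    by have := I i t iN tn; rewrite ltnn /cell.
  rewrite ltnS leq_eqVlt (introF eqP ne) /=.
  by rewrite -(I s t sn tn).
move=> T1 s1 f1 _ D1 hT1; have G1 := glob_frame f1 isT isT G.
(* The output once the pairs of new names before (i,j) in lexicographic order have been written. *)
pose rs i j s t := if [&& s \in o, t \in o & (index s o < i)%N || (index s o == i) && (index t o < j)%N]
  then res o (Xc s0) s t else diag s t.
apply: (@wp_for _ _ _ _ _ (fun i st => forall s t, (s < n)%N -> (t < n)%N ->
   cell st 3 2 (s * n + t) = rs i 0%N s t) N (150 * (N + 1))) => //.
- exact: ltn_trans NW WltM.
- by rewrite /= mod0n (gN G1).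
- by move=> s t sn tn; rewrite D1// sn /rs ltn0 andbF !andbF.
- move=> i s2 iN f2 hi I; have G2 := glob_frame f2 isT isT G1.
  apply: (@wp_for _ _ _ _ _ (fun j st => forall s t, (s < n)%N -> (t < n)%N ->
    cell st 3 2 (s * n + t) = rs i j s t) N 110) => //.
  + exact: ltn_trans NW WltM.
  + by rewrite /= mod0n (gN G2).
  + move=> j s3 jN f3 hj J; have F3 := frame_cat f1 (frame_cat f2 f3); have G3 := glob_frame f3 isT isT G2.
    have hi3 : imem s3 vs 0 = i by rewrite (f3.1 vs isT).
    pose u := nth 0%N o i; pose v := nth 0%N o j.
    have uin : u \in o by apply: mem_nth; rewrite szo.
    have vin : v \in o by apply: mem_nth; rewrite szo.
    have un : (u < n)%N := allP ao _ uin.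
    have vn : (v < n)%N := allP ao _ vin.
    have iu : index u o = i by apply: index_uniq; rewrite ?szo.
    have jv : index v o = j by apply: index_uniq; rewrite ?szo.
    have E1 : ieval M s3 (Ix (Var vs) (Var vt)) = (i * W + j)%N.
      by apply: (ievalIx W2 WM) => //=; rewrite ?mod0n ?(gW G3)//; apply: ltn_trans NW.
    have X3 : Xc s3 = Xc s0 by rewrite /cell (F3.1 aXe isT) (F3.2 rXv isT).
    have oE s : imem s aorig = imem s0 aorig -> imem s 0 = imem s0 0 -> imem s vs 0 = i ->
        imem s vt 0 = j -> ieval M s OIx = (u * n + v)%N.
      by move=> e1 e2 e3 e4; rewrite /= !mod0n e1 e2 e3 e4 hn !ho// oM.
    have eqm s t : (s < n)%N -> (t < n)%N -> (s * n + t == u * n + v)%N = (s == u) && (t == v).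
      by move=> sn tn; rewrite idx_eq.
    have rsS s t : rs i j.+1 s t = if (s == u) && (t == v) then res o (Xc s0) u v else rs i j s t.
      rewrite /rs; case: (s =P u) => [->|su] /=.
        rewrite uin iu ltnn eqxx /= ltnS leq_eqVlt; case: (t =P v) => [->|tv] /=.
          by rewrite vin jv eqxx.
        case: (boolP (t \in o)) => //= tin; rewrite -jv.
        case: eqP => // e; case: tv; by rewrite -(nth_index 0%N tin) e nth_index.
      case: (boolP (s \in o)) => //= sin; case: eqP => //= e; case: su.
      by rewrite -(nth_index 0%N sin) e.
    apply: wp_if; rewrite /= E1 (modn_small M1) => h.
      apply: wp_seq; apply: (wp_store (i := (u * n + v)%N) (x := 1%N)).
      * by apply: oE => //; rewrite ?(F3.1 aorig isT) ?(F3.1 0%N isT).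
      * exact: modn_small.
      move=> s4 f4 h4; apply: (wp_rstore (i := (u * n + v)%N) (x := rmem s3 rXv (i * W + j))).
      * apply: oE; rewrite ?(f4.1 vs isT) ?(f4.1 vt isT)//.
          by rewrite (f4.1 aorig isT) (F3.1 aorig isT).
        by rewrite (f4.1 0%N isT) (F3.1 0%N isT).
      * rewrite [LHS]/= (ievalIx W2 WM (i := i) (j := j)) ?(f4.2 rXv isT)//=; rewrite ?mod0n//.
        - by rewrite (f4.1 vW isT) (gW G3).
        - by rewrite (f4.1 vs isT).
        - by rewrite (f4.1 vt isT).
        - exact: ltn_trans NW.
        - exact: ltn_trans NW.
      move=> s5 f5 h5; split; first by rewrite /= !icost_Ix.
      move=> s t sn tn; rewrite /cell h5 (f5.1 3%N isT) h4 (f4.2 2%N isT) eqm// rsS.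
      case: ((s == u) && (t == v)) => /=; last by rewrite -(J s t sn tn).
      rewrite /res iu jv -X3.
      by have -> : Xc s3 (i * W + j)%N = Some (rmem s3 rXv (i * W + j)) by apply/cell_some.
    apply: wp_skip; split; first by rewrite /= !icost_Ix.
    move=> s t sn tn; rewrite rsS J//; case: ifP => // /andP[/eqP-> /eqP->].
    rewrite /rs uin vin iu jv !ltnn eqxx /= /res iu jv -X3.
    by rewrite {1}/cell; move: h; rewrite -eqn0Ngt => ->.
  + move=> T2 s3 f3 _ J hT; split; first by move: hT => /=; clear; nia.
    move=> s t sn tn; rewrite J// /rs; case: (boolP (t \in o)) => //= tin.
    have -> : (index s o < i.+1)%N = (index s o < i)%N || (index s o == i) by rewrite ltnS leq_eqVlt orbC.
    have -> : (index t o < N)%N by rewrite -szo index_mem.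
    by rewrite andbT ltn0 andbF orbF.
- move=> T2 s2 f2 _ I hT; apply: hQ.
  + exact: (frame_sub _ _ (frame_cat f1 f2)).
  + by move: hT hT1 => /=; clear; nia.
  + move=> s t sn tn; rewrite I// /rs; case: (boolP (s \in o)) => //= sin.
    by rewrite -szo index_mem sin /= andbT.
Qed.

End Algorithm.

(** * Relabelling and initialization *)

(** The array [aid] holds the new name plus 1, so that the initial 0 means that the vertex has not
    been met. *)
Definition Label e :=
  vu ::= e ;;
  If (BILe (IGet aid (Var vu)) (INat 0))
    (ISet aorig (Var vN) (Var vu) ;; vN ::= Var vN +^ INat 1 ;; ISet aid (Var vu) (Var vN)) Skip.

Definition Relabel :=
  vN ::= INat 0 ;;
  For ve (IGet 0 (INat 1)) (
    Label (IGet 1 (Var ve)) ;; ISet asrc (Var ve) (IGet aid (Var vu) -^ INat 1) ;;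
    Label (IGet 2 (Var ve)) ;; ISet adst (Var ve) (IGet aid (Var vu) -^ INat 1)).

Definition FindK :=
  vk ::= INat 2 ;;
  While (BNot (BILe (Var vN *^ Var vN) (Var vk *^ Var vk *^ Var vk *^ Var vk *^ IGet 0 (INat 1))))
    (vk ::= Var vk +^ INat 1).

Definition FindLog :=
  vpw ::= INat 1 ;; vlg ::= INat 0 ;;
  While (BILe (Var vpw) (Var vN *^ Var vN +^ INat 1))
    (vpw ::= Var vpw +^ Var vpw ;; vlg ::= Var vlg +^ INat 1).

Definition Powers :=
  RSet rpw (INat 0) (RNat 1) ;;
  For vj (Var vN *^ Var vk)
    (RSet rpw (Var vj +^ INat 1) (RBin RMul (RGet 1 (INat 0)) (RGet rpw (Var vj)))).

(** Three squarings of n + 2 give W = (n+2)^8. Its square is the word modulus (n+2)^16, so products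
    of two numbers below W never wrap around. *)
Definition Stride :=
  vW ::= IGet 0 (INat 0) +^ INat 2 ;; vW ::= Var vW *^ Var vW ;; vW ::= Var vW *^ Var vW ;;
  vW ::= Var vW *^ Var vW.

Section Pre.
Context (R : realType) (n M W : nat).
Hypotheses (WE : W = (n.+2 ^ 8)%N) (WM : (W * W <= M)%N).

Let W2 : (2 < W)%N.
Proof. by rewrite WE; apply: (@leq_trans (2 ^ 8)); rewrite // leq_exp2r. Qed.
Let WltM : (W < M)%N. Proof. exact: ltWM W2 WM. Qed.
Let M1 : (1 < M)%N. Proof. exact: ltn_trans (ltnW W2) WltM. Qed.

Lemma W_pow k x : (k <= 8)%N -> (x < n.+2 ^ k)%N -> (x < W)%N.
Proof. by move=> k8 xk; rewrite WE; apply: leq_trans xk _; rewrite leq_exp2l. Qed.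

Let nW : (n + 2 < W)%N. Proof. by apply: (@W_pow 2) => //; rewrite expnS expn1; nia. Qed.

Lemma wp_Stride (s0 : state R) (Q : nat -> state R -> Prop) :
  imem s0 0 0 = n ->
  (forall T s', frame (iwrites Stride) (rwrites Stride) s0 s' -> (T <= 50)%N ->
     imem s' vW 0 = W -> Q T s') ->
  wp M Stride Q s0.
Proof.
move=> hn hQ.
apply: wp_seq; apply: (wp_assign (x := n.+2)).
  rewrite /= mod0n (modW W2 WM W2) hn /iop_eval (modA W2 WM) ?addn2//.
  by move: nW; clear; lia.
move=> s1 f1 h1; apply: wp_seq; apply: (wp_assign (x := (n.+2 ^ 2)%N)).
  rewrite /= mod0n h1 /iop_eval (modMul W2 WM)//; by move: nW; clear; lia.
move=> s2 f2 h2; apply: wp_seq; apply: (wp_assign (x := (n.+2 ^ 4)%N)).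
  rewrite /= mod0n h2 /iop_eval (modMul W2 WM) -?expnD//;
    by rewrite WE ltn_exp2l.
move=> s3 f3 h3; apply: (wp_assign (x := W)).
  rewrite /= mod0n h3 /iop_eval (modMul W2 WM) -?expnD// ?WE// ltn_exp2l//.
move=> s4 f4 h4; apply: hQ => //.
exact: (frame_sub _ _ (frame_cat f1 (frame_cat f2 (frame_cat f3 f4)))).
Qed.

Definition labels (o : seq nat) (s : state R) :=
  [/\ uniq o, all (fun u => u < n)%N o, imem s vN 0 = size o,
      forall i, (i < size o)%N -> imem s aorig i = nth 0%N o i &
      forall u, (u < n)%N -> imem s aid u = if u \in o then (index u o).+1 else 0%N].

Lemma size_labels o s : labels o s -> (size o <= n)%N.
Proof.
move=> [uo ao _ _ _]; rewrite -(size_iota 0 n); apply: uniq_leq_size => // u /(allP ao).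
by rewrite mem_iota.
Qed.

Lemma wp_Label s0 o e u (Q : nat -> state R -> Prop) :
  labels o s0 -> ieval M s0 e = u -> (u < n)%N ->
  (forall T s' o', frame (iwrites (Label e)) (rwrites (Label e)) s0 s' -> (T <= 40 + icost e)%N ->
     labels o' s' -> prefix o o' -> (size o' <= (size o).+1)%N -> u \in o' -> imem s' vu 0 = u -> Q T s') ->
  wp M (Label e) Q s0.
Proof.
move=> Lb he un hQ; have szo := size_labels Lb; have [uo ao oN oo oi] := Lb.
apply: wp_seq; apply: (wp_assign (x := u)) => // s1 f1 h1.
apply: wp_if; rewrite /= !mod0n h1 (f1.1 aid isT) oi// => hu.
  have uno : u \notin o by apply/negP => h; move: hu; rewrite h.
  apply: wp_seq; apply: (wp_store (i := size o) (x := u)); rewrite /= ?mod0n ?(f1.1 vN isT)//.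
  move=> s2 f2 h2; apply: wp_seq; apply: (wp_assign (x := (size o).+1)).
    apply: (ieval_incr W2 WM); first by rewrite (f2.1 vN isT) (f1.1 vN isT).
    by move: szo nW; clear; lia.
  move=> s3 f3 h3; apply: (wp_store (i := u) (x := (size o).+1)); rewrite /= ?mod0n//.
    by rewrite (f3.1 vu isT) (f2.1 vu isT).
  move=> s4 f4 h4; apply: (hQ _ _ (rcons o u)).
  - exact: (frame_sub _ _ (frame_cat f1 (frame_cat f2 (frame_cat f3 f4)))).
  - by move=> /=; clear; lia.
  - split.
    + by rewrite rcons_uniq uno.
    + by rewrite all_rcons un.
    + by rewrite (f4.1 vN isT) h3 size_rcons.
    + move=> i; rewrite size_rcons ltnS (f4.1 aorig isT) (f3.1 aorig isT) h2 nth_rcons leq_eqVlt.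
      case: eqP => [->|_] /=; first by rewrite ltnn.
      by move=> io; rewrite io (f1.1 aorig isT) oo.
    + move=> v vn; rewrite h4 mem_rcons inE -cats1 index_cat.
      case: eqP => [->|ne] /=; first by rewrite (negbTE uno) /= eqxx addn0.
      rewrite (f3.1 aid isT) (f2.1 aid isT) (f1.1 aid isT) oi//.
      by case: ifP.
  - exact: prefix_rcons.
  - by rewrite size_rcons.
  - by rewrite mem_rcons inE eqxx.
  - by rewrite (f4.1 vu isT) (f3.1 vu isT) (f2.1 vu isT).
apply: wp_skip; apply: (hQ _ _ o) => //.
- exact: (frame_sub _ _ f1).
- by move=> /=; clear; lia.
- by split=> // *; rewrite ?(f1.1 vN isT) ?(f1.1 aorig isT) ?(f1.1 aid isT); auto.
- exact: prefix_refl.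
- by move: hu; case: (u \in o).
Qed.

Lemma wp_Relabel s0 m (Sr Ds : nat -> nat) (Q : nat -> state R -> Prop) :
  (m < W)%N -> imem s0 0 1 = m ->
  (forall e, (e < m)%N -> imem s0 1 e = Sr e /\ (Sr e < n)%N) ->
  (forall e, (e < m)%N -> imem s0 2 e = Ds e /\ (Ds e < n)%N) ->
  (forall u, imem s0 aid u = 0%N) ->
  (forall T s' o, frame (iwrites Relabel) (rwrites Relabel) s0 s' -> (T <= 200 * (m + 1))%N ->
     labels o s' -> (size o <= 2 * m)%N ->
     (forall e, (e < m)%N -> [/\ Sr e \in o, Ds e \in o, imem s' asrc e = index (Sr e) o &
        imem s' adst e = index (Ds e) o]) -> Q T s') ->
  wp M Relabel Q s0.
Proof.
move=> mW hm hS hD z hQ.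
apply: wp_seq; apply: (wp_assign (x := 0%N)); first exact: mod0n.
move=> s1 f1 h1.
have ipre (o o' : seq nat) u : prefix o o' -> u \in o -> index u o' = index u o.
  by move=> /prefixP[r ->] uo; rewrite index_cat uo.
have mpre (o o' : seq nat) u : prefix o o' -> u \in o -> u \in o'.
  by move=> /prefixP[r ->] uo; rewrite mem_cat uo.
apply: (@wp_for _ _ _ _ _ (fun i st => exists o, [/\ labels o st, (size o <= 2 * i)%N &
  forall e, (e < i)%N -> [/\ Sr e \in o, Ds e \in o, imem st asrc e = index (Sr e) o &
        imem st adst e = index (Ds e) o]]) m 150) => //.
- exact: ltn_trans mW WltM.
- by rewrite /= modn_small// (f1.1 0%N isT).
- exists [::]; split=> //; split=> // u un; by rewrite (f1.1 aid isT) z.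
- move=> e s2 em f2 he [ol [Lo so I]]; have F2 := frame_cat f1 f2.
  have [hSe Sn] := hS e em; have [hDe Dn] := hD e em.
  apply: wp_seq; apply: (wp_Label Lo (u := Sr e)) => //.
    by rewrite /= mod0n he (F2.1 1%N isT).
  move=> T3 s3 o3 f3 hT3 L3 p3 z3 m3 h3.
  have idE o' (s : state R) u : labels o' s -> u \in o' -> (u < n)%N -> imem s vu 0 = u ->
      ieval M s (IGet aid (Var vu) -^ INat 1) = index u o'.
    move=> Lb uo un hu; have szo := size_labels Lb; have [_ _ _ _ oi] := Lb.
    rewrite /= mod0n (modn_small M1) /iop_eval hu oi// uo (modB W2 WM) ?subn1//.
    by apply: leq_ltn_trans (leq_trans _ szo) (leq_ltn_trans (leq_addr 2 n) nW); rewrite index_mem.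
  apply: wp_seq; apply: (wp_store (i := e) (x := index (Sr e) o3)).
  + by rewrite /= mod0n (f3.1 ve isT).
  + exact: idE.
  move=> s4 f4 h4; have F4 := frame_cat (frame_cat F2 f3) f4.
  have L4 : labels o3 s4.
    by case: L3 => *; split=> // *; rewrite ?(f4.1 vN isT) ?(f4.1 aorig isT) ?(f4.1 aid isT); auto.
  apply: wp_seq; apply: (wp_Label L4 (u := Ds e)) => //.
    by rewrite /= mod0n (f4.1 ve isT) (f3.1 ve isT) he (F4.1 2%N isT).
  move=> T5 s5 o5 f5 hT5 L5 p5 z5 m5 h5.
  apply: (wp_store (i := e) (x := index (Ds e) o5)).
  + by rewrite /= mod0n (f5.1 ve isT) (f4.1 ve isT) (f3.1 ve isT).
  + exact: idE.
  move=> s6 f6 h6; split; first by move: hT3 hT5 => /=; clear; lia.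
  exists o5; split.
  + by case: L5 => *; split=> // *; rewrite ?(f6.1 vN isT) ?(f6.1 aorig isT) ?(f6.1 aid isT); auto.
  + by move: z3 z5 so; clear; lia.
  + move=> e'; rewrite ltnS (f6.1 asrc isT) (f5.1 asrc isT) h4 h6 leq_eqVlt.
    case: eqP => [->|_] /=; first by move=> _; rewrite (mpre _ _ _ p5 m3) (ipre _ _ _ p5 m3).
    move=> /I[i1 i2 i3 i4].
    have p35 : prefix ol o5 by apply: prefix_trans p3 p5.
    rewrite (f3.1 asrc isT) (f5.1 adst isT) (f4.1 adst isT) (f3.1 adst isT) !(ipre _ _ _ p35)//.
    by rewrite !(mpre ol o5).
- move=> T s2 f2 _ [ol [Lo so I]] hT; apply: (hQ _ _ ol) => //.
  + exact: (frame_sub _ _ (frame_cat f1 f2)).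
  + by move: hT => /=; clear; lia.
Qed.

Lemma wp_FindK s0 N m (Q : nat -> state R -> Prop) :
  imem s0 vN 0 = N -> (N <= n)%N -> imem s0 0 1 = m -> (m <= n * n)%N -> (N <= 2 * m)%N ->
  (forall T s' k, frame (iwrites FindK) (rwrites FindK) s0 s' -> (T <= 50 * (N + 2))%N ->
     imem s' vk 0 = k -> (1 < k)%N -> (k <= N + 2)%N -> (N * N <= k ^ 4 * m)%N ->
     (k = 2%N \/ k.-1 ^ 4 * m < N * N)%N -> Q T s') ->
  wp M FindK Q s0.
Proof.
move=> hN Nn hm mn N2 hQ.
apply: wp_seq; apply: (wp_assign (x := 2%N)); first exact: (modW W2 WM W2).
move=> s1 f1 h1.
have pW k : (k <= N + 2)%N -> [/\ (k * k < W)%N, (k * k * k < W)%N & (k * k * k * k < W)%N].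
  move=> kN; have kn : (k <= n.+2)%N by move: kN Nn; clear; lia.
  have kn2 := leq_mul kn kn; have kn3 := leq_mul kn2 kn; have kn4 := leq_mul kn3 kn.
  by split; apply: (@W_pow 5) => //; rewrite !expnS expn0 muln1;
    move: kn2 kn3 kn4; clear; move: (n) => x; nia.
(* As long as the search goes on, k < N: if N <= k, then N^2 <= k^2 <= k^4 m because there is an
   edge. So the search is short and its products stay small. *)
have kb k : (1 < k)%N -> (k ^ 4 * m < N * N)%N -> (k < N)%N.
  move=> k1; rewrite ltnNge => /negP h; rewrite ltnNge; apply/negP => Nk; apply: h.
  have m0 : (0 < m)%N \/ N = 0%N by move: N2; clear; lia.
  case: m0 => [m0|->]; last by rewrite mul0n.
  apply: (@leq_trans (k ^ 2 * 1)); first by rewrite muln1; apply: leq_mul.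
  by apply: leq_mul => //; rewrite leq_exp2l.
have bE (s : state R) k : imem s vN 0 = N -> imem s 0 1 = m -> imem s vk 0 = k -> (k <= N + 2)%N ->
    beval M s (BILe (Var vN *^ Var vN) (Var vk *^ Var vk *^ Var vk *^ Var vk *^ IGet 0 (INat 1))) =
    (N * N <= k ^ 4 * m)%N.
  move=> e1 e2 e3 kN; have [p1 p2 p3] := pW k kN.
  have kW : (k < W)%N by move: kN Nn nW; clear; lia.
  have mW : (m < W)%N by apply: (@W_pow 2) => //; rewrite !expnS expn0; move: mn; clear; nia.
  have NW : (N < W)%N by move: Nn nW; clear; lia.
  rewrite /= !mod0n (modn_small M1) /iop_eval e1 e2 e3 !(modMul W2 WM)//.
  by rewrite !expnS expn0 muln1 !mulnA.
apply: (@wp_while _ _ _ _ (fun T st => exists k, [/\ imem st vk 0 = k, (1 < k <= N + 2)%N,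
   (k = 2%N \/ k.-1 ^ 4 * m < N * N)%N & (T <= (k - 2) * 40)%N])
   (fun st => (N + 2 - imem st vk 0)%N)).
- by exists 2%N; split=> //; [rewrite leq_addl|left].
- move=> T st hf [k [hk /andP[k1 kN] kI hT]].
  have eN : imem st vN 0 = N by rewrite (hf.1 vN isT) (f1.1 vN isT).
  have em : imem st 0 1 = m by rewrite (hf.1 0%N isT) (f1.1 0%N isT).
  rewrite -[beval _ _ _]/(~~ beval M st (BILe (Var vN *^ Var vN) (Var vk *^ Var vk *^ Var vk *^ Var vk *^ IGet 0 (INat 1)))).
  rewrite (bE st k eN em hk kN) -ltnNge => lt.
  have kN' := kb k k1 lt.
  apply: (wp_assign (x := k.+1)).
    by apply: (ieval_incr W2 WM) => //; move: kN Nn nW; clear; lia.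
  move=> s2 f2 h2; rewrite h2 hk; split; last by move: kN'; clear; lia.
  exists k.+1; split=> //.
  + by move: k1 kN'; clear; lia.
  + by right.
  + by move: hT k1 => /=; clear; lia.
- move=> T st hf [k [hk /andP[k1 kN] kI hT]].
  have eN : imem st vN 0 = N by rewrite (hf.1 vN isT) (f1.1 vN isT).
  have em : imem st 0 1 = m by rewrite (hf.1 0%N isT) (f1.1 0%N isT).
  rewrite -[beval _ _ _]/(~~ beval M st (BILe (Var vN *^ Var vN) (Var vk *^ Var vk *^ Var vk *^ Var vk *^ IGet 0 (INat 1)))).
  rewrite (bE st k eN em hk kN) negbK => le.
  apply: (hQ _ _ k) => //.
  + exact: (frame_sub _ _ (frame_cat f1 hf)).
  + by move: hT kN => /=; clear; lia.
Qed.

Lemma wp_FindLog s0 N (Q : nat -> state R -> Prop) :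
  imem s0 vN 0 = N -> (N <= n)%N ->
  (forall T s' b, frame (iwrites FindLog) (rwrites FindLog) s0 s' -> (T <= 50 * (b + 1))%N ->
     imem s' vlg 0 = b -> (N * N + 1 < 2 ^ b)%N -> (2 ^ b <= 2 * (N * N + 1))%N -> (b < W)%N -> Q T s') ->
  wp M FindLog Q s0.
Proof.
move=> hN Nn hQ.
have NW : (N < W)%N by move: Nn nW; clear; lia.
have N2W : (2 * (N * N + 1) < W)%N.
  by apply: (@W_pow 3) => //; rewrite !expnS expn0; move: Nn; clear; nia.
apply: wp_seq; apply: (wp_assign (x := 1%N)); first exact: modn_small.
move=> s1 f1 h1; apply: wp_seq; apply: (wp_assign (x := 0%N)); first exact: mod0n.
move=> s2 f2 h2; have F2 := frame_cat f1 f2.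
have bE (s : state R) x : imem s vN 0 = N -> imem s vpw 0 = x ->
    beval M s (BILe (Var vpw) (Var vN *^ Var vN +^ INat 1)) = (x <= N * N + 1)%N.
  move=> e1 e2; rewrite /= !mod0n (modn_small M1) /iop_eval e1 e2 (modMul W2 WM)// (modA W2 WM)//.
    by move: N2W; clear; lia.
  exact: ltnW.
apply: (@wp_while _ _ _ _ (fun T st => exists b, [/\ imem st vlg 0 = b, imem st vpw 0 = (2 ^ b)%N,
   (2 ^ b <= 2 * (N * N + 1))%N & (T <= b * 40)%N])
   (fun st => (W - imem st vlg 0)%N)).
- by exists 0%N; rewrite (f2.1 vpw isT); split=> //; rewrite expn0; clear; lia.
- move=> T st hf [b [hb hp pI hT]].
  have eN : imem st vN 0 = N by rewrite (hf.1 vN isT) (F2.1 vN isT).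
  rewrite (bE st _ eN hp) => lt.
  have pW : (2 ^ b < W)%N by apply: leq_ltn_trans pI N2W.
  have bW : (b.+1 < W)%N.
    by have := ltn_expl b (ltnSn 1); move: lt N2W; clear; lia.
  apply: wp_seq; apply: (wp_assign (x := (2 ^ b.+1)%N)).
    by rewrite /= mod0n hp /iop_eval (modA W2 WM)// expnS mul2n addnn.
  move=> s3 f3 h3; apply: (wp_assign (x := b.+1)).
    by apply: (ieval_incr W2 WM); [rewrite (f3.1 vlg isT)|apply: ltnW].
  move=> s4 f4 h4; rewrite h4 hb; split; last by move: bW; clear; lia.
  exists b.+1; rewrite (f4.1 vpw isT); split=> //.
  + by rewrite expnS leq_mul2l lt.
  + by move: hT => /=; clear; lia.
- move=> T st hf [b [hb hp pI hT]].
  have eN : imem st vN 0 = N by rewrite (hf.1 vN isT) (F2.1 vN isT).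
  rewrite (bE st _ eN hp) -ltnNge => lt.
  apply: (hQ _ _ b) => //.
  + exact: (frame_sub _ _ (frame_cat F2 hf)).
  + by move: hT => /=; clear; lia.
  + by apply: ltn_trans (ltn_expl b (ltnSn 1)) (leq_ltn_trans pI N2W).
Qed.

Lemma wp_Powers s0 N k (g : R) (Q : nat -> state R -> Prop) :
  imem s0 vN 0 = N -> imem s0 vk 0 = k -> (N < W)%N -> (k < W)%N -> (N * k < W)%N ->
  rmem s0 1 0 = g ->
  (forall T s', frame (iwrites Powers) (rwrites Powers) s0 s' -> (T <= 50 * (N * k + 1))%N ->
     (forall j, (j <= N * k)%N -> rmem s' rpw j = g ^+ j) -> Q T s') ->
  wp M Powers Q s0.
Proof.
move=> hN hk NW kW NkW hg hQ.
apply: wp_seq; apply: wp_rset; rewrite /= mod0n.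
set s1 := setr _ _ _ _.
have f1 : frame [::] [:: rpw] s0 s1 by apply: frame_setr.
apply: (@wp_for _ _ _ _ _ (fun i st => forall j, (j <= i)%N -> rmem st rpw j = g ^+ j) (N * k)%N 20) => //.
- exact: ltn_trans NkW WltM.
- rewrite -[LHS]/(iop_eval M IMul (imem s0 vN (0 %% M)) (imem s0 vk (0 %% M)))%N.
  by rewrite mod0n /iop_eval hN hk (modMul W2 WM).
- by move=> j; rewrite leqn0 => /eqP->; rewrite expr0.
- move=> i s2 ik f2 hi I; apply: wp_rset; split=> //.
  rewrite (ieval_incr W2 WM hi) ?(ltn_trans ik)// => j.
  rewrite /setr /update /= mod0n hi (f2.2 1%N isT) (f1.2 1%N isT) hg I// -exprS leq_eqVlt.
  by case: eqP => [->//|_] /= /I.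
- move=> T s2 f2 _ I hT; apply: hQ => //.
  + exact: (frame_sub _ _ (frame_cat f1 f2)).
  + by move: hT => /=; clear; lia.
Qed.

End Pre.

(** * The whole program *)

Definition Main := Stride ;; Relabel ;; FindK ;; FindLog ;; Powers ;; Core ;; Out.

Section Main.
Context (R : realType).

Definition total_cost (K : params R) n :=
  (core_cost K + 200 * (pm K + 1) + 50 * (pbb K + 1) + 50 * (pN K * pk K + 1) + 100 * (n + 1) +
   400 * (pN K + 1) * (pN K + 1))%N.

Record solved n m (Sr Ds : nat -> nat) (co : nat -> R) g (K : params R) (o : seq nat)
    (X : nat -> option R) (s : state R) : Prop := Solved {
  so_m : pm K = m;
  so_src : psrc K = fun e => index (Sr e) o;
  so_dst : pdst K = fun e => index (Ds e) o;
  so_cst : pcst K = co;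
  so_g : pg K = g;
  so_N : pN K = size o;
  so_n : (size o <= n)%N;
  so_2m : (size o <= 2 * m)%N;
  so_o : forall e, (e < m)%N -> Sr e \in o /\ Ds e \in o;
  so_k1 : (size o * size o <= pk K ^ 4 * m)%N;
  so_k2 : (pk K = 2 \/ (pk K).-1 ^ 4 * m < size o * size o)%N;
  so_b : (2 ^ pbb K <= 2 * (size o * size o + 1))%N;
  so_sound : xsound K X;
  so_comp : forall a, (a < size o)%N -> xcomp K X a;
  so_out : forall s' t, (s' < n)%N -> (t < n)%N -> cell s 3 2 (s' * n + t) =
    if (s' \in o) && (t \in o) then res K o X s' t else diag R s' t }.

Lemma wp_Main n m M Sr Ds co g s0 (Q : nat -> state R -> Prop) :
  (n.+2 ^ 16 <= M)%N -> 0 < g -> g < 1 -> (m <= n * n)%N ->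
  imem s0 0 0 = n -> imem s0 0 1 = m ->
  (forall e, (e < m)%N -> imem s0 1 e = Sr e /\ (Sr e < n)%N) ->
  (forall e, (e < m)%N -> imem s0 2 e = Ds e /\ (Ds e < n)%N) ->
  (forall e, (e < m)%N -> rmem s0 0 e = co e) -> rmem s0 1 0 = g ->
  (forall a i, (2 < a)%N -> imem s0 a i = 0%N) -> (forall i, rmem s0 2 i = 0) ->
  (forall T s' K o X, (T <= total_cost K n)%N -> solved n m Sr Ds co g K o X s' -> Q T s') ->
  wp M Main Q s0.
Proof.
move=> hM g0 g1 mn hn hm hS hD hc hg z3 z2 hQ.
pose W := (n.+2 ^ 8)%N.
have WE : W = (n.+2 ^ 8)%N by [].
have WM : (W * W <= M)%N by rewrite -expnD.
have W2 : (2 < W)%N by apply: (@leq_trans (2 ^ 8)); rewrite // leq_exp2r.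
have mW : (m < W)%N.
  by apply: (W_pow WE (k := 2)) => //; rewrite !expnS expn0; move: mn; clear; nia.
have nW : (n + 2 < W)%N by apply: (W_pow WE (k := 2)) => //; rewrite !expnS expn0; clear; nia.
have nnW : (n * n < W)%N by apply: (W_pow WE (k := 2)) => //; rewrite !expnS expn0; clear; nia.
apply: wp_seq; apply: (wp_Stride WE WM hn) => T1 s1 f1 hT1 hW1.
apply: wp_seq; apply: (wp_Relabel WE WM mW (Sr := Sr) (Ds := Ds)).
- by rewrite (f1.1 0%N isT).
- by move=> e em; rewrite (f1.1 1%N isT); apply: hS.
- by move=> e em; rewrite (f1.1 2%N isT); apply: hD.
- by move=> u; rewrite (f1.1 aid isT) z3.
move=> T2 s2 o f2 hT2 Lo o2 ho; have F2 := frame_cat f1 f2.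
have szo := size_labels Lo; have [uo ao oN oo _] := Lo.
apply: wp_seq; apply: (wp_FindK WE WM oN szo (m := m)) => //.
  by rewrite (F2.1 0%N isT).
move=> T3 s3 k f3 hT3 hk3 k1 kN kE kE'; have F3 := frame_cat F2 f3.
apply: wp_seq; apply: (wp_FindLog WE WM (N := size o)) => //.
  by rewrite (f3.1 vN isT).
move=> T4 s4 b f4 hT4 hb4 b1 b2 bW; have F4 := frame_cat F3 f4.
have NW : (size o < W)%N by move: szo nW; clear; lia.
have kW : (k < W)%N by move: kN szo nW; clear; lia.
have NkW : (size o * k + 2 < W)%N.
  apply: (W_pow WE (k := 3)) => //; rewrite !expnS expn0; move: szo kN.
  by move: (size o) => x; clear; nia.
have W3 : ((size o + 2) * (size o + 2) * (size o + 2) < W)%N.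
  apply: (W_pow WE (k := 4)) => //; apply: (@leq_ltn_trans (n.+2 ^ 3)); last by rewrite ltn_exp2l.
  have h : (size o + 2 <= n.+2)%N by move: szo; clear; lia.
  by rewrite !expnS expn0 muln1 mulnA; do 2 apply: leq_mul => //.
apply: wp_seq; apply: (wp_Powers WE WM (N := size o) (k := k) (g := g)) => //.
- by rewrite (f4.1 vN isT) (f3.1 vN isT).
- by rewrite (f4.1 vk isT).
- by move: NkW; clear; lia.
- by rewrite (F4.2 1%N isT).
move=> T5 s5 f5 hT5 hp5; have F5 := frame_cat F4 f5.
have srcN e : (e < m)%N -> (index (Sr e) o < size o)%N.
  by move=> /ho[h _ _ _]; rewrite index_mem.
have dstN e : (e < m)%N -> (index (Ds e) o < size o)%N.
  by move=> /ho[_ h _ _]; rewrite index_mem.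
(* Level lengths never exceed N k, since a nonempty level l satisfies k^l <= N; so powers of g are
   tabulated up to N k. *)
pose K := @Params R M W (size o) m k (size o * k)%N b (fun e => index (Sr e) o) (fun e => index (Ds e) o)
  co g W2 WM NW mW NkW W3 k1 (leqnn _) b1 bW srcN dstN g0 g1.
have G5 : glob K s5.
  split.
  - by rewrite (F5.1 0%N isT).
  - by rewrite (f5.1 vW isT) (f4.1 vW isT) (f3.1 vW isT) (f2.1 vW isT).
  - by rewrite (f5.1 vN isT) (f4.1 vN isT) (f3.1 vN isT).
  - by move=> e /ho[_ _ h _]; rewrite (f5.1 asrc isT) (f4.1 asrc isT) (f3.1 asrc isT).
  - by move=> e /ho[_ _ _ h]; rewrite (f5.1 adst isT) (f4.1 adst isT) (f3.1 adst isT).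
  - by move=> e em; rewrite (F5.2 0%N isT) hc.
  - by rewrite (F5.2 1%N isT).
apply: wp_seq; apply: (wp_Core G5 hp5) => //.
- by rewrite (f5.1 vlg isT).
- by rewrite (f5.1 vk isT) (f4.1 vk isT).
- move=> a i; rewrite !inE => ha; rewrite F5.1; last by case/or4P: ha => [/eqP->|/eqP->|/eqP->|/or3P[]/eqP->].
  by apply: z3; case/or4P: ha => [/eqP->|/eqP->|/eqP->|/or3P[]/eqP->].
move=> T6 s6 f6 hT6 xs xc; have F6 := frame_cat F5 f6.
have G6 := glob_frame f6 isT isT G5.
apply: (wp_Out G6 (n := n) (o := o)) => //.
- by rewrite (F6.1 0%N isT).
- move=> i iN; rewrite (f6.1 aorig isT) (f5.1 aorig isT) (f4.1 aorig isT) (f3.1 aorig isT).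
  exact: oo.
- by move=> i; rewrite (F6.1 3%N isT) z3.
- by move=> i; rewrite (F6.2 2%N isT) z2.
move=> T7 s7 f7 hT7 out; apply: (hQ _ _ K o (cell s6 aXe rXv)).
- rewrite /total_cost /=; move: hT1 hT2 hT3 hT4 hT5 hT6 hT7 szo => /=.
  by move: (core_cost K) (size o * k)%N (size o) => c x y; clear; nia.
- split=> //.
  by move=> e /ho[].
Qed.

End Main.

(** * Discounted distances of the input graph *)

Section Link.
Context (R : realType) (n : nat) (E : {set 'I_n * 'I_n}) (es : seq ('I_n * 'I_n)).
Context (c : 'I_n * 'I_n -> R) (g : R).
Hypotheses (pe : perm_eq es (enum E)) (g0 : 0 < g) (g1 : g < 1).

Definition Sr e := nth 0%N [seq nat_of_ord x.1 | x <- es] e.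
Definition Ds e := nth 0%N [seq nat_of_ord x.2 | x <- es] e.
Definition co e := nth 0 [seq c x | x <- es] e.
Local Notation m := (size es).
Local Notation gwalk := (walk m Sr Ds).
Local Notation fval := (fval co g).
Local Notation reach := (reach m Sr Ds).
Local Notation gdle := (dle m Sr Ds co g).
Local Notation dlb := (dlb m Sr Ds co g).

Lemma size_es : m = #|E|.
Proof. by rewrite (perm_size pe) cardE. Qed.

Lemma mem_es x : (x \in es) = (x \in E).
Proof. by rewrite (perm_mem pe) mem_enum. Qed.

Lemma walk_cost_cons x q : walk_cost c g (x :: q) = c x + g * walk_cost c g q.
Proof.
rewrite /walk_cost /= big_ord_recl /= (tnth_nth x) /= expr0 mulr1; congr (_ + _).
rewrite mulr_sumr; apply: eq_bigr => i _.
by rewrite !(tnth_nth x) /= exprS; ring.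
Qed.

Lemma walk_cost_nil : walk_cost c g [::] = 0.
Proof. by rewrite /walk_cost big_ord0. Qed.

Lemma is_walk_index q s t : is_walk E s q t ->
  gwalk s [seq index x es | x <- q] t /\ fval [seq index x es | x <- q] 0 = walk_cost c g q.
Proof.
elim: q s => [s /= /eqP->|x q IH s /= /and3P[xE /eqP <- /IH[h1 h2]]].
  by rewrite eqxx walk_cost_nil.
have xm : (index x es < m)%N by rewrite index_mem mem_es.
rewrite xm /Sr /Ds /co !(nth_map x)// nth_index ?mem_es// eqxx; split=> //.
by rewrite walk_cost_cons -h2.
Qed.

Lemma walk_is_walk p (s t : 'I_n) : gwalk s p t -> exists q,
  is_walk E s q t /\ walk_cost c g q = fval p 0.
Proof.
elim: p s => [s /= /eqP/val_inj->|e p IH s /= /and3P[em /eqP sE hw]].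
  by exists [::]; rewrite /= eqxx walk_cost_nil.
have x0 : 'I_n * 'I_n by case: (es) em => // x *.
move: sE hw; rewrite /Sr /Ds !(nth_map x0)// => /val_inj sE /IH[q [h1 h2]].
exists (nth x0 es e :: q); rewrite /= -mem_es mem_nth// sE eqxx; split=> //.
by rewrite walk_cost_cons h2 /co (nth_map x0).
Qed.

Lemma disc_dist_le p (s t : 'I_n) : gwalk s p t -> (disc_dist E c g s t <= (fval p 0)%:E)%E.
Proof.
move=> /walk_is_walk[q [h1 <-]].
apply: (@le_trans _ _ (walk_dist E c g (size q) s t)).
  by apply: ereal_inf_lbound; exists (size q).
exact: (bigmin_le_cond _ (j := in_tuple q)).
Qed.

Lemma disc_dist_ge x (s t : 'I_n) : (forall p, gwalk s p t -> (x <= (fval p 0)%:E)%E) ->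
  (x <= disc_dist E c g s t)%E.
Proof.
move=> h; apply: le_ereal_inf_tmp => _ [k _ <-].
apply: le_bigmin => [|q]; first exact: leey.
by move=> /is_walk_index[/h hx <-].
Qed.

Definition isdist (s t : nat) (v : option R) :=
  if v is Some x then gdle s t x /\ dlb s t x else ~ reach s t.

Lemma disc_distE (s t : 'I_n) v : isdist s t v ->
  disc_dist E c g s t = if v is Some x then x%:E else +oo%E.
Proof.
case: v => [x [h1 h2]|h].
  apply/eqP; rewrite eq_le; apply/andP; split; last first.
    by apply: disc_dist_ge => p /h2; rewrite lee_fin.
  apply/lee_addgt0Pr => e /h1[p [hw hp]].
  by apply: le_trans (disc_dist_le hw) _; rewrite -EFinD lee_fin ltW.
apply/eqP; rewrite eq_le leey; apply: disc_dist_ge => p hw.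
by case: h; exists p.
Qed.

Section Relabelled.
Variable o : seq nat.
Hypothesis ho : forall e, (e < m)%N -> Sr e \in o /\ Ds e \in o.
Local Notation walk' := (walk m (fun e => index (Sr e) o) (fun e => index (Ds e) o)).

Lemma index_inj_in (u v : nat) : u \in o -> (index u o == index v o) = (u == v).
Proof.
move=> uo; apply/eqP/eqP => [h|->//].
have vo : v \in o by rewrite -index_mem -h index_mem.
by rewrite -(nth_index 0%N uo) h nth_index.
Qed.

Lemma walk_relabel s p t : s \in o -> walk' (index s o) p (index t o) = gwalk s p t.
Proof.
elim: p s => [s so|e p IH s so] /=; first exact: index_inj_in.
case: (boolP (e < m)%N) => //= em; have [h1 h2] := ho em.
by rewrite index_inj_in// IH.
Qed.

(** Both ends of a nonempty walk are ends of edges and thus have been relabelled. *)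
Lemma walk_out s p t : gwalk s p t -> ~~ ((s \in o) && (t \in o)) -> p = [::] /\ s = t.
Proof.
case: p => [/= /eqP->//|e p h]; have := walk_last h; move: h => /= /and3P[em /eqP <- hw] ->.
have [-> h] /= := ho em; suff -> : last (Ds e) [seq Ds i | i <- p] \in o by [].
elim: p (Ds e) hw h => [//|e' p IH u /= /and3P[em' _ hw] uo].
by apply: IH hw _; case: (ho em').
Qed.

End Relabelled.

Lemma solved_dist K o X st (s t : 'I_n) :
  solved n m Sr Ds co g K o X st -> isdist s t (cell st 3 2 (s * n + t)).
Proof.
move=> H; have ho := so_o H; rewrite (so_out H)//; case: ifP => [/andP[so' to']|sto]; last first.
  rewrite /diag; case: eqP => [st'|ne]; last first.
    by move=> [p hw]; have [_] := walk_out ho hw (negbT sto).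
  split=> [|p hw]; last by have [-> _] := walk_out ho hw (negbT sto).
  by apply: (@dle_walk _ m Sr Ds co g _ [::]) => /=; apply/eqP.
have sN : (index (val s) o < pN K)%N by rewrite (so_N H) index_mem.
have tN : (index (val t) o < pN K)%N by rewrite (so_N H) index_mem.
have sound x : X (index (val s) o * pW K + index (val t) o)%N = Some x -> gdle s t x.
  move=> Xx; have := so_sound H sN tN Xx.
  rewrite /dle (so_m H) (so_src H) (so_dst H) (so_cst H) (so_g H) => h eps /h[p [hw hp]].
  by exists p; split=> //; rewrite walk_relabel in hw.
have comp p : gwalk s p t -> ole (X (index (val s) o * pW K + index (val t) o)%N) (fval p 0).
  move=> hw; apply: (so_comp H) => //; first by rewrite -(so_N H).
  rewrite (so_m H) (so_src H) (so_dst H) (so_cst H) (so_g H); apply: dle_walk.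
  by rewrite walk_relabel.
rewrite /res; case Xx : (X _) => [x|].
  split; first exact: sound.
  by move=> p /comp; rewrite Xx.
have nr : ~ reach s t by move=> [p /comp]; rewrite Xx.
by rewrite /diag; case: eqP => // /val_inj e; case: nr; rewrite e; exists [::] => /=.
Qed.

End Link.

(** * The total cost in natural numbers *)

Lemma sum_scaled B p1 p2 p3 p4 p5 p6 q1 q2 q3 q4 q5 q6 : (B * p1 <= q1 -> B * p2 <= q2 ->
  B * p3 <= q3 -> B * p4 <= q4 -> B * p5 <= q5 -> B * p6 <= q6 ->
  B * (p1 + p2 + (p3 + p4 + p5 + p6)) <= q1 + q2 + (q3 + q4 + q5 + q6))%N.
Proof. by move=> h1 h2 h3 h4 h5 h6; rewrite !mulnDr !leq_add. Qed.

(** Everything is compared with m n k, using N <= n and N <= 2 m; the latter is where isolated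
    vertices must have been removed. The fourth power of the logarithm comes from the queries: one
    factor for the levels, one for the bisection, two for the sizes of two consecutive hitting
    sets. *)
Lemma cost_bound : exists C : nat, forall R (K : params R) n,
  (pN K <= n)%N -> (pN K <= 2 * pm K)%N -> (1 < n)%N -> (0 < pm K)%N ->
  (pN K * pN K <= pk K ^ 4 * pm K)%N ->
  (total_cost K n <= C * ((pbb K + 1) ^ 4 * (pm K * n * pk K)))%N.
Proof.
exists (1000 * 1000)%N => R K n.
rewrite /total_cost /core_cost /lev_cost /down_cost; have := pk2 K.
move: (pN K) (pm K) (pk K) (pbb K) => N m k b k2 Nn N2 n1 m0 hk.
set X := (m * n * k)%N.
have a0 : (0 < X)%N by rewrite !muln_gt0 m0 (ltnW n1) (ltnW k2).
have mn : (m <= m * n)%N by rewrite leq_pmulr// ltnW.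
have nm : (n <= m * n)%N by rewrite leq_pmull.
have mX : (2 * (m * n) <= X)%N by rewrite /X mulnC leq_mul2l k2 orbT.
have a1 : ((k + 1) * (N + 1) * (N + m + 1) <= 16 * X)%N.
  have -> : (16 * X = (2 * k) * (2 * n) * (4 * m))%N by rewrite /X; ring.
  by apply: leq_mul; [apply: leq_mul|]; [move: k2|move: Nn n1|move: N2 m0]; clear; lia.
have a2 : (N * k * (N + m + 1) <= 4 * X)%N.
  have -> : (4 * X = n * k * (4 * m))%N by rewrite /X; ring.
  by apply: leq_mul; [rewrite leq_mul2r Nn orbT|move: N2 m0; clear; lia].
have a3 : ((N + 1) * (N + 1) <= 6 * X)%N.
  apply: (@leq_trans ((2 * n) * (3 * m))%N); last by move: mX; clear; lia.
  by apply: leq_mul; [move: Nn n1|move: N2 m0]; clear; lia.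
have a4 : (N * N * k <= 2 * X)%N.
  have -> : (2 * X = n * (2 * m) * k)%N by rewrite /X; ring.
  by rewrite leq_mul2r leq_mul ?orbT.
(* Multiplying N^2 <= k^4 m by N <= n and dividing by k^3 turns N^3 / k^3 into at most k m n. *)
have a5 : (4 * (N * N * N) * (b * b) %/ (k * k * k) <= 4 * (b * b) * X)%N.
  have kp : (0 < k * k * k)%N by rewrite !muln_gt0 (ltnW k2).
  rewrite -(mulnK (4 * (b * b) * X)%N kp); apply: leq_div2r.
  have -> : (4 * (N * N * N) * (b * b) = 4 * (b * b) * (N * N * N))%N by ring.
  rewrite -[leqRHS]mulnA leq_mul2l; apply/orP; right.
  apply: (@leq_trans (k ^ 4 * m * n)); first exact: leq_mul.
  by rewrite /X !expnS expn0; apply: eq_leq; ring.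
rewrite -/X; set B := (b + 1)%N; set Y := (B ^ 4 * X)%N.
have B0 : (0 < B)%N by rewrite /B addn1.
have bB : (b <= B)%N by rewrite /B leq_addr.
have B1 i : (i <= 4)%N -> (B ^ i * X <= Y)%N.
  by move=> i4; rewrite leq_mul2r; apply/orP; right; rewrite leq_pexp2l.
have y0 : (X <= Y)%N by have := B1 0%N isT; rewrite expn0 mul1n.
have y1 : (B * X <= Y)%N by have := B1 1%N isT; rewrite expn1.
have y2 : (B * b * X <= Y)%N.
  apply: leq_trans (B1 2%N isT); rewrite leq_mul2r; apply/orP; right.
  by rewrite !expnS expn0 muln1 leq_mul2l bB orbT.
have y2' : (B * B * X <= Y)%N by apply: leq_trans (B1 2%N isT); rewrite !expnS expn0 muln1.
have y3 : (B * (b * b) * X <= Y)%N.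
  apply: leq_trans (B1 3%N isT); rewrite leq_mul2r; apply/orP; right.
  by rewrite !expnS expn0 muln1 leq_mul2l leq_mul ?orbT.
have y4 : (B * B * (b * b) * X <= Y)%N.
  rewrite leq_mul2r; apply/orP; right.
  have -> : (B ^ 4 = B * B * (B * B))%N by rewrite !expnS expn0; ring.
  by rewrite leq_mul2l leq_mul ?orbT.
have l1 : (B * (3000 * (4 * N * k * b) * (N + m + 1)) <= 48 * 1000 * Y)%N.
  have -> : (B * (3000 * (4 * N * k * b) * (N + m + 1)) = 12 * 1000 * (B * b) * (N * k * (N + m + 1)))%N by ring.
  apply: (@leq_trans (12 * 1000 * (B * b) * (4 * X))%N); first by rewrite leq_mul2l a2 orbT.
  have -> : (12 * 1000 * (B * b) * (4 * X) = 48 * 1000 * (B * b * X))%N by ring.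
  by rewrite leq_mul2l y2 orbT.
have l2 : (B * (2000 * B * ((N + 1) * (N + 1))) <= 12 * 1000 * Y)%N.
  have -> : (B * (2000 * B * ((N + 1) * (N + 1))) = 2000 * (B * B) * ((N + 1) * (N + 1)))%N by ring.
  apply: (@leq_trans (2000 * (B * B) * (6 * X))%N); first by rewrite leq_mul2l a3 orbT.
  have -> : (2000 * (B * B) * (6 * X) = 12 * 1000 * (B * B * X))%N by ring.
  by rewrite leq_mul2l y2' orbT.
have l3 : (B * (1100 * (4 * N * k * b) * (N + m + 1)) <= 48 * 1000 * Y)%N.
  apply: leq_trans l1; rewrite leq_mul2l leq_mul2r leq_mul2r; by rewrite !orbT.
have l4 : (B * (32 * 1000 * (N * N * k * (b * b))) <= 64 * 1000 * Y)%N.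
  have -> : (B * (32 * 1000 * (N * N * k * (b * b))) = 32 * 1000 * (B * (b * b)) * (N * N * k))%N by ring.
  apply: (@leq_trans (32 * 1000 * (B * (b * b)) * (2 * X))%N); first by rewrite leq_mul2l a4 orbT.
  have -> : (32 * 1000 * (B * (b * b)) * (2 * X) = 64 * 1000 * (B * (b * b) * X))%N by ring.
  by rewrite leq_mul2l y3 orbT.
have l5 : (B * (840 * B * (4 * (N * N * N) * (b * b) %/ (k * k * k))) <= 3360 * Y)%N.
  apply: (@leq_trans (B * (840 * B * (4 * (b * b) * X)))%N); first by rewrite !leq_mul2l a5 !orbT.
  have -> : (B * (840 * B * (4 * (b * b) * X)) = 3360 * (B * B * (b * b) * X))%N by ring.
  by rewrite leq_mul2l y4 orbT.
have l6 : (B * 100 <= 100 * Y)%N.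
  by apply: (@leq_trans (100 * (B * X))%N); [rewrite mulnC leq_mul2l leq_pmulr ?orbT|rewrite leq_mul2l y1 orbT].
have c1 : (N * k <= X)%N.
  by rewrite /X leq_mul2r; apply/orP; right; apply: leq_trans Nn nm.
have BY : (B <= Y)%N by apply: leq_trans y1; rewrite leq_pmulr.
apply: (@leq_trans (2000 * (16 * X) + (48 * 1000 * Y + 12 * 1000 * Y + (48 * 1000 * Y + 64 * 1000 * Y +
    3360 * Y + 100 * Y)) + 200 * (m + 1) + 50 * B + 50 * (N * k + 1) + 100 * (n + 1) + 400 * (6 * X))%N).
  have h1 : (2000 * (k + 1) * (N + 1) * (N + m + 1) <= 2000 * (16 * X))%N.
    by rewrite -!mulnA leq_mul2l mulnA a1 orbT.
  have h2 : (400 * (N + 1) * (N + 1) <= 400 * (6 * X))%N by rewrite -mulnA leq_mul2l a3 orbT.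
  have h3 := sum_scaled l1 l2 l3 l4 l5 l6.
  exact: (leq_add (leq_add (leq_add (leq_add (leq_add (leq_add h1 h3) (leqnn _)) (leqnn _)) (leqnn _)) (leqnn _)) h2).
clearbody Y B X; clear - y0 mX mn nm c1 a0 BY.
move: (N * k)%N (m * n)%N c1 mX mn nm => q r; lia.
Qed.

(** Minimality of k gives k^4 m <= 16 n^2: either (k - 1)^4 m < N^2 and k <= 2 (k - 1), or k = 2 and
    m <= n^2. The fourth power keeps the comparison with n^(3/2) m^(3/4) free of roots. *)
Lemma fourth_power_bound N n m k : (N <= n)%N -> (m <= n * n)%N -> (1 < k)%N ->
  (k = 2 \/ k.-1 ^ 4 * m < N * N)%N -> ((m * n * k) ^ 4 <= 16 * (m ^ 3 * n ^ 6))%N.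
Proof.
move=> Nn mn k1 hk.
have h : (k ^ 4 * m <= 16 * (n * n))%N.
  case: hk => [->|hk]; first by rewrite -[(2 ^ 4)%N]/16%N leq_mul2l mn.
  apply: (@leq_trans ((2 * k.-1) ^ 4 * m)%N).
    by rewrite leq_mul2r leq_exp2r// orbC; apply/orP; left; move: k1; clear; lia.
  rewrite expnMn -[(2 ^ 4)%N]/16%N -mulnA leq_mul2l /=.
  by apply: leq_trans (ltnW hk) (leq_mul Nn Nn).
have -> : ((m * n * k) ^ 4 = m ^ 3 * n ^ 4 * (k ^ 4 * m))%N by rewrite !expnS !expn0; ring.
apply: leq_trans (leq_mul (leqnn _) h) _.
by apply: eq_leq; rewrite !expnS !expn0; ring.
Qed.

(** * Passage to real powers and logarithms *)

Section Reals.
Context (R : realType).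

Lemma powR_exp (a x : R) (k l : nat) : 0 <= a -> x * k%:R = l%:R -> (a `^ x) ^+ k = a ^+ l.
Proof. by move=> a0 h; rewrite -powR_mulrn ?powR_ge0// -powRrM h powR_mulrn. Qed.

Lemma work_bound n m x : (x ^ 4 <= 16 * (m ^ 3 * n ^ 6))%N ->
  x%:R <= 2 * (n%:R `^ (3 / 2) * m%:R `^ (3 / 4)) :> R.
Proof.
move=> h; have rho0 : 0 <= n%:R `^ (3 / 2) * m%:R `^ (3 / 4) :> R by rewrite mulr_ge0 ?powR_ge0.
rewrite -(@ler_pXn2r _ 4)// ?nnegrE ?mulr_ge0//.
rewrite !exprMn (@powR_exp _ _ _ 6)//; last by field.
rewrite (@powR_exp _ _ _ 3)//; last by field.
have -> : (2 ^+ 4 * (n%:R ^+ 6 * m%:R ^+ 3) : R) = (16 * (m ^ 3 * n ^ 6))%:R.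
  by rewrite (natrM _ 16) (natrM _ (m ^ 3)) !natrX; ring.
by rewrite -natrX ler_nat.
Qed.

(** From ln (1 + x) <= x at x = - 1/2. *)
Lemma ln2_ge : 1 / 2 <= ln (2 : R).
Proof.
have h : ln (1 + (- (1 / 2)) : R) <= - (1 / 2) by apply: le_ln1Dx; lra.
have e : (1 + - (1 / 2) : R) = 2^-1 by field.
by move: h; rewrite e lnV ?posrE//; lra.
Qed.

(** From 2^(b+1) <= n^5 and ln 2 >= 1/2. *)
Lemma log_bound N n b : (1 < n)%N -> (N <= n)%N -> (2 ^ b <= 2 * (N * N + 1))%N ->
  (b + 1)%:R <= 10 * ln (n%:R : R).
Proof.
move=> n1 Nn hb.
have h : (2 ^ (b + 1) <= n ^ 5)%N.
  rewrite addn1 expnS; apply: (@leq_trans (n * n ^ 4)); last by rewrite expnS.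
  apply: leq_mul => //; apply: leq_trans hb _.
  apply: (@leq_trans (4 * (n * n))%N).
    have : (0 < n * n)%N by rewrite muln_gt0 !(ltnW n1).
    by have := leq_mul Nn Nn; clear; lia.
  have -> : (n ^ 4 = n * n * (n * n))%N by rewrite !expnS expn0; ring.
  by rewrite leq_mul2r (leq_mul n1 n1) orbT.
have n0 : 0 < n%:R :> R by rewrite ltr0n ltnW.
have : ln ((2 ^ (b + 1))%:R : R) <= ln ((n ^ 5)%:R : R).
  by rewrite ler_ln ?posrE ?ltr0n ?expn_gt0 ?(ltnW n1)// ler_nat.
rewrite !natrX !lnXn// => hl.
have h2 := ln2_ge.
have h3 : (1 / 2) *+ (b + 1) <= ln (2 : R) *+ (b + 1) by apply: ler_wMn2r.
move: hl h3; rewrite -(mulr_natr (ln 2)) -(mulr_natr (ln n%:R)) -(mulr_natr (1 / 2)).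
by move: (ln n%:R) (ln 2) ((b + 1)%:R) => x y z; lra.
Qed.

End Reals.

Theorem theorem1p3 :
  exists (P : cmd) (w C k : nat),
    forall (R : realType) (n : nat) (E : {set 'I_n * 'I_n})
      (es : seq ('I_n * 'I_n)) (c : 'I_n * 'I_n -> R) (g : R),
      perm_eq es (enum E) -> 0 < g -> g < 1 ->
      exists (T : nat) (st : state R),
        [/\ exec (n.+2 ^ w)%N P (input_state es c g) T st,
            (forall s t : 'I_n, output st s t = disc_dist E c g s t)
          & (1 < n)%N -> (0 < #|E|)%N ->
            T%:R <= C%:R * (n%:R `^ (3 / 2) * #|E|%:R `^ (3 / 4))
                    * ln n%:R ^+ k :> R].
Proof.
(* The word modulus is the square of the stride, whence 16. The factor 20 * 1000 is 10^4 from the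
   fourth power of [log_bound] times 2 from [work_bound]. *)
have [C hC] := cost_bound; exists Main, 16%N, (C * (20 * 1000))%N, 4%N.
move=> R n E es c g pe g0 g1.
have mn : (size es <= n * n)%N.
  by rewrite (size_es pe) -[leqRHS](_ : #|{: 'I_n * 'I_n}| = _) ?max_card// card_prod card_ord.
have hS e : (e < size es)%N -> Sr es e = Sr es e /\ (Sr es e < n)%N.
  by move=> em; split=> //; case: (es) em => // x r em; rewrite /Sr (nth_map x).
have hD e : (e < size es)%N -> Ds es e = Ds es e /\ (Ds es e < n)%N.
  by move=> em; split=> //; case: (es) em => // x r em; rewrite /Ds (nth_map x).
have [T [st [ex [K [ol [X [hT H]]]]]]] : wp (n.+2 ^ 16) Main (fun T s' => exists K o X,
    (T <= total_cost K n)%N /\ solved n (size es) (Sr es) (Ds es) (co es c) g K o X s') (input_state es c g).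
  apply: (@wp_Main R n (size es) (n.+2 ^ 16) (Sr es) (Ds es) (co es c) g) => //.
  - by move=> [|[|[|a]]] i.
  - by move=> T s' K ol X hT H; exists K, ol, X.
exists T, st; split=> //.
  move=> s t; rewrite (disc_distE pe (solved_dist s t H)) /output /cell.
  by case: ifP.
move=> n1 E0; have m0 : (0 < size es)%N by rewrite (size_es pe).
have hN : (pN K <= n)%N by rewrite (so_N H); apply: so_n H.
have TC : (T <= C * ((pbb K + 1) ^ 4 * (size es * n * pk K)))%N.
  apply: leq_trans hT _; rewrite -(so_m H); apply: hC => //.
  - by rewrite (so_m H) (so_N H); apply: so_2m H.
  - by rewrite (so_m H).
  - by rewrite (so_m H) (so_N H); apply: so_k1 H.
have hk : (pk K = 2 \/ (pk K).-1 ^ 4 * size es < pN K * pN K)%N.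
  by rewrite (so_N H); apply: so_k2 H.
have wb := work_bound R (fourth_power_bound hN mn (pk2 K) hk).
have hb : (2 ^ pbb K <= 2 * (pN K * pN K + 1))%N by rewrite (so_N H); apply: so_b H.
have lb := log_bound R n1 hN hb.
rewrite -(size_es pe); apply: (@le_trans _ _ (C * ((pbb K + 1) ^ 4 * (size es * n * pk K)))%:R).
  by rewrite ler_nat.
rewrite !(natrM _ C) (natrM _ 20) (natrM _ (_ ^ 4)) natrX.
have -> : C%:R * (20 * 1000) * (n%:R `^ (3 / 2) * (size es)%:R `^ (3 / 4)) * ln n%:R ^+ 4 =
  C%:R * ((10 * ln n%:R) ^+ 4 * (2 * (n%:R `^ (3 / 2) * (size es)%:R `^ (3 / 4)))) :> R by ring.
rewrite ler_wpM2l//; apply: ler_pM => //.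
by apply: lerXn2r => //; rewrite nnegrE//; apply: le_trans lb.
Qed.
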